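(* Let $n\ge 2$, $s\in(1/2,1)$, let $\mu\in\mathcal M(\mathbb R^n)$, let $\Phi:\mathbb R\to\mathbb R$ satisfy the structure assumption with some $\Lambda\ge 1$, and let $u\in W^{s,2}(\mathbb R^n)$ be a weak solution of $\mathcal L u=\mu$ in $\mathbb R^n$. Then for almost every $x_0\in\mathbb R^n$, $$|\nabla u(x_0)|\le c\, I^{|\mu|}_{2s-1}(x_0)$$ for some constant $c=c(n,s,\Lambda)$. In addition, for any fixed $s_0\in(1/2,1)$, the constant $c$ depends only on $n,s_0$ and $\Lambda$ whenever $s\in[s_0,1)$.
   Context: $\mathcal M(\mathbb R^n)$ is the class of signed Radon measures on $\mathbb R^n$ with finite total mass; $|\mu|$ is the variation of $\mu$. Structure assumption on $\Phi$: $\Phi:\mathbb R\to\mathbb R$ is odd and, for all $t,t'\in\mathbb R$, $|\Phi(t)-\Phi(t')|\le\Lambda|t-t'|$ and $(\Phi(t)-\Phi(t'))(t-t')\ge\Lambda^{-1}|t-t'|^2$. The operator is formally $\mathcal L u(x)=(1-s)\,\mathrm{P.V.}\int_{\mathbb R^n}\Phi\big(\frac{u(x)-u(y)}{|x-y|^s}\big)\frac{dy}{|x-y|^{n+s}}$. $L^1_{2s}(\mathbb R^n)=\{u\in L^1_{\rm loc}(\mathbb R^n):\int_{\mathbb R^n}|u(y)|(1+|y|)^{-n-2s}\,dy<\infty\}$. Weak solution: for a domain $\Omega\subset\mathbb R^n$ (here $\Omega=\mathbb R^n$), $u\in W^{s,2}_{\rm loc}(\Omega)\cap L^1_{2s}(\mathbb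 R^n)$ is a weak solution of $\mathcal L u=\mu$ in $\Omega$ if $$(1-s)\int_{\mathbb R^n}\int_{\mathbb R^n}\Phi\Big(\frac{u(x)-u(y)}{|x-y|^s}\Big)\frac{\psi(x)-\psi(y)}{|x-y|^s}\frac{dx\,dy}{|x-y|^n}=\int_\Omega\psi\,d\mu\quad\text{for all }\psi\in C_c^\infty(\Omega).$$ Riesz potential: for $\beta\in(0,n)$, $I^{|\mu|}_\beta(x_0)=\int_{\mathbb R^n}\frac{d|\mu|(y)}{|x_0-y|^{n-\beta}}$. *)

(* Defs.v *)
From HB Require Import structures.
From mathcomp Require Import all_boot all_order all_algebra.
From mathcomp Require Import all_classical all_reals all_analysis measurable_realfun.

Set Implicit Arguments.
Unset Strict Implicit.
Unset Printing Implicit Defensive.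

Import Order.TTheory GRing.Theory Num.Theory.
Import numFieldNormedType.Exports.

Local Open Scope classical_set_scope.
Local Open Scope ring_scope.

Definition rV_display : measure_display.
Proof. exact: default_measure_display. Qed.

Section borel_rV.
Context {R : realType} {n : nat}.

(* The Borel sigma-algebra; 'rV[R]_n carries the (Euclidean) product topology. *)
Let borel : set_system 'rV[R]_n := <<s open >>.

Let borel0 : borel set0. Proof. exact: sigma_algebra0. Qed.

Let borelC A : borel A -> borel (~` A). Proof. exact: sigma_algebraC. Qed.

Let borelU (F : (set 'rV[R]_n)^nat) :
  (forall i, borel (F i)) -> borel (\bigcup_i F i).
Proof. exact: sigma_algebra_bigcup. Qed.

HB.instance Definition _ :=
  @isMeasurable.Build rV_display 'rV[R]_n borel borel0 borelC borelU.

End borel_rV.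

Lemma open_measurable_rV (R : realType) n (A : set 'rV[R]_n) :
  open A -> measurable A.
Proof. by move=> oA; exact: sub_sigma_algebra. Qed.

Lemma measurable_coord (R : realType) n (i : 'I_n) :
  measurable_fun [set: 'rV[R]_n] (fun v => v ord0 i).
Proof.
apply: (measurability _ (RGenOpens.measurableE R)).
move=> _ [_ [a [b ->] <-]]; rewrite setTI; apply: open_measurable_rV.
apply: open_comp => [v _|]; first exact: coord_continuous.
exact: interval_open.
Qed.

Lemma measurable_rV (d : measure_display) (T : measurableType d)
    (R : realType) n (f : T -> 'rV[R]_n) :
  (forall i, measurable_fun setT (fun x => f x ord0 i)) ->
  measurable_fun setT f.
Proof.
move=> mf; apply: (@measurability _ _ T 'rV[R]_n setT f open) => //.
move=> _ [U oU <-]; rewrite setTI.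
pose cube (q : 'rV[rat]_n) (k : nat) : set 'rV[R]_n :=
  [set v | forall i, `|v ord0 i - ratr (q ord0 i)| < k.+1%:R^-1].
pose F (qk : 'rV[rat]_n * nat) :=
  if `[< cube qk.1 qk.2 `<=` U >] then cube qk.1 qk.2 else set0.
have -> : U = \bigcup_qk F qk.
  apply/seteqP; split => [v Uv|v [qk _]]; last first.
    by rewrite /F; case: asboolP => // + ?; exact.
  have /nbhs_ballP[e /= e0 ballU] := open_nbhs_nbhs (conj oU Uv).
  have [k ke] : exists k, k.+1%:R^-1 < e / 2.
    have e20 : 0 < e / 2 by rewrite divr_gt0.
    by have [k _ /(_ k (leqnn k))] := near_infty_natSinv_lt (PosNum e20); exists k.
  have q_ex (i : 'I_n) : exists q : rat, `|v ord0 i - ratr q| < k.+1%:R^-1.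
    have /rat_in_itvoo[q] : v ord0 i - k.+1%:R^-1 < v ord0 i + k.+1%:R^-1.
      by rewrite ltrBlDr -addrA ltrDl addr_gt0.
    by rewrite in_itv/= => qv; exists q; rewrite distrC ltr_distl.
  pose q : 'rV[rat]_n := \row_i sval (cid (q_ex i)).
  have vq i : `|v ord0 i - ratr (q ord0 i)| < k.+1%:R^-1.
    by rewrite mxE; exact: (svalP (cid (q_ex i))).
  have sub : cube q k `<=` U.
    move=> w /= wq; apply: ballU; split => // i j; rewrite (ord1 i).
    apply: (le_lt_trans (ler_distD (ratr (q ord0 j)) _ _)).
    rewrite (splitr e) ltrD//; first exact: lt_trans (vq j) ke.
    by rewrite distrC; exact: lt_trans (wq j) ke.
  by exists (q, k) => //; rewrite /F/=; case: asboolP.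
rewrite preimage_bigcup; apply: countable_bigcupT_measurable.
  exact: countableP.
move=> [q k]; rewrite /F; case: asboolP => _; last by rewrite preimage_set0.
have -> : f @^-1` cube q k = \bigcap_i
    ((fun x => f x ord0 i) @^-1` `]ratr (q ord0 i) - k.+1%:R^-1,
                                 ratr (q ord0 i) + k.+1%:R^-1[%classic).
  apply/seteqP; split => x /= fx i; first by move=> _ /=; rewrite in_itv/= -ltr_distl.
  by have := fx i Logic.I; rewrite /= in_itv/= -ltr_distl.
apply: fin_bigcap_measurable; first exact: finite_finset.
by move=> i _; rewrite -[X in measurable X]setTI; exact: mf.
Qed.

Section lebesgue_rV.
Context {R : realType}.

Definition row_cons n (p : measurableTypeR R * 'rV[R]_n) : 'rV[R]_n.+1 :=
  \row_i oapp (p.2 ord0) p.1 (unlift ord0 i).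

Lemma row_cons0 n p : @row_cons n p ord0 ord0 = p.1.
Proof. by rewrite mxE unlift_none. Qed.

Lemma row_consS n p i : @row_cons n p ord0 (lift ord0 i) = p.2 ord0 i.
Proof. by rewrite mxE liftK. Qed.

Lemma measurable_row_cons n : measurable_fun setT (@row_cons n).
Proof.
apply: measurable_rV => i; case: (unliftP ord0 i) => [j|] ->.
  under eq_fun do rewrite row_consS.
  by apply: (measurableT_comp (measurable_coord j)); exact: measurable_snd.
under eq_fun do rewrite row_cons0.
exact: measurable_fst.
Qed.

Section step.
Context n (m : {sigma_finite_measure set 'rV[R]_n -> \bar R}).
Local Open Scope ereal_scope.

Definition lebesgue_step : set 'rV[R]_n.+1 -> \bar R :=
  pushforward (@lebesgue_measure R \x m) (@row_cons n).

Let step0 : lebesgue_step set0 = 0.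
Proof. by rewrite /lebesgue_step /pushforward preimage_set0 measure0. Qed.

Let step_ge0 A : 0 <= lebesgue_step A.
Proof. by rewrite /lebesgue_step /pushforward measure_ge0. Qed.

Let step_sigma_additive : semi_sigma_additive lebesgue_step.
Proof.
move=> F mF tF mUF; rewrite /lebesgue_step /pushforward preimage_bigcup.
apply: measure_semi_sigma_additive.
- by move=> k; rewrite -[X in measurable X]setTI; exact: measurable_row_cons.
- apply/trivIsetP => /= i j _ _ ij; rewrite -preimage_setI.
  by move/trivIsetP : tF => /(_ _ _ _ _ ij) ->//; rewrite preimage_set0.
- rewrite -preimage_bigcup -[X in measurable X]setTI.
  exact: measurable_row_cons.
Qed.

HB.instance Definition _ := isMeasure.Build _ _ _ lebesgue_step
  step0 step_ge0 step_sigma_additive.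

Let hd (v : 'rV[R]_n.+1) : measurableTypeR R * 'rV[R]_n :=
  (v ord0 ord0, \row_i v ord0 (lift ord0 i)).

Let measurable_hd : measurable_fun setT hd.
Proof.
apply/measurable_fun_pairP; split => /=; first exact: measurable_coord.
apply: measurable_rV => i /=; rewrite /hd.
under eq_fun do rewrite /= mxE; exact: measurable_coord.
Qed.

Let row_consK : cancel (@row_cons n) hd.
Proof.
move=> [x v]; rewrite /hd row_cons0; congr pair.
by apply/rowP => i; rewrite mxE row_consS.
Qed.

Let step_sigma_finite : sigma_finite setT lebesgue_step.
Proof.
have /sigma_finiteP[F [FT ndF Foo]] := sigma_finiteT (@lebesgue_measure R).
have /sigma_finiteP[G [GT ndG Goo]] := sigma_finiteT m.
exists (fun i => hd @^-1` (F i `*` G i)).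
  rewrite -preimage_bigcup (_ : \bigcup_i _ = setT) ?preimage_setT//.
  rewrite -setXTT FT GT predeqE => -[x y]; split; first by move=> [k _ []]; split; exists k.
  move=> [/= [i _ Fix] [j _ Gjy]]; exists (maxn i j) => //; split.
  - by move: x Fix; exact/subsetPset/ndF/leq_maxl.
  - by move: y Gjy; exact/subsetPset/ndG/leq_maxr.
move=> i; have [mF Fi] := Foo i; have [mG Gi] := Goo i; split.
  rewrite -[X in measurable X]setTI; apply: measurable_hd => //.
  exact: measurableX.
rewrite /lebesgue_step /pushforward -comp_preimage.
rewrite (_ : hd \o _ = id); last by apply/funext => p /=; rewrite row_consK.
rewrite (_ : id @^-1` _ = F i `*` G i)//.
by rewrite product_measure1E// lte_mul_pinfty// ge0_fin_numE.
Qed.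

HB.instance Definition _ := Measure_isSigmaFinite.Build _ _ _ lebesgue_step
  step_sigma_finite.

End step.

(* n-dimensional Lebesgue measure on the Borel sets of R^n, as the iterated
   product of the one-dimensional one; the next lemma gives its value on boxes. *)
Fixpoint lebesgue_rV n : {sigma_finite_measure set 'rV[R]_n -> \bar R} :=
  match n with
  | 0 => @dirac _ 'rV[R]_0 0 R
  | k.+1 => lebesgue_step (lebesgue_rV k)
  end.

Lemma lebesgue_rV_box n (a b : 'rV[R]_n) : (forall i, a ord0 i <= b ord0 i) ->
  lebesgue_rV n [set v | forall i, a ord0 i < v ord0 i <= b ord0 i] =
  (\prod_i (b ord0 i - a ord0 i))%:E.
Proof.
elim: n a b => [|n IH] a b ab.
  rewrite big_ord0 /= diracE mem_set//= => -[]//.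
rewrite big_ord_recl /= /lebesgue_step /pushforward.
set B := [set v : 'rV[R]_n | forall i,
  a ord0 (lift ord0 i) < v ord0 i <= b ord0 (lift ord0 i)].
rewrite (_ : _ @^-1` _ = `]a ord0 ord0, b ord0 ord0]%classic `*` B); last first.
  apply/seteqP; split => [[x v] /= h|[x v] /= [hx hv] i].
    split => [|i].
      by have := h ord0; rewrite row_cons0 /= in_itv.
    by have := h (lift ord0 i); rewrite row_consS.
  case: (unliftP ord0 i) => [j|] ->; last by rewrite row_cons0; rewrite /= in_itv in hx.
  by rewrite row_consS; exact: hv.
have BE : B = [set v | forall i,
    (\row_i a ord0 (lift ord0 i)) ord0 i < v ord0 i <=
    (\row_i b ord0 (lift ord0 i)) ord0 i].
  by apply/seteqP; split => v /= h i; have := h i; rewrite !mxE.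
rewrite product_measure1E//; last first.
  rewrite (_ : B = \bigcap_i ((fun v : 'rV[R]_n => v ord0 i) @^-1`
      `]a ord0 (lift ord0 i), b ord0 (lift ord0 i)]%classic)); last first.
    apply/seteqP; split => v /= h i; first by move=> _; rewrite /= in_itv/=; exact: h.
    by have := h i Logic.I; rewrite /= in_itv.
  apply: fin_bigcap_measurable; first exact: finite_finset.
  by move=> i _; rewrite -[X in measurable X]setTI; exact: measurable_coord.
rewrite BE IH; last by move=> i; rewrite !mxE.
rewrite EFinM; congr (_ * _)%E; last first.
  by congr EFin; apply: eq_bigr => i _; rewrite !mxE.
apply: etrans (lebesgue_measure_itv _) _; rewrite /= lte_fin.
have := ab ord0; rewrite le_eqVlt => /predU1P[->|->]; last by rewrite EFinB.
by rewrite ltxx subrr.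
Qed.

End lebesgue_rV.

Notation leb n := (lebesgue_rV n).

(* The library norm on 'rV[R]_n is the sup norm, hence the explicit |x|. *)
Definition enorm {R : realType} {n : nat} (x : 'rV[R]_n) : R :=
  Num.sqrt (\sum_(i < n) x ord0 i ^+ 2).

Definition structure_assumption {R : realType} (Lambda : R) (Phi : R -> R) :=
  [/\ forall t, Phi (- t) = - Phi t,
      forall t t', `|Phi t - Phi t'| <= Lambda * `|t - t'| &
      forall t t', Lambda^-1 * `|t - t'| ^+ 2 <= (Phi t - Phi t') * (t - t')].

Section signed_measures.
Context {R : realType} {d : measure_display} {T : measurableType d}.
Variable mu : {charge set T -> \bar R}.
Local Open Scope ereal_scope.

(* A chosen Hahn decomposition; the Jordan parts do not depend on the choice. *)
Definition hahn_pos : set T := sval (cid (Hahn_decomposition mu)).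

Definition hahn_neg : set T := sval (cid (svalP (cid (Hahn_decomposition mu)))).

Lemma hahn_posneg : hahn_decomposition mu hahn_pos hahn_neg.
Proof. exact: (svalP (cid (svalP (cid (Hahn_decomposition mu))))). Qed.

Definition charge_abs : {measure set T -> \bar R} :=
  charge_variation hahn_posneg.

Definition charge_integral (D : set T) (f : T -> \bar R) : \bar R :=
  \int[jordan_pos hahn_posneg]_(x in D) f x -
  \int[jordan_neg hahn_posneg]_(x in D) f x.

End signed_measures.

Section function_spaces.
Context {R : realType} {n : nat}.
Implicit Types (D Omega : set 'rV[R]_n) (f u psi : 'rV[R]_n -> R).

Definition partial (i : 'I_n) f : 'rV[R]_n -> R :=
  'D_(delta_mx ord0 i : 'rV[R]_n) f.

Fixpoint Ck (k : nat) f : Prop :=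
  match k with
  | 0 => continuous f
  | j.+1 => continuous f /\ forall i : 'I_n,
      (forall x, derivable f x (delta_mx ord0 i)) /\ Ck j (partial i f)
  end.

Definition test_function Omega psi :=
  [/\ forall k, Ck k psi,
      compact (closure [set x | psi x != 0]) &
      closure [set x | psi x != 0] `<=` Omega].

Definition L1_loc Omega f :=
  measurable_fun Omega f /\
  forall K, compact K -> K `<=` Omega ->
    (\int[leb n]_(x in K) `|f x|%:E < +oo)%E.

Definition L1_2s (s : R) u :=
  L1_loc setT u /\
  (\int[leb n]_y (`|u y| * (1 + enorm y) `^ (- n%:R - 2 * s))%:E < +oo)%E.

Definition Ws2 (s : R) D u :=
  [/\ measurable_fun D u,
      (\int[leb n]_(x in D) (`|u x| ^+ 2)%:E < +oo)%E &
      (\int[leb n \x leb n]_(z in D `*` D)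
         (`|u z.1 - u z.2| ^+ 2 / enorm (z.1 - z.2) `^ (n%:R + 2 * s))%:E
       < +oo)%E].

Definition Ws2_loc (s : R) Omega u :=
  forall D, open D -> compact (closure D) -> closure D `<=` Omega -> Ws2 s D u.

Definition weak_gradient Omega u (g : 'rV[R]_n -> 'rV[R]_n) :=
  [/\ L1_loc Omega u,
      forall i, L1_loc Omega (fun x => g x ord0 i) &
      forall i psi, test_function Omega psi ->
        (\int[leb n]_(x in Omega) (u x * partial i psi x)%:E =
         - \int[leb n]_(x in Omega) (g x ord0 i * psi x)%:E)%E].

End function_spaces.

Section nonlocal_equation.
Context {R : realType} {n : nat}.

(* The integrand takes the value 0 on the (null) diagonal, as 0^-1 = 0. *)
Definition weak_form (s : R) (Phi : R -> R) (u psi : 'rV[R]_n -> R) : \bar R :=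
  ((1 - s)%:E * \int[leb n \x leb n]_z
     (Phi ((u z.1 - u z.2) / enorm (z.1 - z.2) `^ s) *
      ((psi z.1 - psi z.2) / enorm (z.1 - z.2) `^ s) /
      enorm (z.1 - z.2) ^+ n)%:E)%E.

(* A charge has finite values, and every finite Borel measure on R^n is Radon,
   so charges on 'rV[R]_n are the signed Radon measures with finite mass. *)
Definition weak_solution (s : R) (Phi : R -> R) (Omega : set 'rV[R]_n)
    (mu : {charge set 'rV[R]_n -> \bar R}) (u : 'rV[R]_n -> R) :=
  [/\ Ws2_loc s Omega u, L1_2s s u &
      forall psi, test_function Omega psi ->
        weak_form s Phi u psi =
        charge_integral mu Omega (fun x => (psi x)%:E)].

(* Here ^-1 is the inverse of \bar R, so the kernel is +oo at y = x0. *)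
Definition riesz_potential (beta : R) (nu : {measure set 'rV[R]_n -> \bar R})
    (x0 : 'rV[R]_n) : \bar R :=
  (\int[nu]_y ((enorm (x0 - y) `^ (n%:R - beta))%:E)^-1)%E.

End nonlocal_equation.

(* Grad u is the distributional gradient, defined up to null sets; that it
   exists as a function is part of the claim. *)
Definition gradient_potential_estimate {R : realType} (n : nat)
    (s Lambda c : R) :=
  forall (mu : {charge set 'rV[R]_n -> \bar R}) (Phi : R -> R)
    (u : 'rV[R]_n -> R),
    structure_assumption Lambda Phi ->
    Ws2 s setT u ->
    weak_solution s Phi setT mu u ->
    exists2 g, weak_gradient setT u g &
      {ae leb n, forall x0, (enorm (g x0))%:E <=
        c%:E * riesz_potential (2 * s - 1) (charge_abs mu) x0}%E.

(* Main.v *)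
(** The increments u(h + x) - u(x) of a solution of the equation with zero right-hand
    side solve linear equations whose kernels are only measurable and comparable to
    (1 - s)|z|^(-n-2s).  De Giorgi's method (Caccioppoli and logarithmic estimates,
    level-set iteration, growth lemma) therefore makes them Hölder continuous, uniformly
    as s -> 1, and, since 2s > 1, makes their distance to constants decay faster than
    the scale.  On a cube, u is compared with the solution having the same
    exterior values: testing the difference of the equations with truncations bounds the
    L^1 distance by the mass of mu near the cube.  Consequently the averaged
    difference quotients of u at scales r_k = rho^k around x0 form a series of total
    variation at most a multiple of the sum of r_k^(2s-1-n) |mu|(Q(x0, 2 r_k)), which is
    controlled by the Riesz potential; as u is in L^2, starting at ever larger scales
    removes the contribution of u itself.  The limits of the quotients are thus bounded
    by the potential, and since the potential is locally integrable, dominated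
    convergence identifies them with the weak gradient. *)
Require Import Defs.
From HB Require Import structures.
From mathcomp Require Import all_boot all_order all_algebra.
From mathcomp Require Import all_classical all_reals all_analysis measurable_realfun.
From mathcomp Require Import ring lra.

Set Implicit Arguments.
Unset Strict Implicit.
Unset Printing Implicit Defensive.

Import Order.TTheory GRing.Theory Num.Theory.
Import numFieldNormedType.Exports.

Local Open Scope classical_set_scope.
Local Open Scope ring_scope.

(** All estimates live at unit scale, on a class of equations stable under translation and dilation;
    the factor 1 - s stays inside the kernel [J]. Instead of Sobolev embeddings, midpoint bisection
    of differences gives both a Poincaré inequality and a bound for functions of small support, with
    constants uniform as s -> 1, and De Giorgi's iteration uses only these. The main obstacle:
    Hölder continuity of increments gives a power r^alpha, whereas excess decay needs more than r.
    It is overcome by writing 2 (u(h+x) - u(x)) as u(2h+x) - u(x) minus a second difference. The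
    Hölder estimate makes the second difference small, so each halving of h nearly halves the
    increment, and one more Hölder estimate, started at a scale between |h| and 1, pushes the total
    beyond r. Tails seen from scale r weigh r^(2s). Only increments minus constants are measured, so
    no gradient of u appears before the final limit. The weak equation admits only smooth tests;
    mollification extends it to truncations. The comparison solution minimises a uniformly convex
    energy. *)

Section affine_change.
Context {R : realType}.

Lemma measurable_mulD_real (a r : R) :
  measurable_fun setT (fun t : measurableTypeR R => a + r * t : measurableTypeR R).
Proof.
apply: measurable_funD; first exact: measurable_cst.
by apply: measurable_funM; [exact: measurable_cst|exact: measurable_id].
Qed.

(** The pushforward of Lebesgue measure under [phi], multiplied by [r], gives every half-open
    interval its length, so uniqueness of Lebesgue measure identifies the two. *)
Lemma ge0_integral_affine1 (a r : R) (f : R -> \bar R) : 0 < r ->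
  measurable_fun setT f -> (forall x, 0 <= f x)%E ->
  (\int[@lebesgue_measure R]_t f (a + r * t)%R =
   (r^-1)%:E * \int[@lebesgue_measure R]_t f t)%E.
Proof.
move=> r0 mf f0; pose phi (t : measurableTypeR R) : measurableTypeR R := a + r * t.
have mphi : measurable_fun setT phi by exact: measurable_mulD_real.
have rge0 : 0 <= r by exact: ltW.
have [m mE] : exists m : {measure set (measurableTypeR R) -> \bar R},
    (m : set _ -> \bar R) = pushforward (@lebesgue_measure R) phi.
  by unshelve eexists (pushforward (@lebesgue_measure R) phi).
pose nu := mscale (NngNum rge0) m.
have nuE (A : set (measurableTypeR R)) : measurable A -> nu A = lebesgue_measure A.
  move=> mA; apply/esym; apply: lebesgue_measure_unique mA => X.
  case=> -[u v] /= uv <-; rewrite /nu /mscale /= mE /pushforward.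
  have -> : phi @^-1` `]u, v] = `](u - a) / r, (v - a) / r]%classic.
    apply/seteqP; split => x /=; rewrite /phi !in_itv /= ltr_pdivrMr// ler_pdivlMr//.
      by move=> /andP[? ?]; apply/andP; split; lra.
    by move=> /andP[? ?]; apply/andP; split; lra.
  rewrite !lebesgue_measure_itv /= !lte_fin.
  have -> : ((u - a) / r < (v - a) / r) = (u < v).
    by rewrite ltr_pM2r ?invr_gt0// ltrD2r.
  case: ifP => _; last by rewrite mule0.
  rewrite -!EFinB -EFinM; congr EFin; field; exact: lt0r_neq0.
have -> : (\int[@lebesgue_measure R]_t f (a + r * t)%R =
    \int[m]_t f t)%E.
  by rewrite mE ge0_integral_pushforward.
have -> : (\int[@lebesgue_measure R]_t f t = \int[nu]_t f t)%E.
  by apply: eq_measure_integral => A mA _; exact/esym/nuE.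
rewrite ge0_integral_mscale //= muleA -EFinM mulVf ?mul1e//; exact: lt0r_neq0.
Qed.

Lemma integral_row_cons n (f : 'rV[R]_n.+1 -> \bar R) :
  measurable_fun setT f -> (forall x, 0 <= f x)%E ->
  (\int[leb n.+1]_x f x = \int[@lebesgue_measure R]_t \int[leb n]_v f (row_cons (t, v)))%E.
Proof.
move=> mf f0; rewrite /= /lebesgue_step.
rewrite ge0_integral_pushforward //=; last exact: measurable_row_cons.
rewrite fubini_tonelli1 //.
by apply: measurableT_comp => //; exact: measurable_row_cons.
Qed.

Lemma row_cons_affine n (a : 'rV[R]_n.+1) (r t : R) (v : 'rV[R]_n) :
  a + r *: row_cons (t, v) =
  row_cons (a ord0 ord0 + r * t, (\row_i a ord0 (lift ord0 i)) + r *: v).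
Proof.
apply/rowP => i; rewrite !mxE; case: (unliftP ord0 i) => [j ->|->] /=.
  by rewrite !mxE.
by [].
Qed.

Lemma measurable_affine n (a : 'rV[R]_n) (r : R) :
  measurable_fun setT (fun x : 'rV[R]_n => a + r *: x).
Proof.
apply: measurable_rV => i.
rewrite (_ : (fun x : 'rV[R]_n => (a + r *: x) ord0 i) = (fun x => a ord0 i + r * x ord0 i)).
  apply: measurable_funD; first exact: measurable_cst.
  by apply: measurable_funM; [exact: measurable_cst|exact: measurable_coord].
by apply/funext => x; rewrite !mxE.
Qed.

Lemma ge0_integral_affine n (a : 'rV[R]_n) (r : R) (f : 'rV[R]_n -> \bar R) : 0 < r ->
  measurable_fun setT f -> (forall x, 0 <= f x)%E ->
  (\int[leb n]_x f (a + r *: x)%R = (r ^- n)%:E * \int[leb n]_x f x)%E.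
Proof.
move=> r0; elim: n a f => [|n IH] a f mf f0.
  rewrite /= !integral_dirac//; last first.
    by apply: measurableT_comp => //; exact: measurable_affine.
  rewrite !diracT !mul1e expr0 invr1 mul1e; congr f.
  by apply/rowP => -[].
have mfa : measurable_fun setT (fun x : 'rV[R]_n.+1 => f (a + r *: x)).
  by apply: measurableT_comp => //; exact: measurable_affine.
rewrite !integral_row_cons //.
pose a' : 'rV[R]_n := \row_i a ord0 (lift ord0 i).
have mrc t : measurable_fun setT (fun v : 'rV[R]_n => f (row_cons (t, v))).
  apply: (measurableT_comp mf).
  apply: (measurableT_comp (@measurable_row_cons R n)).
  exact: pair1_measurable.
have mF : measurable_fun setT
    (fun t : measurableTypeR R => \int[leb n]_v f (row_cons (t, v)))%E.
  apply: (@measurable_fun_fubini_tonelli_F _ _ _ _ _ (leb n) (fun z => f (row_cons z))) => //.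
  by apply: (measurableT_comp mf); exact: measurable_row_cons.
under eq_integral => t _.
  under eq_integral => v _ do rewrite row_cons_affine -/a'.
  rewrite (IH a' (fun v => f (row_cons (a ord0 ord0 + r * t, v)))) //.
  over.
rewrite /= (ge0_integralZl _ measurableT); last 3 first.
- apply: (@measurableT_comp _ _ _ _ _ _ (fun t => \int[leb n]_v f (row_cons (t, v)))%E _ (fun t => a ord0 ord0 + r * t)) => //.
  exact: measurable_mulD_real.
- by move=> t _; exact: integral_ge0.
- by rewrite lee_fin invr_ge0 exprn_ge0// ltW.
rewrite (ge0_integral_affine1 _ r0 mF); last by move=> t; exact: integral_ge0.
by rewrite muleA -EFinM exprSr invfM mulrC.
Qed.

End affine_change.

(** * Measurability of vector-valued maps *)

Section measurable_rowvectors.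
Context {R : realType} {n : nat} {d : measure_display} {T : measurableType d}.
Local Notation V := 'rV[R]_n.

Lemma measurable_funDV (f g : T -> V) : measurable_fun setT f ->
  measurable_fun setT g -> measurable_fun setT (fun x => f x + g x).
Proof.
move=> mf mg; apply: measurable_rV => i; under eq_fun do rewrite mxE.
by apply: measurable_funD; apply: (measurableT_comp (measurable_coord i)).
Qed.

Lemma measurable_funNV (f : T -> V) : measurable_fun setT f ->
  measurable_fun setT (fun x => - f x).
Proof.
move=> mf; apply: measurable_rV => i; under eq_fun do rewrite mxE.
by apply: measurableT_comp => //; apply: (measurableT_comp (measurable_coord i)).
Qed.

Lemma measurable_funZV (k : T -> R) (f : T -> V) : measurable_fun setT k ->
  measurable_fun setT f -> measurable_fun setT (fun x => k x *: f x).
Proof.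
move=> mk mf; apply: measurable_rV => i; under eq_fun do rewrite mxE.
by apply: measurable_funM => //; apply: (measurableT_comp (measurable_coord i)).
Qed.

Lemma continuous_measurable_rV (f : V -> R) : continuous f -> measurable_fun setT f.
Proof.
move=> cf; apply: (measurability _ (RGenOpens.measurableE R)).
move=> _ [_ [a [b ->] <-]]; rewrite setTI; apply: open_measurable_rV.
apply: open_comp => [v _|]; first exact: cf.
exact: interval_open.
Qed.

Lemma measurable_norm_rV : measurable_fun [set: V] (fun x : V => `|x|).
Proof. by apply: continuous_measurable_rV; exact: norm_continuous. Qed.

Lemma measurable_normV (f : T -> V) : measurable_fun setT f ->
  measurable_fun setT (fun x => `|f x|).
Proof.
by move=> mf; apply: (measurableT_comp measurable_norm_rV).
Qed.

Lemma measurable_natr (b : T -> bool) : measurable_fun setT b ->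
  measurable_fun setT (fun x => (b x)%:R : R).
Proof.
move=> mb; rewrite (_ : (fun _ => _) = (fun x => if b x then 1 else 0)).
  by apply: measurable_fun_ifT => //; exact: measurable_cst.
by apply/funext => x; case: (b x).
Qed.

Lemma measurable_funV (f : T -> R) : measurable_fun setT f ->
  measurable_fun setT (fun x => (f x)^-1).
Proof.
(* Powers with exponent -1 are inverses only for a nonnegative base, hence the split by sign. *)
move=> mf; rewrite (_ : (fun _ => _) =
  (fun x => if 0 <= f x then f x `^ (-1) else - ((- f x) `^ (-1)))).
  apply: measurable_fun_ifT.
  - by apply: measurable_fun_ler => //; exact: measurable_cst.
  - exact: (measurableT_comp (measurable_powR _)).
  - apply: measurableT_comp => //; apply: (measurableT_comp (measurable_powR _)).
    exact: measurableT_comp.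
apply/funext => x; case: ifPn => [f0|]; first by rewrite powR_inv1.
by rewrite -ltNge => f0; rewrite powR_inv1 ?oppr_ge0 1?ltW// invrN opprK.
Qed.
End measurable_rowvectors.

Section measurable_aux.
Context {R : realType} {d : measure_display} {T : measurableType d}.
Lemma measurable_oppr_comp (f : T -> R) : measurable_fun setT f ->
  measurable_fun setT (fun x => - f x).
Proof. by move=> mf; apply: measurableT_comp. Qed.

Lemma measurable_normr_comp (f : T -> R) : measurable_fun setT f ->
  measurable_fun setT (fun x => `|f x|).
Proof. by move=> mf; apply: measurableT_comp. Qed.
End measurable_aux.

Ltac meas :=
  repeat (lazymatch goal with
  | |- measurable_fun _ (fun _ => ?c) => exact: measurable_cst
  | |- measurable_fun _ (fun x => x) => exact: measurable_id
  | |- measurable_fun _ (fun x => fst x) => exact: measurable_fst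
  | |- measurable_fun _ (fun x => snd x) => exact: measurable_snd
  | |- measurable_fun _ (fun x => EFin (@?f x)) => apply/measurable_EFinP
  | |- measurable_fun _ (fun x => (@?f x, @?g x)) => apply: measurable_fun_pair
  | |- measurable_fun _ (fun x => @GRing.add _ (@?f x) (@?g x)) =>
      first [apply: measurable_funD | apply: measurable_funDV]
  | |- measurable_fun _ (fun x => @GRing.add _ (@?f x) (@?g x)) =>
      first [apply: measurable_funD | apply: measurable_funDV]
  | |- measurable_fun _ (fun x => @GRing.opp _ (@?f x)) =>
      first [apply: measurable_oppr_comp | apply: measurable_funNV]
  | |- measurable_fun _ (fun x => @Algebra.opp _ (@?f x)) =>
      first [apply: measurable_oppr_comp | apply: measurable_funNV]
  | |- measurable_fun _ (fun x => @GRing.mul _ (@?f x) (@?g x)) => apply: measurable_funM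
  | |- measurable_fun _ (fun x => @GRing.scale _ _ (@?f x) (@?g x)) => apply: measurable_funZV
  | |- measurable_fun _ (fun x => @GRing.exp _ (@?f x) _) => apply: measurable_funX
  | |- measurable_fun _ (fun x => @GRing.inv _ (@?f x)) => apply: measurable_funV
  | |- measurable_fun _ (fun x => @Num.norm _ _ (@?f x)) =>
      first [apply: measurable_normV | apply: measurable_normr_comp]
  | |- measurable_fun _ (fun x => @Order.max _ _ (@?f x) (@?g x)) => apply: measurable_maxr
  | |- measurable_fun _ (fun x => @Order.min _ _ (@?f x) (@?g x)) => apply: measurable_minr
  | |- measurable_fun _ (fun x => powR (@?f x) ?a) => apply: (measurableT_comp (measurable_powR _))
  | |- measurable_fun _ (fun x => @GRing.natmul _ _ (nat_of_bool (@?f x))) => apply: measurable_natr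
  | |- measurable_fun _ (fun x => (@?f x) && (@?g x)) => apply: measurable_and
  | |- measurable_fun _ (fun x => (@?f x) || (@?g x)) => apply: measurable_or
  | |- measurable_fun _ (fun x => ~~ (@?f x)) => apply: measurable_neg
  | |- measurable_fun _ (fun x => @Order.le _ _ (@?f x) (@?g x)) => apply: measurable_fun_ler
  | |- measurable_fun _ (fun x => @Order.lt _ _ (@?f x) (@?g x)) => apply: measurable_fun_ltr
  | |- measurable_fun _ _ =>
      match goal with
      | H : measurable_fun _ ?f |- measurable_fun _ ?f => exact: H
      | H : measurable_fun _ ?f |- measurable_fun _ (fun x => ?f (@?g x)) =>
          apply: (measurableT_comp H)
      | _ => first [exact: measurable_norm_rV | exact: measurable_fst | exact: measurable_snd | exact: measurable_id]
      | |- measurable_fun ?D (@GRing.add ?W ?c) => change (measurable_fun D (fun y => @GRing.add W c y))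
      | |- measurable_fun ?D (@GRing.mul ?W ?c) => change (measurable_fun D (fun y => @GRing.mul W c y))
      | |- measurable_fun ?D (@GRing.scale ?K ?W ?c) => change (measurable_fun D (fun y => @GRing.scale K W c y))
      | |- measurable_fun ?D (@GRing.opp ?W) => change (measurable_fun D (fun y => @GRing.opp W y))
      | _ => apply: measurable_fun_ifT
      end
  end).

(** Redefined with [::=] when new nonnegative functions such as [J], [om] and [posp] appear, so that
    [nn] learns about them. *)
Ltac nn_hook := fail.
Ltac nn :=
  repeat (lazymatch goal with
  | H : is_true (0 <= ?x)%R |- is_true (0 <= ?x)%R => exact: H
  | H : is_true (0 < ?x)%R |- is_true (0 <= ?x)%R => exact: (ltW H)
  | |- is_true (0 <= _ * _)%R => apply: mulr_ge0
  | |- is_true (0 <= _ + _)%R => apply: addr_ge0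
  | |- is_true (0 <= _ ^+ 2)%R => apply: sqr_ge0
  | |- is_true (0 <= _ ^+ _)%R => apply: exprn_ge0
  | |- is_true (0 <= _^-1)%R => rewrite invr_ge0
  | |- is_true (0 <= `|_|)%R => apply: normr_ge0
  | |- is_true (0 <= powR _ _)%R => apply: powR_ge0
  | |- is_true (0 <= @GRing.natmul _ _ _)%R => apply: ler0n
  | |- is_true (0 <= 1)%R => apply: ler01
  | |- is_true (0 <= 0)%R => apply: lexx
  | |- is_true (0 <= Num.max _ _)%R => rewrite le_max; apply/orP; first [by left; nn | by right; nn]
  | |- is_true (0 <= Num.min _ _)%R => rewrite le_min; apply/andP; split
  | |- is_true (0 <= (if _ then _ else _))%R => case: ifP => _
  | H : forall x, is_true (0 <= ?f x)%R |- is_true (0 <= ?f _)%R => apply: H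
  | H : forall x y, is_true (0 <= ?f x y)%R |- is_true (0 <= ?f _ _)%R => apply: H
  | |- _ => nn_hook
  end).

Lemma boolr_le {R : realType} (b : bool) (x : R) : 0 <= x -> (b -> 1 <= x) -> b%:R <= x.
Proof. by case: b => // _; apply. Qed.

(** * Integral bounds for nonnegative functions *)

Section bounded_integral.
Context {d : measure_display} {T : measurableType d} {R : realType}.
Variable mu : {measure set T -> \bar R}.
Implicit Types (f g : T -> R) (c : R).

(* Carrying measurability and positivity along makes upper bounds on integrals
   compositional, and keeps the bounds real-valued. *)
Definition bd f c : Prop :=
  [/\ measurable_fun setT f, forall x, 0 <= f x & (\int[mu]_x (f x)%:E <= c%:E)%E].

Lemma bd_meas f c : bd f c -> measurable_fun setT f. Proof. by case. Qed.

Lemma bd_fun_ge0 f c : bd f c -> forall x, 0 <= f x. Proof. by case. Qed.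

Lemma bd_ge0 f c : bd f c -> 0 <= c.
Proof.
case=> _ f0 fc; rewrite -lee_fin; apply: le_trans fc.
by apply: integral_ge0 => x _; rewrite lee_fin.
Qed.

Lemma bdW f c c' : bd f c -> c <= c' -> bd f c'.
Proof. by case=> mf f0 fc cc; split=> //; apply: le_trans fc _; rewrite lee_fin. Qed.

Lemma bd_le f g c : bd g c -> measurable_fun setT f -> (forall x, 0 <= f x) ->
  (forall x, f x <= g x) -> bd f c.
Proof.
case=> mg g0 gc mf f0 fg; split=> //; apply: le_trans gc.
apply: ge0_le_integral => //.
- by move=> x _; rewrite lee_fin.
- exact/measurable_EFinP.
- exact/measurable_EFinP.
- by move=> x _; rewrite lee_fin.
Qed.

Lemma bd_ae_le f g c : bd g c -> measurable_fun setT f -> (forall x, 0 <= f x) ->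
  {ae mu, forall x, f x <= g x} -> bd f c.
Proof.
case=> mg g0 gc mf f0 fg; split=> //; apply: le_trans gc.
apply: ae_ge0_le_integral => //.
- by move=> x _; rewrite lee_fin.
- exact/measurable_EFinP.
- by move=> x _; rewrite lee_fin.
- exact/measurable_EFinP.
- by apply: filterS fg => x fg _; rewrite lee_fin.
Qed.

Lemma bd_ext f g c : bd g c -> f =1 g -> bd f c.
Proof. by move=> bg /funext ->. Qed.

Lemma bd0 : bd (fun=> 0) 0.
Proof. by split=> //; rewrite integral0. Qed.

Lemma bdD f g a b : bd f a -> bd g b -> bd (fun x => f x + g x) (a + b).
Proof.
case=> mf f0 fa [mg g0 gb]; split; first exact: measurable_funD.
  by move=> x; exact: addr_ge0.
under eq_integral do rewrite EFinD.
rewrite ge0_integralD //; last 4 first.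
- by move=> x _; rewrite lee_fin.
- exact/measurable_EFinP.
- by move=> x _; rewrite lee_fin.
- exact/measurable_EFinP.
by rewrite EFinD; exact: leeD.
Qed.

Lemma bdZ f c k : 0 <= k -> bd f c -> bd (fun x => k * f x) (k * c).
Proof.
move=> k0 [mf f0 fc]; split.
- by apply: measurable_funM => //; exact: measurable_cst.
- by move=> x; exact: mulr_ge0.
under eq_integral do rewrite EFinM.
rewrite ge0_integralZl //; last 2 first.
- exact/measurable_EFinP.
- by move=> x _; rewrite lee_fin.
by rewrite EFinM; apply: lee_wpmul2l => //; rewrite lee_fin.
Qed.

Lemma bd_ex f : measurable_fun setT f -> (forall x, 0 <= f x) ->
  (\int[mu]_x (f x)%:E < +oo)%E ->
  exists2 c, (\int[mu]_x (f x)%:E = c%:E)%E & bd f c.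
Proof.
move=> mf f0 foo; have fin : (\int[mu]_x (f x)%:E)%E \is a fin_num.
  by rewrite ge0_fin_numE //; apply: integral_ge0 => x _; rewrite lee_fin.
exists (fine (\int[mu]_x (f x)%:E)); rewrite ?fineK //; split=> //.
by rewrite fineK.
Qed.

Lemma bd_int f c : bd f c ->
  exists c', [/\ (\int[mu]_x (f x)%:E = c'%:E)%E, bd f c' & c' <= c].
Proof.
move=> bf; have [mf f0 fc] := bf.
have [c' e b] := bd_ex mf f0 (le_lt_trans fc (ltry _)).
by exists c'; split => //; rewrite -lee_fin -e.
Qed.

Lemma bd_integrable f c : bd (fun x => `|f x|) c -> measurable_fun setT f ->
  mu.-integrable setT (EFin \o f).
Proof.
move=> [_ _ fc] mf; apply/integrableP; split; first exact/measurable_EFinP.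
by apply: le_lt_trans (ltry c); under eq_integral do rewrite /= .
Qed.

Lemma integrable_bd f : mu.-integrable setT (EFin \o f) ->
  exists c, bd (fun x => `|f x|) c.
Proof.
move=> /integrableP[/measurable_EFinP mf foo].
have [|x|//|c _ b] := @bd_ex (fun x => `|f x|); last by exists c.
  exact: measurable_normr_comp.
exact: normr_ge0.
Qed.

Lemma bd_fatou (f_ : nat -> T -> R) f c : (forall k, bd (f_ k) c) ->
  measurable_fun setT f -> (forall x, 0 <= f x) ->
  {ae mu, forall x, f_ ^~ x @ \oo --> f x} -> bd f c.
Proof.
move=> bf mf f0 ff; split=> //.
have mf_ k : measurable_fun setT (EFin \o f_ k) by apply/measurable_EFinP; case: (bf k).
have f_0 k x : (0 <= (f_ k x)%:E)%E by rewrite lee_fin; case: (bf k).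
apply: (@le_trans _ _ (\int[mu]_x limn_einf (fun k => (f_ k x)%:E))%E).
  apply: ae_ge0_le_integral => //.
  - by move=> x _; rewrite lee_fin.
  - exact/measurable_EFinP.
  - move=> x _; rewrite limn_einf_lim; apply: lime_ge; first exact: is_cvg_einfs.
    by apply: nearW => k; apply: le_ereal_inf_tmp => _ [j _ <-]; exact: f_0.
  (* Measurability of the lower limit is obtained from that of the upper limit of the opposite
     functions. *)
  - apply: (@measurableT_comp _ _ _ _ _ _ oppe) => //.
    apply: (@measurable_fun_limn_esup _ _ _ _ (fun k x => (- (f_ k x)%:E)%E)) => k.
    change (measurable_fun setT (EFin \o (fun x => - f_ k x))).
    by apply/measurable_EFinP; apply: measurable_oppr_comp; case: (bf k).
  - apply: filterS ff => x ffx _.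
    have /cvg_limn_einf_sup[-> _] : (f_ k x)%:E @[k --> \oo] --> (f x)%:E.
      by apply/fine_cvgP; split; first exact: nearW.
    by [].
apply: (le_trans (fatou mu measurableT mf_ (fun k x _ => f_0 k x))).
rewrite limn_einf_lim; apply: lime_le; first exact: is_cvg_einfs.
apply: nearW => k; apply: (@le_trans _ _ (\int[mu]_x (f_ k x)%:E)%E).
  by apply: ereal_inf_lbound; exists k => /=.
by case: (bf k).
Qed.

Lemma bd_ae0 f : bd f 0 -> {ae mu, forall x, f x = 0}.
Proof.
case=> mf f0 fc.
have e0 : (\int[mu]_x `|(f x)%:E| = 0)%E.
  apply/eqP; rewrite eq_le integral_ge0 // andbT; apply: le_trans fc.
  rewrite le_eqVlt; apply/orP; left; apply/eqP; apply: eq_integral => x _.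
  by rewrite gee0_abs // lee_fin.
have mE : measurable_fun setT (EFin \o f) by exact/measurable_EFinP.
have := (@ae_eq_integral_abs _ _ _ mu setT measurableT _ mE).1 e0.
by apply: filterS => x /(_ Logic.I) [].
Qed.

Lemma bd_small f : measurable_fun setT f -> (forall x, 0 <= f x) ->
  (forall e, 0 < e -> bd f e) -> bd f 0.
Proof.
move=> mf f0 bf; split=> //; apply/lee_addgt0Pr => e e0.
by rewrite add0e; case: (bf e e0).
Qed.

(** The form in which equations are exploited: the integral of [P] is known by testing, [P] has no
    sign, and the integrability of [A] comes from the pointwise bound itself. *)
Lemma bd_test (P A B : T -> R) (m c : R) : mu.-integrable setT (EFin \o P) ->
  (\int[mu]_x (P x)%:E <= m%:E)%E -> bd B c ->
  measurable_fun setT A -> (forall x, 0 <= A x) ->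
  (forall x, A x <= P x + B x) -> bd A (m + c).
Proof.
move=> iP Pm bB mA A0 AP; split=> //; have [mB B0 Bc] := bB.
have iB : mu.-integrable setT (EFin \o B).
  apply: (@bd_integrable _ c) => //; apply: (bd_ext bB) => x.
  by rewrite ger0_norm.
have mP : measurable_fun setT P.
  by case/integrableP: iP => /measurable_EFinP.
have iA : mu.-integrable setT (EFin \o A).
  apply: (le_integrable measurableT _ _ (integrableD measurableT iP iB)).
    exact/measurable_EFinP.
  move=> x _ /=; rewrite lee_fin !ger0_norm //.
  by apply: le_trans (A0 x) _; exact: AP.
apply: (@le_trans _ _ (\int[mu]_x ((EFin \o P) x + (EFin \o B) x))%E).
  apply: le_integral => //; first exact: integrableD.
  by move=> x _; rewrite -EFinD lee_fin.
by rewrite integralD // EFinD; exact: leeD.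
Qed.
End bounded_integral.

(** * Tonelli's theorem *)

Section tonelli.
Context {d1 d2 : measure_display} {T1 : measurableType d1} {T2 : measurableType d2}.
Context {R : realType}.
Variables (m1 : {sigma_finite_measure set T1 -> \bar R}).
Variables (m2 : {sigma_finite_measure set T2 -> \bar R}).
Implicit Types (f : T1 * T2 -> R).

Let measurable_F f : measurable_fun setT f -> (forall z, 0 <= f z) ->
  measurable_fun setT (fun x => \int[m2]_y (f (x, y))%:E)%E.
Proof.
move=> mf f0; apply: (@measurable_fun_fubini_tonelli_F _ _ _ _ _ m2 (EFin \o f)).
  exact/measurable_EFinP.
by move=> z; rewrite lee_fin.
Qed.

Let measurable_G f : measurable_fun setT f -> (forall z, 0 <= f z) ->
  measurable_fun setT (fun y => \int[m1]_x (f (x, y))%:E)%E.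
Proof.
move=> mf f0; apply: (@measurable_fun_fubini_tonelli_G _ _ _ _ _ m1 (EFin \o f)).
  exact/measurable_EFinP.
by move=> z; rewrite lee_fin.
Qed.

Lemma ge0_integral_prod_x f : measurable_fun setT f -> (forall z, 0 <= f z) ->
  (\int[m1 \x m2]_z (f z)%:E = \int[m1]_x \int[m2]_y (f (x, y))%:E)%E.
Proof.
move=> mf f0; rewrite (@fubini_tonelli1 _ _ _ _ _ _ _ (EFin \o f)) //.
exact/measurable_EFinP.
Qed.

Lemma ge0_integral_prod_y f : measurable_fun setT f -> (forall z, 0 <= f z) ->
  (\int[m1 \x m2]_z (f z)%:E = \int[m2]_y \int[m1]_x (f (x, y))%:E)%E.
Proof.
move=> mf f0; rewrite (@fubini_tonelli2 _ _ _ _ _ _ _ (EFin \o f)) //.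
exact/measurable_EFinP.
Qed.

Lemma bd_prod_x f (h : T1 -> R) c : measurable_fun setT f -> (forall z, 0 <= f z) ->
  (forall x, bd m2 (fun y => f (x, y)) (h x)) -> bd m1 h c -> bd (m1 \x m2)%E f c.
Proof.
move=> mf f0 fh [mh h0 hc]; split=> //; rewrite ge0_integral_prod_x //.
apply: le_trans hc; apply: ge0_le_integral => //.
- by move=> x _; apply: integral_ge0 => y _; rewrite lee_fin.
- exact: measurable_F.
- exact/measurable_EFinP.
- by move=> x _; case: (fh x).
Qed.

Lemma bd_prod_y f (h : T2 -> R) c : measurable_fun setT f -> (forall z, 0 <= f z) ->
  (forall y, bd m1 (fun x => f (x, y)) (h y)) -> bd m2 h c -> bd (m1 \x m2)%E f c.
Proof.
move=> mf f0 fh [mh h0 hc]; split=> //; rewrite ge0_integral_prod_y //.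
apply: le_trans hc; apply: ge0_le_integral => //.
- by move=> x _; apply: integral_ge0 => y _; rewrite lee_fin.
- exact: measurable_G.
- exact/measurable_EFinP.
- by move=> x _; case: (fh x).
Qed.

(** The inner integral may be infinite for some [x]; asking only that [h] lie below it keeps [h]
    real-valued. *)
Lemma bd_section_x f (h : T1 -> R) c : bd (m1 \x m2)%E f c ->
  measurable_fun setT h -> (forall x, 0 <= h x) ->
  (forall x, (h x)%:E <= \int[m2]_y (f (x, y))%:E)%E -> bd m1 h c.
Proof.
move=> [mf f0 fc] mh h0 hf; split=> //; apply: le_trans fc.
rewrite ge0_integral_prod_x //; apply: ge0_le_integral => //.
- by move=> x _; rewrite lee_fin.
- exact/measurable_EFinP.
- exact: measurable_F.
Qed.

Lemma ae_prod_x (P : set T1) : {ae m1, forall x, P x} ->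
  {ae (m1 \x m2)%E, forall z, P z.1}.
Proof.
move=> [N [mN N0 PN]]; exists (N `*` setT); split.
- exact: measurableX.
- by rewrite product_measure1E //; rewrite [X in (X * _)%E](_ : _ = 0%E) ?mul0e.
- by move=> [x y] /= Pz; split => //; apply: PN.
Qed.

Lemma ae_prod_y (P : set T2) : {ae m2, forall x, P x} ->
  {ae (m1 \x m2)%E, forall z, P z.2}.
Proof.
move=> [N [mN N0 PN]]; exists (setT `*` N); split.
- exact: measurableX.
- by rewrite product_measure1E //; rewrite [X in (_ * X)%E](_ : _ = 0%E) ?mule0.
- by move=> [x y] /= Pz; split => //; apply: PN.
Qed.

End tonelli.

(** * Changes of variables in simple and double integrals *)

Section change_of_variables.
Context {R : realType} {n : nat}.
Local Notation V := 'rV[R]_n.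
Local Notation mu := (@lebesgue_rV R n).
Local Notation mu2 := (mu \x mu)%E.
Implicit Types (f : V * V -> R).

Lemma bd_affine (h : V -> R) c (a : V) (r : R) : 0 < r ->
  bd mu h c -> bd mu (fun x => h (a + r *: x)) (r ^- n * c).
Proof.
move=> r0 [mh h0 hc]; split=> //.
  by apply: (measurableT_comp mh); exact: measurable_affine.
rewrite (@ge0_integral_affine _ _ a r (EFin \o h)) //; last by exact/measurable_EFinP.
rewrite EFinM; apply: lee_wpmul2l => //.
by rewrite lee_fin invr_ge0 exprn_ge0 // ltW.
Qed.

Lemma bd_shift (h : V -> R) c (a : V) : bd mu h c -> bd mu (fun x => h (a + x)) c.
Proof.
move=> /(bd_affine a ltr01); rewrite expr1n invr1 mul1r.
by move=> b; apply: (bd_ext b) => x; rewrite scale1r.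
Qed.

Lemma ge0_integral_swap f : measurable_fun setT f -> (forall z, 0 <= f z) ->
  (\int[mu2]_z (f (z.2, z.1))%:E = \int[mu2]_z (f z)%:E)%E.
Proof.
move=> mf f0; rewrite (@ge0_integral_prod_x _ _ _ _ _ mu mu (fun z => f (z.2, z.1))) //=.
  by rewrite ge0_integral_prod_y.
by meas.
Qed.

Lemma bd_swap f c : bd mu2 f c -> bd mu2 (fun z => f (z.2, z.1)) c.
Proof. by case=> mf f0 fc; split => //; [meas|rewrite ge0_integral_swap]. Qed.

(** The centre [g z.1] of the affine map may depend on the first variable; shears, dilations of one
    variable and, after a swap, of both are instances. *)
Lemma ge0_integral_fiber f (g : V -> V) (r : R) : 0 < r -> measurable_fun setT g ->
  measurable_fun setT f -> (forall z, 0 <= f z) ->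
  (\int[mu2]_z (f (z.1, g z.1 + r *: z.2))%:E = (r ^- n)%:E * \int[mu2]_z (f z)%:E)%E.
Proof.
move=> r0 mg mf f0.
rewrite (@ge0_integral_prod_x _ _ _ _ _ mu mu (fun z => f (z.1, g z.1 + r *: z.2))) //=; last by meas.
rewrite ge0_integral_prod_x // -ge0_integralZl //; last 3 first.
- apply: (@measurable_fun_fubini_tonelli_F _ _ _ _ _ mu (EFin \o f)).
    exact/measurable_EFinP.
  by move=> z; rewrite lee_fin.
- by move=> x _; apply: integral_ge0 => y _; rewrite lee_fin.
- by rewrite lee_fin invr_ge0 exprn_ge0 // ltW.
apply: eq_integral => x _.
rewrite (@ge0_integral_affine _ _ (g x) r (fun y => (f (x, y))%:E)) //.
  by apply/measurable_EFinP; apply: (measurableT_comp mf); exact: pair1_measurable.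
by move=> y; rewrite lee_fin.
Qed.

Lemma bd_fiber f (g : V -> V) (r : R) c : 0 < r -> measurable_fun setT g ->
  bd mu2 f c -> bd mu2 (fun z => f (z.1, g z.1 + r *: z.2)) (r ^- n * c).
Proof.
move=> r0 mg [mf f0 fc]; split => //; first by meas.
rewrite (ge0_integral_fiber r0 mg mf f0) EFinM; apply: lee_wpmul2l => //.
by rewrite lee_fin invr_ge0 exprn_ge0 // ltW.
Qed.

Lemma bd_shear f c : bd mu2 f c -> bd mu2 (fun z => f (z.1, z.1 + z.2)) c.
Proof.
have mid : measurable_fun setT (fun x : V => x) by meas.
move=> /(bd_fiber ltr01 mid); rewrite expr1n invr1 mul1r.
by move=> b; apply: (bd_ext b) => x; rewrite scale1r.
Qed.

Lemma bd_unshear f c : bd mu2 f c -> bd mu2 (fun z => f (z.1, z.2 - z.1)) c.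
Proof.
have mN : measurable_fun setT (fun x : V => - x) by meas.
move=> /(bd_fiber ltr01 mN); rewrite expr1n invr1 mul1r => b; apply: (bd_ext b).
by move=> x; rewrite scale1r addrC.
Qed.

Lemma ge0_integral_diag f (a : V) (r : R) : 0 < r ->
  measurable_fun setT f -> (forall z, 0 <= f z) ->
  (\int[mu2]_z (f (a + r *: z.1, a + r *: z.2))%:E =
   (r ^- n * r ^- n)%:E * \int[mu2]_z (f z)%:E)%E.
Proof.
move=> r0 mf f0.
have ma : measurable_fun setT (fun _ : V => a) by meas.
rewrite (@ge0_integral_fiber (fun z => f (a + r *: z.1, z.2)) (fun=> a)) //; last by meas.
rewrite EFinM -muleA; congr (_ * _)%E.
rewrite -(@ge0_integral_swap (fun z => f (a + r *: z.1, z.2))) //; last by meas.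
rewrite (@ge0_integral_fiber (fun z => f (z.2, z.1)) (fun=> a)) //; last by meas.
by rewrite ge0_integral_swap.
Qed.

Lemma bd_diag f (a : V) (r : R) c : 0 < r ->
  bd mu2 f c -> bd mu2 (fun z => f (a + r *: z.1, a + r *: z.2)) (r ^- n * r ^- n * c).
Proof.
move=> r0 [mf f0 fc]; split=> //; first by meas.
rewrite (ge0_integral_diag a r0 mf f0) [leRHS]EFinM; apply: lee_wpmul2l => //.
by rewrite lee_fin mulr_ge0 // invr_ge0 exprn_ge0 // ltW.
Qed.

Lemma integral_diag f (a : V) (r : R) : 0 < r -> mu2.-integrable setT (EFin \o f) ->
  mu2.-integrable setT (fun z => (f (a + r *: z.1, a + r *: z.2))%:E) /\
  (\int[mu2]_z (f (a + r *: z.1, a + r *: z.2))%:E =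
   (r ^- n * r ^- n)%:E * \int[mu2]_z (f z)%:E)%E.
Proof.
move=> r0 fi; have [c bc] := integrable_bd fi.
have mf : measurable_fun setT f by case/integrableP: fi => /measurable_EFinP.
split.
  by apply: (bd_integrable (bd_diag a r0 bc)); meas.
have pE (g : V * V -> R) : (fun z => (g z)%:E)^\+%E = (fun z => (Num.max (g z) 0)%:E).
  by apply/funext => z; rewrite funeposE -EFin_max.
have nE (g : V * V -> R) : (fun z => (g z)%:E)^\-%E = (fun z => (Num.max (- g z) 0)%:E).
  by apply/funext => z; rewrite funenegE -EFinN -EFin_max.
have pfin (g : V * V -> R) : measurable_fun setT g -> (forall z, `|g z| <= `|f z|) ->
    (\int[mu2]_z (Num.max (g z) 0)%:E)%E \is a fin_num.
  move=> mg gf.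
  have [|||_ _ h] := @bd_le _ _ _ _ (fun z => Num.max (g z) 0) _ _ bc.
  - by meas.
  - by move=> z; rewrite le_max lexx orbT.
  - by move=> z; apply: le_trans (gf z); rewrite ge_max normr_ge0 ler_norm.
  rewrite ge0_fin_numE ?(le_lt_trans h) ?ltry //.
  by apply: integral_ge0 => z _; rewrite lee_fin le_max lexx orbT.
(* The nonnegative case is applied to both parts; both integrals are finite, which makes their
   difference meaningful. *)
rewrite integralE [in RHS]integralE !pE !nE.
rewrite (@ge0_integral_diag (fun z => Num.max (f z) 0)) //; last 2 first.
- by meas.
- by move=> z; rewrite le_max lexx orbT.
rewrite (@ge0_integral_diag (fun z => Num.max (- f z) 0)) //; last 2 first.
- by meas.
- by move=> z; rewrite le_max lexx orbT.
have := pfin _ mf (fun z => lexx _).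
have : (\int[mu2]_z (Num.max (- f z) 0)%:E)%E \is a fin_num.
  by apply: (pfin (fun z => - f z)); [meas|move=> z; rewrite normrN].
set A := (\int[mu2]_z (Num.max (- f z) 0)%:E)%E.
set B := (\int[mu2]_z (Num.max (f z) 0)%:E)%E => Afin Bfin.
clearbody A B; case: A Afin => [A||] // _; case: B Bfin => [B||] // _.
by transitivity ((r ^- n * r ^- n * (B - A))%:E); [rewrite mulrBr|].
Qed.
End change_of_variables.

(** * Volumes of cubes, the balls of the sup norm *)

Section cubes.
Context {R : realType} {n : nat}.
Local Notation V := 'rV[R]_n.
Local Notation mu := (@lebesgue_rV R n).

Lemma normVE (x : V) : `|x| = \big[Num.max/0]_ij `|x ij.1 ij.2|.
Proof. by rewrite -mx_normrE. Qed.

Lemma normV_ltP (x : V) (r : R) : 0 < r ->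
  reflect (forall i, `|x ord0 i| < r) (`|x| < r).
Proof.
move=> r0; rewrite normVE; apply: (iffP idP).
  by move=> /bigmax_ltP[_ h] i; exact: (h (ord0, i)).
by move=> h; apply/bigmax_ltP; split => // -[i j] _ /=; rewrite (ord1 i).
Qed.

Lemma coord_le_norm (x : V) i : `|x ord0 i| <= `|x|.
Proof.
by rewrite normVE; exact: (le_bigmax _ (fun ij => `|x ij.1 ij.2|) (ord0, i)).
Qed.

Lemma normV_leP (x : V) (r : R) : 0 <= r ->
  reflect (forall i, `|x ord0 i| <= r) (`|x| <= r).
Proof.
move=> r0; apply: (iffP idP) => [h i|h]; first exact: le_trans (coord_le_norm x i) h.
by rewrite normVE; apply/bigmax_leP; split => // -[i j] _ /=; rewrite (ord1 i).
Qed.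

Definition box (a b : R) : set V := [set v | forall i, a < v ord0 i <= b].

Lemma measurable_box a b : measurable (box a b).
Proof.
rewrite (_ : box a b = \bigcap_i ((fun v : V => v ord0 i) @^-1` `]a, b]%classic)).
  apply: fin_bigcap_measurable; first exact: finite_finset.
  by move=> i _; rewrite -[X in measurable X]setTI; exact: measurable_coord.
apply/seteqP; split => v /= h i; first by move=> _; rewrite /= in_itv /=; exact: h.
by have := h i Logic.I; rewrite /= in_itv.
Qed.

Lemma integral_box a b : a <= b -> (\int[mu]_x (\1_(box a b) x)%:E = ((b - a) ^+ n)%:E)%E.
Proof.
move=> ab; rewrite integral_indic //; last exact: measurable_box.
rewrite setIT.
have := @lebesgue_rV_box R n (const_mx a) (const_mx b).
rewrite (_ : (fun x : V => _) = box a b); last first.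
  by apply/seteqP; split => v /= h i; have := h i; rewrite !mxE.
move=> h; apply: (etrans (h _)); first by move=> i; rewrite !mxE.
by congr EFin; under eq_bigr do rewrite !mxE; rewrite prodr_const card_ord.
Qed.

Lemma bd_box (f : V -> R) a b : a <= b -> measurable_fun setT f ->
  (forall x, 0 <= f x <= 1) -> (forall x, f x != 0 -> box a b x) -> bd mu f ((b - a) ^+ n).
Proof.
move=> ab mf f01 fbox.
have bb : bd mu (\1_(box a b) : V -> R) ((b - a) ^+ n).
  split; last by rewrite integral_box.
    by apply: measurable_indic; exact: measurable_box.
  by move=> x; rewrite indicE ler0n.
apply: (bd_le bb) => // x; first by case/andP: (f01 x).
rewrite indicE; case: (eqVneq (f x) 0) => [->|fx]; first exact: ler0n.
by rewrite mem_set; [case/andP: (f01 x)|exact: fbox].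
Qed.

Lemma box_lower (f : V -> R) a b : a <= b -> measurable_fun setT f ->
  (forall x, 0 <= f x) -> (forall x, box a b x -> 1 <= f x) ->
  (((b - a) ^+ n)%:E <= \int[mu]_x (f x)%:E)%E.
Proof.
move=> ab mf f0 fbox; rewrite -integral_box //; apply: ge0_le_integral => //.
- by apply/measurable_EFinP; apply: measurable_indic; exact: measurable_box.
- exact/measurable_EFinP.
- move=> x _; rewrite lee_fin indicE; case: (boolP (x \in _)) => // /set_mem.
  exact: fbox.
Qed.

Lemma bd_cube (r : R) : 0 < r -> bd mu (fun x => (`|x| < r)%R%:R) ((2 * r) ^+ n).
Proof.
move=> r0; have -> : 2 * r = r - (- r) by lra.
apply: bd_box; [lra|by meas|by move=> x; case: ltP; rewrite ?ler01 ?lexx|].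
move=> x; case: (boolP (`|x| < r)) => [/(normV_ltP _ r0) h _ i|]; last by rewrite eqxx.
by have := h i; rewrite ltr_norml => /andP[-> /ltW].
Qed.

Lemma bd_cube_at (r : R) (a : V) : 0 < r -> bd mu (fun x => (`|x - a| < r)%R%:R) ((2 * r) ^+ n).
Proof.
move=> r0; apply: (bd_ext (bd_shift (- a) (bd_cube r0))) => x.
by rewrite addrC.
Qed.

Lemma cube_lower (r : R) : 0 < r -> ((r ^+ n)%:E <= \int[mu]_x ((`|x| < r)%R%:R)%:E)%E.
Proof.
(* The half-open box with sides [r] centred at 0 lies inside the open cube of radius [r], so no
   boundary has to be treated. *)
move=> r0; have {1}-> : r = r / 2 - (- (r / 2)) by lra.
apply: box_lower; [lra|by meas|by move=> x; exact: ler0n|].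
move=> x bx; suff -> : `|x| < r by [].
apply/(normV_ltP _ r0) => i; have /andP[h1 h2] := bx i.
by rewrite ltr_norml; apply/andP; split; lra.
Qed.

(** The annulus contains the box with all coordinates in []r/2, r]]. *)
Lemma annulus_lower (r : R) : (0 < n)%N -> 0 < r ->
  (((r / 2) ^+ n)%:E <= \int[mu]_x (((r / 2 < `|x|)%R && (`|x| <= r)%R)%:R)%:E)%E.
Proof.
move=> n0 r0; have {1}-> : r / 2 = r - r / 2 by lra.
apply: box_lower; [lra|by meas|by move=> x; exact: ler0n|].
move=> x bx; suff -> : (r / 2 < `|x|) && (`|x| <= r) by [].
apply/andP; split.
  apply: lt_le_trans (coord_le_norm x (Ordinal n0)).
  by have /andP[h _] := bx (Ordinal n0); apply: lt_le_trans h (ler_norm _).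
apply/normV_leP; first lra.
move=> i; have /andP[h1 h2] := bx i.
by rewrite ler_norml; apply/andP; split; lra.
Qed.

End cubes.

(** * Integrals of powers of the norm *)

Section powR_facts.
Context {R : realType}.

Lemma powRN_le (x y b : R) : 0 <= b -> 0 < x -> x <= y -> y `^ (- b) <= x `^ (- b).
Proof.
move=> b0 x0 xy; have y0 : 0 < y by exact: lt_le_trans xy.
rewrite !powRN lef_pV2 ?posrE ?powR_gt0 //.
by apply: ge0_ler_powR => //; rewrite nnegrE ltW.
Qed.

(** Used, like the next lemma, with [t = 1 - s]: the lower bound controls the integral of the kernel
    near 0, the upper one the gain in midpoint bisection. *)
Lemma powR4_lower (t : R) : 0 <= t -> 1 + t * ln 4 <= 4 `^ t.
Proof. by move=> t0; rewrite /powR pnatr_eq0 /= expR_ge1Dx. Qed.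

Lemma powR4_upper (t : R) : 0 <= t -> t <= 1 -> 4 `^ t - 1 <= 4 * ln 4 * t.
Proof.
move=> t0 t1; have e1 := expR_ge1Dx (- (t * ln (4 : R))).
have l0 : 0 < ln (4 : R) by rewrite ln_gt0 // ltr1n.
have p0 : 0 < 4 `^ t by rewrite powR_gt0.
have p4 : 4 `^ t <= 4.
  by rewrite -[leRHS]powRr1 //; apply: ler_powR => //; rewrite ler1n.
have pE : 4 `^ t * expR (- (t * ln (4 : R))) = 1.
  by rewrite /powR pnatr_eq0 /= -expRD subrr expR0.
have h1 : 4 `^ t * (1 - t * ln 4) <= 1.
  by rewrite -[leRHS]pE; apply: ler_wpM2l => //; exact: ltW.
have h2 : 4 `^ t * (t * ln 4) <= 4 * (t * ln 4).
  by apply: ler_wpM2r => //; rewrite mulr_ge0 // ltW.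
lra.
Qed.

End powR_facts.

Section power_integrals.
Context {R : realType} {n : nat}.
Local Notation V := 'rV[R]_n.
Local Notation mu := (@lebesgue_rV R n).

Lemma normVZ (r : R) (x : V) : 0 <= r -> `|r *: x| = r * `|x|.
Proof. by move=> r0; rewrite normrZ ger0_norm. Qed.

(** By homogeneity, the integral over the cube without its part of radius 2^-(k+1) is at most 2^b
    2^n plus [q = 2^(b-n)] times the one without radius 2^-k. As q < 1, the fixed point [M] of this
    recursion bounds all of them, and Fatou's lemma concludes. *)
Lemma bd_near (b : R) : 0 < b -> b < n%:R ->
  bd mu (fun z : V => (`|z| < 1)%R%:R * `|z| `^ (- b))
    (2 `^ b * 2 ^+ n / (1 - 2 `^ (b - n%:R))).
Proof.
move=> b0 bn.
have qE : 2 `^ b * 2 ^- n = 2 `^ (b - n%:R) :> R.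
  by rewrite powRD ?powRN ?powR_mulrn // pnatr_eq0 implybT.
have q1 : 2 `^ (b - n%:R) < 1 :> R.
  by rewrite /powR pnatr_eq0 /= expR_lt1 pmulr_llt0 ?ln_gt0 ?ltr1n // subr_lt0.
set q := (2 `^ (b - n%:R) : R) in qE q1 *.
set M := _ / _.
have p0 : 0 < 2 `^ b :> R by rewrite powR_gt0.
have n0 : 0 < 2 ^+ n :> R by rewrite exprn_gt0.
have M0 : 0 <= M by rewrite divr_ge0 ?subr_ge0 ?ltW // mulr_gt0.
have ME : 2 `^ b * 2 ^+ n + q * M = M.
  by rewrite /M; field; rewrite subr_eq0 gt_eqF.
pose f (k : nat) (z : V) : R := ((2 ^- k <= `|z|) && (`|z| < 1))%R%:R * `|z| `^ (- b).
have mf k : measurable_fun setT (f k) by rewrite /f; meas.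
have f0 k z : 0 <= f k z by rewrite /f mulr_ge0 ?powR_ge0.
have fk k : bd mu (f k) M.
  elim: k => [|k IH].
    apply: (bd_le (bdW (bd0 mu) M0)) => // x.
    rewrite /f expr0 invr1; by case: leP => /= h; rewrite mul0r.
  have c1 := bdZ (ltW p0) (bd_cube (n := n) (@ltr01 R)).
  have c2 := bdZ (ltW p0) (bd_affine (0 : V) (ltr0Sn R 1) IH).
  apply: (bd_le (bdW (bdD c1 c2) _)) => //.
    by rewrite mulr1 mulrA qE ME.
  move=> z; rewrite /f add0r (normVZ _ (ler0n _ 2)).
  case: (boolP (2 ^- k.+1 <= `|z|)) => zk /=; last first.
    by rewrite mul0r addr_ge0 // !mulr_ge0 // ?powR_ge0 // ltW.
  case: (ltP `|z| 1) => z1 /=; last first.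
    by rewrite mul0r addr_ge0 // !mulr_ge0 // ?powR_ge0 // ltW.
  have zk2 : 2 ^- k <= 2 * `|z|.
    by move: zk; rewrite exprS invfM -ler_pdivrMl ?invr_gt0 ?invrK //.
  have z0 : 0 < `|z| by apply: lt_le_trans zk; rewrite invr_gt0 exprn_gt0.
  rewrite zk2 /= mulr1 mul1r; case: (ltP (2 * `|z|) 1) => z2 /=.
    have e2 : 2 `^ b * 2 `^ (- b) = 1 :> R by rewrite powRN mulfV // gt_eqF.
    by rewrite !mul1r (powRM _ (ler0n _ 2)) // mulrA e2 mul1r lerDr ltW.
  rewrite mul0r mulr0 addr0.
  have -> : 2 `^ b = 2^-1 `^ (- b) :> R.
    by rewrite -powR_inv1 // -powRrM mulN1r opprK.
  by apply: powRN_le; [exact: ltW|rewrite invr_gt0|lra].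
apply: (bd_fatou fk); first by meas.
  by move=> x; rewrite mulr_ge0 ?powR_ge0.
apply: aeW => z; rewrite /f.
(* A power of 0 with nonzero exponent is 0, so the integrand vanishes at the origin. *)
case: (eqVneq z 0) => [->|z0].
  rewrite normr0 powR0; last by rewrite oppr_eq0 gt_eqF.
  rewrite mulr0; under eq_fun do rewrite mulr0; exact: cvg_cst.
have zn : 0 < `|z| by rewrite normr_gt0.
have [k0 hk] : exists k0, forall k, (k0 <= k)%N -> 2 ^- k <= `|z|.
  exists (Num.bound `|z|^-1) => k hk; rewrite invf_ple ?posrE ?exprn_gt0 //.
  apply: (@le_trans _ _ k%:R); last by rewrite -natrX ler_nat ltnW // ltn_expl.
  apply: (@le_trans _ _ (Num.bound `|z|^-1)%:R); last by rewrite ler_nat.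
  by apply/ltW/archi_boundP; rewrite invr_ge0.
apply: cvg_near_cst; near=> k; rewrite hk //=; near: k; exact: nbhs_infty_ge.
Unshelve. all: by end_near. Qed.

(** The same recursion as in [bd_near], with doubling outer radii and ratio 2^(n-a). *)
Lemma bd_far (a : R) : n%:R < a ->
  bd mu (fun z : V => (1 <= `|z|)%R%:R * `|z| `^ (- a))
    (4 ^+ n / (1 - 2 `^ (n%:R - a))).
Proof.
move=> na.
have a0 : 0 <= a by apply: le_trans (ltW na).
have qE : 2 `^ (- a) * 2 ^+ n = 2 `^ (n%:R - a) :> R.
  by rewrite addrC powRD ?powRN ?powR_mulrn // pnatr_eq0 implybT.
have q1 : 2 `^ (n%:R - a) < 1 :> R.
  by rewrite /powR pnatr_eq0 /= expR_lt1 pmulr_llt0 ?ln_gt0 ?ltr1n // subr_lt0.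
set q := (2 `^ (n%:R - a) : R) in qE q1 *.
set M := _ / _.
have p0 : 0 < 2 `^ (- a) :> R by rewrite powR_gt0.
have M0 : 0 <= M by rewrite divr_ge0 ?subr_ge0 ?ltW.
have ME : 4 ^+ n + q * M = M.
  by rewrite /M; field; rewrite subr_eq0 gt_eqF.
pose f (k : nat) (z : V) : R := ((1 <= `|z|) && (`|z| < 2 ^+ k))%R%:R * `|z| `^ (- a).
have mf k : measurable_fun setT (f k) by rewrite /f; meas.
have f0 k z : 0 <= f k z by rewrite /f mulr_ge0 ?powR_ge0.
have fk k : bd mu (f k) M.
  elim: k => [|k IH].
    apply: (bd_le (bdW (bd0 mu) M0)) => // x.
    rewrite /f expr0; by case: leP => /= h; rewrite mul0r.
  have h0 : 0 < 2^-1 :> R by rewrite invr_gt0.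
  have c1 := bd_cube (n := n) (ltr0Sn R 1).
  have c2 := bdZ (ltW p0) (bd_affine (0 : V) h0 IH).
  apply: (bd_le (bdW (bdD c1 c2) _)) => //.
    by rewrite mulrA exprVn invrK qE -natrM ME.
  move=> z; rewrite /f add0r (normVZ _ (ltW h0)).
  case: (boolP (1 <= `|z|)) => zk /=; last by rewrite mul0r addr_ge0 // !mulr_ge0 // ?powR_ge0 // ltW.
  case: (ltP `|z| (2 ^+ k.+1)) => z1 /=; last by rewrite mul0r addr_ge0 // !mulr_ge0 // ?powR_ge0 // ltW.
  have z0 : 0 < `|z| by exact: lt_le_trans zk.
  case: (ltP `|z| 2) => z2 /=.
    rewrite mul1r -[leLHS]addr0; apply: lerD; last by rewrite !mulr_ge0 // ?powR_ge0 // ltW.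
    by apply: le_trans (powRN_le a0 ltr01 zk) _; rewrite powR1.
  have -> : 1 <= 2^-1 * `|z| by rewrite mulrC ler_pdivlMr // mul1r.
  have -> : 2^-1 * `|z| < 2 ^+ k by rewrite mulrC ltr_pdivrMr // -exprSr.
  rewrite /= !mul1r add0r powRM ?normr_ge0 ?invr_ge0 // mulrA.
  have -> : 2^-1 `^ (- a) = 2 `^ a :> R.
    by rewrite -powR_inv1 // -powRrM mulN1r opprK.
  have -> : 2 `^ (- a) * 2 `^ a = 1 :> R by rewrite powRN mulVf // gt_eqF // powR_gt0.
  by rewrite mul1r.
apply: (bd_fatou fk); first by meas.
  by move=> x; rewrite mulr_ge0 ?powR_ge0.
apply: aeW => z; rewrite /f.
apply: cvg_near_cst; near=> k.
suff -> : `|z| < 2 ^+ k by rewrite andbT.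
apply: (@lt_le_trans _ _ k%:R); last by rewrite -natrX ler_nat ltnW // ltn_expl.
apply: (@lt_le_trans _ _ (Num.bound `|z|)%:R); first exact/archi_boundP.
rewrite ler_nat; near: k; exact: nbhs_infty_ge.
Unshelve. all: by end_near. Qed.

End power_integrals.

(** * The model kernel *)

Section kernel.
Context {R : realType} {n : nat}.
Local Notation V := 'rV[R]_n.
Local Notation mu := (@lebesgue_rV R n).
Implicit Types (s : R) (z : V).

(** Formulated with the sup norm, whose balls are cubes; the passage from the Euclidean kernel of
    the equation is absorbed by the ellipticity constant. *)
Definition J s z : R := (1 - s) * `|z| `^ (- (n%:R + 2 * s)).

Lemma J_ge0 s z : s <= 1 -> 0 <= J s z.
Proof. by move=> s1; rewrite mulr_ge0 ?powR_ge0 // subr_ge0. Qed.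

Lemma measurable_J s : measurable_fun setT (J s).
Proof. by rewrite /J; meas. Qed.

Lemma JN s z : J s (- z) = J s z. Proof. by rewrite /J normrN. Qed.

Lemma JB s (x y : V) : J s (x - y) = J s (y - x).
Proof. by rewrite -JN opprB. Qed.

Lemma J0 s : 0 <= s -> (0 < n)%N -> J s 0 = 0.
Proof.
move=> s0 n0; rewrite /J normr0 powR0 ?mulr0 // oppr_eq0 gt_eqF //.
by rewrite ltr_pwDl ?ltr0n ?mulr_ge0.
Qed.

Lemma JZ s (r : R) z : 0 <= r -> J s (r *: z) = r `^ (- (n%:R + 2 * s)) * J s z.
Proof. by move=> r0; rewrite /J (normVZ _ r0) powRM ?normr_ge0 // mulrCA. Qed.

Lemma J_lower s (r : R) z : 0 <= s -> s <= 1 -> 0 < `|z| -> `|z| <= r ->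
  (1 - s) * r `^ (- (n%:R + 2 * s)) <= J s z.
Proof.
move=> s0 s1 z0 zr; apply: ler_wpM2l; first by rewrite subr_ge0.
by apply: powRN_le => //; rewrite addr_ge0 // mulr_ge0.
Qed.

Lemma J_upper s (r : R) z : 0 <= s -> s <= 1 -> 0 < r -> r <= `|z| ->
  J s z <= (1 - s) * r `^ (- (n%:R + 2 * s)).
Proof.
move=> s0 s1 z0 zr; apply: ler_wpM2l; first by rewrite subr_ge0.
by apply: powRN_le => //; rewrite addr_ge0 // mulr_ge0.
Qed.

(** In [bd_far] the ratio is 2^(-2s), at most 1/2 here, which makes the bound uniform in s. *)
Lemma J_tail (s : R) : 2^-1 <= s -> s < 1 ->
  bd mu (fun z : V => (1 <= `|z|)%R%:R * `|z| `^ (- (n%:R + 2 * s))) (2 * 4 ^+ n).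
Proof.
move=> s0 s1; apply: (bdW (bd_far _)); first by lra.
rewrite [X in _ <= X]mulrC; apply: ler_wpM2l; first exact: exprn_ge0.
have h : 2 `^ (n%:R - (n%:R + 2 * s)) <= 2^-1 :> R.
  rewrite -(powR_inv1 (ler0n R 2)); apply: ler_powR; first by rewrite ler1n.
  lra.
by rewrite invf_ple ?posrE //; lra.
Qed.

(* Uniform in s: the factor 1 - s compensates the divergence of the energy of
   Lipschitz functions as s -> 1. *)
Lemma J_quadratic : (2 <= n)%N -> exists2 C : R, 0 < C & forall s, 2^-1 <= s -> s < 1 ->
  bd mu (fun z => J s z * Num.min 1 (`|z| ^+ 2)) C.
Proof.
move=> n2; have l0 : 0 < ln (4 : R) by rewrite ln_gt0 // ltr1n.
exists (4 ^+ n * 4 / ln 4 * 2 ^+ n + 2 * 4 ^+ n).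
  by rewrite ltr_pwDl ?mulr_gt0 ?mulr_ge0 ?exprn_ge0 ?exprn_gt0 ?invr_gt0.
move=> s s0 s1; have n2R : 2 <= n%:R :> R by rewrite ler_nat.
pose b := n%:R + 2 * s - 2 : R.
have b0 : 0 < b by rewrite /b; lra.
have bn : b < n%:R by rewrite /b; lra.
have s1' : 0 <= 1 - s by lra.
have c1 := bdZ s1' (bd_near b0 bn).
have c2 := J_tail s0 s1.
have c := bdD c1 c2.
apply: (bd_le (bdW c _)).
- apply: lerD => //; rewrite -/b.
  have -> : 2 `^ (b - n%:R) = (4 `^ (1 - s))^-1 :> R.
    have -> : b - n%:R = 2 * (- (1 - s)) by rewrite /b; ring.
    by rewrite powRrM powR_mulrn // -natrX powRN.
  have p1 := powR4_lower s1'; set p := (4 `^ (1 - s) : R) in p1 *.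
  have p4 : p <= 4.
    by rewrite -[leRHS]powRr1 //; apply: ler_powR; [rewrite ler1n|lra].
  have p0 : 1 < p by apply: lt_le_trans p1; rewrite ltrDl mulr_gt0 //; lra.
  have hb : 2 `^ b <= 4 ^+ n :> R.
    apply: (@le_trans _ _ (2 `^ (n%:R * 2))).
      by apply: ler_powR; [rewrite ler1n|lra].
    by rewrite mulrC powRrM !powR_mulrn // -natrX.
  (* The denominator from [bd_near] is at least (1 - s) ln 4 / 4, since p - 1 >= (1 - s) ln 4 and p
     <= 4. *)
  have e0 : (1 - s) / (1 - p^-1) <= 4 / ln 4.
    rewrite ler_pdivrMr; last by rewrite subr_gt0 invf_lt1 //; lra.
    rewrite mulrAC ler_pdivlMr //.
    have -> : 1 - p^-1 = (p - 1) / p by field; rewrite gt_eqF //; lra.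
    rewrite mulrA ler_pdivlMr; last by lra.
    have h1 : (1 - s) * ln 4 * p <= (p - 1) * p by apply: ler_wpM2r; lra.
    by apply: (le_trans h1); rewrite mulrC; apply: ler_wpM2r; lra.
  have -> : (1 - s) * (2 `^ b * 2 ^+ n / (1 - p^-1)) =
    2 `^ b * ((1 - s) / (1 - p^-1)) * 2 ^+ n by ring.
  apply: ler_wpM2r; first exact: exprn_ge0.
  rewrite -mulrA; apply: (ler_pM _ _ hb e0); first exact: powR_ge0.
  by rewrite divr_ge0 // subr_ge0 invf_le1; lra.
- by have := @measurable_J s; move=> mJ; meas.
- move=> z; rewrite mulr_ge0 // ?J_ge0 ?ltW //; nn.
- move=> z; rewrite /J; case: (ltP `|z| 1) => z1 /=.
    rewrite mul0r addr0 mul1r -mulrA; apply: ler_wpM2l => //.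
    case: (eqVneq z 0) => [->|z0].
      by rewrite normr0 expr0n /= (_ : Num.min 1 0 = 0) ?mulr0 ?powR_ge0 //; apply/min_idPr.
    have zn : 0 < `|z| by rewrite normr_gt0.
    apply: (@le_trans _ _ (`|z| `^ (- (n%:R + 2 * s)) * `|z| ^+ 2)).
      by apply: ler_wpM2l; [exact: powR_ge0|rewrite ge_min lexx orbT].
    rewrite -(powR_mulrn 2) // -powRD; last by rewrite (gt_eqF zn) implybT.
    by rewrite /b le_eqVlt; apply/orP; left; apply/eqP; congr (_ `^ _); ring.
  rewrite mul0r mulr0 add0r mul1r.
  apply: (@le_trans _ _ ((1 - s) * `|z| `^ (- (n%:R + 2 * s)))).
    rewrite -[leRHS]mulr1; apply: ler_wpM2l; first by rewrite mulr_ge0 ?powR_ge0.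
    by rewrite ge_min lexx.
  by rewrite ler_piMl ?powR_ge0 //; lra.
Qed.

End kernel.

Ltac nn_hook ::= lazymatch goal with
  | |- is_true (0 <= J _ _)%R => apply: J_ge0; first [assumption | by apply: ltW]
  end.

Lemma ler_boolM {R : realType} (b : bool) (x : R) : 0 <= x -> b%:R * x <= x.
Proof. by move=> x0; case: b; rewrite ?mul1r ?mul0r. Qed.

Section bd_more.
Context {d : measure_display} {T : measurableType d} {R : realType}.
Variable mu : {measure set T -> \bar R}.

Lemma bd_subr (f g : T -> R) (b c : R) : bd mu (fun x => f x + g x) c ->
  measurable_fun setT f -> (forall x, 0 <= f x) ->
  measurable_fun setT g -> (forall x, 0 <= g x) ->
  (\int[mu]_x (g x)%:E = b%:E)%E -> bd mu f (c - b).
Proof.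
case=> mfg fg0 fgc mf f0 mg g0 gb; split=> //.
rewrite EFinB leeBrDr // -gb -ge0_integralD //.
- by move=> x _; rewrite lee_fin.
- exact/measurable_EFinP.
- by move=> x _; rewrite lee_fin.
- exact/measurable_EFinP.
Qed.

Lemma bd_lower (f : T -> R) (a c : R) : bd mu f c ->
  (a%:E <= \int[mu]_x (f x)%:E)%E -> a <= c.
Proof. by case=> _ _ fc af; rewrite -lee_fin; exact: le_trans fc. Qed.

End bd_more.

(** * Midpoint bisection and Poincaré inequalities *)

Section local_differences.
Context {R : realType} {n : nat}.
Local Notation V := 'rV[R]_n.
Local Notation mu := (@lebesgue_rV R n).
Local Notation mu2 := (mu \x mu)%E.
Implicit Types (s : R) (f w : V -> R).

Definition Df f (z : V * V) : R := f z.1 - f z.2.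

Definition enb s f (c : R) : Prop :=
  bd mu2 (fun z => J s (z.1 - z.2) * (Df f z) ^+ 2) c.

Lemma measurable_Df f : measurable_fun setT f -> measurable_fun setT (Df f).
Proof. by move=> mf; rewrite /Df; meas. Qed.

(** The constant of the bisection: 2 from the quadratic inequality, 2^-(n+2s) from the kernel at
    half the distance, and 2^n for each of the two changes of variables. *)
Lemma powR2_exp s : 0 <= s ->
  2 * 2 `^ (- (n%:R + 2 * s)) * (2 * 2 ^+ n) = 4 `^ (1 - s) :> R.
Proof.
move=> s0; have -> : 4 = 2 `^ 2 :> R by rewrite powR_mulrn // -natrX.
rewrite -powRrM -(powR_mulrn n) // mulrACA -natrM mulrC -mulrA -[X in _ = X]mul1r.
have -> : 4 = 2 `^ 2 :> R by rewrite powR_mulrn // -natrX.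
have p2 x y : 2 `^ x * 2 `^ y = 2 `^ (x + y) :> R by rewrite powRD // pnatr_eq0 implybT.
by rewrite !p2 mul1r; congr (_ `^ _); ring.
Qed.

(* Midpoint bisection (f x - f y)^2 <= 2 (f x - f m)^2 + 2 (f m - f y)^2 bounds
   the energy at distance <= rho by 4^(1-s) times the energy at distance
   <= rho/2; the excess 4^(1-s) - 1 = O(1-s) absorbs the factor 1-s of J. *)
Lemma annulus_energy s f (D : V -> bool) (rho e : R) : 2^-1 <= s -> s < 1 -> 0 < rho ->
  measurable_fun setT f -> measurable_fun setT D ->
  (forall x y, D x -> D y -> D (2^-1 *: x + 2^-1 *: y)) ->
  bd mu2 (fun z => (D z.1 && D z.2)%:R * (J s (z.1 - z.2) * (Df f z) ^+ 2)) e ->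
  bd mu2 (fun z => (D z.1 && D z.2)%:R *
     (((rho / 2 < `|z.1 - z.2|)%R && (`|z.1 - z.2| <= rho)%R)%:R * (Df f z) ^+ 2))
   (4 * ln 4 * rho `^ (n%:R + 2 * s) * e).
Proof.
move=> s0 s1 r0 mf mD Dmid bh.
have s1' : 0 < 1 - s by lra.
have mJ := @measurable_J R n s; have mDf := measurable_Df mf.
pose h (z : V * V) : R := (D z.1 && D z.2)%:R * (J s (z.1 - z.2) * (Df f z) ^+ 2).
pose hr (r : R) (z : V * V) := (`|z.1 - z.2| <= r)%R%:R * h z.
have h0 z : 0 <= h z by rewrite /h; nn.
have mh : measurable_fun setT h by rewrite /h; meas.
have mhr r : measurable_fun setT (hr r) by rewrite /hr; meas.
have hr0 r z : 0 <= hr r z by rewrite mulr_ge0.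
have bhr r : bd mu2 (hr r) e.
  apply: (bd_le bh) => // z; exact: ler_boolM.
have hsym z : h (z.2, z.1) = h z.
  by rewrite /h /= JB andbC /Df /= -sqrrN opprB.
have hrsym r z : hr r (z.2, z.1) = hr r z by rewrite /hr hsym /= distrC.
have [E [Eint bE Ee]] := bd_int (bhr (rho / 2)).
pose c := 2 `^ (- (n%:R + 2 * s)) : R.
have c0 : 0 <= c by exact: powR_ge0.
have h20 : 0 < 2^-1 :> R by rewrite invr_gt0.
have h21 : 2 * 2^-1 = 1 :> R by field.
have mg : measurable_fun setT (fun x : V => 2^-1 *: x) by meas.
have b1 := bd_fiber h20 mg bE.
have b2 : bd mu2 (fun z => hr (rho / 2) (2^-1 *: z.1 + 2^-1 *: z.2, z.2)) (2^-1 ^- n * E).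
  apply: (bd_ext (bd_swap b1)) => z /=.
  by rewrite -(hrsym _ (z.2, _)) /= addrC.
have bq : bd mu2 (hr rho) (4 `^ (1 - s) * E).
  have c20 : 0 <= 2 * c by rewrite mulr_ge0.
  apply: (bd_le (bdW (bdZ c20 (bdD b1 b2)) _)) => //.
    rewrite -powR2_exp; last by lra.
    by rewrite exprVn invrK -/c le_eqVlt; apply/orP; left; apply/eqP; ring.
  move=> z; rewrite /hr /h /=.
  case: (boolP (`|z.1 - z.2| <= rho)) => zr; last first.
    by rewrite mul0r; nn.
  case: (boolP (D z.1)) => D1 /=; last first.
    by rewrite mul0r mulr0; nn.
  case: (boolP (D z.2)) => D2 /=; last first.
    by rewrite mul0r mulr0; nn.
  set m := 2^-1 *: z.1 + 2^-1 *: z.2.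
  have e1 : z.1 - m = 2^-1 *: (z.1 - z.2).
    rewrite /m scalerBr opprD addrA -{1}(scale1r z.1) -scalerBl.
    by congr (_ *: _ - _); field.
  have e2 : m - z.2 = 2^-1 *: (z.1 - z.2).
    rewrite /m scalerBr -addrA -{2}(scale1r z.2) -scalerBl; congr (_ + _).
    by rewrite -scaleNr; congr (_ *: _); field.
  have ec : J s (z.1 - z.2) = c * J s (2^-1 *: (z.1 - z.2)).
    by have := JZ s (2^-1 *: (z.1 - z.2)) (ler0n R 2); rewrite scalerA h21 scale1r.
  have en : `|2^-1 *: (z.1 - z.2)| <= rho / 2.
    by rewrite normVZ ?invr_ge0 // mulrC ler_pM2r.
  rewrite e1 e2 en (Dmid _ _ D1 D2) !mul1r ec /Df /=.
  set K := J s _; have K0 : 0 <= c * K by rewrite mulr_ge0 // J_ge0 // ltW.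
  set p := f z.1; set q := f z.2; set t := f m.
  have := sqr_ge0 (p + q - 2 * t) => hh.
  have : (p - q) ^+ 2 <= 2 * ((p - t) ^+ 2 + (t - q) ^+ 2).
    by clear - hh; rewrite !expr2 in hh *; lra.
  move=> /(ler_wpM2l K0) h1; apply: (le_trans h1).
  by rewrite le_eqVlt; apply/orP; left; apply/eqP; ring.
pose an (z : V * V) : R := ((rho / 2 < `|z.1 - z.2|) && (`|z.1 - z.2| <= rho))%R%:R.
have man : measurable_fun setT an by rewrite /an; meas.
have bann : bd mu2 (fun z => an z * h z) (4 `^ (1 - s) * E - E).
  apply: (bd_subr (g := hr (rho / 2))) => //; first last.
  - by move=> z; rewrite mulr_ge0.
  - by meas.
  apply: (bd_ext bq) => z; rewrite /an /hr.
  case: (leP `|z.1 - z.2| (rho / 2)) => zr /=; last by rewrite mul0r addr0.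
  by rewrite mul0r add0r (_ : `|z.1 - z.2| <= rho) //; lra.
have k0 : 0 <= rho `^ (n%:R + 2 * s) / (1 - s) by rewrite divr_ge0 ?powR_ge0 ?ltW.
have E0 := bd_ge0 bE.
apply: (bd_le (bdW (bdZ k0 bann) _)).
- have := @powR4_upper R (1 - s) (ltW s1') _ => /(_ _)/[dup] _ h4.
  have {}h4 : 4 `^ (1 - s) - 1 <= 4 * ln 4 * (1 - s) by apply: h4; lra.
  apply: (@le_trans _ _ (rho `^ (n%:R + 2 * s) / (1 - s) * (4 * ln 4 * (1 - s) * e))).
    apply: ler_wpM2l => //.
    rewrite -[X in _ - X]mul1r -mulrBl; apply: ler_pM => //.
    have := powR4_lower (ltW s1'); have : 0 <= (1 - s) * ln 4 by rewrite mulr_ge0 ?ltW // ln_gt0 // ltr1n.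
    by move: (4 `^ _) => v; lra.
  by rewrite le_eqVlt; apply/orP; left; apply/eqP; field; rewrite gt_eqF.
- by meas.
- by move=> z; nn.
- move=> z; rewrite /an /h.
  case: (boolP (_ && (`|z.1 - z.2| <= rho))) => [/andP[z1 z2]|_] /=; last by rewrite !mul0r !mulr0.
  rewrite !mul1r [leRHS]mulrCA; apply: ler_wpM2l; first exact: ler0n.
  rewrite mulrA ler_peMl ?sqr_ge0 //.
  have z0 : 0 < `|z.1 - z.2| by apply: lt_trans z1; lra.
  have s00 : 0 <= s by lra.
  have := J_lower s00 (ltW s1) z0 z2.
  rewrite powRN => hJ; rewrite mulrAC ler_pdivlMr // mul1r.
  by rewrite -ler_pdivrMl ?powR_gt0 // mulrC.
Qed.

(** The annulus around any x has volume at least (rho/2)^n, twice the bound for the measure of [A].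
    So on at least half of it [f] vanishes and the difference equals f(x); the annulus energy then
    controls the integral of f^2. The gain is the factor rho^(2s), with rho tied to the measure of
    the support. *)
Lemma faber_krahn s f (A : V -> bool) (rho e m : R) : (0 < n)%N -> 2^-1 <= s -> s < 1 ->
  0 < rho -> measurable_fun setT f -> enb s f e ->
  bd mu (fun x => (A x)%:R) m -> m <= 2^-1 * (rho / 2) ^+ n ->
  (forall x, f x != 0 -> A x) ->
  bd mu (fun x => f x ^+ 2) (2 ^+ n * 2 * (4 * ln 4) * rho `^ (2 * s) * e).
Proof.
move=> n0 s0 s1 r0 mf bf bA mrho fA.
have mA : measurable_fun setT (fun x => (A x)%:R : R) by case: bA.
have bh : bd mu2 (fun z => (predT z.1 && predT z.2)%:R * (J s (z.1 - z.2) * (Df f z) ^+ 2)) e.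
  by apply: (bd_ext bf) => z; rewrite mul1r.
have mT : measurable_fun setT (fun x : V => predT x) by meas.
have := annulus_energy s0 s1 r0 mf mT (fun _ _ _ _ => isT) bh => /bd_shear b.
have v0 : 0 < (rho / 2) ^+ n by rewrite exprn_gt0 // divr_gt0.
pose h (x : V) := 2^-1 * (rho / 2) ^+ n * f x ^+ 2.
have bb : bd mu h (4 * ln 4 * rho `^ (n%:R + 2 * s) * e).
  apply: (bd_section_x b); rewrite /h; [by meas|by move=> x; nn|].
  move=> x /=.
  pose an (y : V) : R := ((rho / 2 < `|y|) && (`|y| <= rho))%R%:R.
  have man : measurable_fun setT an by rewrite /an; meas.
  have an0 y : 0 <= an y by exact: ler0n.
  have -> : (\int[mu]_y (1 * (((rho / 2 < `|x - (x + y)|) && (`|x - (x + y)| <= rho))%R%:R *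
      Df f (x, x + y) ^+ 2))%:E = \int[mu]_y (an y * (f x - f (x + y)) ^+ 2)%:E)%E.
    by apply: eq_integral => y _; rewrite mul1r /an opprD addrA subrr sub0r normrN.
  have [Ioo|] := ltP (\int[mu]_y (an y * (f x - f (x + y)) ^+ 2)%:E)%E +oo%E; last first.
    by move=> h'; apply: le_trans h'; exact: leey.
  have [||c cE bc] := bd_ex _ _ Ioo; [by meas|by move=> y; rewrite mulr_ge0 ?sqr_ge0|].
  rewrite cE lee_fin.
  have bsh := bdZ (sqr_ge0 (f x)) (bd_shift x bA).
  have ban : bd mu (fun y => f x ^+ 2 * an y) (c + f x ^+ 2 * m).
    apply: (bd_le (bdD bc bsh)).
    - by meas.
    - by move=> y; rewrite mulr_ge0 ?sqr_ge0.
    move=> y; case: (boolP (A (x + y))) => Ay.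
      rewrite mulr1; apply: (@le_trans _ _ (f x ^+ 2)).
        by rewrite ler_piMr ?sqr_ge0 // /an; case: (_ && _).
      by rewrite lerDr; nn.
    have -> : f (x + y) = 0 by apply/eqP; apply: contraNT Ay; exact: fA.
    by rewrite subr0 mulr0 addr0 mulrC.
  have lo : f x ^+ 2 * (rho / 2) ^+ n <= c + f x ^+ 2 * m.
    apply: (bd_lower ban); under eq_integral do rewrite EFinM.
    rewrite ge0_integralZl //; last 3 first.
    - exact/measurable_EFinP.
    - by move=> y _; rewrite lee_fin.
    - by rewrite lee_fin sqr_ge0.
    rewrite EFinM; apply: lee_wpmul2l; first by rewrite lee_fin sqr_ge0.
    exact: annulus_lower.
  have := ler_wpM2l (sqr_ge0 (f x)) mrho; set X := f x ^+ 2 in lo *; lra.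
have k0 : 0 <= 2 * ((rho / 2) ^+ n)^-1 by rewrite mulr_ge0 ?invr_ge0 ?ltW.
have := bdZ k0 bb; rewrite /h => bk.
have v1 : (rho / 2) ^+ n != 0 by rewrite gt_eqF.
apply: (bd_ext (bdW bk _)); last by move=> x; rewrite mulrA; field.
rewrite powRD; last by rewrite (gt_eqF r0) implybT.
rewrite (powR_mulrn n (ltW r0)) exprMn exprVn invfM invrK.
have r1 : rho ^+ n != 0 by rewrite expf_neq0 // gt_eqF.
by rewrite le_eqVlt; apply/orP; left; apply/eqP; field.
Qed.

(** Sums [annulus_energy] over the dyadic shells rho = 2^-k; the factors rho^(n+2s) are at most rho,
    so they form a convergent geometric series uniformly in s. *)
Lemma local_poincare s f (D : V -> bool) (e : R) : 2^-1 <= s -> s < 1 ->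
  measurable_fun setT f -> measurable_fun setT D ->
  (forall x y, D x -> D y -> D (2^-1 *: x + 2^-1 *: y)) ->
  bd mu2 (fun z => (D z.1 && D z.2)%:R * (J s (z.1 - z.2) * (Df f z) ^+ 2)) e ->
  bd mu2 (fun z => (D z.1 && D z.2)%:R *
     ((`|z.1 - z.2| <= 1)%R%:R * (Df f z) ^+ 2)) (8 * ln 4 * e).
Proof.
move=> s0 s1 mf mD Dmid bh; have mDf := measurable_Df mf.
have e0 := bd_ge0 bh.
have l0 : 0 <= ln 4 :> R by rewrite ln_ge0 // ler1n.
pose P k (z : V * V) : R := (D z.1 && D z.2)%:R *
  (((2 ^- k < `|z.1 - z.2|) && (`|z.1 - z.2| <= 1))%R%:R * (Df f z) ^+ 2).
have mP k : measurable_fun setT (P k) by rewrite /P; meas.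
have P0 k z : 0 <= P k z by rewrite /P; nn.
have bP k : bd mu2 (P k) (4 * ln 4 * e * (2 - 2 * 2 ^- k)).
  elim: k => [|k IH].
    apply: (bd_le (bdW (bd0 mu2) _)) => //.
      by rewrite expr0 invr1 mulr1 subrr mulr0.
    by move=> z; rewrite /P expr0 invr1; case: leP => _; rewrite /= ?mul0r ?mulr0.
  have r0 : 0 < 2 ^- k :> R by rewrite invr_gt0 exprn_gt0.
  have b1 := annulus_energy s0 s1 r0 mf mD Dmid bh.
  apply: (bd_le (bdW (bdD IH b1) _)) => //.
    rewrite exprS invfM.
    have hk : (2 ^- k) `^ (n%:R + 2 * s) <= 2 ^- k :> R.
      apply: ge1r_powR; last by have := ler0n R n; clear - s0; lra.
      by rewrite r0 invf_le1 ?exprn_gt0 // exprn_ege1 // ler1n.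
    have : 4 * ln 4 * e * (2 ^- k) `^ (n%:R + 2 * s) <= 4 * ln 4 * e * 2 ^- k.
      by apply: ler_wpM2l => //; rewrite !mulr_ge0.
    rewrite (mulrA 2) mulfV // mul1r.
    set u := (2 ^- k) `^ _; set v := 2 ^- k; clearbody u v; clear; lra.
  move=> z; rewrite /P -mulrDr -mulrDl; apply: ler_wpM2l => //.
  apply: ler_wpM2r; first exact: sqr_ge0.
  rewrite -natrD ler_nat exprS invfM mulrC.
  case: (ltP _ `|z.1 - z.2|) => // h1; case: (leP `|z.1 - z.2| 1) => // h2 /=.
  by case: (ltP _ `|z.1 - z.2|) => //= ->.
apply: (bd_fatou (f_ := P) (c := 8 * ln 4 * e)).
- move=> k; apply: (bdW (bP k)).
  have : 0 < 2 ^- k :> R by rewrite invr_gt0 exprn_gt0.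
  have : 0 <= ln 4 * e by rewrite mulr_ge0.
  by move: (2 ^- k) => v; nra.
- by meas.
- by move=> z; nn.
apply: aeW => z; rewrite /P.
case: (eqVneq z.1 z.2) => [e12|z12].
  have -> : Df f z = 0 by rewrite /Df e12 subrr.
  rewrite expr0n /= !mulr0; under eq_fun do rewrite !mulr0; exact: cvg_cst.
have zn : 0 < `|z.1 - z.2| by rewrite normr_gt0 subr_eq0.
have [k0 hk] : exists k0, forall k, (k0 <= k)%N -> 2 ^- k < `|z.1 - z.2|.
  exists (Num.bound `|z.1 - z.2|^-1) => k hk; rewrite invf_plt ?posrE ?exprn_gt0 //.
  apply: (@lt_le_trans _ _ k%:R); last by rewrite -natrX ler_nat ltnW // ltn_expl.
  apply: (@lt_le_trans _ _ (Num.bound `|z.1 - z.2|^-1)%:R); last by rewrite ler_nat.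
  by apply/archi_boundP; rewrite invr_ge0.
apply: cvg_near_cst; near=> k; rewrite hk //=; near: k; exact: nbhs_infty_ge.
Unshelve. all: by end_near. Qed.

End local_differences.

(** * Cut-offs, the linear class and Caccioppoli's inequality *)

Section linear_class.
Context {R : realType} {n : nat}.
Local Notation V := 'rV[R]_n.
Local Notation mu := (@lebesgue_rV R n).
Local Notation mu2 := (mu \x mu)%E.
Implicit Types (s : R) (f w g psi phi : V -> R).

Lemma bd_tensor g (h : V -> R) a b : bd mu g a -> bd mu h b ->
  bd mu2 (fun z => g z.1 * h z.2) (a * b).
Proof.
move=> bg bh; have [mg g0 _] := bg; have [mh h0 _] := bh.
have b0 := bd_ge0 bh.
apply: (bd_prod_x (h := fun x => b * g x)); first by meas.
- by move=> z; nn.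
- by move=> x /=; rewrite mulrC; apply: bdZ.
- by rewrite mulrC; apply: bdZ.
Qed.

Lemma bd_convolution g (h : V -> R) a b : bd mu g a -> bd mu h b ->
  bd mu2 (fun z => g z.1 * h (z.2 - z.1)) (a * b).
Proof. by move=> bg bh; exact: (bd_unshear (bd_tensor bg bh)). Qed.

Definition cutoff (K r : R) phi := [/\ measurable_fun setT phi,
  forall x, 0 <= phi x <= 1, forall x y, `|phi x - phi y| <= K * `|x - y| &
  forall x, r <= `|x| -> phi x = 0].

Lemma cutoff_sqr K r phi : cutoff K r phi -> cutoff (2 * K) r (fun x => phi x ^+ 2).
Proof.
case=> mf f01 flip f0; split; first by meas.
- by move=> x; have /andP[a b] := f01 x; rewrite exprn_ge0 //= exprn_ile1.
- move=> x y; rewrite subr_sqr normrM mulrC -mulrA; apply: ler_pM => //.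
  have /andP[a b] := f01 x; have /andP[c d] := f01 y.
  by rewrite ger0_norm; lra.
- by move=> x xr; rewrite f0 // expr0n.
Qed.

Definition cut (r1 r2 : R) (x : V) : R := Num.min 1 (Num.max 0 ((r2 - `|x|) / (r2 - r1))).

Lemma cut_cutoff (r1 r2 : R) : r1 < r2 -> cutoff (r2 - r1)^-1 r2 (cut r1 r2).
Proof.
move=> r12; have d0 : 0 < (r2 - r1)^-1 by rewrite invr_gt0 subr_gt0.
split; first by rewrite /cut; meas.
- move=> x; rewrite /cut le_min ler01 le_max lexx /=; by rewrite ge_min lexx.
- move=> x y; rewrite /cut.
  have : `|(r2 - `|x|) / (r2 - r1) - (r2 - `|y|) / (r2 - r1)| <= (r2 - r1)^-1 * `|x - y|.
    rewrite -mulrBl normrM (ger0_norm (ltW d0)) mulrC; apply: ler_wpM2l; first exact: ltW.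
    rewrite opprB addrC addrA subrK distrC; exact: ler_dist_dist.
  move: ((r2 - `|x|) / _) ((r2 - `|y|) / _) ((r2 - r1)^-1 * _) => u v c.
  by rewrite /Num.min /Num.max !ler_norml; repeat case: ifPn; rewrite -?leNgt; lra.
- move=> x xr; rewrite /cut; have -> : Num.max 0 ((r2 - `|x|) / (r2 - r1)) = 0.
    apply/max_idPl; rewrite pmulr_lle0 // subr_le0 //.
  by apply/min_idPr.
Qed.

Lemma cut1 (r1 r2 : R) x : r1 < r2 -> `|x| <= r1 -> cut r1 r2 x = 1.
Proof.
move=> r12 xr; rewrite /cut; apply/min_idPl; rewrite le_max ler_pdivlMr ?subr_gt0 // mul1r.
by apply/orP; right; lra.
Qed.

Definition loc2 w := forall r : R, exists c, bd mu (fun x => (`|x| < r)%R%:R * w x ^+ 2) c.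

(** The energy space with zero exterior values; no smoothness is asked, so truncations of solutions
    times cut-offs belong to it. *)
Definition H0 s (r : R) psi := [/\ measurable_fun setT psi,
  forall x, r <= `|x| -> psi x = 0,
  exists c, bd mu (fun x => psi x ^+ 2) c & exists c, enb s psi c].

(** A linear equation with measurable coefficients, stated through its flux [P]. The coefficient [k]
    is recovered pointwise from [P]; for a difference of two solutions it is a secant slope of the
    nonlinearity. *)
Definition lin (L s r : R) w := [/\ measurable_fun setT w, exists c, enb s w c, loc2 w &
  exists P : V * V -> R, [/\ measurable_fun setT P,
    forall z, exists2 k, L^-1 * J s (z.1 - z.2) <= k <= L * J s (z.1 - z.2) &
      P z = k * Df w z &
    forall psi, H0 s r psi -> (\int[mu2]_z (P z * Df psi z)%:E = 0)%E]].

Lemma enb_le s f g c : enb s g c -> s <= 1 -> measurable_fun setT f ->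
  (forall x y, `|f x - f y| <= `|g x - g y|) -> enb s f c.
Proof.
move=> bg s1 mf fg; have mJ := @measurable_J R n s; have mD := measurable_Df mf.
apply: (bd_le bg); [by meas|by move=> z; nn|move=> z].
apply: ler_wpM2l; first exact: J_ge0.
by rewrite -(real_normK (num_real (Df f z))) -[leRHS](real_normK (num_real _)) lerXn2r ?nnegrE //; exact: fg.
Qed.

Lemma loc2_le f g : loc2 g -> measurable_fun setT f ->
  (exists2 k : R, 0 <= k & forall x, `|f x| <= `|g x| + k) -> loc2 f.
Proof.
move=> lg mf [k k0 fg] r.
have [r0|r0] := ltP 0 r; last first.
  exists 0; apply: (bd_le (bd0 mu)); [by meas|by move=> x; nn|].
  move=> x; rewrite (_ : (`|x| < r) = false) ?mul0r //.
  by apply/negbTE; rewrite -leNgt (le_trans r0).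
have [c bc] := lg r.
exists (2 * c + 2 * k ^+ 2 * (2 * r) ^+ n).
have k20 : 0 <= 2 * k ^+ 2 by nn.
apply: (bd_le (bdD (bdZ (ler0n _ 2) bc) (bdZ k20 (bd_cube r0)))); [by meas|by move=> x; nn|].
move=> x; case: (`|x| < r); rewrite /= ?mul0r ?mulr0 ?addr0 // !mul1r mulr1.
have := fg x; rewrite -(real_normK (num_real (f x))) -(real_normK (num_real (g x))).
have := normr_ge0 (f x); have := normr_ge0 (g x).
move: (`|f x|) (`|g x|) => u v; rewrite !expr2 => u0 v0 h.
have h1 : u * u <= (v + k) * (v + k) by apply: ler_pM.
have := sqr_ge0 (v - k); rewrite expr2 => h2; lra.
Qed.

Lemma sqr_le_min (K d p : R) : 0 <= d -> `|p| <= 1 -> `|p| <= K * d ->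
  p ^+ 2 <= (1 + K ^+ 2) * Num.min 1 (d ^+ 2).
Proof.
move=> d0 p1 pK; rewrite -(real_normK (num_real p)); have p0 := normr_ge0 p.
move: (`|p|) p0 p1 pK => q q0 q1 qK; rewrite mulrDl mul1r.
rewrite /Num.min; case: ifPn => [|_].
  by have := sqr_ge0 K; move: (K ^+ 2) => k k0 _; rewrite mulr1 expr2; nra.
have h : q ^+ 2 <= (K * d) ^+ 2 by rewrite lerXn2r // nnegrE ?(le_trans q0).
by rewrite exprMn in h; have := sqr_ge0 d; move: h; clear; lra.
Qed.

Definition posp (x : R) : R := Num.max x 0.

(** When exactly one of u, v exceeds the level, truncating both only shrinks the first factor and
    leaves the sign of the product. *)
Lemma posp_test (u v l P Q : R) : 0 <= P -> 0 <= Q ->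
  (posp (u - l) - posp (v - l)) * (posp (u - l) * P - posp (v - l) * Q) <=
  (u - v) * (posp (u - l) * P - posp (v - l) * Q).
Proof.
move=> P0 Q0; rewrite /posp.
have [u0|/ltW u0] := leP (u - l) 0; have [v0|/ltW v0] := leP (v - l) 0.
- by rewrite !mul0r subrr !mulr0.
- have h : 0 <= (- (u - l)) * (v - l) * Q by rewrite !mulr_ge0 // oppr_ge0.
  lra.
- have h : 0 <= (u - l) * (- (v - l)) * P by rewrite !mulr_ge0 // oppr_ge0.
  lra.
- by rewrite (_ : u - l - (v - l) = u - v) //; ring.
Qed.

Section with_constants.
Variables (CJ s : R).
Hypothesis bJ : bd mu (fun z : V => J s z * Num.min 1 (`|z| ^+ 2)) CJ.
Hypothesis s1 : s <= 1.

Lemma cutoff_energy (K r : R) phi g c : cutoff K r phi -> bd mu g c ->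
  bd mu2 (fun z => g z.1 * (J s (z.1 - z.2) * (Df phi z) ^+ 2)) ((1 + K ^+ 2) * (c * CJ)).
Proof.
case=> mf f01 flip f0 bg; have mD := measurable_Df mf; have [mg g0 _] := bg.
have mJ := @measurable_J R n s.
have k0 : 0 <= 1 + K ^+ 2 by nn.
apply: (bd_le (bdZ k0 (bd_convolution bg bJ))); [by meas|by move=> z; nn|].
move=> z; rewrite [leRHS]mulrCA; apply: ler_wpM2l => //.
rewrite (distrC z.2) (JB _ z.2) [leRHS]mulrCA; apply: ler_wpM2l; first exact: J_ge0.
apply: sqr_le_min => //; last exact: flip.
rewrite /Df; have /andP[a b] := f01 z.1; have /andP[c1 d] := f01 z.2.
by rewrite ler_norml; apply/andP; split; lra.
Qed.

Lemma H0_cutoff (K r : R) phi w : cutoff K r phi -> measurable_fun setT w ->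
  (exists c, enb s w c) -> loc2 w -> H0 s r (fun x => w x * phi x).
Proof.
move=> cphi mw [e be] lw; have [mf f01 flip f0] := cphi.
have [c bc] := lw r; have mJ := @measurable_J R n s.
have m1 : measurable_fun setT (fun x => w x * phi x) by meas.
have mD := measurable_Df m1.
split=> //.
- by move=> x xr; rewrite f0 // mulr0.
- exists c; apply: (bd_le bc); [by meas|by move=> x; nn|move=> x].
  case: (ltP `|x| r) => xr /=; last by rewrite f0 // mulr0 mul0r expr0n.
  rewrite mul1r exprMn ler_piMr ?sqr_ge0 //.
  by have /andP[a b] := f01 x; rewrite exprn_ile1.
have bg := cutoff_energy cphi bc.
exists (2 * (e + ((1 + K ^+ 2) * (c * CJ) + (1 + K ^+ 2) * (c * CJ)))).
apply: (bd_le (bdZ (ler0n _ 2) (bdD be (bdD bg (bd_swap bg))))); [by meas|by move=> z; nn|].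
move=> z /=; rewrite (JB _ z.2) /Df /=.
have j0 := J_ge0 (z.1 - z.2) s1.
set j := J s _ in j0 *.
set b1 := (`|z.1| < r)%R; set b2 := (`|z.2| < r)%R.
have -> : 2 * (j * (w z.1 - w z.2) ^+ 2 + (b1%:R * w z.1 ^+ 2 * (j * (phi z.1 - phi z.2) ^+ 2) +
    b2%:R * w z.2 ^+ 2 * (j * (phi z.2 - phi z.1) ^+ 2))) =
  j * (2 * ((w z.1 - w z.2) ^+ 2 + (b1%:R * w z.1 ^+ 2 * (phi z.1 - phi z.2) ^+ 2 +
    b2%:R * w z.2 ^+ 2 * (phi z.2 - phi z.1) ^+ 2))) by ring.
apply: ler_wpM2l => //; rewrite /b1 /b2.
have /andP[p0 p1] := f01 z.1; have /andP[q0 q1] := f01 z.2.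
(* [w] is square integrable only locally, so the product is expanded around the point that lies in
   the cube. *)
have key (a b p q : R) : 0 <= q <= 1 ->
    (a * p - b * q) ^+ 2 <= 2 * ((a - b) ^+ 2 + a ^+ 2 * (p - q) ^+ 2).
  move=> /andP[qq0 qq1]; have -> : a * p - b * q = a * (p - q) + (a - b) * q by ring.
  have h1 := sqr_ge0 (a * (p - q) - (a - b) * q).
  have h2 : ((a - b) * q) ^+ 2 <= (a - b) ^+ 2.
    by rewrite exprMn ler_piMr ?sqr_ge0 // exprn_ile1.
  rewrite -exprMn; move: h1 h2; move: (a * (p - q)) ((a - b) * q) ((a - b) ^+ 2) => u v t.
  by rewrite !expr2 => h1 h2; lra.
case: (ltP `|z.1| r) => h1 /=.
  rewrite mul1r; apply: le_trans (key _ _ _ _ (f01 z.2)) _.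
  by rewrite ler_pM2l // lerD2l lerDl; nn.
case: (ltP `|z.2| r) => h2 /=; last first.
  by rewrite (f0 _ h1) (f0 _ h2) [leLHS](_ : _ = 0); [nn|ring].
rewrite (f0 _ h1) mulr0 !sub0r subr0 !sqrrN !mul0r add0r mul1r -exprMn.
have := sqr_ge0 (w z.1 - w z.2); have := sqr_ge0 (w z.2 * phi z.2).
by move: (_ ^+ 2) (_ ^+ 2) => u v; lra.
Qed.

Lemma lin_test (L r : R) w psi (A B : V * V -> R) c : 1 <= L -> lin L s r w ->
  H0 s r psi -> measurable_fun setT A -> (forall z, 0 <= A z) -> bd mu2 B c ->
  (forall z k, L^-1 * J s (z.1 - z.2) <= k <= L * J s (z.1 - z.2) ->
     A z <= k * Df w z * Df psi z + B z) -> bd mu2 A c.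
Proof.
move=> L1 [mw [e be] lw [P [mP Pk Pz]]] hpsi mA A0 bB hA.
have [mpsi _ _ [e' be']] := hpsi.
have mDw := measurable_Df mw; have mDp := measurable_Df mpsi.
rewrite -(add0r c); apply: (@bd_test _ _ _ mu2 (fun z => P z * Df psi z) A B) => //.
- have L0 : 0 <= L by lra.
  apply: (bd_integrable (c := L * (e + e'))); last by meas.
  apply: (bd_le (bdZ L0 (bdD be be'))); [by meas|by move=> z; nn|move=> z].
  have [k /andP[k1 k2] ->] := Pk z; have j0 := J_ge0 (z.1 - z.2) s1.
  have k0 : 0 <= k by apply: le_trans k1; rewrite mulr_ge0 // invr_ge0.
  rewrite -mulrA normrM ger0_norm // -mulrDr mulrA.
  apply: ler_pM => //; rewrite normrM.
  rewrite -(real_normK (num_real (Df w z))) -(real_normK (num_real (Df psi z))).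
  have := sqr_ge0 (`|Df w z| - `|Df psi z|); have := mulr_ge0 (normr_ge0 (Df w z)) (normr_ge0 (Df psi z)).
  by move: (`|_|) (`|_|) => u v; rewrite !expr2; lra.
- by rewrite Pz.
- by move=> z; have [k kJ ->] := Pk z; exact: hA.
Qed.

(** Tests with (w - l)^+ phi^2 and uses (A - B)(A p^2 - B q^2) = (A p - B q)^2 - A B (p - q)^2. The
    last term keeps the product of both truncations, hence the interaction with far points. *)
Lemma caccioppoli (L K r l c : R) w phi : 1 <= L -> lin L s r w -> cutoff K r phi ->
  bd mu2 (fun z => posp (w z.1 - l) * posp (w z.2 - l) * (J s (z.1 - z.2) * (Df phi z) ^+ 2)) c ->
  enb s (fun x => posp (w x - l) * phi x) (L * (L * c)).
Proof.
move=> L1 lw cphi bB; have [mw [e be] l2 _] := lw; have L0 : 0 < L by lra.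
have [mf f01 flip f0] := cphi.
pose a x := posp (w x - l).
have ma : measurable_fun setT a by rewrite /a /posp; meas.
have a_lip x y : `|a x - a y| <= `|w x - w y|.
  rewrite /a /posp /Num.max; move: (w x) (w y) => u v.
  by repeat case: ifPn; rewrite -?leNgt => h1 h2; case: (ger0P (u - v)) => h3;
    rewrite ler_norml; apply/andP; split; lra.
have ea : exists c, enb s a c by exists e; exact: (enb_le be).
have la : loc2 a.
  apply: (loc2_le l2 ma); exists `|l| => // x; rewrite /a /posp /Num.max.
  case: ifPn => h; first by rewrite normr0; nn.
  by rewrite (le_trans (ler_normB _ _)).
have hpsi := H0_cutoff (cutoff_sqr cphi) ma ea la.
have mJ := @measurable_J R n s.
have maf : measurable_fun setT (fun x => a x * phi x) by meas.
have mD := measurable_Df maf.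
have bA : bd mu2 (fun z => L^-1 * (J s (z.1 - z.2) * Df (fun x => a x * phi x) z ^+ 2)) (L * c).
  apply: (lin_test L1 lw hpsi _ _ (bdZ (ltW L0) bB)); [by meas|by move=> z; nn|].
  move=> z k /andP[k1 k2]; rewrite /Df /= -!/(a _).
  have j0 := J_ge0 (z.1 - z.2) s1; set j := J s _ in k1 k2 j0 *.
  have k0 : 0 <= k by apply: le_trans k1; rewrite mulr_ge0 // invr_ge0 ltW.
  have /andP[p0 p1] := f01 z.1; have /andP[q0 q1] := f01 z.2.
  have a0 x : 0 <= a x by rewrite /a /posp le_max lexx orbT.
  move: (phi z.1) (phi z.2) p0 q0 (a0 z.1) (a0 z.2) => p q p0 q0.
  have h : (a z.1 - a z.2) * (a z.1 * p ^+ 2 - a z.2 * q ^+ 2) <=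
      (w z.1 - w z.2) * (a z.1 * p ^+ 2 - a z.2 * q ^+ 2).
    by apply: posp_test; exact: sqr_ge0.
  move: (a z.1) (a z.2) h => A B h A0 B0.
  have e1 : (A - B) * (A * p ^+ 2 - B * q ^+ 2) = (A * p - B * q) ^+ 2 - A * B * (p - q) ^+ 2 by ring.
  rewrite e1 in h.
  have h5 := ler_wpM2l k0 h; rewrite mulrBr in h5.
  have h3 : L^-1 * (j * (A * p - B * q) ^+ 2) <= k * (A * p - B * q) ^+ 2.
    by rewrite mulrA ler_wpM2r ?sqr_ge0.
  have h4 : k * (A * B * (p - q) ^+ 2) <= L * (A * B * (j * (p - q) ^+ 2)).
    have -> : L * (A * B * (j * (p - q) ^+ 2)) = L * j * (A * B * (p - q) ^+ 2) by ring.
    by apply: ler_wpM2r => //; nn.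
  by clear - h3 h4 h5; lra.
by apply: (bd_ext (bdZ (ltW L0) bA)) => z; rewrite [RHS]mulrA mulfV ?mul1r // gt_eqF.
Qed.

End with_constants.
End linear_class.

(** * De Giorgi's level-set iteration *)

Section local_boundedness.
Context {R : realType} {n : nat}.
Local Notation V := 'rV[R]_n.
Local Notation mu := (@lebesgue_rV R n).
Local Notation mu2 := (mu \x mu)%E.
Implicit Types (s : R) (f w g psi phi : V -> R).

(** The weight of the nonlocal tail: it dominates the kernel seen from a cube whenever the second
    point stays away from it ([J_le_om]). *)
Definition om s (y : V) : R := (1 + `|y|) `^ (- (n%:R + 2 * s)).

Lemma om_ge0 s y : 0 <= om s y. Proof. exact: powR_ge0. Qed.

Lemma measurable_om s : measurable_fun setT (om s).
Proof. by rewrite /om; meas. Qed.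

Lemma powRN_natl (x a : R) (k : nat) : 0 < x -> x <= 1 -> a <= k%:R -> x `^ (- a) <= x^-1 ^+ k.
Proof.
move=> x0 x1 ak; have x00 := ltW x0.
rewrite -powR_mulrn ?invr_ge0 // -(powR_inv1 x00) -powRrM mulN1r.
by apply: ger_powR; rewrite ?x0 // lerN2.
Qed.

Lemma le_posp (x : R) : x <= posp x.
Proof. by rewrite /posp le_max lexx. Qed.

Lemma posp_ge0 (x : R) : 0 <= posp x.
Proof. by rewrite /posp le_max lexx orbT. Qed.

Lemma posp_le (x y : R) : x <= y -> posp x <= posp y.
Proof. by move=> xy; rewrite /posp ge_max !le_max lexx orbT andbT xy. Qed.

Lemma posp_id (x : R) : 0 <= x -> posp x = x.
Proof. by move=> x0; rewrite /posp max_l. Qed.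

Lemma posp_eq0 (x : R) : x <= 0 -> posp x = 0.
Proof. by move=> x0; rewrite /posp max_r. Qed.

Lemma mul_le_sqrD (u v : R) : 0 <= u -> 0 <= v -> u * v <= (u + v) ^+ 2.
Proof. by move=> u0 v0; nra. Qed.

(** Separation of the cube of radius (r0 + r1)/2 from the exterior of radius r0, measured relative
    to 1 + y as [J_le_om] requires. *)
Lemma far_dist (r0 r1 x y : R) : r1 < r0 -> r0 <= 1 -> 0 < r1 ->
  x < r1 + (r0 - r1) / 2 -> r0 <= y -> (r0 - r1) / 8 * (1 + y) <= y - x.
Proof.
move=> h1 h2 h3 h4 h5.
have a1 : 0 <= (1 - (r0 - r1)) * (y - r0) by apply: mulr_ge0; lra.
have a2 : 0 <= (r0 - r1) * (1 - r0) by apply: mulr_ge0; lra.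
lra.
Qed.

Lemma J_le_om s (t : R) (z y : V) : 2^-1 <= s -> s < 1 -> 0 < t -> t <= 1 ->
  t * (1 + `|y|) <= `|z| -> J s z <= t^-1 ^+ (n + 2) * om s y.
Proof.
move=> s0 s1 t0 t1 tz; have y1 : 0 < 1 + `|y| by rewrite ltr_pwDl.
have s00 : 0 <= s by lra.
apply: le_trans (J_upper s00 (ltW s1) (mulr_gt0 t0 y1) tz) _.
rewrite powRM; [|lra|lra]; rewrite mulrA -/(om s y).
apply: ler_wpM2r; first exact: om_ge0.
have h : t `^ (- (n%:R + 2 * s)) <= t^-1 ^+ (n + 2).
  by apply: powRN_natl => //; rewrite natrD; lra.
apply: le_trans h; rewrite ler_piMl ?powR_ge0 //; lra.
Qed.

Section step.
Variables (L CJ s : R).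
Hypothesis n2 : (2 <= n)%N.
Hypothesis L1 : 1 <= L.
Hypothesis s0 : 2^-1 <= s.
Hypothesis s1 : s < 1.
Hypothesis bJ : bd mu (fun z : V => J s z * Num.min 1 (`|z| ^+ 2)) CJ.

(** Caccioppoli's inequality with a cut-off between the radii, then [faber_krahn] on the set where w
    >= l1. Chebyshev's inequality bounds its measure by Y / (l1 - l0)^2, and (w - l1)^+ <= ((w -
    l0)^+)^2 / (l1 - l0) makes the tail term linear in [Y]. The radius [rho] is left free: its power
    2s is the gain of the iteration. *)
Lemma de_giorgi_step w (r0 r1 l0 l1 Y T rho : R) : lin L s 1 w ->
  0 < r1 -> r1 < r0 -> r0 <= 1 -> 0 <= l0 -> l0 < l1 -> 0 < rho ->
  bd mu (fun y => posp (w y) * om s y) T ->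
  bd mu (fun x => (`|x| < r0)%R%:R * posp (w x - l0) ^+ 2) Y ->
  Y <= (l1 - l0) ^+ 2 * (2^-1 * (rho / 2) ^+ n) ->
  bd mu (fun x => (`|x| < r1)%R%:R * posp (w x - l1) ^+ 2)
    (2 ^+ n * 2 * (4 * ln 4) * rho `^ (2 * s) * (L * (L *
      ((r0 - r1)^-1 ^+ (n + 2) * (5 * CJ + 2 * 16 ^+ (n + 2) * (T / (l1 - l0))) * Y)))).
Proof.
move=> lw r10 r10' r01 l00 l01 rho0 bT bY Yrho.
pose d := r0 - r1; pose e := l1 - l0.
have d0 : 0 < d by rewrite subr_gt0.
have d1 : d <= 1 by rewrite /d; lra.
have e0 : 0 < e by rewrite subr_gt0.
pose rm := r1 + d / 2.
have r1m : r1 < rm by rewrite /rm; lra.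
have rmr0 : rm < r0 by move: d0; rewrite /rm /d; clear - bJ n2 L1 s0 s1; lra.
pose phi : V -> R := cut r1 rm.
have cphi : cutoff (rm - r1)^-1 rm phi := cut_cutoff r1m.
have [mw [ew bew] l2w _] := lw.
have cphi1 : cutoff (rm - r1)^-1 1 phi.
  case: cphi => mf f01 flip f0; split => // x x1; apply: f0; apply: le_trans x1.
  by rewrite /rm /d; lra.
have [mf f01 flip f0] := cphi.
pose g x : R := (`|x| < r0)%R%:R * posp (w x - l0) ^+ 2.
pose q y : R := posp (w y) * om s y.
pose a x : R := posp (w x - l1).
have mg : measurable_fun setT g by case: bY.
have mq : measurable_fun setT q by case: bT.
have mom := measurable_om s; have mJ := @measurable_J R n s.
have ma : measurable_fun setT a by rewrite /a /posp; meas.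
have mDp := measurable_Df mf.
have posp0 x : 0 <= posp x :> R by exact: posp_ge0.
have g0 x : 0 <= g x by rewrite /g; nn.
have q0 x : 0 <= q x by rewrite mulr_ge0 ?om_ge0.
have a0 x : 0 <= a x by exact: posp_ge0.
have ag x : `|x| < r0 -> a x ^+ 2 <= g x.
  move=> xr; rewrite /g xr mul1r lerXn2r ?nnegrE //.
  by rewrite /a /posp ge_max !le_max lexx orbT andbT; apply/orP; left; lra.
have age x : `|x| < r0 -> a x <= g x / e.
  move=> xr; rewrite /g xr mul1r ler_pdivlMr // /a /posp.
  have [h|h] := leP (w x - l1) 0; first by rewrite mul0r exprn_ge0 // le_max lexx orbT.
  rewrite max_l; last by rewrite /e in e0; lra.
  have -> : w x - l0 = (w x - l1) + e by rewrite /e; ring.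
  exact: mul_le_sqrD (ltW h) (ltW e0).
have aq y : a y * om s y <= q y.
  apply: ler_wpM2r; first exact: om_ge0.
  by rewrite /a /posp ge_max !le_max lexx orbT andbT; apply/orP; left; lra.
have K8 : 0 <= (d / 8)^-1 ^+ (n + 2) by rewrite exprn_ge0 // invr_ge0; lra.
have far x y : `|x| < rm -> r0 <= `|y| -> J s (x - y) <= (d / 8)^-1 ^+ (n + 2) * om s y.
  move=> xm y0; apply: J_le_om => //; [lra|lra|].
  have h : `|y| - `|x| <= `|x - y| by rewrite distrC lerB_dist.
  by apply: le_trans h; exact: far_dist.
have b1 := cutoff_energy bJ (ltW s1) cphi bY.
have e10 : 0 <= e^-1 by rewrite invr_ge0 ltW.
have b2 := bdZ K8 (bd_tensor (bdZ e10 bY) bT).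
have h20 : 0 <= 2^-1 :> R by rewrite invr_ge0.
pose c := 2^-1 * ((1 + (rm - r1)^-1 ^+ 2) * (Y * CJ) + (1 + (rm - r1)^-1 ^+ 2) * (Y * CJ)) +
  ((d / 8)^-1 ^+ (n + 2) * (e^-1 * Y * T) + (d / 8)^-1 ^+ (n + 2) * (e^-1 * Y * T)).
have bB : bd mu2 (fun z => a z.1 * a z.2 * (J s (z.1 - z.2) * (Df phi z) ^+ 2)) c.
  apply: (bd_le (bdD (bdZ h20 (bdD b1 (bd_swap b1))) (bdD b2 (bd_swap b2)))).
  - by meas.
  - by move=> z; nn.
  move=> z; rewrite /= -!/(g _) -!/(q _) (JB _ z.2).
  have j0 : 0 <= J s (z.1 - z.2) by nn.
  have D2 : Df phi (z.2, z.1) ^+ 2 = Df phi z ^+ 2 by rewrite /Df /= -sqrrN opprB.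
  rewrite D2.
  have far1 x y : `|x| < rm -> r0 <= `|y| -> `|phi x - phi y| <= 1 ->
      a x * a y * (J s (x - y) * (phi x - phi y) ^+ 2) <=
      (d / 8)^-1 ^+ (n + 2) * (e^-1 * g x * q y).
    move=> xm y0 p1.
    have p2 : (phi x - phi y) ^+ 2 <= 1.
      by rewrite -(real_normK (num_real _)) exprn_ile1.
    apply: (@le_trans _ _ (a x * a y * ((d / 8)^-1 ^+ (n + 2) * om s y))).
      apply: ler_wpM2l; first by nn.
      apply: le_trans (far _ _ xm y0); exact: (ler_piMr (J_ge0 _ (ltW s1)) p2).
    have -> : a x * a y * ((d / 8)^-1 ^+ (n + 2) * om s y) =
      (d / 8)^-1 ^+ (n + 2) * (a x * (a y * om s y)) by ring.
    apply: ler_wpM2l => //; apply: ler_pM => //; first by rewrite mulr_ge0 ?om_ge0.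
    by rewrite mulrC; apply: age; exact: lt_trans xm rmr0.
  have phi1 x y : `|phi x - phi y| <= 1.
    have /andP[u1 u2] := f01 x; have /andP[v1 v2] := f01 y.
    by rewrite ler_norml; move: u1 u2 v1 v2; clear - bJ n2 L1 s0 s1; lra.
  have t0 x y : 0 <= (d / 8)^-1 ^+ (n + 2) * (e^-1 * g x * q y) by nn.
  have k0 x : 0 <= g x * (J s (z.1 - z.2) * Df phi z ^+ 2) by nn.
  (* If both points lie in the larger cube, the local energy of [phi] suffices. If exactly one does,
     either it lies beyond [rm], and [phi] vanishes at both points, or the two are separated and the
     kernel is absorbed by the tail weight. *)
  case: (ltP `|z.1| r0) => z1; case: (ltP `|z.2| r0) => z2.
  - apply: (@le_trans _ _ (2^-1 * (g z.1 * (J s (z.1 - z.2) * Df phi z ^+ 2) +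
        g z.2 * (J s (z.1 - z.2) * Df phi z ^+ 2)))); last by rewrite lerDl addr_ge0.
    set X := _ * Df phi z ^+ 2; have X0 : 0 <= X by rewrite /X; nn.
    rewrite -mulrDl (mulrA 2^-1); apply: ler_wpM2r => //.
    have := ag _ z1; have := ag _ z2; have := sqr_ge0 (a z.1 - a z.2).
    by move: (a z.1) (a z.2) (g z.1) (g z.2) => u v u' v'; rewrite !expr2; clear - bJ n2 L1 s0 s1; lra.
  - apply: (@le_trans _ _ ((d / 8)^-1 ^+ (n + 2) * (e^-1 * g z.1 * q z.2))); last first.
      rewrite -[leLHS]add0r; apply: lerD; first by rewrite mulr_ge0 // addr_ge0.
      by rewrite lerDl.
    case: (ltP `|z.1| rm) => zm; first exact: far1.
    by rewrite /Df (f0 _ zm) (f0 z.2 (ltW (lt_le_trans rmr0 z2))) subrr expr0n !mulr0.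
  - apply: (@le_trans _ _ ((d / 8)^-1 ^+ (n + 2) * (e^-1 * g z.2 * q z.1))); last first.
      rewrite -[leLHS]add0r; apply: lerD; first by rewrite mulr_ge0 // addr_ge0.
      by rewrite lerDr.
    case: (ltP `|z.2| rm) => zm.
      by rewrite (mulrC (a z.1)) JB -D2; exact: far1.
    by rewrite /Df (f0 _ zm) (f0 z.1 (ltW (lt_le_trans rmr0 z1))) subrr expr0n !mulr0.
  - rewrite /Df (f0 z.1 (ltW (lt_le_trans rmr0 z1))) (f0 z.2 (ltW (lt_le_trans rmr0 z2))) subrr.
    by rewrite expr0n !mulr0; nn.
have ben := caccioppoli bJ (ltW s1) L1 lw cphi1 bB.
pose A x := (`|x| < r0)%R && (l1 <= w x)%R.
have bA : bd mu (fun x => (A x)%:R) (e ^- 2 * Y).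
  have e20 : 0 <= e ^- 2 by rewrite invr_ge0 exprn_ge0 // ltW.
  apply: (bd_le (bdZ e20 bY)); [by rewrite /A; meas|by move=> x; exact: ler0n|].
  move=> x; rewrite -/(g x); apply: boolr_le; first by nn.
  move=> /andP[xr wl].
  rewrite mulrC ler_pdivlMr ?exprn_gt0 // mul1r /g xr mul1r lerXn2r ?nnegrE //; first exact: ltW.
  by rewrite /posp le_max /e; apply/orP; left; move: wl; clear - bJ n2 L1 s0 s1; lra.
have fA x : posp (w x - l1) * phi x != 0 -> A x.
  move=> h; apply/andP; split.
    rewrite ltNge; apply: contra h => h; rewrite f0 ?mulr0 //.
    exact: le_trans (ltW rmr0) h.
  rewrite leNgt; apply: contra h => h; rewrite /posp max_r ?mul0r //; move: h; clear - bJ n2 L1 s0 s1; lra.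
have maf : measurable_fun setT (fun x => posp (w x - l1) * phi x).
  by rewrite -/(a _); meas.
have hm : e ^- 2 * Y <= 2^-1 * (rho / 2) ^+ n.
  by rewrite mulrC ler_pdivrMr ?exprn_gt0 // mulrC.
have bfk := faber_krahn (ltnW n2) s0 s1 rho0 maf ben bA hm fA.
apply: (bd_le (bdW bfk _)).
- have Y0 := bd_ge0 bY; have T0 := bd_ge0 bT; have CJ0 := bd_ge0 bJ.
  apply: ler_wpM2l; first by rewrite !mulr_ge0 ?exprn_ge0 ?powR_ge0 // ln_ge0 // ler1n.
  have L0 : 0 <= L := le_trans ler01 L1.
  apply: ler_wpM2l => //; apply: ler_wpM2l => //.
  have h1 : 1 + (d / 2)^-1 ^+ 2 <= 5 * d^-1 ^+ (n + 2).
    have h2 : d^-1 ^+ 2 <= d^-1 ^+ (n + 2).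
      by apply: ler_weXn2l; [rewrite invf_ge1|rewrite leq_addl].
    have h3 : 1 <= d^-1 ^+ 2 by rewrite exprn_ege1 // invf_ge1.
    by rewrite invfM invrK exprMn; move: (d^-1 ^+ 2) (d^-1 ^+ (n + 2)) h2 h3 => u v; clear - bJ n2 L1 s0 s1; lra.
  have h2 : (d / 8)^-1 ^+ (n + 2) <= d^-1 ^+ (n + 2) * 16 ^+ (n + 2).
    rewrite invfM invrK exprMn; apply: ler_wpM2l; first by rewrite exprn_ge0 // invr_ge0 ltW.
    by rewrite lerXn2r ?nnegrE ?ler_nat.
  have YC0 : 0 <= Y * CJ by rewrite mulr_ge0.
  have YT0 : 0 <= e^-1 * Y * T by rewrite !mulr_ge0.
  have := ler_wpM2r YC0 h1; have := ler_wpM2r YT0 h2.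
  rewrite /c -/d -/e.
  have -> : rm - r1 = d / 2 by rewrite /rm; ring.
  move: ((d / 8)^-1 ^+ (n + 2)) ((d / 2)^-1 ^+ 2) (d^-1 ^+ (n + 2)) (16 ^+ (n + 2)) (e^-1) => u v t p k.
  clear; lra.
- by rewrite -/(a _); meas.
- by move=> x; nn.
- move=> x; rewrite -/(a x) exprMn; case: (ltP `|x| r1) => xr /=; last by rewrite mul0r; nn.
  have p1 : phi x = 1 by apply: cut1 => //; exact: ltW.
  by rewrite p1 mul1r expr1n mulr1.
Qed.

End step.

Lemma small_bds (f : V -> R) (c q : R) : 0 <= q -> q < 1 -> (forall j, bd mu f (c * q ^+ j)) -> bd mu f 0.
Proof.
move=> q0 q1 bf; have [mf f0 _] := bf 0%N; apply: bd_small => // e e0.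
have /cvgrPdist_lt /(_ e e0) [N _ hN] : (fun j => c * q ^+ j) @ \oo --> (0 : R).
  rewrite -[X in _ --> X](mulr0 c); apply: cvgM; first exact: cvg_cst.
  by apply: cvg_expr; rewrite ger0_norm.
apply: (bdW (bf N)); have := hN N (leqnn N); rewrite sub0r normrN => h.
by apply/ltW; apply: le_lt_trans h; exact: ler_norm.
Qed.

(* De Giorgi iteration at the levels l (1 - 2^-j) and radii decreasing to sg. *)
Lemma sup_lemma (L CJ : R) : (2 <= n)%N -> 1 <= L ->
  (forall s, 2^-1 <= s -> s < 1 -> bd mu (fun z : V => J s z * Num.min 1 (`|z| ^+ 2)) CJ) ->
  exists2 c : R, 0 < c <= 1 & forall s w (sg sg' eta T l : R), 2^-1 <= s -> s < 1 ->
    lin L s 1 w -> 0 < sg -> sg < sg' -> sg' <= 1 -> 0 < eta -> eta <= 1 -> 0 < l ->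
    eta * T <= l -> bd mu (fun y => posp (w y) * om s y) T ->
    bd mu (fun x => (`|x| < sg')%R%:R * posp (w x) ^+ 2)
      ((c * eta * (sg' - sg) ^+ (n + 2)) ^+ n * l ^+ 2) ->
    {ae mu, forall x, `|x| < sg -> w x <= l}.
Proof.
move=> n2 L1 hJ.
(* The exact growth per step: 4 from [rho], 2^(n+2) from the shrinking gaps between radii and 2 from
   those between levels. *)
pose B : R := 2 ^+ (n + 5).
pose C1 : R := 2 ^+ n * 2 * (4 * ln 4) * (L * L) * (5 * CJ + 2 * 16 ^+ (n + 2)).
have hs : 2^-1 <= (2^-1 : R) /\ 2^-1 < (1 : R) by split; lra.
have CJ0 : 0 <= CJ by exact: bd_ge0 (hJ 2^-1 hs.1 hs.2).
have L0 : 0 < L by lra.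
have l40 : 0 < ln 4 :> R by rewrite ln_gt0 // ltr1n.
have C10 : 0 < C1.
  rewrite /C1; apply: mulr_gt0; first by rewrite !mulr_gt0 ?exprn_gt0.
  by rewrite ltr_wpDl ?mulr_ge0 // mulr_gt0 // exprn_gt0.
have B1 : 1 <= B by rewrite exprn_ege1 // ler1n.
have B4 : 4 <= B.
  rewrite /B (_ : 4 = 2 ^+ 2 :> R); last by rewrite -natrX.
  by apply: ler_weXn2l; [rewrite ler1n|rewrite addnC ltn_addr].
have B0 : 0 < B by lra.
pose K : R := 32 * C1 * 2 ^+ (n + 2) * B ^+ n.
have K0 : 0 < K.
  rewrite /K; apply: mulr_gt0; last exact: exprn_gt0.
  by apply: mulr_gt0; [apply: mulr_gt0|exact: exprn_gt0].
(* The bound 16 c <= 1 keeps [rho] at most 1, and K c <= 1 closes the induction. *)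
pose c := (16 + K)^-1.
have c0 : 0 < c by rewrite invr_gt0; lra.
have c16 : 16 * c <= 1 by rewrite /c ler_pdivrMr; lra.
have cK : K * c <= 1 by rewrite /c ler_pdivrMr; lra.
exists c; first by rewrite c0; lra.
move=> s w sg sg' eta T l s0 s1 lw sg0 sgs sg1 eta0 eta1 l0 etaT bT bY.
pose d := sg' - sg.
have d0 : 0 < d by rewrite subr_gt0.
have d1 : d <= 1 by rewrite /d; lra.
pose ka := c * eta * d ^+ (n + 2).
have dn0 : 0 < d ^+ (n + 2) by rewrite exprn_gt0.
have dn1 : d ^+ (n + 2) <= 1 by rewrite exprn_ile1 // ltW.
have ka0 : 0 < ka by rewrite !mulr_gt0.
have kac : ka <= c.
  rewrite /ka -mulrA ler_piMr ?(ltW c0) //; rewrite -[leRHS]mulr1; apply: ler_pM => //; exact: ltW.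
have mw : measurable_fun setT w by case: lw.
have T0 := bd_ge0 bT.
pose r j := sg + d * 2 ^- j.
pose lv j := l * (1 - 2 ^- j).
have h2 (j : nat) : 0 < 2 ^- j :> R by rewrite invr_gt0 exprn_gt0.
have h2S (j : nat) : 2 ^- j.+1 = 2 ^- j / 2 :> R by rewrite exprSr invfM mulrC.
have h21 (j : nat) : 2 ^- j <= 1 :> R by rewrite invf_le1 ?exprn_gt0 // exprn_ege1 // ler1n.
have iter j : bd mu (fun x => (`|x| < r j)%R%:R * posp (w x - lv j) ^+ 2)
    (ka ^+ n * l ^+ 2 * (B^-1 ^+ n) ^+ j).
  elim: j => [|j IH].
    rewrite /r /lv expr0 invr1 subrr mulr0 mulr1 expr0 mulr1 /d addrC subrK.
    by apply: (bd_ext bY) => x; rewrite subr0.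
  set Y := (X in bd _ _ X) in IH.
  pose e := l * 2 ^- j.+1.
  have e0 : 0 < e by rewrite mulr_gt0.
  have lvS : lv j.+1 - lv j = e by rewrite /lv /e h2S; field.
  have rS : r j - r j.+1 = d * 2 ^- j.+1 by rewrite /r h2S; field.
  have dj0 : 0 < d * 2 ^- j.+1 by rewrite mulr_gt0.
  (* Large enough for the measure hypothesis [Yle] of the step, and at most 1, so that rho^(2s) <=
     rho for every s >= 1/2. *)
  pose rho := 4 * ka * B^-1 ^+ j * 4 ^+ j.+1.
  have Bi0 : 0 < B^-1 by rewrite invr_gt0.
  have Bj0 : 0 < B^-1 ^+ j by rewrite exprn_gt0.
  have rho0 : 0 < rho by rewrite !mulr_gt0 ?exprn_gt0.
  have B4j : B^-1 ^+ j * 4 ^+ j <= 1.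
    rewrite -exprMn exprn_ile1 //; first by rewrite mulr_ge0 // ltW.
    by rewrite mulrC ler_pdivrMr // mul1r.
  have rho1 : rho <= 1.
    rewrite /rho exprS; have -> : 4 * ka * B^-1 ^+ j * (4 * 4 ^+ j) =
      16 * ka * (B^-1 ^+ j * 4 ^+ j) by ring.
    rewrite -[leRHS]mulr1; apply: ler_pM => //; [nn|nn|lra].
  have Yle : Y <= (lv j.+1 - lv j) ^+ 2 * (2^-1 * (rho / 2) ^+ n).
    rewrite lvS /Y /e /rho.
    have -> : 4 * ka * B^-1 ^+ j * 4 ^+ j.+1 / 2 = 2 * (ka * B^-1 ^+ j) * 4 ^+ j.+1.
      by field.
    set u := B^-1 ^+ j; set t := 2 ^- j.+1.
    have -> : (l * t) ^+ 2 = l ^+ 2 * t ^+ 2 by rewrite exprMn.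
    have -> : (2 * (ka * u) * 4 ^+ j.+1) ^+ n = 2 ^+ n * (ka ^+ n * u ^+ n) * (4 ^+ j.+1) ^+ n.
      by rewrite !exprMn.
    have -> : (B^-1 ^+ n) ^+ j = u ^+ n by rewrite /u -!exprM mulnC.
    rewrite {}/t.
    have e4 : 2 ^- j.+1 ^+ 2 * 4 ^+ j.+1 = 1 :> R.
      rewrite exprVn -exprM mulnC exprM -natrX mulVf // expf_neq0 //.
    have h4 : 4 ^+ j.+1 <= (4 ^+ j.+1) ^+ n :> R.
      rewrite -{1}(expr1 (4 ^+ j.+1)); apply: ler_weXn2l; last exact: ltnW.
      by rewrite exprn_ege1 // ler1n.
    have hn : 1 <= 2^-1 * 2 ^+ n :> R.
      have -> : n = n.-1.+1 by rewrite prednK // ltnW.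
      by rewrite exprS mulrA mulVf // mul1r exprn_ege1 // ler1n.
    have -> : l ^+ 2 * 2 ^- j.+1 ^+ 2 * (2^-1 * (2 ^+ n * (ka ^+ n * u ^+ n) * (4 ^+ j.+1) ^+ n)) =
      (ka ^+ n * l ^+ 2 * u ^+ n) * ((2^-1 * 2 ^+ n) * (2 ^- j.+1 ^+ 2 * (4 ^+ j.+1) ^+ n)) by ring.
    rewrite ler_peMr; first by [].
      by rewrite !mulr_ge0 ?exprn_ge0 // ltW.
    rewrite -[leLHS]mulr1; apply: ler_pM => //.
    by have := ler_wpM2l (sqr_ge0 (2 ^- j.+1)) h4; rewrite e4.
  have r01 : r j.+1 < r j by rewrite -subr_gt0 rS.
  have rj0 : 0 < r j.+1 by rewrite ltr_wpDr // mulr_ge0 // ltW.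
  have rj1 : r j <= 1.
    have : d * 2 ^- j <= d by rewrite ler_piMr // ltW.
    by rewrite /r /d; lra.
  have lv0 : 0 <= lv j by rewrite mulr_ge0 ?subr_ge0 // ltW.
  have lvlt : lv j < lv j.+1 by rewrite -subr_gt0 lvS.
  have := de_giorgi_step n2 L1 s0 s1 (hJ s s0 s1) lw rj0 r01 rj1 lv0 lvlt rho0 bT IH Yle.
  move=> bb; apply: (bdW bb); rewrite lvS rS.
  have Y0 : 0 <= Y := bd_ge0 IH.
  have rs : rho `^ (2 * s) <= rho.
    by apply: ge1r_powR; [rewrite rho0|move: s0; clear; lra].
  have Te : T / e <= 2 ^+ j.+1 / eta.
    rewrite /e ler_pdivrMr ?mulr_gt0 // mulrAC mulrA ler_pdivlMr //.
    have -> : 2 ^+ j.+1 * l / 2 ^+ j.+1 = l :> R.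
      by rewrite mulrAC mulfV ?mul1r // expf_neq0.
    by rewrite mulrC.
  have Te1 : 5 * CJ + 2 * 16 ^+ (n + 2) * (T / e) <= (5 * CJ + 2 * 16 ^+ (n + 2)) * (2 ^+ j.+1 / eta).
    rewrite [leRHS]mulrDl; apply: lerD; last by apply: ler_wpM2l => //; nn.
    rewrite ler_peMr ?mulr_ge0 // ler_pdivlMr // mul1r.
    by apply: (le_trans eta1); rewrite exprn_ege1 // ler1n.
  set D := (d * 2 ^- j.+1)^-1 ^+ (n + 2).
  have DE : D = (d ^+ (n + 2))^-1 * (2 ^+ (n + 2)) ^+ j.+1.
    by rewrite /D invfM invrK exprMn exprVn -!exprM mulnC.
  have D0 : 0 <= D by rewrite /D; nn.
  apply: (@le_trans _ _ (2 ^+ n * 2 * (4 * ln 4) * rho * (L * (L *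
      (D * ((5 * CJ + 2 * 16 ^+ (n + 2)) * (2 ^+ j.+1 / eta)) * Y))))).
    apply: ler_pM.
    - by nn.
    - by nn; rewrite divr_ge0 // ltW.
    - by apply: ler_wpM2l => //; nn.
    - do 2! (apply: ler_wpM2l; first exact: ltW).
      by apply: ler_wpM2r => //; apply: ler_wpM2l.
  rewrite [leRHS](_ : _ = Y * (B^-1 ^+ n)); last first.
    by rewrite (exprSr _ j) /Y mulrA.
  rewrite DE /rho /ka.
  pose q := (B^-1 * (4 * 2 ^+ (n + 2) * 2)) ^+ j.
  rewrite [leLHS](_ : _ = (32 * C1 * 2 ^+ (n + 2) * c * q) * Y * 1); last first.
    have -> : q = B^-1 ^+ j * (4 ^+ j * (2 ^+ (n + 2)) ^+ j * 2 ^+ j) by rewrite /q !exprMn.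
    rewrite /C1 (exprS 4 j) (exprS 2 j) (exprS (2 ^+ (n + 2)) j).
    move: (gt_eqF eta0) (gt_eqF dn0) => /negbT.
    move: (B^-1 ^+ j) ((4 : R) ^+ j) ((2 : R) ^+ j) (((2 : R) ^+ (n + 2)) ^+ j) ((2 : R) ^+ (n + 2)) (d ^+ (n + 2)) ((16 : R) ^+ (n + 2)) ((2 : R) ^+ n) (ln (4 : R)).
    by clear => u1 u2 u3 u4 u5 u6 u7 u8 u9 h1 /negbT h2; field; rewrite h1 h2.
  have q1 : q = 1.
    rewrite /q (_ : 4 * 2 ^+ (n + 2) * 2 = B) ?mulVf ?expr1n ?gt_eqF //.
    by rewrite /B !exprD -natrX; ring.
  rewrite q1 !mulr1 [leRHS]mulrC; apply: ler_wpM2r => //.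
  rewrite exprVn -[leRHS]mul1r ler_pdivlMr ?exprn_gt0 //.
  by apply: le_trans cK; rewrite /K le_eqVlt; apply/orP; left; apply/eqP; ring.
have bz : bd mu (fun x => (`|x| < sg)%R%:R * posp (w x - l) ^+ 2) 0.
  apply: (@small_bds _ (ka ^+ n * l ^+ 2) (B^-1 ^+ n)).
  - by rewrite exprn_ge0 // invr_ge0 ltW.
  - have Bi1 : B^-1 < 1 by rewrite invf_lt1 //; lra.
    by rewrite exprn_ilt1 ?invr_ge0 ?(ltW B0) // -lt0n ltnW.
  - move=> j; apply: (bd_le (iter j)); first by rewrite /posp; meas.
      by move=> x; nn.
    move=> x; apply: ler_pM; [by nn|by nn| |].
      have : sg <= r j by rewrite lerDl mulr_ge0 // ltW.
      by rewrite ler_nat; case: (ltP `|x| sg) => // g1 g2; rewrite (lt_le_trans g1 g2).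
    have lvl : lv j <= l by rewrite /lv ler_piMr ?(ltW l0) // lerBlDr lerDl ltW.
    by rewrite lerXn2r ?nnegrE ?posp_ge0 //; apply: posp_le; lra.
apply: filterS (bd_ae0 bz) => x /eqP; rewrite mulf_eq0 => h xs.
move: h; rewrite xs oner_eq0 /= sqrf_eq0 => /eqP h.
by have := le_posp (w x - l); rewrite h subr_le0.
Qed.

End local_boundedness.

Ltac nn_hook ::= lazymatch goal with
  | |- is_true (0 <= J _ _)%R => apply: J_ge0; first [assumption | by apply: ltW]
  | |- is_true (0 <= om _ _)%R => apply: om_ge0
  | |- is_true (0 <= posp _)%R => apply: posp_ge0
  end.

(** * Invariance of the linear class *)

Section linear_class_operations.
Context {R : realType} {n : nat}.
Local Notation V := 'rV[R]_n.
Local Notation mu := (@lebesgue_rV R n).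
Local Notation mu2 := (mu \x mu)%E.
Implicit Types (s : R) (f w g psi phi : V -> R).

Lemma flux_integrable (L s e e' : R) w psi (P : V * V -> R) : 0 <= L ->
  enb s w e -> enb s psi e' -> measurable_fun setT P ->
  measurable_fun setT w -> measurable_fun setT psi -> s <= 1 ->
  (forall z, `|P z| <= L * J s (z.1 - z.2) * `|Df w z|) ->
  mu2.-integrable setT (EFin \o (fun z => P z * Df psi z)).
Proof.
move=> L0 bw bp mP mw mp s1 hP.
have mDw := measurable_Df mw; have mDp := measurable_Df mp.
apply: (bd_integrable (c := L * (e + e'))); last by meas.
apply: (bd_le (bdZ L0 (bdD bw bp))); [by meas|by move=> z; nn|move=> z].
have j0 := J_ge0 (z.1 - z.2) s1.
rewrite normrM; apply: le_trans (ler_wpM2r (normr_ge0 _) (hP z)) _.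
set j := J s _ in j0 *.
have -> : L * j * `|Df w z| * `|Df psi z| = L * (j * (`|Df w z| * `|Df psi z|)) by ring.
apply: ler_wpM2l => //; rewrite -mulrDr; apply: ler_wpM2l => //.
rewrite -(real_normK (num_real (Df w z))) -(real_normK (num_real (Df psi z))).
have := sqr_ge0 (`|Df w z| - `|Df psi z|); have := mulr_ge0 (normr_ge0 (Df w z)) (normr_ge0 (Df psi z)).
by move: (`|Df w z|) (`|Df psi z|) => u v; clear; rewrite !expr2; lra.
Qed.

Lemma enbZ s (k : R) f c : enb s f c -> enb s (fun x => k * f x) (k ^+ 2 * c).
Proof.
move=> bf; apply: (bd_ext (bdZ (sqr_ge0 k) bf)) => z.
by rewrite /Df /= -mulrBr exprMn; ring.
Qed.

Lemma H0Z s (r k : R) psi : H0 s r psi -> H0 s r (fun x => k * psi x).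
Proof.
case=> mp p0 [c bc] [e be]; split.
- by meas.
- by move=> x xr; rewrite p0 // mulr0.
- by exists (k ^+ 2 * c); apply: (bd_ext (bdZ (sqr_ge0 k) bc)) => x; rewrite exprMn.
- by exists (k ^+ 2 * e); exact: enbZ.
Qed.

Lemma H0_mono s (r r' : R) psi : r <= r' -> H0 s r psi -> H0 s r' psi.
Proof. by move=> rr [mp p0 l2 en]; split => // x xr; apply: p0; exact: le_trans xr. Qed.

Lemma lin_mono (L s r r' : R) w : r' <= r -> lin L s r w -> lin L s r' w.
Proof.
move=> rr [mw ew lw [P [mP Pk Pz]]]; split => //; exists P; split => // psi hp.
by apply: Pz; exact: H0_mono hp.
Qed.

Lemma loc2_cst (k : R) : loc2 (fun _ : V => k).
Proof.
apply: (@loc2_le _ _ _ (fun=> 0)); [|by meas|by exists `|k| => // x; rewrite normr0 add0r].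
move=> r; exists 0; apply: (bd_ext (bd0 mu)) => x; rewrite expr0n mulr0 //.
Qed.

Lemma lin_affine (L s r k c : R) w : 1 <= L -> s <= 1 -> lin L s r w ->
  lin L s r (fun x => k * w x + c).
Proof.
move=> L1 s1 [mw [e be] lw [P [mP Pk Pz]]].
have DE z : Df (fun x => k * w x + c) z = k * Df w z by rewrite /Df /=; ring.
split; first by meas.
- exists (k ^+ 2 * e); apply: (bd_ext (enbZ k be)) => z.
  by rewrite DE /Df /= -mulrBr.
- have mk : measurable_fun setT (fun x => k * w x + c) by meas.
  move=> ro; have [C bC] := lw ro.
  have [D bD] := loc2_cst c ro.
  exists (2 * (k ^+ 2 * C + D)).
  apply: (bd_le (bdZ (ler0n _ 2) (bdD (bdZ (sqr_ge0 k) bC) bD))); [by meas|by move=> x; nn|].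
  move=> x; have := sqr_ge0 (k * w x - c); have : 0 <= (`|x| < ro)%R%:R :> R by exact: ler0n.
  by move: ((`|x| < ro)%R%:R) (w x) => b u b0 h; have := mulr_ge0 b0 h; clear; lra.
- exists (fun z => k * P z); split.
  + by meas.
  + by move=> z; have [t tJ ->] := Pk z; exists t => //; rewrite DE; ring.
  + move=> psi hpsi; have hk := H0Z k hpsi.
    rewrite -(Pz _ hk); apply: eq_integral => z _; congr EFin.
    by rewrite /Df /= -mulrBr; ring.
Qed.

Lemma enb_rescale s (x0 : V) (r c : R) f : 0 < r -> enb s f c ->
  enb s (fun x => f (x0 + r *: x)) (r `^ (n%:R + 2 * s) * (r ^- n * r ^- n * c)).
Proof.
move=> r0 bf; have h := bdZ (powR_ge0 r (n%:R + 2 * s)) (bd_diag x0 r0 bf).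
apply: (bd_ext h) => z; rewrite /Df /=.
have -> : x0 + r *: z.1 - (x0 + r *: z.2) = r *: (z.1 - z.2).
  by rewrite scalerBr opprD addrACA subrr add0r.
by rewrite JZ ?(ltW r0) // !mulrA powRN mulfV ?mul1r // gt_eqF // powR_gt0.
Qed.

Lemma loc2_rescale (x0 : V) (r : R) f : 0 < r -> loc2 f -> measurable_fun setT f ->
  loc2 (fun x => f (x0 + r *: x)).
Proof.
move=> r0 lf mf ro; have [c bc] := lf (`|x0| + r * ro).
exists (r ^- n * c); apply: (bd_le (bd_affine x0 r0 bc)).
- by have := measurable_affine x0 r => ma; meas.
- by move=> x; nn.
move=> x; apply: ler_wpM2r; first exact: sqr_ge0.
rewrite ler_nat; case: (ltP `|x| ro) => // xr.
suff -> : `|x0 + r *: x| < `|x0| + r * ro by [].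
apply: le_lt_trans (ler_normD _ _) _; rewrite ltrD2l normVZ ?(ltW r0) //.
by rewrite ltr_pM2l.
Qed.

(** Homogeneity of [J] shows that the factor rho^(n+2s) on the flux restores the ellipticity bounds;
    test functions are carried back by the inverse affine map. *)
Lemma lin_rescale (L s r r' : R) (x0 : V) (rho : R) w : 1 <= L -> 0 <= s -> s <= 1 ->
  0 < rho -> `|x0| + rho * r' <= r -> lin L s r w ->
  lin L s r' (fun x => w (x0 + rho *: x)).
Proof.
move=> L1 s0 s1 rho0 hr [mw [e be] lw [P [mP Pk Pz]]].
have ma := measurable_affine x0 rho.
have L0 : 0 <= L by lra.
pose p := rho `^ (n%:R + 2 * s).
have p0 : 0 < p by rewrite powR_gt0.
have sub (z : V * V) : x0 + rho *: z.1 - (x0 + rho *: z.2) = rho *: (z.1 - z.2).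
  by rewrite scalerBr opprD addrACA subrr add0r.
have JE (z : V) : J s z = p * J s (rho *: z).
  rewrite JZ ?(ltW rho0) // /p mulrA powRN mulfV ?mul1r // gt_eqF //.
split; first by meas.
- by exists (p * (rho ^- n * rho ^- n * e)); exact: enb_rescale.
- exact: loc2_rescale.
exists (fun z => p * P (x0 + rho *: z.1, x0 + rho *: z.2)); split.
- by meas.
- move=> z; have [k /andP[k1 k2] ->] := Pk (x0 + rho *: z.1, x0 + rho *: z.2).
  rewrite /= sub in k1 k2; exists (p * k); last by rewrite mulrA.
  rewrite JE; apply/andP; split.
    by rewrite mulrCA; apply: ler_wpM2l => //; exact: ltW.
  by rewrite mulrCA; apply: ler_wpM2l => //; exact: ltW.
move=> psi hpsi; have [mp pz [c bc] [e' be']] := hpsi.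
pose psi' x := psi (- (rho^-1 *: x0) + rho^-1 *: x).
have ri0 : 0 < rho^-1 by rewrite invr_gt0.
have hinv x : psi' (x0 + rho *: x) = psi x.
  rewrite /psi' scalerDr scalerA mulVf ?gt_eqF // scale1r addrA addNr add0r //.
have hpsi' : H0 s r psi'.
  split.
  - by have := measurable_affine (- (rho^-1 *: x0)) rho^-1 => ma'; rewrite /psi'; meas.
  - move=> x xr; apply: pz.
    have -> : - (rho^-1 *: x0) + rho^-1 *: x = rho^-1 *: (x - x0).
      by rewrite scalerBr addrC.
    rewrite normVZ ?(ltW ri0) // mulrC ler_pdivlMr // mulrC.
    have := lerB_dist x x0; lra.
  - by exists (rho^-1 ^- n * c); exact: (bd_affine _ ri0 bc).
  - by eexists; exact: (enb_rescale _ ri0 be').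
have [mp' _ _ [e'' be'']] := hpsi'.
have intP : mu2.-integrable setT (EFin \o (fun z => P z * Df psi' z)).
  apply: (flux_integrable L0 be be'' mP mw mp' s1) => z.
  have [k /andP[k1 k2] ->] := Pk z; have j0 := J_ge0 (z.1 - z.2) s1.
  have k0 : 0 <= k by apply: le_trans k1; rewrite mulr_ge0 // invr_ge0.
  by rewrite normrM ger0_norm //; apply: ler_wpM2r.
have [i1 i2] := integral_diag x0 rho0 intP.
rewrite (Pz _ hpsi') mule0 in i2.
transitivity (p%:E * \int[mu2]_z (P (x0 + rho *: z.1, x0 + rho *: z.2) *
   Df psi' (x0 + rho *: z.1, x0 + rho *: z.2))%:E)%E.
  rewrite -integralZl //; apply: eq_integral => z _; rewrite -EFinM; congr EFin.
  by rewrite /Df /= !hinv mulrA.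
by rewrite i2 mule0.
Qed.

End linear_class_operations.

(** * Local boundedness in terms of the weighted L^1 norm *)

Section weighted_bounds.
Context {R : realType} {n : nat}.
Local Notation V := 'rV[R]_n.
Local Notation mu := (@lebesgue_rV R n).
Implicit Types (s : R) (f w : V -> R).

Lemma om_lower s (r : R) (x : V) : 2^-1 <= s -> s < 1 -> 0 < r -> `|x| <= r ->
  (1 + r)^-1 ^+ (n + 2) <= om s x.
Proof.
move=> s0 s1 r0 xr; rewrite /om -powR_mulrn ?invr_ge0; last by lra.
have r1 : 0 <= 1 + r by lra.
rewrite -(powR_inv1 r1) -powRrM mulN1r.
have x0 : 0 < 1 + `|x| by rewrite ltr_pwDl.
have n0 := ler0n R n.
apply: (@le_trans _ _ ((1 + r) `^ (- (n%:R + 2 * s)))); last first.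
  by apply: powRN_le => //; lra.
by apply: ler_powR; [lra|rewrite lerN2 natrD; lra].
Qed.

Lemma om_le1 s (x : V) : 0 <= s -> om s x <= 1.
Proof.
move=> s0; have h : 0 <= n%:R + 2 * s :> R by rewrite addr_ge0 // mulr_ge0.
have x1 : 1 <= 1 + `|x| by rewrite lerDl.
by rewrite /om; apply: le_trans (powRN_le h ltr01 x1) _; rewrite powR1.
Qed.

Lemma om_le_tail s (x : V) : 0 <= s -> x != 0 -> om s x <= `|x| `^ (- (n%:R + 2 * s)).
Proof.
move=> s0 x0; have h : 0 <= n%:R + 2 * s :> R by rewrite addr_ge0 // mulr_ge0.
by apply: powRN_le => //; [rewrite normr_gt0|rewrite lerDr].
Qed.

Lemma bd_om s : 2^-1 <= s -> s < 1 -> bd mu (om s) (2 ^+ n + 2 * 4 ^+ n).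
Proof.
move=> s0 s1; have mom := @measurable_om R n s; have s00 : 0 <= s by lra.
have := bdD (bd_cube (n := n) (@ltr01 R)) (J_tail s0 s1); rewrite mulr1 => b.
apply: (bd_le b) => //; first by move=> x; exact: om_ge0.
move=> x; case: (ltP `|x| 1) => x1 /=.
  by rewrite mul0r addr0; exact: om_le1.
rewrite add0r mul1r; apply: om_le_tail => //.
by rewrite -normr_gt0; lra.
Qed.

Lemma om_unweight s w (r T : R) : 2^-1 <= s -> s < 1 -> 0 < r -> measurable_fun setT w ->
  bd mu (fun y => `|w y| * om s y) T ->
  bd mu (fun y => (`|y| <= r)%R%:R * `|w y|) ((1 + r) ^+ (n + 2) * T).
Proof.
move=> s0 s1 r0 mw bT; have r10 : 0 < (1 + r) ^+ (n + 2) by rewrite exprn_gt0 //; lra.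
apply: (bd_le (bdZ (ltW r10) bT)); [by meas|by move=> y; nn|].
move=> y; case: (leP `|y| r) => yr /=; last by rewrite mul0r; nn.
rewrite mul1r mulrCA; apply: ler_peMr => //.
have := ler_wpM2l (ltW r10) (om_lower s0 s1 r0 yr).
by rewrite -exprMn mulfV ?expr1n // gt_eqF //; lra.
Qed.

(** [sup_lemma] asks for a small square integral, which is at most the supremum on a larger cube
    times the L^1 norm. A crude bound C0 T A^j on some cube thus improves by the factor A on each
    smaller one, down to j = 0; the crude bound exists because [w] is locally square integrable. *)
Lemma local_sup_l1 (L CJ : R) : (2 <= n)%N -> 1 <= L ->
  (forall s, 2^-1 <= s -> s < 1 -> bd mu (fun z : V => J s z * Num.min 1 (`|z| ^+ 2)) CJ) ->
  exists2 C : R, 1 <= C & forall s w T, 2^-1 <= s -> s < 1 -> 0 < T ->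
    lin L s 1 w -> bd mu (fun y => `|w y| * om s y) T ->
    {ae mu, forall x, `|x| < 2^-1 -> `|w x| <= C * T}.
Proof.
move=> n2 L1 hJ; have [c /andP[c0 c1] hsup] := sup_lemma n2 L1 hJ.
(* The factor by which the threshold of [sup_lemma] drops when the gap between the radii is halved,
   see [kaE]. *)
pose A : R := 2 ^+ (n * (n + 2)).
pose c8 : R := (c * 8^-1 ^+ (n + 2)) ^+ n.
have c80 : 0 < c8 by rewrite exprn_gt0 // mulr_gt0 // exprn_gt0 // invr_gt0.
have A1 : 1 <= A by rewrite exprn_ege1 // ler1n.
pose C0 := 1 + A * 2 ^+ (n + 2) / c8.
have C01 : 1 <= C0 by rewrite lerDl; nn; lra.
exists C0 => // s w T s0 s1 T0 lw bT.
have mw : measurable_fun setT w by case: lw.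
have s00 : 0 <= s by lra.
(* The radii grow with [j] from 1/2 towards 3/4, so descending in [j] shrinks the cubes. *)
pose sg j : R := 3 / 4 - 4^-1 * 2 ^- j.
have h2 (j : nat) : 0 < 2 ^- j :> R by rewrite invr_gt0 exprn_gt0.
have h2S (j : nat) : 2 ^- j.+1 = 2 ^- j / 2 :> R by rewrite exprSr invfM mulrC.
have h21 (j : nat) : 2 ^- j <= 1 :> R by rewrite invf_le1 ?exprn_gt0 // exprn_ege1 // ler1n.
have sgS j : sg j.+1 - sg j = 8^-1 * 2 ^- j by rewrite /sg h2S; field.
have sg0 j : 0 < sg j by have := h21 j; rewrite /sg; lra.
have sg1 j : sg j <= 1 by have := h2 j; rewrite /sg; lra.
have sglt j : sg j < sg j.+1 by rewrite -subr_gt0 sgS mulr_gt0.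
have kaE j : (c * 1 * (sg j.+1 - sg j) ^+ (n + 2)) ^+ n = c8 / A ^+ j.
  rewrite sgS mulr1 /c8 !exprMn !exprVn -mulrA; congr (_ * (_ * _)).
  congr (_^-1); rewrite /A -!exprM; congr (_ ^+ _).
  by rewrite mulnC (mulnC (n + 2)%N n).
have lN := lin_affine (-1) 0 L1 (ltW s1) lw.
have two j (l : R) : T <= l ->
    bd mu (fun x => (`|x| < sg j.+1)%R%:R * w x ^+ 2) (c8 / A ^+ j * l ^+ 2) ->
    {ae mu, forall x, `|x| < sg j -> `|w x| <= l}.
  move=> Tl bw; have l0 : 0 < l by lra.
  have h1 : {ae mu, forall x, `|x| < sg j -> w x <= l}.
    apply: (hsup s w (sg j) (sg j.+1) 1 T) => //; first by rewrite mul1r.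
      apply: (bd_le bT); [by have := @measurable_om R n s; rewrite /posp => mom; meas|..].
        by move=> y; rewrite mulr_ge0 ?posp_ge0 ?om_ge0.
      move=> y; apply: ler_wpM2r; first exact: om_ge0.
      by rewrite /posp ge_max normr_ge0 ler_norm.
    rewrite kaE; apply: (bd_le bw); [by rewrite /posp; meas|by move=> x; nn|].
    move=> x; apply: ler_wpM2l; first exact: ler0n.
    rewrite -[leRHS](real_normK (num_real _)) lerXn2r ?nnegrE ?posp_ge0 //.
    by rewrite /posp ge_max normr_ge0 ler_norm.
  have h3 : {ae mu, forall x, `|x| < sg j -> -1 * w x + 0 <= l}.
    apply: (hsup s (fun x => -1 * w x + 0) (sg j) (sg j.+1) 1 T) => //; first by rewrite mul1r.
      apply: (bd_le bT); [by have := @measurable_om R n s; rewrite /posp => mom; meas|..].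
        by move=> y; rewrite mulr_ge0 ?posp_ge0 ?om_ge0.
      move=> y; apply: ler_wpM2r; first exact: om_ge0.
      by rewrite mulN1r addr0 /posp ge_max normr_ge0 -normrN ler_norm.
    rewrite kaE; apply: (bd_le bw); [by rewrite /posp; meas|by move=> x; nn|].
    move=> x; apply: ler_wpM2l; first exact: ler0n.
    rewrite -[leRHS](real_normK (num_real _)) lerXn2r ?nnegrE ?posp_ge0 //.
    by rewrite mulN1r addr0 /posp ge_max normr_ge0 -normrN ler_norm.
  apply: filterS2 h1 h3 => x a b xs; rewrite ler_norml; apply/andP; split; last exact: a.
  by have := b xs; lra.
have A0 : 0 < A by lra.
(* The starting index depends on [w] through its square integral [X]; the final constant does not,
   since the descent ends at j = 0. *)
have [Jm hJm] : exists Jm, {ae mu, forall x, `|x| < sg Jm -> `|w x| <= C0 * T * A ^+ Jm}.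
  have [_ _ l2 _] := lw; have [X bX] := l2 1.
  have X0 := bd_ge0 bX.
  pose Jm := Num.bound (X / (c8 * T ^+ 2)).
  have cT : 0 < c8 * T ^+ 2 by rewrite mulr_gt0 // exprn_gt0.
  have hX : X <= c8 * T ^+ 2 * A ^+ Jm.
    rewrite -ler_pdivrMl // mulrC; apply: (@le_trans _ _ Jm%:R).
      by apply/ltW/archi_boundP; rewrite divr_ge0 // ltW.
    apply: (@le_trans _ _ (2 ^+ Jm)); first by rewrite -natrX ler_nat ltnW // ltn_expl.
    rewrite lerXn2r ?nnegrE //; first exact: ltW.
    rewrite /A -{1}(expr1 2); apply: ler_weXn2l; first by rewrite ler1n.
    by rewrite muln_gt0 addn_gt0 (ltnW n2) orbT.
  have AJ : 1 <= A ^+ Jm by rewrite exprn_ege1.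
  exists Jm; apply: two.
    rewrite -mulrA mulrCA ler_peMr ?(ltW T0) //; rewrite -[leLHS]mulr1; exact: ler_pM.
  apply: (bdW (c := X)).
    apply: (bd_le bX); [by meas|by move=> x; nn|move=> x].
    apply: ler_wpM2r; first exact: sqr_ge0.
    by rewrite ler_nat; case: (ltP `|x| (sg Jm.+1)) => // xs; rewrite (lt_le_trans xs).
  apply: (le_trans hX).
  have -> : c8 / A ^+ Jm * (C0 * T * A ^+ Jm) ^+ 2 = c8 * T ^+ 2 * A ^+ Jm * C0 ^+ 2.
    by field; rewrite expf_neq0 // gt_eqF.
  rewrite ler_peMr ?exprn_ege1 //; nn.
(* One power of w^2 is estimated by the current supremum and the other by the L^1 bound [bu]; [C0]
   is chosen so that the product meets the threshold for the smaller cube. *)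
have down j : {ae mu, forall x, `|x| < sg j.+1 -> `|w x| <= C0 * T * A ^+ j.+1} ->
    {ae mu, forall x, `|x| < sg j -> `|w x| <= C0 * T * A ^+ j}.
  move=> hj; have AJ : 1 <= A ^+ j by rewrite exprn_ege1.
  apply: two.
    rewrite -mulrA mulrCA ler_peMr ?(ltW T0) //; rewrite -[leLHS]mulr1; exact: ler_pM.
  have M0 : 0 <= C0 * T * A ^+ j.+1 by rewrite !mulr_ge0 ?exprn_ge0 //; lra.
  have bu := om_unweight s0 s1 (@ltr01 R) mw bT.
  apply: (bdW (c := C0 * T * A ^+ j.+1 * ((1 + 1) ^+ (n + 2) * T))).
    apply: (bd_ae_le (bdZ M0 bu)); [by meas|by move=> x; nn|].
    apply: filterS hj => x hx; case: (ltP `|x| (sg j.+1)) => xs /=; last first.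
      by rewrite mul0r; nn.
    have -> : `|x| <= 1 by have := sg1 j.+1; lra.
    rewrite !mul1r -(real_normK (num_real _)) expr2; apply: ler_wpM2r => //; exact: hx.
  have -> : c8 / A ^+ j * (C0 * T * A ^+ j) ^+ 2 = C0 * T * A ^+ j * (T * (c8 * C0)).
    by field; rewrite expf_neq0 // gt_eqF.
  have -> : C0 * T * A ^+ j.+1 * ((1 + 1) ^+ (n + 2) * T) = C0 * T * A ^+ j * (T * (A * 2 ^+ (n + 2))).
    by rewrite exprSr (_ : 1 + 1 = 2) //; ring.
  apply: ler_wpM2l; first by rewrite !mulr_ge0 ?exprn_ge0 //; lra.
  apply: ler_wpM2l; first exact: ltW.
  rewrite /C0 mulrDr mulrCA mulfV ?mulr1 ?gt_eqF // lerDr; exact: ltW.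
have all0 k : {ae mu, forall x, `|x| < sg k -> `|w x| <= C0 * T * A ^+ k} ->
    {ae mu, forall x, `|x| < sg 0%N -> `|w x| <= C0 * T * A ^+ 0}.
  by elim: k => // k IH /down.
apply: filterS (all0 _ hJm) => x hx xs; rewrite expr0 mulr1 in hx; apply: hx.
by rewrite /sg expr0 invr1; lra.
Qed.

End weighted_bounds.

(** * The logarithmic estimate and the growth lemma *)

Section growth.
Context {R : realType} {n : nat}.
Local Notation V := 'rV[R]_n.
Local Notation mu := (@lebesgue_rV R n).
Local Notation mu2 := (mu \x mu)%E.
Implicit Types (s : R) (f w v : V -> R).

(** For a >= b take t = sqrt(a/b): ln t <= t - 1 gives t ln t <= t^2 - 1, and (t^2 - 1)^2 / t^2 is
    the quotient on the right. The other case is symmetric. *)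
Lemma ln_sqr_le (a b : R) : 0 < a -> 0 < b ->
  (ln a - ln b) ^+ 2 <= 4 * ((a - b) ^+ 2 / (a * b)).
Proof.
have key (x y : R) : 0 < y -> y <= x -> (ln x - ln y) ^+ 2 <= 4 * ((x - y) ^+ 2 / (x * y)).
  move=> y0 yx; have x0 : 0 < x by lra.
  pose t := Num.sqrt (x / y).
  have xy0 : 0 < x / y by rewrite divr_gt0.
  have t0 : 0 < t by rewrite sqrtr_gt0.
  have t2 : t ^+ 2 = x / y by rewrite sqr_sqrtr // ltW.
  have t1 : 1 <= t.
    by rewrite -[leLHS]sqrtr1 ler_wsqrtr // ler_pdivlMr // mul1r.
  have lE : ln x - ln y = 2 * ln t.
    by rewrite -ln_div ?posrE // -t2 lnXn // mulr_natl.
  have l1 : ln t <= t - 1.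
    rewrite {1}(_ : t = 1 + (t - 1)); last by ring.
    by apply: le_ln1Dx; lra.
  have l0 : 0 <= ln t by rewrite ln_ge0.
  have -> : (x - y) ^+ 2 / (x * y) = (t ^+ 2 - 1) ^+ 2 / t ^+ 2.
    by rewrite t2; field; rewrite !gt_eqF.
  rewrite lE exprMn (_ : 2 ^+ 2 = 4); last by rewrite -natrX.
  rewrite ler_pM2l // ler_pdivlMr ?exprn_gt0 // -exprMn lerXn2r ?nnegrE //.
  - by rewrite mulr_ge0 // ltW.
  - by rewrite subr_ge0 exprn_ege1.
  - by apply: (@le_trans _ _ ((t - 1) * t)); [apply: ler_wpM2r; [exact: ltW|]|rewrite expr2; lra].
move=> a0 b0; case: (leP b a) => [|/ltW] ab; first exact: key.
by rewrite -sqrrN opprB -(sqrrN (a - b)) opprB (mulrC a); exact: key.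
Qed.

(** The left side equals (p - q)^2 - (a - b)(p^2/a - q^2/b). Replacing a - b by vx - vy costs the
    negative parts of [v], divided by the shift [d]. *)
Lemma log_test (vx vy p q d a b : R) : 0 < d -> a = posp vx + d -> b = posp vy + d ->
  (p * b - q * a) ^+ 2 / (a * b) <=
    - ((vx - vy) * (p ^+ 2 / a - q ^+ 2 / b)) + (p - q) ^+ 2 +
    (posp (- vx) * q ^+ 2 + posp (- vy) * p ^+ 2) / d.
Proof.
move=> d0 aE bE.
have a0 : 0 < a by rewrite aE ltr_wpDl // posp_ge0.
have b0 : 0 < b by rewrite bE ltr_wpDl // posp_ge0.
have ad : d <= a by rewrite aE lerDr posp_ge0.
have bd' : d <= b by rewrite bE lerDr posp_ge0.
have e1 : (p * b - q * a) ^+ 2 / (a * b) = (p - q) ^+ 2 - (a - b) * (p ^+ 2 / a - q ^+ 2 / b).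
  by field; rewrite !gt_eqF.
have vE (x : R) : x = posp x - posp (- x).
  rewrite /posp; case: (leP 0 x) => x0.
    by rewrite max_r; lra.
  by rewrite max_l; lra.
have -> : vx - vy = (a - b) - (posp (- vx) - posp (- vy)).
  by rewrite {1}(vE vx) {1}(vE vy) aE bE; ring.
have P0 := sqr_ge0 p; have Q0 := sqr_ge0 q.
have nx := posp_ge0 (- vx); have ny := posp_ge0 (- vy).
(* where the negative part does not vanish, the positive one does *)
have px : posp (- vx) * (p ^+ 2 / a) = posp (- vx) * (p ^+ 2 / d).
  rewrite aE; case: (leP 0 vx) => h; first by rewrite posp_eq0 ?mul0r //; lra.
  by rewrite (posp_eq0 (ltW h)) add0r.
have py : posp (- vy) * (q ^+ 2 / b) = posp (- vy) * (q ^+ 2 / d).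
  rewrite bE; case: (leP 0 vy) => h; first by rewrite posp_eq0 ?mul0r //; lra.
  by rewrite (posp_eq0 (ltW h)) add0r.
have h1 : posp (- vx) * (q ^+ 2 / b) <= posp (- vx) * (q ^+ 2 / d).
  by apply: ler_wpM2l => //; apply: ler_wpM2l => //; rewrite lef_pV2.
have h2 : posp (- vy) * (p ^+ 2 / a) <= posp (- vy) * (p ^+ 2 / d).
  by apply: ler_wpM2l => //; apply: ler_wpM2l => //; rewrite lef_pV2.
have z1 : 0 <= posp (- vx) * (p ^+ 2 / d) by rewrite mulr_ge0 // divr_ge0 // ltW.
have z2 : 0 <= posp (- vy) * (q ^+ 2 / d) by rewrite mulr_ge0 // divr_ge0 // ltW.
rewrite e1.
have -> : (posp (- vx) * q ^+ 2 + posp (- vy) * p ^+ 2) / d =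
  posp (- vx) * (q ^+ 2 / d) + posp (- vy) * (p ^+ 2 / d) by ring.
move: px py h1 h2 z1 z2.
move: (p ^+ 2 / a) (q ^+ 2 / b) (p ^+ 2 / d) (q ^+ 2 / d) => A B C D.
clear aE bE; move: (posp (- vx)) (posp (- vy)) => X Y; clear; lra.
Qed.

Section one_s.
Variables (L CJ s : R).
Hypothesis n2 : (2 <= n)%N.
Hypothesis L1 : 1 <= L.
Hypothesis s0 : 2^-1 <= s.
Hypothesis s1 : s < 1.
Hypothesis bJ : bd mu (fun z : V => J s z * Num.min 1 (`|z| ^+ 2)) CJ.

Definition log_const : R := 4 * L * (L * ((1 + 8 ^+ 2) * (2 ^+ n * CJ) * 2 + 8 ^+ (n + 2) * 2 ^+ n * 2)).

(** The negative part of [v] lives outside the unit cube and its tail is at most [d], while the test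
    function contributes 1/d; the bound is therefore independent of [d]. *)
Lemma log_estimate v (d : R) : 0 < d -> lin L s 1 v ->
  {ae mu, forall x, `|x| < 1 -> 0 <= v x} ->
  bd mu (fun y => posp (- v y) * om s y) d ->
  bd mu2 (fun z => ((`|z.1| < 2^-1)%R && (`|z.2| < 2^-1)%R)%:R *
    (J s (z.1 - z.2) * (Df (fun x => ln (posp (v x) + d)) z) ^+ 2)) log_const.
Proof.
move=> d0 lv vpos bT; have [mv [e be] l2 _] := lv.
pose phi : V -> R := cut 2^-1 (3 / 4).
have r12 : 2^-1 < 3 / 4 :> R by lra.
have cphi0 := cut_cutoff (n := n) r12.
have K4 : (3 / 4 - 2^-1)^-1 = 4 :> R by field.
rewrite K4 in cphi0.
have cphi : cutoff 4 1 phi.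
  case: cphi0 => mf f01 flip f0; split => // x x1; apply: f0; lra.
have [mf f01 flip f00] := cphi0.
have f0 x : 3 / 4 <= `|x| -> phi x = 0 by exact: f00.
have c2phi := cutoff_sqr cphi.
pose a x := posp (v x) + d.
have a0 x : 0 < a x by rewrite ltr_wpDl // posp_ge0.
have ma : measurable_fun setT a by rewrite /a /posp; meas.
(* The test function is g phi^2; since a >= d, g depends on v with Lipschitz constant d^-2 and
   inherits its finite energy. *)
pose g x := - (a x)^-1.
have mg : measurable_fun setT g by rewrite /g; meas.
have da x : d <= a x by rewrite lerDr posp_ge0.
have dd0 : 0 < d ^+ 2 by rewrite exprn_gt0.
have eg : exists c, enb s g c.
  have b2 := enbZ (d ^+ 2)^-1 be; eexists; apply: (enb_le b2 (ltW s1) mg) => x y.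
  rewrite -mulrBr normrM ger0_norm; last by rewrite invr_ge0 ltW.
  have -> : g x - g y = (a x - a y) / (a x * a y) by rewrite /g; field; rewrite !gt_eqF.
  rewrite normrM normfV (ger0_norm (ltW (mulr_gt0 (a0 x) (a0 y)))) mulrC.
  apply: ler_pM; [by rewrite invr_ge0 mulr_ge0 // ltW|by []| |].
    rewrite lef_pV2 ?posrE ?mulr_gt0 //; rewrite expr2; apply: ler_pM => //; exact: ltW.
  rewrite /a; have -> : posp (v x) + d - (posp (v y) + d) = posp (v x) - posp (v y) by ring.
  rewrite /posp; have [h1|/ltW h1] := leP (v x) 0; have [h2|/ltW h2] := leP (v y) 0;
    rewrite ?subrr ?normr0 // ler_norml; apply/andP; case: (ger0P (v x - v y)) => ?; split; lra.
have lg : loc2 g.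
  apply: (loc2_le l2 mg); exists d^-1; first by rewrite invr_ge0 ltW.
  move=> x; rewrite /g normrN normfV (ger0_norm (ltW (a0 x))).
  apply: (@le_trans _ _ d^-1); first by rewrite lef_pV2 ?posrE.
  by rewrite lerDr.
have hpsi := H0_cutoff bJ (ltW s1) c2phi mg eg lg.
have mom := @measurable_om R n s; have mJ := @measurable_J R n s.
have mDp := measurable_Df mf.
pose D (x : V) := (`|x| < 2^-1)%R.
pose lnf x := ln (a x).
have mlnf : measurable_fun setT lnf by apply: measurableT_comp ma; exact: measurable_ln.
have mDl := measurable_Df mlnf.
pose T1 z : R := L * (J s (z.1 - z.2) * Df phi z ^+ 2).
pose T2 (z : V * V) : R := L * d^-1 * (J s (z.1 - z.2) *
  (posp (- v z.1) * phi z.2 ^+ 2 + posp (- v z.2) * phi z.1 ^+ 2)).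
have mT1 : measurable_fun setT T1 by rewrite /T1; meas.
have mT2 : measurable_fun setT T2 by rewrite /T2 /posp; meas.
have L0 : 0 <= L := le_trans ler01 L1.
have di0 : 0 <= d^-1 by rewrite invr_ge0 ltW.
have j0 (z : V) : 0 <= J s z by nn.
have bc := bd_cube (n := n) (@ltr01 R); rewrite mulr1 in bc.
have b1 := cutoff_energy bJ (ltW s1) cphi bc.
have bB1 : bd mu2 T1 (L * ((1 + 8 ^+ 2) * (2 ^+ n * CJ) * 2)).
  have k0 : 0 <= 2 ^+ n * CJ by rewrite mulr_ge0 ?exprn_ge0 //; exact: bd_ge0 bJ.
  apply: (bd_le (bdW (bdZ L0 (bdD b1 (bd_swap b1))) _)) => //.
  - apply: ler_wpM2l => //; rewrite -mulr2n -(mulr_natr (_ * _) 2).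
    apply: ler_wpM2r => //; apply: ler_wpM2r => //.
    by rewrite lerD2l lerXn2r ?nnegrE // ler_nat.
  - by move=> z; rewrite /T1; nn.
  - move=> z; rewrite /T1 /= (JB _ z.2); apply: ler_wpM2l => //.
    have -> : Df phi (z.2, z.1) ^+ 2 = Df phi z ^+ 2 by rewrite /Df /= -sqrrN opprB.
    have X0 : 0 <= J s (z.1 - z.2) * Df phi z ^+ 2 by nn.
    case: (ltP `|z.1| 1) => h1 /=; first by rewrite mul1r lerDl; nn.
    case: (ltP `|z.2| 1) => h2 /=; first by rewrite mul1r mul0r add0r.
    by rewrite /Df !f0 ?subrr ?expr0n ?mulr0 ?addr0 //; lra.
have bB2 : bd mu2 T2 (L * (8 ^+ (n + 2) * 2 ^+ n * 2)).
  have bt := bd_tensor bT bc.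
  have k0 : 0 <= L * d^-1 * 8 ^+ (n + 2) by nn.
  apply: (bd_ae_le (bdW (bdZ k0 (bdD bt (bd_swap bt))) _)) => //.
  - by rewrite le_eqVlt; apply/orP; left; apply/eqP; field; rewrite gt_eqF.
  - by move=> z; rewrite /T2; nn.
  have hx := ae_prod_x mu vpos; have hy := ae_prod_y mu vpos.
  apply: filterS2 hx hy => z hx hy.
  rewrite /T2 -(mulrA (L * _)); apply: ler_wpM2l; first by nn.
  (* For |x| >= 1 and |y| < 3/4 the distance is at least (1 + |x|)/8, which is where the constant 8
     comes from. *)
  have half x y : (`|x| < 1 -> 0 <= v x) -> J s (x - y) * (posp (- v x) * phi y ^+ 2) <=
      8 ^+ (n + 2) * (posp (- v x) * om s x * (`|y| < 1)%R%:R).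
    move=> vx; case: (ltP `|x| 1) => x1.
      by rewrite posp_eq0 ?mul0r ?mulr0 // oppr_le0; exact: vx.
    case: (ltP `|y| (3 / 4)) => y1; last first.
      by rewrite f0 // expr0n !mulr0; nn.
    have -> : (`|y| < 1) = true by lra.
    rewrite mulr1 mulrCA [leRHS]mulrCA; apply: ler_wpM2l; first exact: posp_ge0.
    have h8 : 8^-1 * (1 + `|x|) <= `|x - y|.
      by apply: le_trans (lerB_dist _ _); lra.
    have e0 : 0 < 8^-1 :> R by rewrite invr_gt0.
    have e1 : 8^-1 <= 1 :> R by rewrite invf_le1 // ler1n.
    have := J_le_om s0 s1 e0 e1 h8; rewrite invrK => hJ.
    apply: le_trans hJ; rewrite ler_piMr //.
    by have /andP[u1 u2] := f01 y; exact: exprn_ile1.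
  rewrite [leLHS]mulrDr [leRHS]mulrDr; apply: lerD; first exact: half.
  by rewrite JB; exact: half.
have bB := bdD bB1 bB2.
pose A z : R := L^-1 * 4^-1 * ((D z.1 && D z.2)%:R * (J s (z.1 - z.2) * Df lnf z ^+ 2)).
have bA : bd mu2 A (L * ((1 + 8 ^+ 2) * (2 ^+ n * CJ) * 2) + L * (8 ^+ (n + 2) * 2 ^+ n * 2)).
  apply: (lin_test (ltW s1) L1 lv hpsi _ _ bB).
  - by rewrite /A /D; meas.
  - by move=> z; rewrite /A; nn; lra.
  move=> z k /andP[k1 k2].
  have k0 : 0 <= k by apply: le_trans k1; rewrite mulr_ge0 // invr_ge0.
  have Li0 : 0 <= L^-1 by rewrite invr_ge0.
  set p := phi z.1; set q := phi z.2.
  have lt := log_test p q d0 (erefl (a z.1)) (erefl (a z.2)).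
  have h1 : A z <= L^-1 * (J s (z.1 - z.2) * ((p * a z.2 - q * a z.1) ^+ 2 / (a z.1 * a z.2))).
    rewrite /A -mulrA; apply: ler_wpM2l => //.
    case: (boolP (D z.1 && D z.2)) => [/andP[D1 D2]|_] /=; last first.
      rewrite mul0r mulr0 mulr_ge0 // mulr_ge0 ?sqr_ge0 // invr_ge0 mulr_ge0 // ltW //.
    rewrite mul1r mulrCA; apply: ler_wpM2l => //.
    have p1 : p = 1 by apply: cut1 => //; exact: ltW.
    have q1 : q = 1 by apply: cut1 => //; exact: ltW.
    rewrite p1 q1 !mul1r mulrC ler_pdivrMr // mulrC -(sqrrN (a z.2 - a z.1)) opprB.
    exact: ln_sqr_le.
  apply: (le_trans h1).
  apply: (@le_trans _ _ (k * ((p * a z.2 - q * a z.1) ^+ 2 / (a z.1 * a z.2)))).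
    rewrite [leLHS]mulrA; apply: ler_wpM2r => //.
    by rewrite divr_ge0 ?sqr_ge0 // mulr_ge0 // ltW.
  apply: le_trans (ler_wpM2l k0 lt) _.
  have -> : k * Df v z * Df (fun x => g x * phi x ^+ 2) z =
    k * - ((v z.1 - v z.2) * (p ^+ 2 / a z.1 - q ^+ 2 / a z.2)).
    by rewrite /Df /g /p /q; ring.
  rewrite -addrA mulrDr lerD2l mulrDr; apply: lerD.
    by rewrite /T1 mulrA; apply: ler_wpM2r; [exact: sqr_ge0|].
  rewrite /T2 -/p -/q.
  set X := posp _ * _ + _; have X0 : 0 <= X by rewrite /X; nn.
  have -> : k * (X / d) = X * (d^-1 * k) by ring.
  have -> : L * d^-1 * (J s (z.1 - z.2) * X) = X * (d^-1 * (L * J s (z.1 - z.2))) by ring.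
  by apply: ler_wpM2l => //; apply: ler_wpM2l.
have k4 : 0 <= 4 * L by nn.
apply: (bd_ext (bdW (bdZ k4 bA) _)).
  by rewrite /log_const -mulrDr mulrA.
move=> z; rewrite /A /lnf /a; field.
by rewrite gt_eqF //; exact: lt_le_trans ltr01 L1.
Qed.

End one_s.

(** By [log_estimate] and [local_poincare], the logarithm of v^+ + d has controlled differences. It
    is nonnegative on a set of definite measure and at most -K where v < d, so the latter set has
    measure O(K^-2). For large K, [sup_lemma] applied to d - v gives d - v <= d/2 in the smaller
    cube. *)
Lemma growth_lemma (L CJ : R) : (2 <= n)%N -> 1 <= L ->
  (forall s, 2^-1 <= s -> s < 1 -> bd mu (fun z : V => J s z * Num.min 1 (`|z| ^+ 2)) CJ) ->
  exists2 de : R, 0 < de <= 2^-1 & forall s v, 2^-1 <= s -> s < 1 ->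
    lin L s 1 v -> {ae mu, forall x, `|x| < 1 -> 0 <= v x} ->
    bd mu (fun y => posp (- v y) * om s y) de ->
    (((2^-1 * 2^-1 ^+ n)%R%:E <= \int[mu]_x (((`|x| < 2^-1)%R && (1 <= v x)%R)%:R)%:E)%E) ->
    {ae mu, forall x, `|x| < 4^-1 -> de <= v x}.
Proof.
move=> n2 L1 hJ; have [c /andP[c0 c1] hsup] := sup_lemma n2 L1 hJ.
have hs : 2^-1 <= (2^-1 : R) /\ 2^-1 < (1 : R) by split; lra.
have CJ0 : 0 <= CJ by exact: bd_ge0 (hJ 2^-1 hs.1 hs.2).
have L0 : 0 <= L := le_trans ler01 L1.
pose h0 : R := 2^-1 * 2^-1 ^+ n.
have h00 : 0 < h0 by rewrite mulr_gt0 ?exprn_gt0 // invr_gt0.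
pose C3 : R := 8 * ln 4 * log_const L CJ.
have C30 : 0 <= C3.
  by rewrite /C3 /log_const; nn; rewrite ?ln_ge0 ?ler1n //.
pose Com : R := 2 ^+ n + 2 * 4 ^+ n + 1.
have Com1 : 1 <= Com by rewrite lerDr; nn.
(* The positive part of d - v has weighted integral at most d Com, so that eta T <= d/2, the level
   aimed at. *)
pose eta := (2 * Com)^-1.
have eta0 : 0 < eta by rewrite invr_gt0; lra.
have eta1 : eta <= 1 by rewrite invf_le1; lra.
pose ka : R := (c * eta * (2^-1 - 4^-1) ^+ (n + 2)) ^+ n.
have ka0 : 0 < ka by rewrite exprn_gt0 // !mulr_gt0 // exprn_gt0 //; lra.
(* Makes the measure bound C3 / (h0 K^2) at most ka / 4; the 4 compensates the level d/2 against the
   bound d for d - v. *)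
pose K : R := 1 + 4 * C3 / (h0 * ka).
have K1 : 1 <= K by rewrite lerDl; nn.
have K0 : 0 < K by lra.
have KK : C3 / (h0 * K ^+ 2) * 4 <= ka.
  have K2 : K <= K ^+ 2 by rewrite expr2 ler_peMr //; lra.
  have hK : 4 * C3 / (h0 * ka) <= K ^+ 2 by apply: le_trans K2; rewrite /K lerDr.
  rewrite ler_pdivrMr ?mulr_gt0 // in hK.
  rewrite mulrAC ler_pdivrMr ?mulr_gt0 ?exprn_gt0 //.
  by clear - hK; lra.
(* If v < d then v^+ + d <= 2 d, whose logarithm is -K. *)
pose d : R := expR (- K) / 2.
have d0 : 0 < d by rewrite divr_gt0 ?expR_gt0.
have d1 : d <= 2^-1.
  by rewrite /d ler_piMl ?invr_ge0 // expR_le1; lra.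
have dE : expR (- K) = 2 * d by rewrite /d; field.
have kaE : (c * eta * (2^-1 - 4^-1) ^+ (n + 2)) ^+ n = ka by [].
have etaE : eta * Com = 2^-1 by rewrite /eta; field; lra.
have ComE : Com = 2 ^+ n + 2 * 4 ^+ n + 1 by [].
clearbody d K ka eta Com.
exists (d / 2); first by move: d0 d1; clear; lra.
move=> s v s0 s1 lv vpos bT hhalf; have s00 : 0 <= s by lra.
have mv : measurable_fun setT v by case: lv.
have bTd : bd mu (fun y => posp (- v y) * om s y) d by apply: (bdW bT); lra.
have hlog := log_estimate L1 s0 s1 (hJ s s0 s1) d0 lv vpos bTd.
pose D (x : V) := (`|x| < 2^-1)%R.
have mD : measurable_fun setT D by rewrite /D; meas.
pose lnf x := ln (posp (v x) + d).
have mlnf : measurable_fun setT lnf.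
  by apply: (measurableT_comp (@measurable_ln R)); rewrite /posp; meas.
have Dmid x y : D x -> D y -> D (2^-1 *: x + 2^-1 *: y).
  rewrite /D => hx hy; apply: le_lt_trans (ler_normD _ _) _.
  by rewrite !normVZ ?invr_ge0 //; move: hx hy; clear; lra.
have hpo := local_poincare s0 s1 mlnf mD Dmid hlog.
pose A (x : V) : R := (D x && (v x < d))%:R.
have mA : measurable_fun setT A by rewrite /A; meas.
have bA : bd mu A (C3 / (h0 * K ^+ 2)).
  have hk0 : 0 < h0 * K ^+ 2 by rewrite mulr_gt0 // exprn_gt0.
  have : bd mu (fun x => h0 * K ^+ 2 * A x) C3.
    apply: (bd_section_x hpo); [by meas|by move=> x; rewrite mulr_ge0 ?ler0n // ltW|].
    move=> x; rewrite /A; case: (boolP (D x && (v x < d))) => [/andP[Dx vx]|_]; last first.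
      rewrite mulr0; apply: integral_ge0 => y _; rewrite lee_fin; nn.
    rewrite mulr1 mulrC EFinM.
    have mH : measurable_fun setT (fun y : V => ((`|y| < 2^-1) && (1 <= v y))%R%:R : R) by meas.
    apply: (@le_trans _ _ ((K ^+ 2)%:E * \int[mu]_y (((`|y| < 2^-1)%R && (1 <= v y)%R)%:R)%:E)%E).
      by apply: lee_wpmul2l => //; rewrite lee_fin sqr_ge0.
    rewrite -ge0_integralZl; [|by []|exact/measurable_EFinP|by move=> y _; rewrite lee_fin|by rewrite lee_fin sqr_ge0].
    have mDl := measurable_Df mlnf.
    apply: ge0_le_integral => //.
    - by move=> y _; rewrite -EFinM lee_fin; nn.
    - by under eq_fun do rewrite -EFinM; apply/measurable_EFinP; meas.
    - by apply/measurable_EFinP; meas.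
    move=> y _; rewrite -EFinM lee_fin Dx /=.
    case: (boolP ((`|y| < 2^-1) && (1 <= v y))) => [/andP[Dy vy]|_]; last first.
      by rewrite mulr0; nn.
    rewrite /D Dy mulr1 mul1r.
    have -> : `|x - y| <= 1 by have := ler_normB x y; move: Dx Dy; rewrite /D; clear; lra.
    have l1 : 0 <= lnf y.
      rewrite /lnf ln_ge0 //; have := le_posp (v y); move: vy d0; clear; lra.
    have l2 : lnf x <= - K.
      rewrite /lnf -(expRK (- K)) ler_ln ?posrE ?expR_gt0 ?ltr_wpDl ?posp_ge0 //.
      have : posp (v x) <= d by rewrite /posp ge_max (ltW vx) ltW.
      by rewrite dE; have := d0; clear; lra.
    have hh : K <= lnf y - lnf x by move: l1 l2; clear; lra.
    have -> : true%:R * Df lnf (x, y) ^+ 2 = (lnf y - lnf x) ^+ 2.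
      by rewrite mul1r /Df /= -sqrrN opprB.
    by rewrite lerXn2r ?nnegrE ?(ltW K0) //; exact: le_trans (ltW K0) hh.
  have hk1 : 0 <= (h0 * K ^+ 2)^-1 by rewrite invr_ge0 ltW.
  move=> /(bdZ hk1) bb; apply: (bd_ext (bdW bb _)); first by rewrite mulrC.
  by move=> x; rewrite mulrA mulVf ?mul1r // gt_eqF.
have lw := lin_affine (-1) d L1 (ltW s1) lv.
have posw x : posp (-1 * v x + d) <= d + posp (- v x).
  rewrite mulN1r /posp ge_max; apply/andP; split.
    by rewrite addrC lerD2l le_max lexx.
  by rewrite addr_ge0 ?(ltW d0) // le_max lexx orbT.
have mom := @measurable_om R n s.
have bTw : bd mu (fun y => posp (-1 * v y + d) * om s y) (d * Com).
  apply: (bd_le (bdW (bdD (bdZ (ltW d0) (bd_om s0 s1)) bTd) _)).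
  - by rewrite ComE; clear; lra.
  - by rewrite /posp; meas.
  - by move=> y; nn.
  - by move=> y; rewrite -mulrDl; apply: ler_wpM2r; [exact: om_ge0|exact: posw].
have q0 : 0 < 4^-1 :> R by rewrite invr_gt0.
have q1 : 4^-1 < 2^-1 :> R by clear; lra.
have q2 : 2^-1 <= 1 :> R by clear; lra.
have d20 : 0 < d / 2 by rewrite divr_gt0.
have etaT : eta * (d * Com) <= d / 2.
  by rewrite mulrCA etaE.
have dd0 : 0 <= d ^+ 2 by exact: sqr_ge0.
have bY : bd mu (fun x => (`|x| < 2^-1)%R%:R * posp (-1 * v x + d) ^+ 2) (ka * (d / 2) ^+ 2).
  apply: (bd_ae_le (bdW (bdZ dd0 bA) _)).
  - have -> : (d / 2) ^+ 2 = d ^+ 2 / 4 by field.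
    have := ler_wpM2l dd0 KK; move: (C3 / _) (d ^+ 2) => u1 u2; clear; lra.
  - by rewrite /posp; meas.
  - by move=> x; nn.
  apply: filterS vpos => x vx; rewrite /A /D.
  case: (ltP `|x| 2^-1) => xr /=; last by rewrite mul0r; nn.
  rewrite mul1r; case: (ltP (v x) d) => vd /=; last first.
    by rewrite posp_eq0 ?expr0n ?mulr0 //; move: vd; clear; lra.
  rewrite mulr1 lerXn2r ?nnegrE ?posp_ge0 //; first exact: ltW.
  rewrite posp_id; last by move: vd; clear; lra.
  have : 0 <= v x by apply: vx; move: xr; clear; lra.
  by clear; lra.
rewrite -kaE in bY.
have := hsup s _ 4^-1 2^-1 eta (d * Com) (d / 2) s0 s1 lw q0 q1 q2 eta0 eta1 d20 etaT bTw bY.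
by apply: filterS => x h xr; have := h xr; clear; lra.
Qed.
End growth.

(** * Oscillation decay and Hölder continuity *)

Section hoelder_estimate.
Context {R : realType} {n : nat}.
Local Notation V := 'rV[R]_n.
Local Notation mu := (@lebesgue_rV R n).
Implicit Types (s : R) (f w v : V -> R).

Lemma ae_rescale (P : V -> Prop) (x0 : V) (r : R) : 0 < r ->
  {ae mu, forall x, P x} -> {ae mu, forall x, P (x0 + r *: x)}.
Proof.
move=> r0 [N [mN N0 PN]].
have mpre : measurable ((fun x : V => x0 + r *: x) @^-1` N).
  by rewrite -[X in measurable X]setTI; exact: measurable_affine.
exists ((fun x : V => x0 + r *: x) @^-1` N); split => //; last first.
  by move=> x /= Px; apply: PN.
have mI : measurable_fun setT (fun x : V => (\1_N x : R)%:E).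
  by apply/measurable_EFinP; exact: measurable_indic.
have := ge0_integral_affine x0 r0 mI (fun x => _).
have I0 : (\int[mu]_x (\1_N x : R)%:E = 0)%E by rewrite integral_indic // setIT.
rewrite I0 mule0 => E.
rewrite -[X in mu X]setIT -integral_indic //; apply: etrans (E _) => //.
Qed.

Lemma posp_le_ge0 (a b : R) : 0 <= b -> a <= b -> posp a <= b.
Proof. by move=> b0 ab; rewrite /posp ge_max ab b0. Qed.

(** Only the part of |f| above 1 counts, since it is the only part that can make f + 1 or 1 - f
    negative. The homogeneous power, in place of [om], makes the tail scale exactly. *)
Definition tl s f (y : V) : R :=
  (1 <= `|y|)%R%:R * (posp (`|f y| - 1) * `|y| `^ (- (n%:R + 2 * s))).

Definition normalized (L s tau : R) f := [/\ lin L s 1 f,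
  {ae mu, forall x, `|x| < 1 -> `|f x| <= 1} & bd mu (tl s f) tau].

(** One of f, -f is nonnegative on half of the cube of radius 1/2; the growth lemma for 1 + f or 1 -
    f then lifts one of the bounds by [de] on the cube of radius 1/4. Shifting by [e], much smaller
    than [de], and dividing by 1 - e restores the bound 1. The tail condition survives because
    zooming by 4 multiplies the old tail by at most 1/4. *)
Lemma oscillation_step (L CJ : R) : (2 <= n)%N -> 1 <= L ->
  (forall s, 2^-1 <= s -> s < 1 -> bd mu (fun z : V => J s z * Num.min 1 (`|z| ^+ 2)) CJ) ->
  exists lam tau : R, [/\ 2^-1 <= lam < 1, 0 < tau <= 1 & forall s f, 2^-1 <= s -> s < 1 ->
    normalized L s tau f ->
    exists b, normalized L s tau (fun x => lam^-1 * f (0 + 4^-1 *: x) + b)].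
Proof.
move=> n2 L1 hJ; have [de /andP[de0 de2] hgrow] := growth_lemma n2 L1 hJ.
pose Ct : R := 2 * 4 ^+ n.
have Ct1 : 1 <= Ct.
  have h : (1:R) <= 4 ^+ n by rewrite exprn_ege1 // ler1n.
  by rewrite /Ct; move: h; lra.
(* The shift adds at most 2 e Ct = de/8 to the tail and the old tail contributes at most de/4; the
   sum stays below de (1 - e). *)
pose e : R := de / (16 * Ct).
have e0 : 0 < e by rewrite divr_gt0 //; lra.
have eC : e * Ct = de / 16 by rewrite /e; field; lra.
have ede : e <= de / 16 by rewrite -eC ler_peMr // ltW.
clearbody e.
have e1 : 0 < 1 - e by lra.
have e2 : 0 <= 2^-1 - e by lra.
have h4 : 0 < 4^-1 :> R by rewrite invr_gt0.
exists (1 - e), de; split; [by apply/andP; split; lra|by apply/andP; split; lra|].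
move=> s f s0 s1 [lf fb bt]; have s00 : 0 <= s by lra.
have [mf _ _ _] := lf.
have mom := @measurable_om R n s.
have li0 : 0 < (1 - e)^-1 by rewrite invr_gt0; lra.
have mf4 : measurable_fun setT (fun x : V => f (0 + 4^-1 *: x)).
  by apply: (measurableT_comp mf); exact: measurable_affine.
have main sig : sig = 1 \/ sig = -1 ->
    (((2^-1 * 2^-1 ^+ n)%R%:E <= \int[mu]_x (((`|x| < 2^-1)%R && (1 <= sig * f x + 1)%R)%:R)%:E)%E) ->
    exists b, normalized L s de (fun x => (1 - e)^-1 * f (0 + 4^-1 *: x) + b).
  move=> hsig half; exists (- ((1 - e)^-1 * (sig * e))).
  have sabs (x : R) : `|sig * x| = `|x| by case: hsig => ->; rewrite ?mul1r // mulN1r normrN.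
  have lv := lin_affine sig 1 L1 (ltW s1) lf.
  have vpos : {ae mu, forall x, `|x| < 1 -> 0 <= sig * f x + 1}.
    apply: filterS fb => x h /h; rewrite -(sabs (f x)) ler_norml => /andP[a b].
    by clear - a; lra.
  have bv : bd mu (fun y => posp (- (sig * f y + 1)) * om s y) de.
    apply: (bd_ae_le bt); [by rewrite /posp; meas|by move=> y; nn|].
    apply: filterS vpos => y h; rewrite /tl; case: (ltP `|y| 1) => y1 /=.
      by rewrite mul0r posp_eq0 ?mul0r // oppr_le0; exact: h.
    rewrite mul1r; apply: ler_pM; [exact: posp_ge0|exact: om_ge0| |].
      apply: posp_le; have := ler_norm (- (sig * f y)); rewrite normrN sabs.
      by move: (sig * f y) (`|f y|) => u v; clear; lra.
    apply: om_le_tail => //; by rewrite -normr_gt0; apply: lt_le_trans y1.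
  have hv := hgrow s _ s0 s1 lv vpos bv half.
  have f1b : {ae mu, forall x, `|x| < 1 ->
      `|(1 - e)^-1 * f (0 + 4^-1 *: x) + - ((1 - e)^-1 * (sig * e))| <= 1}.
    have a1 := ae_rescale (0 : V) h4 hv; have a2 := ae_rescale (0 : V) h4 fb.
    apply: filterS2 a1 a2 => x a1 a2 x1.
    have xn : `|0 + 4^-1 *: x| < 4^-1 by rewrite add0r normVZ ?invr_ge0 // gtr_pMr.
    have h1 := a1 xn; have h2 : `|f (0 + 4^-1 *: x)| <= 1 by apply: a2; move: xn; clear; lra.
    move: (f _) h1 h2 => F h1 h2.
    rewrite -mulrBr normrM (ger0_norm (ltW li0)) mulrC (ler_pdivrMr _ _ e1).
    rewrite mul1r.
    have -> : `|F - sig * e| = `|sig * F - e|.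
      rewrite -(sabs (F - _)) mulrBr mulrA; congr (`|_ - _|).
      by case: hsig => ->; ring.
    rewrite -(sabs F) ler_norml in h2; have /andP[_ h3] := h2.
    rewrite ler_norml; apply/andP; split; move: (sig * F) h1 h3 => G h1 h3.
      by clear - h1 ede de0; lra.
    by clear - h3; lra.
  split => //.
    have zz : `|0 : V| + 4^-1 * 1 <= 1 by rewrite normr0 add0r mulr1 invf_le1 // ler1n.
    exact: (lin_affine _ _ L1 (ltW s1) (lin_rescale L1 s00 (ltW s1) h4 zz lf)).
  have jt := J_tail (n := n) s0 s1.
  have e20 : 0 <= 2 * e by rewrite mulr_ge0 // ltW.
  have p0 : 0 <= 4 `^ (- (n%:R + 2 * s)) :> R by exact: powR_ge0.
  have bb := bdZ (ltW li0) (bdD (bdZ e20 jt) (bdZ p0 (bd_affine (0 : V) h4 bt))).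
  apply: (bd_ae_le (bdW bb _)).
  - have hp : 4 `^ (- (n%:R + 2 * s)) * 4^-1 ^- n <= 4^-1 :> R.
      rewrite exprVn invrK -(powR_mulrn n) // -powRD; last by rewrite pnatr_eq0 implybT.
      rewrite -[leRHS]powR_inv1 //; apply: ler_powR; first by rewrite ler1n.
      by clear - s0; lra.
    rewrite mulrC (ler_pdivrMr _ _ e1).
    have E : 2 * e * Ct = de / 8 by rewrite -mulrA eC; field.
    have h := ler_wpM2r (ltW de0) hp; move: h; rewrite -/Ct E mulrA.
    have h9 : 0 <= de * (2^-1 - e) by exact: mulr_ge0 (ltW de0) e2.
    by set X := _ / _ * de => h; move: h h9 de0; clear; lra.
  - by rewrite /tl /posp; meas.
  - by move=> y; rewrite /tl; nn.
  have a2 := ae_rescale (0 : V) h4 fb.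
  apply: filterS a2 => y a2; rewrite /tl.
  case: (leP 1 `|y|) => y1 /=; last first.
    by rewrite !mul0r mulr0 add0r; apply: mulr_ge0; [exact: ltW|nn].
  rewrite !mul1r; set G := f _ in a2 *; set P := _ `^ _.
  have P0 : 0 <= P by exact: powR_ge0.
  have ty0 : 0 <= 4 `^ (- (n%:R + 2 * s)) * tl s f (0 + 4^-1 *: y).
    by rewrite /tl; nn.
  have F1 : `|(1 - e)^-1 * G + - ((1 - e)^-1 * (sig * e))| <= (1 - e)^-1 * (`|G| + e).
    apply: le_trans (ler_normB _ _) _; rewrite !normrM (ger0_norm (ltW li0)) -mulrDr.
    have -> : `|sig| = 1 by case: hsig => ->; rewrite ?normrN normr1.
    by rewrite mul1r (ger0_norm (ltW e0)).
  have lam1 : (1 - e)^-1 * (`|G| + e) - 1 = (1 - e)^-1 * (`|G| + 2 * e - 1).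
    by field; rewrite gt_eqF //; clear - ede de2; lra.
  case: (ltP `|0 + 4^-1 *: y| 1) => y2.
    apply: (@le_trans _ _ ((1 - e)^-1 * (2 * e * P))); last first.
      by rewrite ler_pM2l // lerDl mul0r mulr0.
    rewrite [leRHS]mulrA; apply: ler_wpM2r => //; apply: posp_le_ge0; first by nn.
    apply: le_trans (lerB F1 (lexx 1)) _; rewrite lam1 ler_pM2l //.
    by have := a2 y2; clear; lra.
  rewrite mul1r.
  have -> : `|0 + 4^-1 *: y| = 4^-1 * `|y| by rewrite add0r normVZ ?invr_ge0.
  have PE : 4 `^ (- (n%:R + 2 * s)) * (4^-1 * `|y|) `^ (- (n%:R + 2 * s)) = P.
    rewrite -powRM ?mulrA ?mulfV ?mul1r // ?pnatr_eq0 //.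
  rewrite [4 `^ _ * _]mulrCA PE -mulrDl [leRHS]mulrA; apply: ler_wpM2r => //.
  have g0 := posp_ge0 (`|G| - 1); have g1 := le_posp (`|G| - 1).
  apply: posp_le_ge0; first by nn.
  apply: le_trans (lerB F1 (lexx 1)) _; rewrite lam1 ler_pM2l //.
  by move: g1; clear; lra.
(* If the set where f >= 0 is too small, the set where -f >= 0 is not, as together they cover the
   cube of radius 1/2. *)
case: (pselect (((2^-1 * 2^-1 ^+ n)%R%:E <=
   \int[mu]_x (((`|x| < 2^-1)%R && (1 <= 1 * f x + 1)%R)%:R)%:E)%E)) => [h|/negP h].
  by apply: (main 1) => //; left.
apply: (main (-1)); first by right.
rewrite -ltNge in h.
have h2 : (0 : R) < 2^-1 by [].
have cl := cube_lower (n := n) h2.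
rewrite leNgt; apply/negP => h'; have := lteD h h'.
rewrite -EFinD -mulrDl -ge0_integralD //; try by apply/measurable_EFinP; meas.
apply/negP; rewrite -leNgt.
have -> : 2^-1 + 2^-1 = 1 :> R by lra.
rewrite mul1r; apply: le_trans cl _; apply: ge0_le_integral => //.
- by apply/measurable_EFinP; meas.
- by apply: emeasurable_funD; apply/measurable_EFinP; meas.
move=> x _; rewrite -EFinD lee_fin mul1r mulN1r; case: (ltP `|x| 2^-1) => _ //=; last by rewrite addr0.
case: (leP 1 (f x + 1)) => c1 //=; first by rewrite lerDl ler0n.
case: (leP 1 (- f x + 1)) => c2 //=; first by rewrite lerDr ler0n.
by exfalso; move: c1 c2; clear; lra.
Qed.

Lemma normalized_bd L s tau f : 2^-1 <= s -> s < 1 -> normalized L s tau f ->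
  bd mu (fun y => `|f y| * om s y) (2 ^+ n + 2 * 4 ^+ n + tau).
Proof.
move=> s0 s1 [[mf _ _ _] fb bt]; have mom := @measurable_om R n s; have s00 : 0 <= s by lra.
apply: (bd_ae_le (bdD (bd_om s0 s1) bt)); [by meas|by move=> y; nn|].
apply: filterS fb => y fy; rewrite /tl; have o0 := om_ge0 s y.
case: (leP 1 `|y|) => y1 /=; last first.
  by rewrite mul0r addr0; apply: ler_piMl => //; exact: fy.
rewrite mul1r; apply: (@le_trans _ _ ((1 + posp (`|f y| - 1)) * om s y)).
  by apply: ler_wpM2r => //; rewrite -lerBlDl; exact: le_posp.
rewrite mulrDl mul1r lerD2l; apply: ler_wpM2l; first exact: posp_ge0.
by apply: om_le_tail => //; rewrite -normr_gt0; apply: lt_le_trans y1.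
Qed.

Lemma normalized_start (L s tau C T M0 : R) w : 1 <= L -> 2^-1 <= s -> s < 1 ->
  0 < T -> 0 < tau -> 1 <= C -> C <= M0 -> 2 ^+ n * 2 ^+ (n + 2) <= M0 * tau -> lin L s 1 w ->
  {ae mu, forall x, `|x| < 2^-1 -> `|w x| <= C * T} ->
  bd mu (fun y => `|w y| * om s y) T ->
  normalized L s tau (fun x => (M0 * T)^-1 * w (0 + 2^-1 *: x) + 0).
Proof.
move=> L1 s0 s1 T0 tau0 C1 CM Mtau lw wb bT; have s00 : 0 <= s by lra.
have h2 : 0 < 2^-1 :> R by [].
have A0 : 0 < M0 * T by rewrite mulr_gt0 //; lra.
have [mw _ _ _] := lw.
have mom := @measurable_om R n s.
have mw2 : measurable_fun setT (fun x : V => w (0 + 2^-1 *: x)).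
  by apply: (measurableT_comp mw); exact: measurable_affine.
split.
- have zz : `|0 : V| + 2^-1 * 1 <= 1 by rewrite normr0 add0r mulr1 invf_le1 // ler1n.
  exact: (lin_affine _ _ L1 (ltW s1) (lin_rescale L1 s00 (ltW s1) h2 zz lw)).
- apply: filterS (ae_rescale (0 : V) h2 wb) => x a x1.
  rewrite addr0 normrM gtr0_norm ?invr_gt0 // mulrC ler_pdivrMr // mul1r.
  apply: le_trans (a _) _; last by rewrite ler_pM2r.
  by rewrite add0r normVZ // gtr_pMr.
apply: (bd_le (bdW (bdZ (_ : 0 <= (M0 * T)^-1 * 2 ^+ (n + 2)) (bd_affine (0 : V) h2 bT)) _)).
- by apply: mulr_ge0; [rewrite invr_ge0 ltW|exact: exprn_ge0].
- rewrite exprVn invrK -mulrA [leLHS]mulrC ler_pdivrMr // mulrA.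
  have -> : tau * (M0 * T) = M0 * tau * T by ring.
  by rewrite ler_pM2r // mulrC.
- by rewrite /tl /posp; meas.
- by move=> y; rewrite /tl; nn.
move=> y; rewrite /tl; case: (leP 1 `|y|) => y1 /=; last first.
  by rewrite mul0r; apply: mulr_ge0; [apply: mulr_ge0; [rewrite invr_ge0 ltW|exact: exprn_ge0]|nn].
rewrite mul1r addr0; have Ai : 0 < (M0 * T)^-1 by rewrite invr_gt0.
apply: (@le_trans _ _ ((M0 * T)^-1 * `|w (0 + 2^-1 *: y)| * `|y| `^ (- (n%:R + 2 * s)))).
  apply: ler_wpM2r; first exact: powR_ge0.
  apply: posp_le_ge0; first by apply: mulr_ge0; [exact: ltW|nn].
  by rewrite normrM gtr0_norm // gerBl.
rewrite -mulrA -[leRHS]mulrA; apply: ler_wpM2l; first exact: ltW.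
rewrite [leRHS]mulrCA; apply: ler_wpM2l; first exact: normr_ge0.
have y0 : 0 < `|y| by apply: lt_le_trans y1.
rewrite /om add0r normVZ // ; have n0 := ler0n R n.
have a0 : 0 <= n%:R + 2 * s :> R by lra.
apply: (@le_trans _ _ (2 ^+ (n + 2) * (2 * `|y|) `^ (- (n%:R + 2 * s)))); last first.
  apply: ler_wpM2l; first exact: exprn_ge0.
  by apply: powRN_le => //; move: y1; clear; lra.
rewrite powRM // mulrA; apply: ler_peMl; first exact: powR_ge0.
rewrite -powR_mulrn // -powRD; last by rewrite pnatr_eq0 implybT.
by rewrite -[leLHS](powRr0 (2 : R)); apply: ler_powR; [rewrite ler1n|rewrite natrD; clear - s1; lra].
Qed.

(** The same constant serves for the supremum on the cube and for the weighted integral over the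
    whole space; later zooms start from the latter. *)
Definition close_to_cst s w (r e : R) : Prop := exists2 c : R,
  {ae mu, forall x, `|x| < 1 -> `|w (0 + r *: x) - c| <= e} &
  bd mu (fun y => `|w (0 + r *: y) - c| * om s y) e.

(** Iterates [oscillation_step] from [normalized_start]; the accumulated additive constants give, at
    each scale, the constant to which [w] is close. *)
Lemma hoelder (L CJ : R) : (2 <= n)%N -> 1 <= L ->
  (forall s, 2^-1 <= s -> s < 1 -> bd mu (fun z : V => J s z * Num.min 1 (`|z| ^+ 2)) CJ) ->
  exists M lam : R, [/\ 1 <= M, 2^-1 <= lam < 1 & forall s w T, 2^-1 <= s -> s < 1 ->
    0 < T -> lin L s 1 w -> bd mu (fun y => `|w y| * om s y) T -> forall j, close_to_cst s w (2^-1 * 4^-1 ^+ j) (M * T * lam ^+ j)].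
Proof.
move=> n2 L1 hJ; have [C C1 hsup] := local_sup_l1 n2 L1 hJ.
have [lam [tau [/andP[l0 l1] /andP[t0 t1] hosc]]] := oscillation_step n2 L1 hJ.
pose X : R := 2 ^+ n * 2 ^+ (n + 2) / tau.
have X0 : 0 <= X by rewrite /X; apply: mulr_ge0; [nn|rewrite invr_ge0 ltW].
pose M0 := C + X; pose K : R := 2 ^+ n + 2 * 4 ^+ n + 1.
have K1 : 1 <= K by rewrite /K lerDr; nn.
have XM : 2 ^+ n * 2 ^+ (n + 2) <= M0 * tau.
  rewrite -ler_pdivrMr // -/X /M0; clear - C1; lra.
have M01 : 1 <= M0 by rewrite /M0; clear - C1 X0; lra.
have CM : C <= M0 by rewrite /M0; clear - X0; lra.
clearbody M0.
exists (M0 * K), lam; split; [|by apply/andP|].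
  by rewrite -[leLHS]mulr1; apply: ler_pM.
move=> s w T s0 s1 T0 lw bT; have l00 : 0 < lam by apply: lt_le_trans l0.
have it j : exists b, normalized L s tau
    (fun x => (M0 * T * lam ^+ j)^-1 * w (0 + (2^-1 * 4^-1 ^+ j) *: x) + b).
  elim: j => [|j [b nb]].
    exists 0; rewrite !expr0 !mulr1.
    exact: (normalized_start L1 s0 s1 T0 t0 C1 CM XM lw (hsup _ _ _ s0 s1 T0 lw bT) bT).
  have [b' nb'] := hosc _ _ s0 s1 nb; exists (lam^-1 * b + b').
  rewrite (_ : (fun x => _) = (fun x => lam^-1 * ((M0 * T * lam ^+ j)^-1 *
    w (0 + (2^-1 * 4^-1 ^+ j) *: (0 + 4^-1 *: x)) + b) + b')) //.
  apply/funext => x; rewrite mulrDr addrA; congr (_ + _ + _).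
  rewrite mulrA; congr (_ * w _); last by rewrite !add0r scalerA -mulrA -exprSr.
  by rewrite exprSr mulrA invfM mulrC.
move=> j; have [b nb] := it j; set A := (M0 * T * lam ^+ j)^-1 in nb.
have A0 : 0 < A by rewrite invr_gt0 !mulr_gt0 ?exprn_gt0 //; lra.
have AE : A^-1 = M0 * T * lam ^+ j by rewrite invrK.
have eqA (t : R) : `|t - - (A^-1 * b)| = A^-1 * `|A * t + b|.
  have Ai : 0 < A^-1 by rewrite invr_gt0.
  rewrite -{2}(gtr0_norm Ai) -normrM mulrDr mulrA mulVf ?gt_eqF //.
  by rewrite mul1r opprK.
exists (- (A^-1 * b)).
  have [_ fb _] := nb; apply: filterS fb => x a x1; rewrite eqA.
  apply: (@le_trans _ _ A^-1).
    by apply: ler_piMr; [rewrite invr_ge0 ltW|exact: a].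
  rewrite AE ler_pM2r ?exprn_gt0 // ler_pM2r //; apply: ler_peMr => //; lra.
have bb := bdZ (_ : 0 <= A^-1) (normalized_bd s0 s1 nb).
apply: (bd_ext (bdW (bb _) _)).
- by rewrite invr_ge0 ltW.
- rewrite AE; set P := lam ^+ j.
  have -> : M0 * K * T * P = M0 * T * P * K by ring.
  apply: ler_wpM2l; first by rewrite -AE invr_ge0 ltW.
  by rewrite /K lerD2l.
by move=> y; rewrite eqA mulrA.
Qed.

End hoelder_estimate.

(** * Nonlinear fluxes and their solutions *)

Section flux_class.
Context {R : realType} {n : nat}.
Local Notation V := 'rV[R]_n.
Local Notation mu := (@lebesgue_rV R n).
Local Notation mu2 := (mu \x mu)%E.
Implicit Types (s : R) (f u v w psi : V -> R) (F : V -> R -> R).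

(** The flux sees x and y only through x - y, so translates of solutions are solutions. The
    condition on secant slopes combines Lipschitz continuity and monotonicity in [t], relative to
    [J]. *)
Definition flux (L s : R) F := [/\ measurable_fun setT (fun p : V * measurableTypeR R => F p.1 p.2),
  forall zeta, F zeta 0 = 0 &
  forall zeta t t', exists2 k, L^-1 * J s zeta <= k <= L * J s zeta &
    F zeta t - F zeta t' = k * (t - t')].

Lemma measurable_flux L s F (g : V * V -> R) : flux L s F -> measurable_fun setT g ->
  measurable_fun setT (fun z : V * V => F (z.1 - z.2) (g z)).
Proof.
move=> [mF _ _] mg.
apply: (@measurableT_comp _ _ _ _ _ _ (fun p : V * measurableTypeR R => F p.1 p.2) _
  (fun z : V * V => (z.1 - z.2, g z))) => //.
by meas.
Qed.

Lemma flux_le (L s : R) F zeta t : 1 <= L -> s <= 1 -> flux L s F ->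
  `|F zeta t| <= L * J s zeta * `|t|.
Proof.
move=> L1 s1 [_ F0 Fk]; have [k /andP[k1 k2]] := Fk zeta t 0.
rewrite F0 !subr0 => ->; have j0 := J_ge0 zeta s1.
have k0 : 0 <= k by apply: le_trans k1; rewrite mulr_ge0 // invr_ge0 (le_trans ler01).
by rewrite normrM ger0_norm //; apply: ler_wpM2r.
Qed.

Lemma fluxN (L s : R) F (k : R) : k != 0 -> flux L s F ->
  flux L s (fun zeta t => k^-1 * F zeta (k * t)).
Proof.
move=> k0 [mF F0 Fk]; split.
- have mg : measurable_fun setT (fun p : V * measurableTypeR R => F p.1 (k * p.2)).
    apply: (@measurableT_comp _ _ _ _ _ _ (fun p : V * measurableTypeR R => F p.1 p.2) _
      (fun p : V * measurableTypeR R => (p.1, k * p.2 : measurableTypeR R))) => //.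
    apply: measurable_fun_pair; first by meas.
    by apply: measurable_funM; [exact: measurable_cst|exact: measurable_snd].
  by apply: measurable_funM; [exact: measurable_cst|].
- by move=> zeta; rewrite mulr0 F0 mulr0.
move=> zeta t t'; have [c c1 E] := Fk zeta (k * t) (k * t'); exists c => //.
by rewrite -mulrBr E; field.
Qed.

Definition form F v psi : \bar R :=
  (\int[mu2]_z (F (z.1 - z.2) (Df v z) * Df psi z)%:E)%E.

Definition sol (L s r : R) F v := [/\ measurable_fun setT v, exists c, enb s v c, loc2 v &
  forall psi, H0 s r psi -> form F v psi = 0%E].

Lemma form_integrable (L s e e' : R) F v psi : 1 <= L -> s <= 1 -> flux L s F ->
  measurable_fun setT v -> measurable_fun setT psi -> enb s v e -> enb s psi e' ->
  mu2.-integrable setT (EFin \o (fun z => F (z.1 - z.2) (Df v z) * Df psi z)).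
Proof.
move=> L1 s1 fF mv mp ev ep; apply: (flux_integrable (le_trans ler01 L1) ev ep) => //.
  by apply: (measurable_flux fF); exact: measurable_Df.
by move=> z; exact: flux_le.
Qed.

Lemma enbD s f g a b : s <= 1 -> enb s f a -> enb s g b -> measurable_fun setT f ->
  measurable_fun setT g -> enb s (fun x => f x + g x) (2 * (a + b)).
Proof.
move=> s1 ef eg mf mg; have mJ := @measurable_J R n s.
have mDf := measurable_Df mf; have mDg := measurable_Df mg.
have mD : measurable_fun setT (Df (fun x => f x + g x)) by apply: measurable_Df; meas.
apply: (bd_le (bdZ (ler0n _ 2) (bdD ef eg))); [by meas|by move=> z; nn|move=> z].
rewrite -mulrDr [leRHS]mulrCA; apply: ler_wpM2l; first exact: J_ge0.
have -> : Df (fun x => f x + g x) z = Df f z + Df g z by rewrite /Df; ring.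
have := sqr_ge0 (Df f z - Df g z); move: (Df f z) (Df g z) => p q.
by clear; rewrite !expr2; lra.
Qed.

Lemma enbB s f g a b : s <= 1 -> enb s f a -> enb s g b -> measurable_fun setT f ->
  measurable_fun setT g -> enb s (fun x => f x - g x) (2 * (a + b)).
Proof.
move=> s1 ef eg mf mg; have mg' : measurable_fun setT (fun x => -1 * g x) by meas.
have := enbD s1 ef (enbZ (-1) eg) mf mg'; rewrite sqrrN expr1n mul1r => h.
by apply: (bd_ext h) => z; rewrite /Df; congr (_ * _ ^+ 2); ring.
Qed.

Lemma loc2B f g : loc2 f -> loc2 g -> measurable_fun setT f -> measurable_fun setT g ->
  loc2 (fun x => f x - g x).
Proof.
move=> lf lg mf mg r; have [a ba] := lf r; have [b bb] := lg r; exists (2 * (a + b)).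
apply: (bd_le (bdZ (ler0n _ 2) (bdD ba bb))); [by meas|by move=> x; nn|move=> x].
rewrite -mulrDr [leRHS]mulrCA; apply: ler_wpM2l; first exact: ler0n.
have := sqr_ge0 (f x + g x); move: (f x) (g x) => p q.
by clear; rewrite !expr2; lra.
Qed.

(** Linearisation by secants: the difference of the two fluxes is the flux of the linear equation,
    and its coefficients are the slopes granted by [flux]. *)
Lemma sol_sub (L s r : R) F u v : 1 <= L -> s <= 1 -> flux L s F ->
  sol L s r F u -> sol L s r F v -> lin L s r (fun x => u x - v x).
Proof.
move=> L1 s1 fF [mu_ [eu bu] lu Fu] [mv [ev bv] lv Fv].
have mDu := measurable_flux fF (measurable_Df mu_).
have mDv := measurable_flux fF (measurable_Df mv).
split; first by meas.
- by exists (2 * (eu + ev)); exact: enbB.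
- exact: loc2B.
exists (fun z => F (z.1 - z.2) (Df u z) - F (z.1 - z.2) (Df v z)); split; first by meas.
  move=> z; have [_ _ Fk] := fF; have [k k1 ->] := Fk (z.1 - z.2) (Df u z) (Df v z).
  by exists k => //; congr (_ * _); rewrite /Df /=; ring.
move=> psi hp; have [mp _ _ [ep bp]] := hp.
have iu := form_integrable L1 s1 fF mu_ mp bu bp.
have iv := form_integrable L1 s1 fF mv mp bv bp.
have := integralB measurableT iu iv; rewrite /= => E.
transitivity (form F u psi - form F v psi)%E; last by rewrite Fu // Fv // sube0.
by rewrite -E; apply: eq_integral => z _; rewrite -EFinB; congr EFin; ring.
Qed.

(** The factor r^(n+2s) keeps the comparison with [J]. Only the space variable is rescaled, not the
    values of solutions; amplitudes are handled by [fluxN] and [solZ]. *)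
Definition rescale_flux (s r : R) F (zeta : V) (t : R) : R :=
  r `^ (n%:R + 2 * s) * F (r *: zeta) t.

Lemma rescale_flux_flux (L s r : R) F : 1 <= L -> 0 < r -> flux L s F ->
  flux L s (rescale_flux s r F).
Proof.
move=> L1 r0 [mF F0 Fk]; have p0 : 0 < r `^ (n%:R + 2 * s) by rewrite powR_gt0.
split.
- have mg : measurable_fun setT (fun p : V * measurableTypeR R => F (r *: p.1) p.2).
    apply: (@measurableT_comp _ _ _ _ _ _ (fun p : V * measurableTypeR R => F p.1 p.2) _
      (fun p : V * measurableTypeR R => (r *: p.1, p.2))) => //.
    by apply: measurable_fun_pair; [meas|exact: measurable_snd].
  by apply: measurable_funM; [exact: measurable_cst|].
- by move=> zeta; rewrite /rescale_flux F0 mulr0.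
move=> zeta t t'; have [k /andP[k1 k2] E] := Fk (r *: zeta) t t'.
exists (r `^ (n%:R + 2 * s) * k); last by rewrite /rescale_flux -mulrBr E mulrA.
have JE : J s zeta = r `^ (n%:R + 2 * s) * J s (r *: zeta).
  by rewrite JZ ?(ltW r0) // mulrA powRN mulfV ?mul1r // gt_eqF.
by rewrite JE ![_ * (_ `^ _ * _)]mulrCA !ler_pM2l // k1.
Qed.

Lemma H0_rescale s (r r' rho : R) (x0 : V) psi : 0 < rho -> `|x0| + rho * r' <= r ->
  H0 s r' psi -> H0 s r (fun x => psi (- (rho^-1 *: x0) + rho^-1 *: x)).
Proof.
move=> rho0 hr [mp pz [c bc] [e' be']]; have ri0 : 0 < rho^-1 by rewrite invr_gt0.
split.
- by have := measurable_affine (- (rho^-1 *: x0)) rho^-1 => ma'; meas.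
- move=> x xr; apply: pz.
  have -> : - (rho^-1 *: x0) + rho^-1 *: x = rho^-1 *: (x - x0).
    by rewrite scalerBr addrC.
  rewrite normVZ ?(ltW ri0) // mulrC ler_pdivlMr // mulrC.
  have := lerB_dist x x0; lra.
- by exists (rho^-1 ^- n * c); exact: (bd_affine _ ri0 bc).
- by eexists; exact: (enb_rescale _ ri0 be').
Qed.

Lemma form_rescale (L s e e' rho : R) (x0 : V) F v psi : 1 <= L -> s <= 1 -> 0 < rho ->
  flux L s F -> measurable_fun setT v -> measurable_fun setT psi -> enb s v e -> enb s psi e' ->
  form (rescale_flux s rho F) (fun x => v (x0 + rho *: x)) psi =
  ((rho `^ (n%:R + 2 * s) * (rho ^- n * rho ^- n))%:E *
    form F v (fun x => psi (- (rho^-1 *: x0) + rho^-1 *: x)%R))%E.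
Proof.
move=> L1 s1 rho0 fF mv mp bv bp; have ri0 : 0 < rho^-1 by rewrite invr_gt0.
set psi' := fun x : V => psi _.
have mp' : measurable_fun setT psi'.
  by have := measurable_affine (- (rho^-1 *: x0)) rho^-1 => ma'; rewrite /psi'; meas.
have hinv x : psi' (x0 + rho *: x) = psi x.
  rewrite /psi' scalerDr scalerA mulVf ?gt_eqF // scale1r addrA addNr add0r //.
have bp' := enb_rescale (- (rho^-1 *: x0)) ri0 bp.
have iP := form_integrable L1 s1 fF mv mp' bv bp'.
have [i1 i2] := integral_diag x0 rho0 iP.
rewrite EFinM -muleA -[X in (_ * X)%E]i2 -integralZl //.
apply: eq_integral => z _; rewrite -EFinM; congr EFin.
rewrite /rescale_flux /Df /= !hinv mulrA; congr (_ * F _ _ * _).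
by rewrite scalerBr opprD addrACA subrr add0r.
Qed.

Lemma sol_rescale (L s r r' rho : R) (x0 : V) F v : 1 <= L -> 0 <= s -> s <= 1 -> 0 < rho ->
  `|x0| + rho * r' <= r -> flux L s F -> sol L s r F v ->
  sol L s r' (rescale_flux s rho F) (fun x => v (x0 + rho *: x)).
Proof.
move=> L1 s0 s1 rho0 hr fF [mv [e be] lv Fv]; have ma := measurable_affine x0 rho.
split; first by meas.
- by eexists; exact: enb_rescale be.
- exact: loc2_rescale.
move=> psi hp; have [mp _ _ [e' be']] := hp.
by rewrite (form_rescale x0 L1 s1 rho0 fF mv mp be be') Fv ?mule0 //; exact: H0_rescale hp.
Qed.

Lemma rescale_flux1 s F : rescale_flux s 1 F = F.
Proof. by apply/funext => z; apply/funext => t; rewrite /rescale_flux powR1 mul1r scale1r. Qed.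

Definition incr (h : V) v (x : V) : R := v (h + x) - v x.

Lemma sol_incr (L s r : R) F v h : 1 <= L -> 0 <= s -> s <= 1 -> flux L s F ->
  sol L s r F v -> lin L s (r - `|h|) (incr h v).
Proof.
move=> L1 s0 s1 fF sv.
have hr : `|h| + 1 * (r - `|h|) <= r by lra.
have := sol_rescale L1 s0 s1 ltr01 hr fF sv; rewrite rescale_flux1.
under eq_fun do rewrite scale1r; move=> sv'.
apply: (sol_sub L1 s1 fF sv'); have [mv ev lv Fv] := sv; split; [exact: mv|exact: ev|exact: lv|].
by move=> psi hp; apply: Fv; apply: H0_mono hp; rewrite gerBl.
Qed.

Lemma solZ (L s r : R) F (k : R) v : 1 <= L -> s <= 1 -> k != 0 -> flux L s F -> sol L s r F v ->
  sol L s r (fun zeta t => k * F zeta (k^-1 * t)) (fun x => k * v x).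
Proof.
move=> L1 s1 k0 fF [mv [e be] lv Fv]; split; first by meas.
- by exists (k ^+ 2 * e); exact: enbZ.
- move=> ro; have [c bc] := lv ro; exists (k ^+ 2 * c).
  by apply: (bd_ext (bdZ (sqr_ge0 k) bc)) => x; rewrite exprMn mulrCA.
move=> psi hp; have [mp _ _ [e' be']] := hp.
have iP := form_integrable L1 s1 fF mv mp be be'.
have E : (\int[mu2]_z (k%:E * (F (z.1 - z.2) (Df v z) * Df psi z)%:E) = k%:E * form F v psi)%E.
  exact: integralZl.
rewrite (Fv _ hp) mule0 in E; rewrite -[RHS]E; apply: eq_integral => z _.
rewrite -EFinM mulrA; congr (k * F _ _ * _)%:E.
by rewrite /Df -mulrBr mulrA mulVf // mul1r.
Qed.

End flux_class.

(** * Superlinear decay of increments *)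

Section increments.
Context {R : realType} {n : nat}.
Local Notation V := 'rV[R]_n.
Local Notation mu := (@lebesgue_rV R n).
Implicit Types (s : R) (f u v w : V -> R) (F : V -> R -> R).

Lemma measurable_incr h v : measurable_fun setT v -> measurable_fun setT (incr h v).
Proof. by move=> mv; rewrite /incr; meas. Qed.

(** Within distance g of x0 the supremum bound is used. Farther away the weight of the zoomed
    function is at most (3r/g)^(n+2s) times the original one; with the Jacobian r^-n this leaves
    r^(2s). *)
Lemma bd_zoom s f (x0 : V) (r g A B : R) : 2^-1 <= s -> s < 1 -> 0 < r -> 0 < g -> g <= 1 ->
  `|x0| <= 1 -> 0 <= A -> measurable_fun setT f ->
  {ae mu, forall y, `|y - x0| < g -> `|f y| <= A} -> bd mu (fun y => `|f y| * om s y) B ->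
  bd mu (fun x => `|f (x0 + r *: x)| * om s x)
    (A * (2 ^+ n + 2 * 4 ^+ n) + r `^ (2 * s) * (3 / g) ^+ (n + 2) * B).
Proof.
move=> s0 s1 r0 g0 g1 x01 A0 mf fA bB; have ma := measurable_affine x0 r.
have mom := @measurable_om R n s; have n0 := ler0n R n.
pose a := n%:R + 2 * s; have a0 : 0 <= a by rewrite /a; lra.
have B0 := bd_ge0 bB.
have g30 : 0 < 3 / g by rewrite divr_gt0.
have p0 : 0 <= (3 * r / g) `^ a by exact: powR_ge0.
apply: (bd_ae_le (bdW (bdD (bdZ A0 (bd_om s0 s1)) (bdZ p0 (bd_affine x0 r0 bB))) _)).
- rewrite lerD2l mulrA; apply: ler_wpM2r => //.
  have -> : 3 * r / g = r * (3 / g) by rewrite mulrAC mulrC.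
  rewrite powRM ?(ltW r0) ?(ltW g30) // mulrAC; apply: ler_pM.
  + by apply: mulr_ge0; [exact: powR_ge0|rewrite invr_ge0 exprn_ge0 // ltW].
  + exact: powR_ge0.
  + rewrite /a powRD; last by rewrite (gt_eqF r0) implybT.
    by rewrite powR_mulrn ?(ltW r0) // mulrAC mulfV ?mul1r // expf_neq0 // gt_eqF.
  rewrite -powR_mulrn ?(ltW g30) //; apply: ler_powR.
    by rewrite ler_pdivlMr // mul1r (le_trans g1) // ler1n.
  by rewrite /a natrD; clear - s1; lra.
- by meas.
- by move=> x; nn.
have fA' := ae_rescale x0 r0 fA.
apply: filterS fA' => x fx; have o0 := om_ge0 s x.
case: (ltP (r * `|x|) g) => xg.
  apply: ler_wpDr; first by nn.
  apply: ler_wpM2r => //; apply: fx.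
  by rewrite addrAC subrr add0r normVZ ?(ltW r0).
apply: ler_wpDl; first by nn.
rewrite mulrCA; apply: ler_wpM2l; first exact: normr_ge0.
have x0' : 0 < `|x| by rewrite -(pmulr_rgt0 _ r0); apply: lt_le_trans xg.
rewrite /om -/a.
apply: (@le_trans _ _ (`|x| `^ (- a))); first by apply: powRN_le => //; rewrite lerDr.
set Y := 1 + _; have Y0 : 0 < Y by rewrite /Y ltr_pwDl.
have YX : Y <= 3 * r / g * `|x|.
  have -> : 3 * r / g * `|x| = 3 * (r * `|x| / g) by ring.
  have h1 : 1 <= r * `|x| / g by rewrite ler_pdivlMr // mul1r.
  have h2 : r * `|x| <= r * `|x| / g.
    by rewrite ler_pdivlMr //; apply: ler_piMr => //; rewrite mulr_ge0 // ltW.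
  have := ler_normD x0 (r *: x); rewrite normVZ ?(ltW r0) // /Y.
  by move: h1 h2 x01; clear; lra.
have k0 : 0 < 3 * r / g by rewrite divr_gt0 // mulr_gt0.
apply: (@le_trans _ _ ((3 * r / g) `^ a * (3 * r / g * `|x|) `^ (- a))).
  by rewrite [(_ * `|x|) `^ _]powRM ?(ltW k0) // [leRHS]mulrA [(3 * r / g) `^ (- a)]powRN mulfV ?mul1r // gt_eqF // powR_gt0.
by apply: ler_wpM2l => //; exact: powRN_le.
Qed.

(** Countably many cubes around rational points suffice. The centre for x is chosen slightly below x
    in each coordinate, yet above -a, so that it stays in the cube. *)
Lemma ae_cover (a d : R) (P : V -> Prop) : 0 < d ->
  (forall x0 : V, `|x0| < a -> {ae mu, forall x, `|x - x0| < d -> P x}) ->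
  {ae mu, forall x, `|x| < a -> P x}.
Proof.
move=> d0 h; pose c (q : 'rV[rat]_n) : V := \row_i ratr (q ord0 i).
have H (k : nat) : {ae mu, forall x, forall q : 'rV[rat]_n, unpickle k = Some q ->
    `|c q| < a -> `|x - c q| < d -> P x}.
  case: (unpickle k) => [q|]; last by apply: aeW => x q.
  have [ca|ca] := ltP `|c q| a.
    by apply: filterS (h _ ca) => x hx q' [<-].
  by apply: aeW => x q' [<-] ca'; move: (le_lt_trans ca ca'); rewrite ltxx.
apply: filterS (ae_foralln H) => x hx xa.
have a0 : 0 < a by apply: le_lt_trans xa.
have xi i : `|x ord0 i| < a by move: i; exact/(normV_ltP x a0).
have q_ex (i : 'I_n) : exists q : rat, Num.max (x ord0 i - d) (- a) < ratr q < x ord0 i.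
  have /rat_in_itvoo[q] : Num.max (x ord0 i - d) (- a) < x ord0 i.
    by rewrite gt_max; have := xi i; rewrite ltr_norml => /andP[-> _]; rewrite andbT ltrBlDr ltrDl.
  by rewrite in_itv /= => qv; exists q.
pose q : 'rV[rat]_n := \row_i sval (cid (q_ex i)).
have qi i : Num.max (x ord0 i - d) (- a) < c q ord0 i < x ord0 i.
  by rewrite !mxE; exact: (svalP (cid (q_ex i))).
apply: (hx (pickle q) q (pickleK q)).
  apply/normV_ltP => // i; have := qi i; rewrite gt_max ltr_norml => /andP[/andP[_ ->] h2] /=.
  by have := xi i; rewrite ltr_norml => /andP[_]; exact: lt_trans.
apply/normV_ltP => // i; have := qi i; rewrite !mxE gt_max ltr_norml => /andP[/andP[h1 _] h2].
by apply/andP; split; move: h1 h2 d0; clear; lra.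
Qed.

(** If c and c' were farther apart, f would be far from c' on the whole cube of radius 1/8, whose
    volume and weight are bounded below. *)
Lemma cst_compare s f (c c' A B : R) : 2^-1 <= s -> s < 1 ->
  measurable_fun setT f -> {ae mu, forall x, `|x| < 8^-1 -> `|f x - c| <= A} ->
  bd mu (fun y => `|f y - c'| * om s y) B ->
  `|c - c'| <= A + (9 / 8) ^+ (n + 2) * 8 ^+ n * B.
Proof.
move=> s0 s1 mf fA bB; rewrite -lerBlDl; set D := `|c - c'| - A.
have [D0|D0] := leP D 0.
  apply: le_trans D0 _; apply: mulr_ge0; last exact: bd_ge0 bB.
  by apply: mulr_ge0; apply: exprn_ge0; rewrite ?divr_ge0.
pose ka : R := (9 / 8) ^-1 ^+ (n + 2).
have h8 : (0 : R) < 8^-1 by [].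
have ka0 : 0 < ka by rewrite /ka exprn_gt0 // invr_gt0 divr_gt0.
have b1 : bd mu (fun x => (`|x| < 8^-1)%R%:R * (D * ka)) B.
  apply: (bd_ae_le bB); first by meas.
    by move=> x; apply: mulr_ge0; [exact: ler0n|rewrite ltW // mulr_gt0].
  apply: filterS fA => x fx; case: ltP => x8 /=; last by rewrite mul0r; nn.
  rewrite mul1r; apply: ler_pM; [exact: ltW|exact: ltW| |].
    rewrite /D; have := ler_normD (c - f x) (f x - c'); rewrite addrA subrK.
    by have := fx x8; rewrite distrC; clear; lra.
  have := om_lower s0 s1 h8 (ltW x8); rewrite /ka.
  by have -> : 1 + 8^-1 = 9 / 8 :> R by field.
have lo := cube_lower (n := n) h8.
have Dk : 0 < D * ka by rewrite mulr_gt0.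
have b2 := bdZ (_ : 0 <= (D * ka)^-1) b1.
have b3 : bd mu (fun x => (`|x| < 8^-1)%R%:R) ((D * ka)^-1 * B).
  apply: (bd_ext (b2 _)) => [|x]; first by rewrite invr_ge0 ltW.
  by rewrite mulrC -mulrA mulfV ?mulr1 // gt_eqF.
have := bd_lower b3 lo; rewrite mulrC ler_pdivlMr // exprVn.
rewrite mulrC ler_pdivrMr ?exprn_gt0 // /ka exprVn -ler_pdivlMr ?invr_gt0 ?exprn_gt0 ?divr_gt0 //.
by rewrite invrK => h; apply: le_trans h _; rewrite le_eqVlt; apply/orP; left; apply/eqP; ring.
Qed.

Lemma exists_expr_le (lam X Y : R) : 0 <= lam -> lam < 1 -> 0 < Y ->
  exists m, forall k, (m <= k)%N -> X * lam ^+ k <= Y.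
Proof.
move=> l0 l1 Y0; have X0 : 0 < `|X| + 1 by rewrite ltr_wpDl.
have h : (fun k : nat => lam ^+ k) @ \oo --> (0:R) by apply: cvg_expr; rewrite ger0_norm.
have e0 : 0 < Y / (`|X| + 1) by rewrite divr_gt0.
have /cvgrPdist_lt /(_ _ e0) [m _ Hm] := h; exists m => k mk.
have := Hm k mk; rewrite sub0r normrN ger0_norm ?exprn_ge0 // ltr_pdivlMr // => h1.
apply: le_trans (ltW h1); rewrite mulrC; apply: ler_wpM2l; first exact: exprn_ge0.
by have := ler_norm X; clear; lra.
Qed.

(** Induction on the number of halvings of h. The increment along 2h is twice that along h plus the
    second difference, and the Hölder estimate for the increment along h makes the second difference
    at most an ep-fraction of the current bound. So each halving gains the factor (1 + ep)/2, on
    slightly smaller cubes: almost a full power of |h|. *)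
Lemma small_increments (L CJ s0 ep : R) : (2 <= n)%N -> 1 <= L ->
  (forall s, 2^-1 <= s -> s < 1 -> bd mu (fun z : V => J s z * Num.min 1 (`|z| ^+ 2)) CJ) ->
  2^-1 < s0 -> 0 < ep -> ep <= 1 ->
  exists (C0 B : R) (i1 : nat), [/\ 1 <= C0, 1 <= B, (2 <= i1)%N &
    forall s F v, s0 <= s -> s < 1 -> flux L s F -> sol L s 1 F v ->
    (forall h, `|h| <= 1 -> exists c, bd mu (fun x => `|incr h v x - c| * om s x) 1) ->
    forall l h, `|h| <= 2^-1 ^+ (i1 + l) -> exists2 c,
      {ae mu, forall x, `|x| < 8^-1 -> `|incr h v x - c| <= C0 * ((1 + ep) / 2) ^+ l} &
      bd mu (fun x => `|incr h v x - c| * om s x) B].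
Proof.
move=> n2 L1 hJ s0h ep0 ep1.
have [C C1 hsup] := local_sup_l1 n2 L1 hJ.
have [M [lam [M1 /andP[l0 l1] hH]]] := hoelder n2 L1 hJ.
pose Kn : R := 2 ^+ n + 2 * 4 ^+ n.
have Kn0 : 0 <= Kn by rewrite /Kn; nn.
pose C2 : R := (9 / 8) ^+ (n + 2) * 8 ^+ n.
have C20 : 0 <= C2 by rewrite /C2; apply: mulr_ge0; apply: exprn_ge0; rewrite ?divr_ge0.
pose C0 : R := C * 2 ^+ n.
have C01 : 1 <= C0 by rewrite /C0 -[leLHS]mulr1; apply: ler_pM => //; rewrite exprn_ege1 // ler1n.
pose B : R := 1 + (C0 + C2) * Kn.
have B1 : 1 <= B by rewrite /B lerDl; apply: mulr_ge0 => //; clear - C01 C20; lra.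
(* The cubes shrink at the rate nu, which costs nu^(-l(n+2)) in the tail, while zooming to r =
   2^-(l+1) gains r^(2s). The choice nu^(n+2) = 2^(1-2s0) leaves the product at 2^-l, and nu < 1 is
   exactly s0 > 1/2. *)
pose nu : R := 2 `^ ((1 - 2 * s0) / (n + 2)%:R).
have n20 : (0 : R) < (n + 2)%:R by rewrite ltr0n addn2.
have nu0 : 0 < nu by rewrite powR_gt0.
have nuE : nu ^+ (n + 2) = 2 * 2 `^ (- (2 * s0)).
  rewrite -powR_mulrn ?(ltW nu0) // /nu -powRrM -mulrA mulVf ?gt_eqF // mulr1.
  by rewrite powRD ?pnatr_eq0 ?implybT // powRr1.
have nu1 : nu < 1.
  rewrite /nu /powR pnatr_eq0 /= -[ltRHS]expR0 ltr_expR pmulr_llt0; last by rewrite ln_gt0 // ltr1n.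
  by rewrite pmulr_llt0 ?invr_gt0 //; clear - s0h; lra.
pose C3 : R := (24 / (1 - nu)) ^+ (n + 2).
have C30 : 0 <= C3 by rewrite /C3 exprn_ge0 // divr_ge0 // subr_ge0 ltW.
pose T0 : R := C0 * Kn + C3 * B.
have T00 : 0 < T0.
  rewrite /T0; apply: ltr_wpDr; first by apply: mulr_ge0 => //; clear - B1; lra.
  apply: mulr_gt0; first by clear - C01; lra.
  by rewrite /Kn ltr_wpDr ?exprn_gt0 //; nn.
(* Number of Hölder steps that make the second difference, twice the distance to a constant, at most
   the fraction [ep] of the bound. *)
have [m hm0] : exists m, forall k, (m <= k)%N -> (2 * M * T0) * lam ^+ k <= ep * C0.
  apply: exists_expr_le => //; first by clear - l0; lra.
  by apply: mulr_gt0 => //; clear - C01; lra.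
have {hm0} hm := hm0 m (leqnn m).
have BE : B = 1 + (C0 + C2) * Kn by [].
have KnE : Kn = 2 ^+ n + 2 * 4 ^+ n by [].
have C3E : C3 = (24 / (1 - nu)) ^+ (n + 2) by [].
have T0E : T0 = C0 * Kn + C3 * B by [].
have C0E : C0 = C * 2 ^+ n by [].
have C2E : C2 = (9 / 8) ^+ (n + 2) * 8 ^+ n by [].
clearbody C3 B C2 T0 Kn C0.
exists C0, B, (2 * m + 2)%N; split => //; first by rewrite addn2.
move=> s F v s0s s1 fF sv hv; have sh : 2^-1 <= s by clear - s0h s0s; lra.
have s00 : 0 <= s by clear - sh; lra.
have mom := @measurable_om R n s.
have [mv _ _ _] := sv; set q := (1 + ep) / 2.
have qh : 2^-1 <= q by rewrite /q; clear - ep0; lra.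
have q1 : q <= 1 by rewrite /q; clear - ep1; lra.
have q0 : 0 < q by apply: lt_le_trans qh.
(* Radii decreasing from 1/4 towards 1/8. *)
pose a l : R := 8^-1 + nu ^+ l / 8.
have a8 l : 8^-1 <= a l by rewrite /a lerDl divr_ge0 // exprn_ge0 // ltW.
have h24 : 2^-1 ^+ (2 * m + 2) <= 4^-1 :> R.
  have -> : 4^-1 = 2^-1 ^+ 2 :> R by rewrite exprVn -natrX.
  apply: ler_wiXn2l; [by rewrite invr_ge0|by rewrite invf_le1 // ler1n|by rewrite addn2].
have hsmall l h : `|h : V| <= 2^-1 ^+ (2 * m + 2 + l) -> `|h| <= 4^-1.
  move=> hh; apply: le_trans hh (le_trans _ h24).
  by apply: ler_wiXn2l; [rewrite invr_ge0|rewrite invf_le1 // ler1n|exact: leq_addr].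
have linh h : `|h : V| <= 4^-1 -> lin L s (3 / 4) (incr h v).
  move=> hh; apply: (lin_mono _ (sol_incr h L1 s00 (ltW s1) fF sv)).
  by move: hh; clear; lra.
(* The weighted bound does not deteriorate with [l]: it is taken from [hv], whose constant is close
   to the current one by [cst_compare]. *)
have full l h c : `|h : V| <= 4^-1 ->
    {ae mu, forall x, `|x| < a l -> `|incr h v x - c| <= C0 * q ^+ l} ->
    bd mu (fun x => `|incr h v x - c| * om s x) B.
  move=> hh hc; have [|c' bc'] := hv h; first by move: hh; clear; lra.
  have mi := measurable_incr h mv.
  have hc8 : {ae mu, forall x, `|x| < 8^-1 -> `|incr h v x - c| <= C0 * q ^+ l}.
    by apply: filterS hc => x hx x8; apply: hx; exact: lt_le_trans (a8 l).
  have := cst_compare sh s1 mi hc8 bc'.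
  rewrite mulr1 -C2E => cc; have bom := bd_om (n := n) sh s1.
  apply: (bd_le (bdW (bdD bc' (bdZ (normr_ge0 (c - c')) bom)) _)); [|by meas|by move=> x; nn|].
    rewrite -KnE BE lerD2l; apply: ler_wpM2r => //; apply: le_trans cc _.
    by rewrite lerD2r; apply: ler_piMr; [clear - C01; lra|apply: exprn_ile1 => //; exact: ltW].
  move=> x; rewrite -mulrDl; apply: ler_wpM2r; first exact: om_ge0.
  have -> : incr h v x - c = (incr h v x - c') - (c - c') by ring.
  exact: ler_normB.
have main l h : `|h : V| <= 2^-1 ^+ (2 * m + 2 + l) -> exists c,
    {ae mu, forall x, `|x| < a l -> `|incr h v x - c| <= C0 * q ^+ l}.
  elim: l h => [|l IH] h hh; have h4 := hsmall _ _ hh.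
    have [|c' bc'] := hv h; first by move: h4; clear; lra.
    have mi := measurable_incr h mv.
    have h2 : 0 < 2^-1 :> R by [].
    have hr : `|0 : V| + 2^-1 * 1 <= 3 / 4 by rewrite normr0 add0r mulr1; clear; lra.
    have lw := lin_affine 1 (- c') L1 (ltW s1) (lin_rescale L1 s00 (ltW s1) h2 hr (linh h h4)).
    have bw : bd mu (fun x => `|1 * incr h v (0 + 2^-1 *: x) + - c'| * om s x) (2 ^+ n).
      have ma := measurable_affine (0 : V) 2^-1.
      apply: (bd_le (bdW (bd_affine (0 : V) h2 bc') _)); [|by meas|by move=> x; nn|].
        by rewrite mulr1 exprVn invrK.
      move=> x; rewrite mul1r; apply: ler_wpM2l; first exact: normr_ge0.
      rewrite /om; have n0 := ler0n R n; apply: powRN_le; first by clear - s00 n0; lra.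
        by rewrite ltr_pwDl.
      rewrite lerD2l add0r normVZ ?(ltW h2) //; apply: ler_piMl => //.
      by clear; lra.
    have bC := hsup _ _ _ sh s1 (exprn_gt0 n (ltr0Sn R 1)) lw bw.
    exists c'; apply: filterS (ae_rescale (0 : V) (ltr0Sn R 1) bC) => x hx.
    rewrite /a !expr0 mulr1 C0E => xa; move: hx; rewrite mul1r !add0r scalerA mulVf // scale1r.
    by apply; rewrite normVZ //; move: xa; clear; lra.
  have hexp : 2^-1 ^+ (2 * m + 2 + l.+1) = 2^-1 * 2^-1 ^+ (2 * m + 2 + l) :> R.
    by rewrite addnS exprS.
  set d : R := 2^-1 ^+ (2 * m + 2 + l.+1) in hh hexp.
  have d0 : 0 < d by rewrite exprn_gt0.
  have hl : `|h| <= 2^-1 ^+ (2 * m + 2 + l).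
    by move: hh (normr_ge0 h); rewrite hexp; clear; lra.
  have hl2 : `|h + h| <= 2^-1 ^+ (2 * m + 2 + l).
    by apply: le_trans (ler_normD _ _) _; move: hh; rewrite hexp; clear; lra.
  have [c1 H1] := IH h hl; have [c2 H2] := IH (h + h) hl2.
  have bf := full l h c1 h4 H1; have mi := measurable_incr h mv.
  (* [r] is the radius at which the Hölder estimate is started around each centre, [g] the gap
     between consecutive cubes. *)
  pose r : R := 2^-1 ^+ l / 2; pose g : R := a l - a l.+1.
  have gE : g = nu ^+ l * (1 - nu) / 8 by rewrite /g /a exprS; ring.
  have nul : 0 < nu ^+ l by rewrite exprn_gt0.
  have g0 : 0 < g by rewrite gE divr_gt0 // mulr_gt0 // subr_gt0.
  have al k : a k <= 4^-1.
    have : nu ^+ k <= 1 by rewrite exprn_ile1 // ltW.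
    by rewrite /a; clear; lra.
  have g1 : g <= 1 by rewrite /g; have := al l; have := a8 l.+1; clear; lra.
  have r0 : 0 < r by rewrite /r divr_gt0 // exprn_gt0.
  have r2 : r <= 2^-1.
    by rewrite /r ler_piMl // exprn_ile1 // ?invf_le1 // ?ler1n.
  have ql0 : 0 < q ^+ l by rewrite exprn_gt0.
  (* This explains the value 2 m + 2 for the starting exponent: [m] Hölder steps from [r] end at
     radius 2 d, which contains both y and h + y when |y - x0| < d and |h| <= d. *)
  have rd : r * (2^-1 * 4^-1 ^+ m) = 2 * d.
    rewrite /r /d (_ : 4^-1 = 2^-1 ^+ 2 :> R); last by rewrite exprVn -natrX.
    rewrite -exprM !exprD [2^-1 ^+ l.+1]exprS; move: ((2^-1 : R) ^+ (2 * m)) ((2^-1 : R) ^+ l) => X Y.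
    by field.
  have TT : C0 * q ^+ l * Kn + r `^ (2 * s) * (3 / g) ^+ (n + 2) * B <= q ^+ l * T0.
    rewrite T0E mulrDr; apply: lerD; first by rewrite [C0 * _]mulrC mulrA.
    rewrite mulrA; apply: ler_wpM2r; first by clear - B1; lra.
    pose e : R := 2 `^ (- (2 * s0)); have e0 : 0 < e by rewrite powR_gt0.
    have t0 : 0 < 2^-1 ^+ l :> R by rewrite exprn_gt0.
    have t1 : 2^-1 ^+ l <= 1 :> R by rewrite exprn_ile1 // invf_le1 // ler1n.
    have rt : r `^ (2 * s) <= e ^+ l.
      apply: (@le_trans _ _ ((2^-1 ^+ l) `^ (2 * s))).
        apply: ge0_ler_powR; rewrite ?nnegrE ?(ltW r0) ?(ltW t0) //; first by clear - s00; lra.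
        by rewrite /r ler_pdivrMr //; move: t0; clear; lra.
      apply: (@le_trans _ _ ((2^-1 ^+ l) `^ (2 * s0))).
        apply: ger_powR; first by rewrite t0.
        by clear - s0s; lra.
      rewrite -(@powR_mulrn _ 2^-1 l) ?invr_ge0 // -powRrM mulrC powRrM powR_mulrn ?powR_ge0 //.
      by rewrite -(powR_inv1 (ler0n R 2)) -powRrM mulN1r.
    have gt : (3 / g) ^+ (n + 2) = C3 * ((2 * e) ^+ l)^-1.
      rewrite C3E -nuE -/e; have -> : 3 / g = 24 / (1 - nu) * (nu ^+ l)^-1.
        by rewrite gE; field; rewrite gt_eqF //= gt_eqF // subr_gt0.
      by rewrite exprMn exprVn exprAC.
    apply: le_trans (ler_wpM2r (exprn_ge0 _ (ltW (divr_gt0 (ltr0Sn R 2) g0))) rt) _.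
    rewrite gt exprMn invfM mulrCA [leLHS]mulrC.
    have -> : e ^+ l * ((2 ^+ l)^-1 * (e ^+ l)^-1) = 2^-1 ^+ l.
      by rewrite mulrCA mulfV ?mulr1 ?exprVn // gt_eqF // exprn_gt0.
    by apply: ler_wpM2r => //; apply: lerXn2r; rewrite // nnegrE ?invr_ge0 // ltW.
  have osc (x0 : V) : `|x0| < a l.+1 -> {ae mu, forall x, `|x - x0| < d ->
      `|incr h v (h + x) - incr h v x| <= ep * C0 * q ^+ l}.
    move=> x0a; have x01 : `|x0| <= 4^-1 by apply: le_trans (ltW x0a) (al _).
    have fA : {ae mu, forall y, `|y - x0| < g -> `|incr h v y - c1| <= C0 * q ^+ l}.
      apply: filterS H1 => y hy yg; apply: hy; have := ler_normD (y - x0) x0; rewrite subrK.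
      by move: yg x0a; rewrite /g; clear; lra.
    have mf : measurable_fun setT (fun x => incr h v x - c1) by meas.
    have x01' : `|x0| <= 1 by move: x01; clear; lra.
    have A0 : 0 <= C0 * q ^+ l by apply: mulr_ge0; [clear - C01; lra|exact: ltW].
    have bz := bd_zoom sh s1 r0 g0 g1 x01' A0 mf fA bf; rewrite -KnE in bz.
    have hr : `|x0| + r * 1 <= 3 / 4 by rewrite mulr1; move: x01 r2; clear; lra.
    have := lin_affine 1 (- c1) L1 (ltW s1) (lin_rescale L1 s00 (ltW s1) r0 hr (linh h h4)).
    under eq_fun do rewrite mul1r.
    move=> lw; have Tp : 0 < q ^+ l * T0 by rewrite mulr_gt0.
    have [c' Hc _] := hH _ _ _ sh s1 Tp lw (bdW bz TT) m.
    have rm0 : 0 < 2 * d by rewrite mulr_gt0.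
    have rmi : 0 < (2 * d)^-1 by rewrite invr_gt0.
    have Hy : {ae mu, forall y, `|y - x0| < 2 * d ->
        `|incr h v y - c1 - c'| <= M * (q ^+ l * T0) * lam ^+ m}.
      apply: filterS (ae_rescale (- ((2 * d)^-1 *: x0)) rmi Hc) => y hy yd.
      move: hy; rewrite add0r scalerA rd scalerDr scalerN !scalerA mulfV ?gt_eqF // !scale1r.
      rewrite addrA subrr add0r; apply.
      by rewrite addrC -scalerBr normVZ ?(ltW rmi) // mulrC ltr_pdivrMr // mul1r.
    have Hh := ae_rescale h ltr01 Hy.
    apply: filterS2 Hy Hh => y hy hyh yd.
    have e1 : `|incr h v y - c1 - c'| <= M * (q ^+ l * T0) * lam ^+ m.
      by apply: hy; move: yd d0; clear; lra.
    have e2 : `|incr h v (h + y) - c1 - c'| <= M * (q ^+ l * T0) * lam ^+ m.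
      rewrite scale1r in hyh; apply: hyh; rewrite -addrA.
      by apply: le_lt_trans (ler_normD _ _) _; move: hh yd; clear; lra.
    have h5 := ler_wpM2l (ltW ql0) hm.
    move: (incr h v (h + y)) (incr h v y) e1 e2 => p p' e1 e2.
    move: (ler_distD (c1 + c') p p'); rewrite [X in _ <= _ + X]distrC.
    move: e1 e2; rewrite -!addrA -!opprD => e1 e2 e3; apply: le_trans e3 _.
    apply: le_trans (lerD e2 e1) _.
    have -> : ep * C0 * q ^+ l = q ^+ l * (ep * C0) by ring.
    by apply: le_trans h5; rewrite le_eqVlt; apply/orP; left; apply/eqP; ring.
  have cov := ae_cover d0 osc.
  exists (c2 / 2); apply: filterS2 cov H2 => x hx1 hx2 xa.
  have e1 := hx1 xa; have : `|x| < a l by apply: lt_trans xa _; rewrite -subr_gt0.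
  move=> /hx2 e2.
  (* The doubling identity; half of the constant for h + h is the new constant for h. *)
  have -> : incr h v x - c2 / 2 =
      2^-1 * (incr (h + h) v x - c2) - 2^-1 * (incr h v (h + x) - incr h v x).
    by rewrite /incr addrA; field.
  apply: le_trans (ler_normB _ _) _; rewrite !normrM ger0_norm ?invr_ge0 //.
  rewrite exprS /q -/q; move: e1 e2; clear; set Q := ((1 + ep) / 2) ^+ l => e1 e2.
  have -> : C0 * ((1 + ep) / 2 * Q) = 2^-1 * (C0 * Q) + 2^-1 * (ep * C0 * Q) by field.
  by apply: lerD; rewrite ler_pM2l.
move=> l h hh; have [c hc] := main l h hh; exists c; last exact: full (hsmall _ _ hh) hc.
by apply: filterS hc => x hx x8; apply: hx; exact: lt_le_trans (a8 l).
Qed.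

Lemma one_plus_pow (ep : R) (K : nat) : 0 <= ep -> ep <= 1 ->
  (1 + ep) ^+ K <= 1 + ep * (2 ^+ K - 1).
Proof.
move=> e0 e1; elim: K => [|K IH]; first by rewrite !expr0 subrr mulr0 addr0.
rewrite exprS; apply: le_trans (ler_wpM2l (_ : 0 <= 1 + ep) IH) _; first by clear - e0; lra.
have p1 : 1 <= 2 ^+ K :> R by rewrite exprn_ege1 // ler1n.
rewrite exprS; move: (2 ^+ K) p1 => P p1.
have h : 0 <= ep * (1 - ep) * (P - 1) by rewrite !mulr_ge0 // subr_ge0.
by move: h; clear; lra.
Qed.

(** For steps of size rho = 2^-(i1+Kj), [small_increments] bounds the increment by a multiple of rho
    (1 + ep)^(Kj), and j Hölder steps from radius r down to rho gain lam^j. With (1 + ep)^K lam < 1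
    the total is o(rho) as j grows, so it falls below any [de] times rho. *)
Lemma homogeneous_decay1 (L CJ s0 de : R) : (2 <= n)%N -> 1 <= L ->
  (forall s, 2^-1 <= s -> s < 1 -> bd mu (fun z : V => J s z * Num.min 1 (`|z| ^+ 2)) CJ) ->
  2^-1 < s0 -> s0 < 1 -> 0 < de ->
  exists2 N, (0 < N)%N & forall s F v, s0 <= s -> s < 1 -> flux L s F -> sol L s 1 F v ->
    (forall h, `|h| <= 1 -> exists c, bd mu (fun x => `|incr h v x - c| * om s x) 1) ->
    forall h, `|h| <= 1 -> exists c,
      bd mu (fun x => `|incr h (fun y => v (0 + 2^-1 ^+ N *: y)) x - c| * om s x) (de * 2^-1 ^+ N).
Proof.
move=> n2 L1 hJ s0h s01 de0.
have [M [lam [M1 /andP[l0 l1] hH]]] := hoelder n2 L1 hJ.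
(* The surplus power r^(2s0-1) has to beat the factors 4^j by which [r] exceeds [rho]; K (2 s0 - 1)
   >= 8 leaves 16^-j to spare. *)
pose K := (8 + Num.bound (8 / (2 * s0 - 1)))%N.
have K8 : 8 <= (2 * s0 - 1) * K%:R.
  have s20 : 0 < 2 * s0 - 1 by clear - s0h; lra.
  rewrite mulrC -ler_pdivrMr //; apply: ltW; apply: lt_le_trans (archi_boundP _) _.
    by rewrite divr_ge0 // ltW.
  by rewrite ler_nat /K leq_addl.
have K2 : (8 <= K)%N by rewrite /K leq_addr.
clearbody K.
(* By [one_plus_pow] the power (1 + ep)^K is at most 2 - lam, and (2 - lam) lam < 1. *)
pose ep : R := (1 - lam) / 2 ^+ K.
have p2K : 1 <= 2 ^+ K :> R by rewrite exprn_ege1 // ler1n.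
have ep0 : 0 < ep by rewrite divr_gt0 ?exprn_gt0 // subr_gt0.
have ep1 : ep <= 1.
  by rewrite /ep ler_pdivrMr ?exprn_gt0 // mul1r; apply: le_trans p2K; clear - l0; lra.
pose th := (1 + ep) ^+ K * lam.
have th1 : th < 1.
  apply: (@le_lt_trans _ _ ((2 - lam) * lam)).
    apply: ler_wpM2r; first by clear - l0; lra.
    apply: le_trans (one_plus_pow K (ltW ep0) ep1) _.
    rewrite mulrBr mulr1 /ep -mulrA mulVf ?mulr1 ?gt_eqF ?exprn_gt0 //.
    by move: ep0; rewrite /ep; clear; lra.
  have : 0 < (1 - lam) ^+ 2 by rewrite exprn_gt0 // subr_gt0.
  by rewrite expr2; clear; lra.
have th0 : 0 <= th.
  by rewrite /th; apply: mulr_ge0; [apply: exprn_ge0; clear - ep0; lra|clear - l0; lra].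
have [C0 [B [i1 [C01 B1 i2 hI]]]] := small_increments n2 L1 hJ s0h ep0 ep1.
pose Kn : R := 2 ^+ n + 2 * 4 ^+ n.
have Kn0 : 0 <= Kn by rewrite /Kn; nn.
have d20 : 0 < de / 2 by rewrite divr_gt0.
have [m1 hm1] := exists_expr_le (M * C0 * Kn * 2 ^+ i1) th0 th1 d20.
have i160 : 0 <= 16^-1 :> R by rewrite invr_ge0.
have i161 : 16^-1 < 1 :> R by rewrite invf_lt1 // ltr1n.
have [m2 hm2] := exists_expr_le (M * 24 ^+ (n + 2) * B * 2) i160 i161 d20.
pose j := (m1 + m2)%N.
have j1 := hm1 j (leq_addr _ _); have j2 := hm2 j (leq_addl _ _).
clearbody j.
exists (i1 + K * j)%N; first by rewrite addn_gt0 (leq_trans _ i2).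
move=> s F v s0s s1 fF sv hv h hh.
have sh : 2^-1 <= s by clear - s0h s0s; lra.
have s00 : 0 <= s by clear - sh; lra.
have [mv _ _ _] := sv; have mom := @measurable_om R n s.
set rho : R := 2^-1 ^+ (i1 + K * j).
have rho0 : 0 < rho by rewrite exprn_gt0.
have hk : `|rho *: h| <= rho by rewrite normVZ ?(ltW rho0) // ler_piMr // ltW.
have [c Hc Bc] := hI s F v s0s s1 fF sv hv (K * j)%N (rho *: h) hk.
have i21 : 2^-1 <= 1 :> R by rewrite invf_le1 // ler1n.
have i20 : 0 <= 2^-1 :> R by rewrite invr_ge0.
have rho4 : rho <= 4^-1.
  have -> : 4^-1 = 2^-1 ^+ 2 :> R by rewrite exprVn -natrX.
  by apply: ler_wiXn2l => //; rewrite (leq_trans i2) // leq_addr.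
(* Chosen so that [j] steps of [hoelder], which start at half the radius, end exactly at [rho]. *)
pose r := 2 * 4 ^+ j * rho.
pose e8 : R := 4 ^+ j * 2^-1 ^+ (K * j).
have r0 : 0 < r by rewrite /r !mulr_gt0 // exprn_gt0.
have e80 : 0 < e8 by rewrite /e8 mulr_gt0 // exprn_gt0.
have re : r <= 2^-1 * e8.
  rewrite /r /e8 /rho exprD.
  have : 2^-1 ^+ i1 <= 2^-1 ^+ 2 :> R by apply: ler_wiXn2l.
  move: (2^-1 ^+ i1 : R) => P hP.
  have q0 : 0 <= 2 * (4 ^+ j * 2^-1 ^+ (K * j)) :> R.
    by rewrite !mulr_ge0 // exprn_ge0.
  have := ler_wpM2r q0 hP; move: (4 ^+ j : R) (2^-1 ^+ (K * j) : R) => X Y.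
  by rewrite expr2; clear; lra.
have e81 : e8 <= 1.
  rewrite /e8 exprM -exprMn exprn_ile1 //.
  have : 2^-1 ^+ K <= 2^-1 ^+ 2 :> R by apply: ler_wiXn2l => //; exact: leq_trans K2.
  by rewrite expr2; clear; lra.
have r2 : r <= 2^-1 by apply: le_trans re _; rewrite ler_piMr.
have mi := measurable_incr (rho *: h) mv.
have mf : measurable_fun setT (fun x => incr (rho *: h) v x - c) by meas.
have g0 : 0 < 8^-1 :> R by [].
have g1 : 8^-1 <= 1 :> R by rewrite invf_le1 // ler1n.
set q := (1 + ep) / 2 in Hc.
have q0 : 0 < q by rewrite /q divr_gt0 //; clear - ep0; lra.
have A0 : 0 <= C0 * q ^+ (K * j) by rewrite mulr_ge0 ?exprn_ge0 ?(ltW q0) //; clear - C01; lra.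
have fA : {ae mu, forall y, `|y - 0| < 8^-1 -> `|incr (rho *: h) v y - c| <= C0 * q ^+ (K * j)}.
  by apply: filterS Hc => y hy; rewrite subr0; exact: hy.
have z0 : `|0 : V| <= 1 by rewrite normr0.
have bz := bd_zoom sh s1 r0 g0 g1 z0 A0 mf fA Bc; rewrite invrK -/Kn in bz.
have lk : lin L s (3 / 4) (incr (rho *: h) v).
  apply: (lin_mono _ (sol_incr _ L1 s00 (ltW s1) fF sv)).
  by move: hk rho4; clear; lra.
have hr : `|0 : V| + r * 1 <= 3 / 4 by rewrite normr0 add0r mulr1; move: r2; clear; lra.
have := lin_affine 1 (- c) L1 (ltW s1) (lin_rescale L1 s00 (ltW s1) r0 hr lk).
under eq_fun do rewrite mul1r.
move=> lw; set T := _ + _ in bz.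
have qT : 0 < T.
  rewrite /T; apply: ltr_wpDl; first by rewrite mulr_ge0.
  apply: mulr_gt0; last by clear - B1; lra.
  by rewrite mulr_gt0 ?powR_gt0 // exprn_gt0 // mulr_gt0.
have [c' _ Hc'] := hH _ _ _ sh s1 qT lw bz j.
exists (c + c'); apply: (bd_ext (bdW Hc' _)); last first.
  move=> x; congr (`|_| * _); rewrite /incr !add0r !scalerDr scalerA.
  have -> : r * (2^-1 * 4^-1 ^+ j) = rho.
    rewrite /r exprVn; field; rewrite gt_eqF // exprn_gt0 //.
  by ring.
have rhoE : rho = 2^-1 ^+ i1 * 2^-1 ^+ (K * j) by rewrite /rho exprD.
have t1 : M * (C0 * q ^+ (K * j) * Kn) * lam ^+ j <= de / 2 * rho.
  have -> : M * (C0 * q ^+ (K * j) * Kn) * lam ^+ j = M * C0 * Kn * 2 ^+ i1 * th ^+ j * rho.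
    rewrite rhoE /th /q [in RHS]exprMn -exprM !exprMn [in RHS]exprVn.
    by field; rewrite !gt_eqF ?exprn_gt0.
  by rewrite ler_pM2r.
have l00 : 0 <= lam by clear - l0; lra.
have t2 : M * (r `^ (2 * s) * (3 * 8) ^+ (n + 2) * B) * lam ^+ j <= de / 2 * rho.
  have b0 : 0 <= 2 * s0 - 1 by clear - s0h; lra.
  have X1 : r `^ (2 * s) <= 2 * rho * 16^-1 ^+ j.
    apply: (@le_trans _ _ (r `^ (2 * s0))).
      by apply: ger_powR; [rewrite r0 /=; move: r2; clear; lra|clear - s0s; lra].
    have -> : 2 * s0 = 1 + (2 * s0 - 1) by ring.
    rewrite powRD; last by rewrite (gt_eqF r0) implybT.
    rewrite powRr1 ?(ltW r0) //.
    have -> : 2 * rho * 16^-1 ^+ j = r * (4 ^+ j * 2^-1 ^+ (8 * j)).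
      rewrite /r exprM; have -> : (16^-1 : R) = 4 * 4 * 2^-1 ^+ 8 by field.
      by rewrite !exprMn; ring.
    rewrite ler_pM2l //; apply: (@le_trans _ _ (e8 `^ (2 * s0 - 1))).
      apply: ge0_ler_powR; rewrite ?nnegrE ?(ltW r0) ?(ltW e80) //.
      by apply: le_trans re _; move: e80; clear; lra.
    rewrite /e8 powRM ?exprn_ge0 //; apply: ler_pM; rewrite ?powR_ge0 //.
      rewrite -[leRHS]powRr1 ?exprn_ge0 //; apply: ler_powR; last by clear - s01; lra.
      by rewrite exprn_ege1 // ler1n.
    rewrite -(@powR_mulrn _ 2^-1 (K * j)) // -powRrM -(@powR_mulrn _ 2^-1 (8 * j)) //.
    apply: ger_powR; first by rewrite invr_gt0 ltr0n.
    rewrite !natrM mulrAC; apply: ler_wpM2r; first exact: ler0n.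
    by rewrite mulrC.
  have -> : 3 * 8 = 24 :> R by rewrite -natrM.
  have MB : 0 <= M * 24 ^+ (n + 2) * B.
    by rewrite !mulr_ge0 ?exprn_ge0 //; [clear - M1|clear - B1]; lra.
  apply: (@le_trans _ _ (M * 24 ^+ (n + 2) * B * (2 * rho * 16^-1 ^+ j) * 1)).
    apply: ler_pM; rewrite ?exprn_ge0 //.
    + by rewrite mulr_ge0 // ?mulr_ge0 ?powR_ge0 ?exprn_ge0 //; [clear - M1|clear - B1]; lra.
    + have -> : M * (r `^ (2 * s) * 24 ^+ (n + 2) * B) = M * 24 ^+ (n + 2) * B * r `^ (2 * s) by ring.
      exact: ler_wpM2l.
    + by rewrite exprn_ile1 // ltW.
  have -> : M * 24 ^+ (n + 2) * B * (2 * rho * 16^-1 ^+ j) * 1 =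
    M * 24 ^+ (n + 2) * B * 2 * 16^-1 ^+ j * rho by ring.
  by rewrite ler_pM2r.
by rewrite /T mulrDr mulrDl; move: t1 t2; clear; lra.
Qed.

Lemma homogeneous_decay (L CJ s0 de : R) : (2 <= n)%N -> 1 <= L ->
  (forall s, 2^-1 <= s -> s < 1 -> bd mu (fun z : V => J s z * Num.min 1 (`|z| ^+ 2)) CJ) ->
  2^-1 < s0 -> s0 < 1 -> 0 < de ->
  exists2 N, (0 < N)%N & forall s F v E, s0 <= s -> s < 1 -> flux L s F -> sol L s 1 F v -> 0 < E ->
    (forall h, `|h| <= 1 -> exists c, bd mu (fun x => `|incr h v x - c| * om s x) E) ->
    forall h, `|h| <= 1 -> exists c,
      bd mu (fun x => `|incr h (fun y => v (0 + 2^-1 ^+ N *: y)) x - c| * om s x) (de * 2^-1 ^+ N * E).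
Proof.
move=> n2 L1 hJ s0h s01 de0.
have [N N0 H] := homogeneous_decay1 n2 L1 hJ s0h s01 de0; exists N => //.
move=> s F v E s0s s1 fF sv E0 hv h hh.
have Ei : 0 < E^-1 by rewrite invr_gt0.
have eqE (f g c : R) : `|E^-1 * f - E^-1 * g - E^-1 * c| = E^-1 * `|f - g - c|.
  by rewrite -!mulrBr normrM gtr0_norm.
have hv' h' : `|h'| <= 1 -> exists c, bd mu (fun x => `|incr h' (fun x => E^-1 * v x) x - c| * om s x) 1.
  move=> /hv[c bc]; exists (E^-1 * c); apply: (bd_ext (bdW (bdZ (ltW Ei) bc) _)).
    by rewrite mulVf // gt_eqF.
  by move=> x; rewrite /incr eqE mulrA.
have fF' := fluxN (lt0r_neq0 E0) fF.
have sv' := solZ L1 (ltW s1) (lt0r_neq0 Ei) fF sv.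
have {}fF' : flux L s (fun zeta t => E^-1 * F zeta (E^-1^-1 * t)) by rewrite invrK.
have [c bc] := H _ _ _ s0s s1 fF' sv' hv' h hh.
exists (E * c); apply: (bd_ext (bdW (bdZ (ltW E0) bc) _)); first by rewrite mulrC.
move=> x; rewrite mulrA; congr (_ * _).
rewrite (_ : incr h _ x - E * c = E * (incr h (fun y => E^-1 * v (0 + 2^-1 ^+ N *: y)) x - c)).
  by rewrite normrM gtr0_norm.
by rewrite /incr; field; rewrite gt_eqF.
Qed.

End increments.

(** * The comparison estimate in L^1 *)

Section comparison_estimate.
Context {R : realType} {n : nat}.
Local Notation V := 'rV[R]_n.
Local Notation mu := (@lebesgue_rV R n).
Local Notation mu2 := (mu \x mu)%E.
Implicit Types (s : R) (f u v w psi : V -> R) (F : V -> R -> R).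

Definition clamp (k t : R) : R := Num.max (- k) (Num.min k t).

(** The part of [t] between the levels k and 2k: zero up to modulus k, of modulus k beyond 2k. Its
    support sees {|t| >= k} and its values detect {|t| >= 2k}. *)
Definition layer (k t : R) : R := clamp (2 * k) t - clamp k t.

Lemma clampP (k t : R) : 0 <= k -> [\/ t <= - k /\ clamp k t = - k,
  (- k <= t /\ t <= k) /\ clamp k t = t | k <= t /\ clamp k t = k].
Proof.
move=> k0; have kk : - k <= k by move: k0; clear; lra.
rewrite /clamp; have [h|h] := leP t (- k).
  apply: Or31; split => //; rewrite (min_idPr (le_trans h kk)); exact/max_idPl.
have [h'|h'] := leP t k.
  apply: Or32; split; first by split => //; exact: ltW.
  by apply/max_idPr; exact: ltW.
by apply: Or33; split; [exact: ltW|exact/max_idPr].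
Qed.

Lemma layer_lip (k t t' : R) : 0 <= k -> t' <= t -> 0 <= layer k t - layer k t' <= t - t'.
Proof.
move=> k0 tt; have k20 : 0 <= 2 * k by rewrite mulr_ge0.
have P (x : R) : (x <= - (2 * k) /\ layer k x = - k) \/ (- (2 * k) <= x <= - k /\ layer k x = x + k) \/
    (- k <= x <= k /\ layer k x = 0) \/ (k <= x <= 2 * k /\ layer k x = x - k) \/
    (2 * k <= x /\ layer k x = k).
  rewrite /layer; have [[a ->]|[[a a'] ->]|[a ->]] := clampP x k20; have [[b ->]|[[b b'] ->]|[b ->]] := clampP x k0; lra.
have [[a ->]|[[/andP[a a'] ->]|[[/andP[a a'] ->]|[[/andP[a a'] ->]|[a ->]]]]] := P t;
  have [[b ->]|[[/andP[b b'] ->]|[[/andP[b b'] ->]|[[/andP[b b'] ->]|[b ->]]]]] := P t';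
  clear P; lra.
Qed.

Lemma layer_mono (k t t' : R) : 0 <= k ->
  (layer k t - layer k t') ^+ 2 <= (t - t') * (layer k t - layer k t').
Proof.
move=> k0; have [tt|/ltW tt] := leP t' t.
  have /andP[a b] := layer_lip k0 tt; rewrite expr2; exact: ler_wpM2r.
have /andP[a b] := layer_lip k0 tt; rewrite -(sqrrN (_ - _)) opprB expr2.
rewrite -(opprB t') -(opprB (layer k t')) mulrNN; exact: ler_wpM2r.
Qed.

Lemma layer_dist (k t t' : R) : 0 <= k -> `|layer k t - layer k t'| <= `|t - t'|.
Proof.
move=> k0; have [tt|/ltW tt] := leP t' t.
  by have /andP[a b] := layer_lip k0 tt; rewrite !ger0_norm // subr_ge0.
by rewrite distrC [leRHS]distrC; have /andP[a b] := layer_lip k0 tt; rewrite !ger0_norm // subr_ge0.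
Qed.

Lemma layer0 (k : R) : 0 <= k -> layer k 0 = 0.
Proof.
move=> k0; have k20 : 0 <= 2 * k by rewrite mulr_ge0.
rewrite /layer; have [[a ->]|[[a a'] ->]|[a ->]] := clampP 0 k20;
  have [[b ->]|[[b b'] ->]|[b ->]] := clampP 0 k0; lra.
Qed.

Lemma layer_le (k t : R) : 0 <= k -> `|layer k t| <= k.
Proof.
move=> k0; have k20 : 0 <= 2 * k by rewrite mulr_ge0.
rewrite /layer ler_norml; apply/andP.
by have [[a ->]|[[a a'] ->]|[a ->]] := clampP t k20; have [[b ->]|[[b b'] ->]|[b ->]] := clampP t k0;
  split; lra.
Qed.

Lemma layer_supp (k t : R) : 0 <= k -> layer k t != 0 -> k <= `|t|.
Proof.
move=> k0; apply: contraR; rewrite -ltNge ltr_norml => /andP[h h'].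
have k20 : 0 <= 2 * k by rewrite mulr_ge0.
apply/eqP; rewrite /layer; have [[a ->]|[[a a'] ->]|[a ->]] := clampP t k20;
  have [[b ->]|[[b b'] ->]|[b ->]] := clampP t k0; lra.
Qed.

Lemma layer_top (k t : R) : 0 <= k -> 2 * k <= `|t| -> layer k t ^+ 2 = k ^+ 2.
Proof.
move=> k0 kt; suff [->|->] : layer k t = k \/ layer k t = - k by rewrite ?sqrrN.
have k20 : 0 <= 2 * k by rewrite mulr_ge0.
move: kt; rewrite ler_normr /layer => /orP[] h; [left|right];
 have [[a ->]|[[a a'] ->]|[a ->]] := clampP t k20;
  have [[b ->]|[[b b'] ->]|[b ->]] := clampP t k0; lra.
Qed.

Lemma measurable_layer (k : R) f : measurable_fun setT f -> measurable_fun setT (fun x => layer k (f x)).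
Proof. by move=> mf; rewrite /layer /clamp; meas. Qed.

Lemma H0_layer s (k r : R) w : s <= 1 -> 0 <= k -> H0 s r w -> H0 s r (fun x => layer k (w x)).
Proof.
move=> s1 k0 [mw w0 [c bc] [e be]]; have ml := measurable_layer k mw; split => //.
- by move=> x xr; rewrite w0 // layer0.
- exists c; apply: (bd_le bc); [by meas|by move=> x; nn|move=> x].
  have := layer_dist (w x) 0 k0; rewrite layer0 // !subr0 => h.
  by rewrite -(real_normK (num_real (layer k (w x)))) -(real_normK (num_real (w x))) lerXn2r ?nnegrE.
by exists e; apply: (enb_le be) => // x y; exact: layer_dist.
Qed.

(** Divided by [k], the layer of u - v is an admissible test bounded by 1. Subtracting the equation
    of [v] and using monotonicity bounds its energy linearly in [k]. *)
Lemma layer_energy (L s k M : R) F u v : 1 <= L -> s <= 1 -> 0 < k -> flux L s F ->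
  measurable_fun setT u -> (exists c, enb s u c) -> sol L s 1 F v ->
  H0 s 1 (fun x => u x - v x) ->
  (forall psi, H0 s 1 psi -> (forall x, `|psi x| <= 1) -> (form F u psi <= M%:E)%E) ->
  enb s (fun x => layer k (u x - v x)) (L * (k * M)).
Proof.
move=> L1 s1 k0 fF mu_ [eu bu] [mv [ev bv] lv Fv] hw hM.
set w := fun x => u x - v x in hw *.
have hp := H0_layer s1 (ltW k0) hw; set psi := fun x => layer k (w x) in hp *.
have [mp pz _ [ep bp]] := hp.
have hk : H0 s 1 (fun x => k^-1 * psi x) by exact: H0Z.
have hk1 x : `|k^-1 * psi x| <= 1.
  by rewrite normrM gtr0_norm ?invr_gt0 // mulrC ler_pdivrMr // mul1r; exact: layer_le (ltW k0).
have iu := form_integrable L1 s1 fF mu_ mp bu bp.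
have iv := form_integrable L1 s1 fF mv mp bv bp.
have fu : (form F u psi <= (k * M)%:E)%E.
  have h := lee_wpmul2l (_ : 0 <= k%:E)%E (hM _ hk hk1).
  have {}h : (k%:E * form F u (fun x => k^-1 * psi x)%R <= k%:E * M%:E)%E by apply: h; rewrite lee_fin ltW.
  apply: le_trans h; rewrite -integralZl //=.
    rewrite le_eqVlt; apply/orP; left; apply/eqP; apply: eq_integral => z _.
    rewrite -EFinM; congr EFin; rewrite /Df -mulrBr mulrCA; congr (_ * _).
    by rewrite mulrA mulfV ?mul1r // gt_eqF.
  by have [mk _ _ [ek bk]] := hk; exact: (form_integrable L1 s1 fF mu_ mk bu bk).
have mJ := @measurable_J R n s.
have mDp := measurable_Df mp.
have L0 : 0 < L by apply: lt_le_trans L1.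
have E : bd mu2 (fun z => L^-1 * (J s (z.1 - z.2) * (Df psi z) ^+ 2)) (k * M + 0).
  apply: (@bd_test _ _ _ mu2 (fun z => F (z.1 - z.2) (Df u z) * Df psi z -
      F (z.1 - z.2) (Df v z) * Df psi z) _ (fun=> 0)).
  - have := integrableB measurableT iu iv.
    by apply: eq_integrable => // z _.
  - have -> : (\int[mu2]_z (F (z.1 - z.2) (Df u z) * Df psi z -
      F (z.1 - z.2) (Df v z) * Df psi z)%:E = form F u psi - form F v psi)%E.
      rewrite -integralB_EFin //.
    by rewrite Fv // sube0.
  - exact: bd0.
  - by meas.
  - by move=> z; nn.
  move=> z; rewrite addr0 -mulrBl; have [_ _ Fk] := fF.
  have [c /andP[c1 c2] ->] := Fk (z.1 - z.2) (Df u z) (Df v z).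
  have -> : Df u z - Df v z = w z.1 - w z.2 by rewrite /Df /w; ring.
  rewrite mulrA -[leRHS]mulrA; apply: ler_pM; [|exact: sqr_ge0|exact: c1|exact: layer_mono (ltW k0)].
  by rewrite mulr_ge0 // ?invr_ge0 ?(ltW L0) // J_ge0.
apply: (bd_ext (bdW (bdZ (ltW L0) E) _)); first by rewrite addr0.
by move=> z; rewrite [RHS]mulrA mulfV ?mul1r // gt_eqF.
Qed.

Lemma layer_sum (K t : R) (N : nat) : 0 <= K ->
  Num.min `|t| (K * 2 ^+ N.+1) <= Num.min `|t| (K * 2 ^+ N) +
    K * 2 ^+ N * (K * 2 ^+ N <= `|t|)%R%:R.
Proof.
move=> K0; have k0 : 0 <= K * 2 ^+ N by rewrite mulr_ge0 // exprn_ge0.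
rewrite exprS mulrCA; move: (K * 2 ^+ N) k0 => k k0; case: (leP k `|t|) => h /=.
  rewrite mulr1 ge_min; apply/orP; right.
  by move: k0; clear; lra.
by rewrite mulr0 addr0 ge_min lexx.
Qed.

(** The energy of the layer and [faber_krahn] bound the measure of {|w| >= 2k} by a multiple of
    (M/k) rho^(2s), if rho^n dominates the measure of {|w| >= k}. A first use with fixed rho is a
    weak L^1 bound, which fails to be summable over dyadic levels; fed back, it permits a
    geometrically small rho and the layer sums converge, uniformly in s as 2s >= 1. *)
Lemma comparison_estimate (L : R) : (2 <= n)%N -> 1 <= L ->
  exists2 C : R, 0 < C & forall s F u v (M : R), 2^-1 <= s -> s < 1 -> flux L s F ->
    measurable_fun setT u -> (exists c, enb s u c) -> sol L s 1 F v ->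
    H0 s 1 (fun x => u x - v x) -> 0 < M ->
    (forall psi, H0 s 1 psi -> (forall x, `|psi x| <= 1) -> (form F u psi <= M%:E)%E) ->
    bd mu (fun x => `|u x - v x|) (C * M).
Proof.
move=> n2 L1; have n0 : (0 < n)%N by apply: leq_trans n2.
pose fk : R := 2 ^+ n * 2 * (4 * ln 4) * L.
have fk0 : 0 < fk.
  by rewrite /fk !mulr_gt0 ?exprn_gt0 ?ln_gt0 ?ltr1n //; apply: lt_le_trans L1.
have fkE : fk = 2 ^+ n * 2 * (4 * ln 4) * L by [].
clearbody fk; pose K1 : R := 64 * fk.
have K10 : 0 < K1 by rewrite mulr_gt0.
have K1E : K1 = 64 * fk by [].
(* With this factor the weak bound at level K0 M 2^i is exactly the measure 2^-1 (th^i / 2)^n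
   required for rho = th^i. *)
clearbody K1; pose K0 : R := 4 * K1 * 2 ^+ n.
have K00 : 0 < K0 by rewrite /K0 !mulr_gt0 ?exprn_gt0.
have K0E : K0 = 4 * K1 * 2 ^+ n by [].
clearbody K0.
(* Satisfies th^n = 1/2, matching the halving of the weak bound when the level doubles. *)
pose th : R := 2 `^ (- n%:R^-1).
have th0 : 0 < th by rewrite powR_gt0.
have th1 : th < 1.
  rewrite /th /powR pnatr_eq0 /= -[ltRHS]expR0 ltr_expR pmulr_llt0; last by rewrite ln_gt0 // ltr1n.
  by rewrite oppr_lt0 invr_gt0 ltr0n.
have thn : th ^+ n = 2^-1.
  by rewrite -powR_mulrn ?(ltW th0) // /th -powRrM mulNr mulVf ?pnatr_eq0 -?lt0n // powR_inv1.
clearbody th; have t10 : 0 < (1 - th)^-1 by rewrite invr_gt0 subr_gt0.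
exists (2 * K0 * 2 ^+ n + 2 * fk * (1 - th)^-1).
  by apply: addr_gt0; rewrite !mulr_gt0 ?exprn_gt0.
move=> s F u v M s0 s1 fF mu_ eu sv hw M0 hM.
set w := fun x => u x - v x in hw *; have [mw w0 _ _] := hw.
have en (k : R) : 0 < k -> enb s (fun x => layer k (w x)) (L * (k * M)).
  by move=> k0; exact: (layer_energy L1 (ltW s1) k0 fF mu_ eu sv hw hM).
have L0 : 0 < L by apply: lt_le_trans L1.
have step (k m rho : R) : 0 < k -> 0 < rho -> bd mu (fun x => (k <= `|w x|)%R%:R) m ->
    m <= 2^-1 * (rho / 2) ^+ n ->
    bd mu (fun x => (2 * k <= `|w x|)%R%:R) (fk * M / k * rho `^ (2 * s)).
  move=> k0 rho0 bm mrho; have ml := measurable_layer k mw.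
  have := faber_krahn n0 s0 s1 rho0 ml (en k k0) bm mrho (fun x => layer_supp (ltW k0)).
  move=> b; have k20 : 0 < k ^+ 2 by rewrite exprn_gt0.
  have k2i : 0 <= (k ^+ 2)^-1 by rewrite invr_ge0 ltW.
  apply: (bd_le (bdW (bdZ k2i b) _)); [|by meas|by move=> x; exact: ler0n|].
    by rewrite fkE le_eqVlt; apply/orP; left; apply/eqP; field; rewrite gt_eqF.
  move=> x; apply: boolr_le; first by apply: mulr_ge0 => //; exact: sqr_ge0.
  by move=> /(layer_top (ltW k0)) ->; rewrite mulVf // gt_eqF.
have s20 : 0 <= 2 * s by move: s0; clear; lra.
(* The weak bound: w vanishes off the unit cube, of volume 2^n, and rho = 8 is large enough for that
   measure. *)
have one (k : R) : 0 < k -> bd mu (fun x => (k <= `|w x|)%R%:R) (2 * K1 * M / k).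
  move=> k0; have k2 : 0 < k / 2 by rewrite divr_gt0.
  have b0 : bd mu (fun x => (k / 2 <= `|w x|)%R%:R) (2 ^+ n).
    have := bd_cube (n := n) (@ltr01 R); rewrite mulr1 => b1.
    apply: (bd_le b1); [by meas|by move=> x; exact: ler0n|move=> x].
    rewrite ler_nat; case: (ltP `|x| 1) => x1 /=; first by case: (_ <= _).
    by rewrite w0 // normr0 leNgt k2.
  have hr : 2 ^+ n <= 2^-1 * (8 / 2) ^+ n :> R.
    have -> : 8 / 2 = 2 * 2 :> R by field.
    rewrite exprMn mulrA; apply: ler_peMl; first exact: exprn_ge0.
    have : 2 ^+ 1 <= 2 ^+ n :> R by rewrite ler_eXn2l // ltr1n.
    by rewrite expr1; clear; lra.
  have r8 : (0 : R) < 8 by [].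
  have := step _ _ 8 k2 r8 b0 hr.
  have -> : 2 * (k / 2) = k by field.
  move=> b; apply: (bdW b).
  have h8 : 8 `^ (2 * s) <= 64 :> R.
    have -> : 64 = 8 ^+ 2 :> R by rewrite -natrX.
    rewrite -powR_mulrn //; apply: ler_powR; first by rewrite ler1n.
    by move: s1; clear; lra.
  apply: (@le_trans _ _ (fk * M / (k / 2) * 64)).
    by apply: ler_wpM2l => //; rewrite !mulr_ge0 ?invr_ge0 // ltW.
  by rewrite le_eqVlt; apply/orP; left; apply/eqP; rewrite K1E; field; rewrite gt_eqF.
have two i : bd mu (fun x => (2 * K0 * M * 2 ^+ i <= `|w x|)%R%:R) (fk * M / (K0 * M * 2 ^+ i) * th ^+ i).
  have k0 : 0 < K0 * M * 2 ^+ i by rewrite !mulr_gt0 ?exprn_gt0.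
  have ti0 : 0 < th ^+ i by rewrite exprn_gt0.
  have := step _ _ (th ^+ i) k0 ti0 (one _ k0) _.
  have -> : 2 * K0 * M * 2 ^+ i = 2 * (K0 * M * 2 ^+ i) by ring.
  move=> b; apply: (bdW (b _)).
    rewrite exprMn exprVn exprAC thn exprVn K0E le_eqVlt; apply/orP; left; apply/eqP.
    by field; rewrite !gt_eqF // exprn_gt0.
  apply: ler_wpM2l; first by rewrite !mulr_ge0 ?invr_ge0 ?exprn_ge0 // ltW.
  rewrite -[leRHS]powRr1 ?(ltW ti0) //; apply: ger_powR; last by move: s0; clear; lra.
  by rewrite ti0 exprn_ile1 // ltW.
pose A : R := 2 * K0 * M.
have A0 : 0 < A by rewrite /A !mulr_gt0.
have sum N : bd mu (fun x => Num.min `|w x| (A * 2 ^+ N))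
    (A * 2 ^+ n + 2 * fk * M * ((1 - th ^+ N) * (1 - th)^-1)).
  elim: N => [|N IH].
    rewrite !expr0 subrr mul0r mulr0 addr0 mulr1.
    have := bdZ (ltW A0) (bd_cube (n := n) (@ltr01 R)); rewrite mulr1 => b1.
    apply: (bd_le b1); [by meas|by move=> x; nn; exact: ltW|move=> x].
    case: (ltP `|x| 1) => x1 /=; first by rewrite mulr1 ge_min lexx orbT.
    by rewrite w0 // normr0 mulr0 ge_min lexx.
  have AN : 0 <= A * 2 ^+ N by rewrite mulr_ge0 ?exprn_ge0 // ltW.
  apply: (bd_le (bdW (bdD IH (bdZ AN (two N))) _)); [|by meas| |].
  - rewrite -addrA lerD2l le_eqVlt; apply/orP; left; apply/eqP.
    rewrite exprSr /A; field.
    by rewrite !gt_eqF ?exprn_gt0 // subr_gt0.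
  - move=> x; rewrite le_min normr_ge0 /=; rewrite mulr_ge0 ?exprn_ge0 // ltW //.
  by move=> x; exact: layer_sum (ltW A0).
have E : (2 * K0 * 2 ^+ n + 2 * fk * (1 - th)^-1) * M = A * 2 ^+ n + 2 * fk * M * (1 - th)^-1.
  by rewrite /A; ring.
rewrite E; apply: (bd_fatou (f_ := fun N x => Num.min `|w x| (A * 2 ^+ N))).
- move=> N; apply: (bdW (sum N)); rewrite lerD2l; apply: ler_wpM2l.
    by rewrite !mulr_ge0 // ltW.
  by apply: ler_piMl; [exact: ltW|rewrite gerBl exprn_ge0 // ltW].
- by have [mv _ _ _] := sv; meas.
- by move=> x; exact: normr_ge0.
apply: aeW => x; apply: cvg_near_cst.
pose B := Num.bound (`|w x| / A).
exists B => // N /= BN; apply: (min_idPl (x := `|w x|) _).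
rewrite mulrC -ler_pdivrMr //; apply: ltW; apply: lt_le_trans (archi_boundP _) _.
  by rewrite divr_ge0 // ltW.
rewrite -natrX ler_nat; apply: leq_trans BN _; exact/ltnW/ltn_expl.
Qed.

End comparison_estimate.

(** * Existence of solutions with given exterior values *)

Section almost_everywhere_limits.
Context {d : measure_display} {T : measurableType d} {R : realType}.
Variable m : {measure set T -> \bar R}.
Implicit Types f : T -> R.

(** The series of the |f_(k+1) - f_k| has finite integral, hence converges almost everywhere, and
    the telescoping sums converge with it. *)
Lemma ae_cauchy_limit (f_ : nat -> T -> R) (C : R) :
  (forall k, measurable_fun setT (f_ k)) ->
  (forall k, bd m (fun x => `|f_ k.+1 x - f_ k x|) (C * 2^-1 ^+ k)) ->
  exists2 f : T -> R, measurable_fun setT f & {ae m, forall x, (fun k => f_ k x) @ \oo --> f x}.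
Proof.
move=> mf bf.
pose g k x : \bar R := `|f_ k.+1 x - f_ k x|%:E.
have mg k : measurable_fun setT (g k) by apply/measurable_EFinP; case: (bf k).
have g0 k x : setT x -> (0 <= g k x)%E by move=> _; rewrite lee_fin.
have mh : measurable_fun setT (fun x => \sum_(0 <= k <oo) g k x)%E.
  by apply: (@ge0_emeasurable_sum _ _ _ setT g xpredT) => // k x _ _; exact: g0.
have h0 x : (0 <= \sum_(0 <= k <oo) g k x)%E by apply: nneseries_ge0 => k _ _; exact: g0.
have C0 : 0 <= C by have := bd_ge0 (bf 0); rewrite expr0 mulr1.
have bh : (\int[m]_x \sum_(0 <= k <oo) g k x <= (2 * C)%:E)%E.
  rewrite integral_nneseries //; apply: lime_le.
    by apply: is_cvg_nneseries => k _ _; apply: integral_ge0 => x _; exact: g0.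
  apply: nearW => N.
  apply: (@le_trans _ _ (\sum_(0 <= k < N) (C * 2^-1 ^+ k)%:E)%E).
    by apply: lee_sum => k _; have [_ _] := bf k.
  rewrite sumEFin lee_fin -mulr_sumr.
  have -> : \sum_(0 <= k < N) 2^-1 ^+ k = 2 - 2 * 2^-1 ^+ N :> R.
    elim: N => [|N IH]; first by rewrite big_nil expr0; ring.
    by rewrite big_nat_recr //= IH exprS; field.
  rewrite mulrC; apply: ler_wpM2r => //.
  by rewrite gerBl mulr_ge0 // exprn_ge0 // invr_ge0.
have ih : m.-integrable setT (fun x => \sum_(0 <= k <oo) g k x)%E.
  apply/integrableP; split => //; apply: le_lt_trans (ltry (2 * C)); apply: le_trans bh.
  by rewrite le_eqVlt; apply/orP; left; apply/eqP; apply: eq_integral => x _; rewrite gee0_abs.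
have fin := integrable_ae measurableT ih.
(* The upper limit is defined everywhere and measurable, and equals the limit where that exists. *)
pose f x := fine (limn_esup (fun k => (f_ k x)%:E)).
exists f.
  apply: measurableT_comp; first exact: fine_measurable.
  by apply: measurable_fun_limn_esup => k; apply/measurable_EFinP.
apply: filterS fin => x /(_ Logic.I) fx.
have cS : cvgn [normed series (fun k => f_ k.+1 x - f_ k x)].
  apply: nondecreasing_is_cvgn.
    move=> a b ab; change (\sum_(0 <= k < a) `|f_ k.+1 x - f_ k x| <= \sum_(0 <= k < b) `|f_ k.+1 x - f_ k x|).
    rewrite (@big_cat_nat _ _ _ a 0 b) //= lerDl.
    by apply: sumr_ge0 => k _; exact: normr_ge0.
  exists (fine (\sum_(0 <= k <oo) g k x)%E) => _ [N _ <-].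
  rewrite -lee_fin fineK // /series /= -sumEFin.
  by apply: nneseries_lim_ge => k _ _; exact: g0.
have cf : cvgn (fun k => f_ k x).
  have := normed_cvg cS => c.
  have -> : (fun k => f_ k x) = (fun k => f_ 0%N x + series (fun k => f_ k.+1 x - f_ k x) k).
    by apply/funext => k; rewrite /series /= telescope_sumr // addrC subrK.
  by apply: is_cvgD => //; exact: is_cvg_cst.
have c2 : (fun k => (f_ k x)%:E) @ \oo --> (limn (fun k => f_ k x))%:E by apply: cvg_EFin => //; exact: nearW.
by rewrite /f (cvg_limn_einf_sup c2).2 /=.
Qed.

End almost_everywhere_limits.

Section existence.
Context {R : realType} {n : nat}.
Local Notation V := 'rV[R]_n.
Local Notation mu := (@lebesgue_rV R n).
Local Notation mu2 := (mu \x mu)%E.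
Implicit Types (s : R) (f u v w psi : V -> R) (F G : V -> R -> R).

(** A primitive of the flux in [t], encoded by uniform convexity alone: applied with t and t'
    exchanged, it also yields the upper bound [potential_upper], so derivatives never appear. *)
Definition potential (L s : R) F G :=
  [/\ measurable_fun setT (fun p : V * measurableTypeR R => G p.1 p.2),
  forall zeta, G zeta 0 = 0 &
  forall zeta t t', (2 * L)^-1 * J s zeta * (t' - t) ^+ 2 <=
    G zeta t' - G zeta t - F zeta t * (t' - t)].

Lemma measurable_potential L s F G (g : V * V -> R) : potential L s F G -> measurable_fun setT g ->
  measurable_fun setT (fun z : V * V => G (z.1 - z.2) (g z)).
Proof.
move=> [mF _ _] mg.
apply: (@measurableT_comp _ _ _ _ _ _ (fun p : V * measurableTypeR R => G p.1 p.2) _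
  (fun z : V * V => (z.1 - z.2, g z))) => //.
by meas.
Qed.

Section potential_bounds.
Variables (L s : R) (F G : V -> R -> R).
Hypotheses (L1 : 1 <= L) (s1 : s <= 1) (fF : flux L s F) (pG : potential L s F G).

Lemma potential_upper zeta t t' :
  G zeta t' - G zeta t - F zeta t * (t' - t) <= L * J s zeta * (t' - t) ^+ 2.
Proof.
have [_ _ Gk] := pG; have [_ _ Fk] := fF.
have [k /andP[_ k2] E] := Fk zeta t' t.
have h := Gk zeta t' t.
have c0 : 0 <= (2 * L)^-1 * J s zeta * (t - t') ^+ 2.
  apply: mulr_ge0; last exact: sqr_ge0.
  by apply: mulr_ge0; [rewrite invr_ge0 mulr_ge0 // (le_trans ler01)|exact: J_ge0].
have := ler_wpM2r (sqr_ge0 (t' - t)) k2.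
have e2 : k * (t' - t) ^+ 2 = (F zeta t' - F zeta t) * (t' - t) by rewrite E expr2 mulrA.
rewrite e2; move: h c0; clear; lra.
Qed.

Lemma potential_ge0 zeta t : 0 <= G zeta t.
Proof.
have [_ G0 Gk] := pG; have [_ F0 _] := fF.
have := Gk zeta 0 t; rewrite G0 F0 mul0r !subr0; apply: le_trans.
apply: mulr_ge0; last exact: sqr_ge0.
by apply: mulr_ge0; [rewrite invr_ge0 mulr_ge0 // (le_trans ler01)|exact: J_ge0].
Qed.

Lemma potential_le zeta t : G zeta t <= L * J s zeta * t ^+ 2.
Proof.
have [_ G0 _] := pG; have [_ F0 _] := fF.
by have := potential_upper zeta 0 t; rewrite G0 F0 mul0r !subr0.
Qed.

Lemma potential_mid zeta a b :
  G zeta ((a + b) / 2) + (8 * L)^-1 * J s zeta * (a - b) ^+ 2 <= (G zeta a + G zeta b) / 2.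
Proof.
have [_ _ Gk] := pG; have L0 : 0 < L by apply: lt_le_trans L1.
have h1 := Gk zeta ((a + b) / 2) a; have h2 := Gk zeta ((a + b) / 2) b.
have e1 : (2 * L)^-1 * J s zeta * (a - (a + b) / 2) ^+ 2 = (8 * L)^-1 * J s zeta * (a - b) ^+ 2.
  by field; rewrite gt_eqF.
have e2 : (2 * L)^-1 * J s zeta * (b - (a + b) / 2) ^+ 2 = (8 * L)^-1 * J s zeta * (a - b) ^+ 2.
  by field; rewrite gt_eqF.
rewrite e1 in h1; rewrite e2 in h2; move: h1 h2; clear; lra.
Qed.

Lemma potential_continuous zeta (t_ : nat -> R) t : t_ @ \oo --> t ->
  (fun k => G zeta (t_ k)) @ \oo --> G zeta t.
Proof.
move=> ct; have j0 := J_ge0 zeta s1; have L0 : 0 <= L by apply: le_trans L1.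
have cl (k : R) : (fun i => G zeta t + F zeta t * (t_ i - t) + k * (t_ i - t) ^+ 2) @ \oo --> G zeta t.
  have ct0 : (fun i => t_ i - t) @ \oo --> (0 : R).
    by rewrite -(subrr t); apply: cvgB => //; exact: cvg_cst.
  have h : (fun i => G zeta t + F zeta t * (t_ i - t) + k * ((t_ i - t) * (t_ i - t))) @ \oo -->
      G zeta t + F zeta t * 0 + k * (0 * 0).
    apply: cvgD; first by apply: cvgD; [exact: cvg_cst|apply: cvgM => //; exact: cvg_cst].
    by apply: cvgM; [exact: cvg_cst|exact: cvgM].
  by rewrite !mulr0 !addr0 in h.
apply: (squeeze_cvgr _ (cl 0) (cl (L * J s zeta))).
apply: nearW => i; have := potential_upper zeta t (t_ i); have [_ _ Gk] := pG.
have := Gk zeta t (t_ i).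
have : 0 <= (2 * L)^-1 * J s zeta * (t_ i - t) ^+ 2.
  apply: mulr_ge0; last exact: sqr_ge0.
  by apply: mulr_ge0 => //; rewrite invr_ge0 mulr_ge0.
by move=> h1 h2 h3; apply/andP; split; move: h1 h2 h3; clear; lra.
Qed.

End potential_bounds.

Lemma H0D s (r : R) f g : s <= 1 -> H0 s r f -> H0 s r g -> H0 s r (fun x => f x + g x).
Proof.
move=> s1 [mf f0 [a ba] [e be]] [mg g0 [b bb] [e' be']]; split; first by meas.
- by move=> x xr; rewrite f0 // g0 // addr0.
- exists (2 * (a + b)).
  apply: (bd_le (bdZ (ler0n _ 2) (bdD ba bb))); [by meas|by move=> x; nn|move=> x].
  have := sqr_ge0 (f x - g x); move: (f x) (g x) => p q.
  by clear; rewrite !expr2; lra.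
by exists (2 * (e + e')); exact: enbD.
Qed.

Lemma H0B s (r : R) f g : s <= 1 -> H0 s r f -> H0 s r g -> H0 s r (fun x => f x - g x).
Proof.
move=> s1 hf hg; have := H0D s1 hf (H0Z (-1) hg).
by under eq_fun do rewrite mulN1r.
Qed.

Lemma H00 s (r : R) : H0 s r (fun _ : V => 0).
Proof.
split => //.
- by exists 0; apply: (bd_ext (bd0 mu)) => x; rewrite expr0n.
by exists 0; apply: (bd_ext (bd0 mu2)) => z; rewrite /Df subrr expr0n mulr0.
Qed.

Lemma H0_loc2 s (r : R) f : H0 s r f -> loc2 f.
Proof.
move=> [mf _ [c bc] _] ro; exists c; apply: (bd_le bc); [by meas|by move=> x; nn|move=> x].
by apply: ler_piMl; [exact: sqr_ge0|case: (_ < _) => /=].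
Qed.

Lemma H0_poincare s f e : (0 < n)%N -> 2^-1 <= s -> s < 1 -> H0 s 1 f -> enb s f e ->
  bd mu (fun x => f x ^+ 2) (2 ^+ n * 2 * (4 * ln 4) * 64 * e).
Proof.
move=> n0 s0 s1 [mf f0 _ _] be.
have b1 := bd_cube (n := n) (@ltr01 R); rewrite mulr1 in b1.
have r8 : (0 : R) < 8 by [].
have hr : 2 ^+ n <= 2^-1 * (8 / 2) ^+ n :> R.
  have -> : 8 / 2 = 2 * 2 :> R by field.
  rewrite exprMn mulrA; apply: ler_peMl; first exact: exprn_ge0.
  have : 2 ^+ 1 <= 2 ^+ n :> R by rewrite ler_eXn2l // ltr1n.
  by rewrite expr1; clear; lra.
have := faber_krahn n0 s0 s1 r8 mf be b1 hr _ => b.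
apply: (bdW (b _)).
  by move=> x; apply: contraR; rewrite -leNgt => x1; rewrite f0.
apply: ler_wpM2r; first exact: bd_ge0 be.
apply: ler_wpM2l.
  by rewrite !mulr_ge0 ?exprn_ge0 // ln_ge0 // ler1n.
have -> : 64 = 8 ^+ 2 :> R by rewrite -natrX.
rewrite -powR_mulrn //; apply: ler_powR; first by rewrite ler1n.
by move: s1; clear; lra.
Qed.

(** Direct method: the energy of u - psi is minimised over psi in [H0]. Uniform convexity makes
    minimising sequences Cauchy in energy, [H0_poincare] makes them converge almost everywhere,
    Fatou's lemma shows that the limit is a minimiser, and the first variation is the equation. *)
Lemma exists_solution (L s : R) F G u : (0 < n)%N -> 1 <= L -> 2^-1 <= s -> s < 1 ->
  flux L s F -> potential L s F G -> measurable_fun setT u -> (exists c, enb s u c) -> loc2 u ->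
  exists2 v, sol L s 1 F v & H0 s 1 (fun x => u x - v x).
Proof.
move=> n0 L1 s0 s1 fF pG mu_ [eu bu] lu; have s1' := ltW s1.
have L0 : 0 < L by apply: lt_le_trans L1.
pose Gd psi (z : V * V) : R := G (z.1 - z.2) (Df u z - Df psi z).
have mDu := measurable_Df mu_; have mJ := @measurable_J R n s.
have mGd psi : measurable_fun setT psi -> measurable_fun setT (Gd psi).
  by move=> mp; apply: (measurable_potential pG); have := measurable_Df mp => mDp; meas.
have Gd0 psi z : 0 <= Gd psi z by exact: (potential_ge0 L1 s1' fF pG).
(* Real upper bounds of energies rather than the energies, so that the infimum is one of real
   numbers. *)
pose S := [set e : R | exists2 psi, H0 s 1 psi & bd mu2 (Gd psi) e].
have S0 : lbound S 0 by move=> e [psi _ b]; exact: bd_ge0 b.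
have Sne : S !=set0.
  exists (L * eu); exists (fun=> 0); first exact: H00.
  apply: (bd_le (bdZ (ltW L0) bu)) => //; first exact: mGd.
  move=> z; apply: le_trans (potential_le L1 s1' fF pG _ _) _.
  by rewrite /Df subrr subr0 -mulrA.
pose m := inf S.
have mS e : S e -> m <= e by move=> Se; apply: ge_inf => //; exists 0.
have seq k : exists psi, H0 s 1 psi /\ bd mu2 (Gd psi) (m + 4^-1 ^+ k).
  have e0 : 0 < 4^-1 ^+ k :> R by rewrite exprn_gt0.
  have [e [psi hp b] em] := inf_adherent e0 (conj Sne (ex_intro _ 0 S0)).
  by exists psi; split => //; apply: (bdW b); exact: ltW.
have [p_ hp_] := choice seq.
have hp k := (hp_ k).1; have bp k := (hp_ k).2.
have mp k : measurable_fun setT (p_ k) by case: (hp k).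
(* The midpoint of two almost minimisers is a competitor, of energy at least m; the convexity gain
   therefore bounds their distance. *)
have cl k l (e : R) : bd mu2 (Gd (p_ k)) (m + e) -> bd mu2 (Gd (p_ l)) (m + e) ->
    enb s (fun x => p_ k x - p_ l x) (8 * L * e).
  move=> bk bl; pose q x := 2^-1 * (p_ k x + p_ l x).
  have hq : H0 s 1 q by apply: H0Z; exact: H0D.
  have mq : measurable_fun setT q by case: hq.
  have mD := measurable_Df (mp k); have mD' := measurable_Df (mp l).
  pose X (z : V * V) : R := (8 * L)^-1 * J s (z.1 - z.2) * (Df (p_ k) z - Df (p_ l) z) ^+ 2.
  have mX : measurable_fun setT X by rewrite /X; meas.
  have X0 z : 0 <= X z.
    rewrite /X; apply: mulr_ge0; last exact: sqr_ge0.
    by apply: mulr_ge0; [rewrite invr_ge0 mulr_ge0 // ltW|exact: J_ge0].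
  have bm : bd mu2 (fun z => X z + Gd q z) (m + e).
    apply: (bd_le (bdW (bdZ (_ : 0 <= 2^-1) (bdD bk bl)) _)).
    + by rewrite invr_ge0.
    + by rewrite le_eqVlt; apply/orP; left; apply/eqP; field.
    + by have := mGd _ mq => mGq; meas.
    + by move=> z; apply: addr_ge0.
    move=> z; have := potential_mid L1 pG (z.1 - z.2) (Df u z - Df (p_ k) z) (Df u z - Df (p_ l) z).
    have -> : (Df u z - Df (p_ k) z + (Df u z - Df (p_ l) z)) / 2 = Df u z - Df q z.
      by rewrite /q /Df; field.
    have -> : (Df u z - Df (p_ k) z - (Df u z - Df (p_ l) z)) ^+ 2 = (Df (p_ k) z - Df (p_ l) z) ^+ 2.
      by ring.
    by rewrite -/(Gd q z) -/(Gd (p_ k) z) -/(Gd (p_ l) z) -/(X z); clear; lra.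
  have bq : bd mu2 (Gd q) (m + e).
    by apply: (bd_le bm) => // [|z]; [exact: mGd|rewrite lerDr].
  have [b [Eb bb _]] := bd_int bq.
  have mb : m <= b by apply: mS; exists q.
  have bX := bd_subr bm mX X0 (mGd _ mq) (Gd0 q) Eb.
  have L8 : 0 <= 8 * L by rewrite mulr_ge0 // ltW.
  apply: (bd_ext (bdW (bdZ L8 bX) _)).
    by apply: ler_wpM2l => //; move: mb; clear; lra.
  move=> z; have -> : 8 * L * X z = J s (z.1 - z.2) * (Df (p_ k) z - Df (p_ l) z) ^+ 2.
    by rewrite /X; field; rewrite gt_eqF.
  by congr (_ * _ ^+ 2); rewrite /Df; ring.
pose fk : R := 2 ^+ n * 2 * (4 * ln 4) * 64.
have fk0 : 0 <= fk by rewrite /fk !mulr_ge0 ?exprn_ge0 // ln_ge0 // ler1n.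
have i41 : 4^-1 <= 1 :> R by rewrite invf_le1 // ler1n.
have i40 : 0 <= 4^-1 :> R by rewrite invr_ge0.
have hd k : H0 s 1 (fun x => p_ k.+1 x - p_ k x) by exact: H0B.
have ed k : enb s (fun x => p_ k.+1 x - p_ k x) (8 * L * 4^-1 ^+ k).
  apply: cl => //; apply: (bdW (bp k.+1)); rewrite lerD2l.
  by rewrite exprS ler_piMl // exprn_ge0.
have b1 := bd_cube (n := n) (@ltr01 R); rewrite mulr1 in b1.
(* On the unit cube |f| <= 2^-k + 2^k f^2; square integrals of order 4^-k thus give summable L^1
   distances of order 2^-k. *)
have l1 k : bd mu (fun x => `|p_ k.+1 x - p_ k x|) ((2 ^+ n + fk * (8 * L)) * 2^-1 ^+ k).
  have i2 : 0 < 2^-1 ^+ k :> R by rewrite exprn_gt0.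
  have p2 : 0 < 2 ^+ k :> R by rewrite exprn_gt0.
  have pc := H0_poincare n0 s0 s1 (hd k) (ed k); rewrite -/fk in pc.
  apply: (bd_le (bdW (bdD (bdZ (ltW i2) b1) (bdZ (ltW p2) pc)) _)).
  - have -> : 4^-1 = 2^-1 * 2^-1 :> R by field.
    rewrite exprMn [(_ + _) * _]mulrDl [2 ^+ n * _]mulrC lerD2l.
    rewrite le_eqVlt; apply/orP; left; apply/eqP; rewrite exprVn; field.
    by rewrite gt_eqF.
  - by have := mp k.+1; have := mp k => m1 m2; meas.
  - by move=> x; exact: normr_ge0.
  move=> x; case: (ltP `|x| 1) => x1 /=; last first.
    by have [_ -> // _ _] := hd k; rewrite normr0 mulr0 add0r; nn.
  rewrite mulr1; have -> : 2^-1 ^+ k = (2 ^+ k)^-1 :> R by rewrite exprVn.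
  rewrite -(real_normK (num_real (p_ k.+1 x - p_ k x))).
  move: (`|_|) (2 ^+ k : R) p2 (normr_ge0 (p_ k.+1 x - p_ k x)) => t p p0 t0.
  rewrite -(ler_pM2l p0) mulrDr mulfV ?gt_eqF // mulrA -expr2 -exprMn.
  have := sqr_ge0 (p * t - 1); have : 0 <= p * t by rewrite mulr_ge0 // ltW.
  by rewrite !expr2; clear; lra.
have [q mq cq] := ae_cauchy_limit mp l1.
(* [q] is a limit only almost everywhere; cutting it off makes the exterior values vanish
   everywhere, as [H0] demands. *)
pose psi x := (`|x| < 1)%R%:R * q x.
have mpsi : measurable_fun setT psi by rewrite /psi; meas.
have cpsi : {ae mu, forall x, (fun k => p_ k x) @ \oo --> psi x}.
  apply: filterS cq => x cx; rewrite /psi; case: (ltP `|x| 1) => x1 /=; first by rewrite mul1r.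
  rewrite mul0r (_ : (fun k => p_ k x) = (fun=> 0)); first exact: cvg_cst.
  by apply/funext => k; have [_ -> // _ _] := hp k.
have cD : {ae mu2, forall z, (fun k => Df (p_ k) z) @ \oo --> Df psi z}.
  apply: filterS2 (ae_prod_x mu cpsi) (ae_prod_y mu cpsi) => z c1 c2.
  by rewrite /Df; exact: cvgB.
have [e0 be0] : exists e, enb s (p_ 0%N) e by case: (hp 0%N).
have ep k : enb s (p_ k) (2 * (8 * L * 1 + e0)).
  have m4 : m + 4^-1 ^+ k <= m + 1 by rewrite lerD2l exprn_ile1.
  have e1 := cl k 0%N 1 (bdW (bp k) m4) (bdW (bp 0%N) (lexx _)).
  have md : measurable_fun setT (fun x => p_ k x - p_ 0%N x).
    by have := mp k; have := mp 0%N => m1 m2; meas.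
  apply: (bd_ext (enbD s1' e1 be0 md (mp 0%N))) => z.
  by congr (_ * _ ^+ 2); rewrite /Df; ring.
have hpsi : H0 s 1 psi.
  have mDp := measurable_Df mpsi; split => //.
  - by move=> x x1; rewrite /psi ltNge x1 mul0r.
  - exists (fk * (2 * (8 * L * 1 + e0))).
    apply: (bd_fatou (fun k => H0_poincare n0 s0 s1 (hp k) (ep k))); [by meas|by move=> x; nn|].
    by apply: filterS cpsi => x cx; rewrite expr2; under eq_fun do rewrite expr2; exact: cvgM.
  exists (2 * (8 * L * 1 + e0)); apply: (bd_fatou ep); [by meas|by move=> z; nn|].
  apply: filterS cD => z cz; apply: cvgM; first exact: cvg_cst.
  by rewrite expr2; under eq_fun do rewrite expr2; exact: cvgM.
have bpsi N : bd mu2 (Gd psi) (m + 4^-1 ^+ N).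
  apply: (bd_fatou (f_ := fun k => Gd (p_ (k + N)%N))) => //; last 2 first.
  - exact: mGd.
  - apply: filterS cD => z cz; apply: (potential_continuous L1 s1' fF pG).
    apply: cvgB; first exact: cvg_cst.
    exact: cvg_comp (cvg_addnr N) cz.
  move=> k; apply: (bdW (bp _)); rewrite lerD2l exprD ler_piMl ?exprn_ge0 //.
  by rewrite exprn_ile1.
have [a [Ea ba am]] := bd_int (bpsi 0%N).
have am' : a <= m.
  apply/ler_addgt0Pr => e e0'.
  have i41' : 4^-1 < 1 :> R by rewrite invf_lt1 // ltr1n.
  have [N hN] := exists_expr_le 1 i40 i41' e0'.
  have [b [Eb _ bm]] := bd_int (bpsi N).
  have -> : a = b by apply: EFin_inj; rewrite -Ea -Eb.
  apply: le_trans bm _; rewrite lerD2l; have := hN N (leqnn N); by rewrite mul1r.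
pose v x := u x - psi x.
have [_ _ _ [epsi bepsi]] := hpsi.
have mv : measurable_fun setT v by rewrite /v; meas.
have bv : enb s v (2 * (eu + epsi)) by exact: enbB.
exists v; last first.
  rewrite (_ : (fun x => u x - v x) = psi) //.
  by apply/funext => x; rewrite /v opprB addrC subrK.
split => //; first by exists (2 * (eu + epsi)).
  by apply: loc2B => //; exact: H0_loc2 hpsi.
move=> phi hphi; have [mphi _ _ [ephi bphi]] := hphi.
have ifm := form_integrable L1 s1' fF mv mphi bv bphi.
have fin : form F v phi \is a fin_num by apply: integrable_fin_num.
pose X := fine (form F v phi).
have EX : form F v phi = X%:E by rewrite fineK.
have mDp := measurable_Df mphi.
(* Minimality against psi - t phi, with the energy expanded to second order by [potential_upper]. *)
have H t : 0 <= t * X + t ^+ 2 * (L * ephi).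
  have ht : H0 s 1 (fun x => psi x + (- t) * phi x) by apply: H0D => //; exact: H0Z.
  have [mt _ _ _] := ht.
  have t2L : 0 <= t ^+ 2 * L by rewrite mulr_ge0 ?sqr_ge0 // ltW.
  have bA : bd mu2 (Gd (fun x => psi x + (- t) * phi x)) (t * X + (a + t ^+ 2 * L * ephi)).
    apply: (@bd_test _ _ _ mu2 (fun z => t * (F (z.1 - z.2) (Df v z) * Df phi z)) _
      (fun z => Gd psi z + t ^+ 2 * L * (J s (z.1 - z.2) * Df phi z ^+ 2))).
    - exact: (integrableZl measurableT t ifm).
    - have -> : (\int[mu2]_z (t * (F (z.1 - z.2) (Df v z) * Df phi z))%:E = t%:E * form F v phi)%E.
        by rewrite /form -integralZl //; apply: eq_integral.
      by rewrite EX -EFinM.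
    - exact: bdD ba (bdZ t2L bphi).
    - exact: mGd.
    - by [].
    move=> z; have := potential_upper L1 s1' fF pG (z.1 - z.2) (Df v z) (Df v z + t * Df phi z).
    have -> : Gd psi z = G (z.1 - z.2) (Df v z) by rewrite /Gd /v; congr (G _ _); rewrite /Df; ring.
    have -> : Gd (fun x => psi x + - t * phi x) z = G (z.1 - z.2) (Df v z + t * Df phi z).
      by rewrite /Gd /v; congr (G _ _); rewrite /Df; ring.
    have -> : Df v z + t * Df phi z - Df v z = t * Df phi z by ring.
    have -> : L * J s (z.1 - z.2) * (t * Df phi z) ^+ 2 =
      t ^+ 2 * L * (J s (z.1 - z.2) * Df phi z ^+ 2) by ring.
    by clear; lra.
  have Sx : S (t * X + (a + t ^+ 2 * L * ephi)).
    by exists (fun x => psi x + (- t) * phi x).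
  by have := mS _ Sx; move: am'; clear; lra.
have e0' := bd_ge0 bphi; have Le0 : 0 <= L * ephi by rewrite mulr_ge0 // ltW.
(* At t = - d X the inequality reads d X^2 (1 - d L ephi) <= 0 with a positive factor, whence X = 0;
   the 1 guards against vanishing [ephi]. *)
pose d : R := (2 * (L * ephi + 1))^-1.
have d0 : 0 < d by rewrite invr_gt0 mulr_gt0 // ltr_wpDl.
have dL : d * (L * ephi) <= 2^-1.
  rewrite /d mulrC ler_pdivrMr ?mulr_gt0 // ?ltr_wpDl //; move: Le0; clear; lra.
have hX := H (- (d * X)).
have X2 := sqr_ge0 X.
have : d * X ^+ 2 * (1 - d * (L * ephi)) <= 0.
  move: hX; rewrite !expr2; clear; lra.
have h1 : 0 < d * (1 - d * (L * ephi)) by rewrite mulr_gt0 //; move: dL; clear; lra.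
rewrite mulrAC pmulr_rle0 // => X20; rewrite EX.
by have : X ^+ 2 == 0 by [rewrite eq_le X20]; rewrite sqrf_eq0 => /eqP ->.
Qed.

End existence.

(** * Smooth bumps and a class of smooth functions *)

Section smooth_bump.
Context {R : realType}.

(* The family [t^-k exp (- 1/t)] is closed under differentiation up to linear combinations. *)
Definition flat (k : nat) (t : R) : R := if 0 < t then t^-1 ^+ k * expR (- t^-1) else 0.

Lemma flat_ge0 k t : 0 <= flat k t.
Proof.
rewrite /flat; case: ifPn => // t0; apply: mulr_ge0; last exact: expR_ge0.
by rewrite exprn_ge0 // invr_ge0 ltW.
Qed.

Lemma flat_gt0 k t : 0 < t -> 0 < flat k t.
Proof. by move=> t0; rewrite /flat t0 mulr_gt0 ?expR_gt0 // exprn_gt0 // invr_gt0. Qed.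

Lemma flat_eq0 k t : t <= 0 -> flat k t = 0.
Proof. by move=> t0; rewrite /flat ltNge t0. Qed.

Lemma flat_le k t : flat k t <= k`!%:R.
Proof.
rewrite /flat; case: ifPn => t0; last exact: ler0n.
rewrite expRN ler_pdivrMr ?expR_gt0 //; set x := t^-1.
have x0 : 0 < x by rewrite invr_gt0.
case: k => [|k]; first by rewrite expr0 fact0 mul1r ltW // pexpR_gt1.
have := expR_ge1Dxn k (ltW x0) => h.
have f0 : 0 < k.+1`!%:R :> R by rewrite ltr0n fact_gt0.
by rewrite -ler_pdivrMl // mulrC; apply: le_trans h; rewrite lerDr.
Qed.

Lemma flatS k t : flat k t = t * flat k.+1 t.
Proof.
rewrite /flat; case: ifPn => t0; last by rewrite mulr0.
by rewrite exprS !mulrA mulfV ?mul1r // gt_eqF.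
Qed.

(** At 0 the difference quotient is h times [flat k.+2 h], and [flat k.+2] is bounded. *)
Lemma is_derive_flat k (t : R) : is_derive t (1 : R) (flat k) (flat k.+2 t - k%:R * flat k.+1 t).
Proof.
have [t0|t0|->] := ltgtP t 0.
- rewrite !flat_eq0 ?(ltW t0) // mulr0 subr0.
  have := is_derive_cst (0 : R) t (1 : R); apply: near_eq_is_derive.
  near=> y; rewrite flat_eq0 //; apply: ltW; near: y.
  exact: lt_nbhsl.
- have tn : t != 0 by rewrite gt_eqF.
  have h1 := is_deriveV (f := id) tn (is_derive_id t (1 : R)).
  have h2 := is_deriveX k h1.
  have h3 := is_derive1_comp (is_derive_expR _) (is_deriveN h1).
  have h4 := is_deriveM h2 h3.
  apply: (near_eq_is_derive _ (is_derive_eq h4 _)).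
    near=> y; rewrite /flat; have -> : 0 < y by near: y; exact: lt_nbhsr.
    by rewrite !fctE.
  rewrite !fctE /flat t0 /GRing.scale /= /GRing.scale /= mulr1; set E := expR _.
  have -> : t ^- 2 = t^-1 ^+ 2 by rewrite exprVn.
  case: k {h2 h4} => [|k] /=; first by ring.
  by rewrite !exprS; ring.
- rewrite !flat_eq0 // mulr0 subr0.
  have c : (fun h : R => h^-1 *: ((flat k \o shift 0) (h *: (1 : R)) - flat k 0)) @ 0^' --> (0 : R).
    apply/cvgrPdist_le => e e0; near=> h.
    rewrite sub0r normrN /= [flat k 0]flat_eq0 // subr0 addr0 [h *: 1]mulr1 flatS.
    have h0 : h != 0 by near: h; exact: nbhs_dnbhs_neq.
    rewrite [_ *: _]mulrA mulVf // mul1r flatS normrM (ger0_norm (flat_ge0 _ _)).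
    have f0 : 0 < k.+2`!%:R :> R by rewrite ltr0n fact_gt0.
    apply: (@le_trans _ _ (`|h| * k.+2`!%:R)); first by rewrite ler_wpM2l // flat_le.
    rewrite -ler_pdivlMr //; near: h; apply: dnbhs0_le; exact: divr_gt0.
  apply: DeriveDef; first exact: cvgP c.
  exact: cvg_lim c.
Unshelve. all: end_near.
Qed.

Lemma mean_value (f df : R -> R) (a b : R) : (forall x : R, is_derive x (1 : R) f (df x)) ->
  exists2 c, `|c - a| <= `|b - a| & f b - f a = df c * (b - a).
Proof.
move=> fd; have cf : continuous f by move=> x; apply: differentiable_continuous; apply/derivable1_diffP; case: (fd x).
have seg (x y : R) : x <= y -> exists2 c, x <= c <= y & f y - f x = df c * (y - x).
  move=> xy; have [|c] := MVT_segment xy (fun x _ => fd x).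
    exact: continuous_subspaceT.
  by rewrite in_itv /= => cxy ->; exists c.
have [ab|/ltW ba] := leP a b.
  have [c /andP[c1 c2] E] := seg _ _ ab; exists c => //.
  by rewrite !ger0_norm ?subr_ge0 // lerD2r.
have [c /andP[c1 c2] E] := seg _ _ ba; exists c.
  by rewrite !ler0_norm ?subr_le0 // lerN2 lerD2r.
by rewrite -opprB E -mulrN opprB.
Qed.

Lemma flat_lip k : exists2 C, 0 <= C & forall t t', `|flat k t - flat k t'| <= C * `|t - t'|.
Proof.
exists (k.+2`!%:R + k%:R * k.+1`!%:R); first by rewrite addr_ge0 ?mulr_ge0 ?ler0n.
move=> t t'; have [c _ ->] := mean_value t' t (is_derive_flat k).
rewrite normrM; apply: ler_wpM2r; first exact: normr_ge0.
apply: le_trans (ler_normB _ _) _; rewrite normrM !(ger0_norm (flat_ge0 _ _)) ger0_norm ?ler0n //.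
by apply: lerD; rewrite ?flat_le //; apply: ler_wpM2l; rewrite ?ler0n ?flat_le.
Qed.

Lemma flat_taylor k : exists2 C, 0 <= C & forall t h,
  `|flat k (t + h) - flat k t - h * (flat k.+2 t - k%:R * flat k.+1 t)| <= C * h ^+ 2.
Proof.
have [C1 C10 h1] := flat_lip k.+2; have [C2 C20 h2] := flat_lip k.+1.
exists (C1 + k%:R * C2); first by rewrite addr_ge0 ?mulr_ge0 ?ler0n.
move=> t h; have [c] := mean_value t (t + h) (is_derive_flat k).
rewrite addrAC subrr add0r => ch ->; rewrite [_ * h]mulrC -mulrBr normrM.
rewrite -(real_normK (num_real h)) expr2 mulrCA; apply: ler_wpM2l; first exact: normr_ge0.
have -> : flat k.+2 c - k%:R * flat k.+1 c - (flat k.+2 t - k%:R * flat k.+1 t) =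
  (flat k.+2 c - flat k.+2 t) - k%:R * (flat k.+1 c - flat k.+1 t) by ring.
apply: le_trans (ler_normB _ _) _; rewrite normrM (ger0_norm (ler0n _ k)) mulrDl.
apply: lerD; first by apply: le_trans (h1 _ _) _; exact: ler_wpM2l.
rewrite -mulrA; apply: ler_wpM2l; first exact: ler0n.
by apply: le_trans (h2 _ _) _; exact: ler_wpM2l.
Qed.

End smooth_bump.

Section smooth_class.
Context {R : realType} {n : nat}.
Local Notation V := 'rV[R]_n.
Implicit Types f g : V -> R.

Definition bounded_lip f := exists2 C : R, 0 <= C &
  (forall x, `|f x| <= C) /\ (forall x y, `|f x - f y| <= C * `|x - y|).

(** A uniform quadratic remainder in direction i stands for the partial derivative. Such an
    inequality passes through products and averages, so no integral has to be differentiated. *)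
Definition taylor (i : 'I_n) f g := exists2 C : R, 0 <= C & forall x t,
  `|f (t *: delta_mx ord0 i + x) - f x - t * g x| <= C * t ^+ 2.

Fixpoint Cb (k : nat) f : Prop := bounded_lip f /\
  match k with 0 => True | j.+1 => forall i : 'I_n, exists2 g, taylor i f g & Cb j g end.

Lemma Cb_lip k f : Cb k f -> bounded_lip f. Proof. by case: k => [|k] []. Qed.

Lemma CbW k f : Cb k.+1 f -> Cb k f.
Proof.
elim: k f => [|k IH] f [fb fd]; split => // i; have [g tg cg] := fd i.
by exists g => //; exact: IH.
Qed.

Lemma norm_delta_mx (i : 'I_n) : `|delta_mx ord0 i : V| <= 1.
Proof.
apply/normV_leP => // j; rewrite mxE eqxx /=; case: eqP => _ /=; rewrite ?normr1 ?normr0 //.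
Qed.

Lemma norm_shift (i : 'I_n) (t : R) (x : V) : `|t *: delta_mx ord0 i + x - x| <= `|t|.
Proof. by rewrite addrK normrZ ler_piMr ?norm_delta_mx. Qed.

Lemma bounded_lipD f g : bounded_lip f -> bounded_lip g -> bounded_lip (fun x => f x + g x).
Proof.
move=> [C C0 [f1 f2]] [D D0 [g1 g2]]; exists (C + D); first exact: addr_ge0.
split=> [x|x y]; first by apply: le_trans (ler_normD _ _) _; exact: lerD.
by rewrite opprD addrACA mulrDl; apply: le_trans (ler_normD _ _) _; exact: lerD.
Qed.

Lemma bounded_lipZ (k : R) f : bounded_lip f -> bounded_lip (fun x => k * f x).
Proof.
move=> [C C0 [f1 f2]]; exists (`|k| * C); first exact: mulr_ge0.
split=> [x|x y]; first by rewrite normrM ler_wpM2l.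
by rewrite -mulrBr normrM -mulrA ler_wpM2l.
Qed.

Lemma bounded_lipM f g : bounded_lip f -> bounded_lip g -> bounded_lip (fun x => f x * g x).
Proof.
move=> [C C0 [f1 f2]] [D D0 [g1 g2]]; exists (C * D + C * D); first by rewrite addr_ge0 // mulr_ge0.
split=> [x|x y].
  by apply: ler_wpDl; [exact: mulr_ge0|rewrite normrM; apply: ler_pM].
have -> : f x * g x - f y * g y = f x * (g x - g y) + (f x - f y) * g y by ring.
apply: le_trans (ler_normD _ _) _; rewrite !normrM mulrDl; apply: lerD.
  by rewrite -mulrA; apply: ler_pM.
by rewrite mulrAC; apply: ler_pM.
Qed.

Lemma bounded_lip_cst (c : R) : bounded_lip (fun=> c).
Proof.
exists `|c| => //; split=> [x|x y] //.
by rewrite subrr normr0 mulr_ge0.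
Qed.

Lemma CbZ k (c : R) f : Cb k f -> Cb k (fun x => c * f x).
Proof.
elim: k f => [|k IH] f [fb fd]; split; [exact: bounded_lipZ|by []|exact: bounded_lipZ|].
move=> i; have [g [C C0 hC] cg] := fd i; exists (fun x => c * g x); last exact: IH.
exists (`|c| * C) => [|x t]; first exact: mulr_ge0.
by rewrite mulrCA -!mulrBr normrM -mulrA ler_wpM2l.
Qed.

Lemma CbD k f g : Cb k f -> Cb k g -> Cb k (fun x => f x + g x).
Proof.
elim: k f g => [|k IH] f g [fb fd] [gb gd]; split; [exact: bounded_lipD|by []|exact: bounded_lipD|].
move=> i; have [f' [C C0 hC] cf] := fd i; have [g' [D D0 hD] cg] := gd i.
exists (fun x => f' x + g' x); last exact: IH.
exists (C + D) => [|x t]; first exact: addr_ge0.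
set y := t *: _ + x.
have -> : f y + g y - (f x + g x) - t * (f' x + g' x) =
  (f y - f x - t * f' x) + (g y - g x - t * g' x) by ring.
by rewrite [leRHS]mulrDl; apply: le_trans (ler_normD _ _) _; apply: lerD; [exact: hC|exact: hD].
Qed.

Lemma CbM k f g : Cb k f -> Cb k g -> Cb k (fun x => f x * g x).
Proof.
elim: k f g => [|k IH] f g cf cg; have [fb fd] := cf; have [gb gd] := cg.
  by split => //; exact: bounded_lipM.
split; first exact: bounded_lipM.
move=> i; have [f' [C C0 hC] cf'] := fd i; have [g' [D D0 hD] cg'] := gd i.
exists (fun x => f' x * g x + f x * g' x).
  have [A A0 [f1 f2]] := fb; have [B B0 [g1 g2]] := gb; have [E E0 [f'1 _]] := Cb_lip cf'.
  exists (C * B + A * D + E * B) => [|x t]; first by rewrite !addr_ge0 // mulr_ge0.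
  set y := t *: _ + x.
  have -> : f y * g y - f x * g x - t * (f' x * g x + f x * g' x) =
    (f y - f x - t * f' x) * g y + f x * (g y - g x - t * g' x) + t * (f' x * (g y - g x)) by ring.
  have e1 : `|(f y - f x - t * f' x) * g y| <= C * B * t ^+ 2.
    by rewrite normrM mulrAC; apply: ler_pM => //; exact: hC.
  have e2 : `|f x * (g y - g x - t * g' x)| <= A * D * t ^+ 2.
    by rewrite normrM -mulrA; apply: ler_pM => //; exact: hD.
  have e3 : `|t * (f' x * (g y - g x))| <= E * B * t ^+ 2.
    rewrite !normrM mulrCA -mulrA; apply: ler_pM => //.
    rewrite -(real_normK (num_real t)) expr2 mulrCA; apply: ler_wpM2l; first exact: normr_ge0.
    by apply: le_trans (g2 _ _) _; apply: ler_wpM2l => //; exact: norm_shift.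
  rewrite [leRHS]mulrDl [X in _ <= X + _]mulrDl; apply: le_trans (ler_normD _ _) _; apply: lerD => //.
  by apply: le_trans (ler_normD _ _) _; exact: lerD.
by apply: CbD; apply: IH => //; exact: CbW.
Qed.

Lemma Cb_cst k (c : R) : Cb k (fun=> c).
Proof.
elim: k c => [|k IH] c; split; [exact: bounded_lip_cst|by []|exact: bounded_lip_cst|].
move=> i; exists (fun=> 0) => //; exists 0 => // x t.
by rewrite subrr mulr0 subrr normr0 mul0r.
Qed.

Lemma Cb_flat k j (a : R) (i : 'I_n) : Cb k (fun x : V => flat j (1 + a * x ord0 i)).
Proof.
have nice l : bounded_lip (fun x : V => flat l (1 + a * x ord0 i)).
  have [C C0 hC] := flat_lip (R := R) l; exists (l`!%:R + C * `|a|).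
    by rewrite addr_ge0 ?mulr_ge0 ?ler0n.
  split=> [x|x y].
    by rewrite ger0_norm ?flat_ge0 //; apply: ler_wpDr; [rewrite mulr_ge0|exact: flat_le].
  apply: le_trans (hC _ _) _; rewrite opprD addrACA subrr add0r -mulrBr normrM mulrA mulrDl.
  apply: ler_wpDl; first by rewrite mulr_ge0 ?ler0n.
  apply: ler_wpM2l; first by rewrite mulr_ge0.
  by have := coord_le_norm (x - y) i; rewrite !mxE.
elim: k j => [|k IH] j; split => // i'.
have [->|ii] := eqVneq i' i; last first.
  exists (fun=> 0); last exact: Cb_cst.
  exists 0 => // x t; rewrite mulr0 subr0 mul0r !mxE eqxx /= eq_sym (negbTE ii) mulr0 add0r.
  by rewrite subrr normr0.
exists (fun x => a * (flat j.+2 (1 + a * x ord0 i) + - j%:R * flat j.+1 (1 + a * x ord0 i))).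
  have [C C0 hC] := flat_taylor (R := R) j; exists (C * a ^+ 2) => [|x t].
    by rewrite mulr_ge0 // sqr_ge0.
  have := hC (1 + a * x ord0 i) (a * t); rewrite !mxE !eqxx /= mulr1.
  have -> : 1 + a * x ord0 i + a * t = 1 + a * (t + x ord0 i) by ring.
  by rewrite exprMn mulrA mulNr mulrA [t * a]mulrC.
by apply: CbZ; apply: CbD => //; apply: CbZ.
Qed.

Definition bump (a : R) (x : V) : R := \prod_(i < n) (flat 0 (1 + a * x ord0 i) * flat 0 (1 + (- a) * x ord0 i)).

Lemma Cb_prod k (r : seq 'I_n) (f : 'I_n -> V -> R) : (forall i, Cb k (f i)) ->
  Cb k (fun x => \prod_(i <- r) f i x).
Proof.
move=> cf; elim: r => [|i r IH].
  by under eq_fun do rewrite big_nil; exact: Cb_cst.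
by under eq_fun do rewrite big_cons; exact: CbM.
Qed.

Lemma Cb_bump k a : Cb k (bump a).
Proof. by apply: Cb_prod => i; apply: CbM; exact: Cb_flat. Qed.

Lemma bump_ge0 a x : 0 <= bump a x.
Proof. by apply: prodr_ge0 => i _; rewrite mulr_ge0 ?flat_ge0. Qed.

Lemma bumpN a x : bump a (- x) = bump a x.
Proof.
apply: eq_bigr => i _; rewrite mxE mulrN mulrNN mulrC; congr (_ * flat 0 (1 + _)).
by rewrite mulNr.
Qed.

Lemma bump_le1 a x : bump a x <= 1.
Proof.
have h (t : R) : 0 <= flat 0 t <= 1.
  by rewrite flat_ge0; have := flat_le (R := R) 0 t; rewrite fact0.
suff /andP[] : 0 <= bump a x <= 1 by [].
rewrite /bump; elim/big_rec: _ => [|i y _ /andP[y0 y1]]; first by rewrite ler01 lexx.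
have /andP[a0 a1] := h (1 + a * x ord0 i); have /andP[b0 b1] := h (1 + - a * x ord0 i).
by rewrite !mulr_ge0 // !mulr_ile1 // mulr_ge0.
Qed.

Lemma bump_eq0 a x : 0 < a -> a^-1 <= `|x| -> bump a x = 0.
Proof.
move=> a0; apply: contraPeq => b0; apply/negP; rewrite -ltNge.
apply/normV_ltP; first by rewrite invr_gt0.
move=> i.
have : flat 0 (1 + a * x ord0 i) * flat 0 (1 + - a * x ord0 i) != 0.
  by apply: contraNneq b0 => h; rewrite /bump (bigD1 i) //= h mul0r.
have pos (t : R) : flat 0 t != 0 -> 0 < t.
  by apply: contraR; rewrite -leNgt => t0; rewrite flat_eq0.
rewrite mulf_eq0 negb_or => /andP[/pos h1 /pos h2].
rewrite ltr_norml -(ltr_pM2l a0) mulrN -[X in _ && X](ltr_pM2l a0) mulfV ?gt_eqF //.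
by apply/andP; split; move: h1 h2; rewrite ?mulNr; clear; lra.
Qed.

Lemma bump_gt0 a x : 0 < a -> `|x| < a^-1 -> 0 < bump a x.
Proof.
move=> a0 /normV_ltP; rewrite invr_gt0 => /(_ a0) h.
apply: prodr_gt0 => i _; have := h i; rewrite -(ltr_pM2l a0) mulfV ?gt_eqF //.
rewrite -[X in X * _](gtr0_norm a0) -normrM ltr_norml => /andP[h1 h2].
by rewrite mulr_gt0 ?flat_gt0 // ?mulNr; move: h1 h2; clear; lra.
Qed.

Lemma bumpZ a b x : bump a (b *: x) = bump (a * b) x.
Proof. by apply: eq_bigr => i _; rewrite mxE -mulNr !mulrA. Qed.

End smooth_class.

(** * Convolution *)

Section convolution.
Context {R : realType} {n : nat}.
Local Notation V := 'rV[R]_n.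
Local Notation mu := (@lebesgue_rV R n).
Local Notation mu2 := (mu \x mu)%E.
Implicit Types (f g psi rho : V -> R) (F : V -> R -> R).

Lemma lip_continuous f C : 0 <= C -> (forall x y, `|f x - f y| <= C * `|x - y|) -> continuous f.
Proof.
move=> C0 fl x A /nbhs_ballP[e /= e0 hA]; have C10 : 0 < C + 1 by rewrite ltr_wpDl.
apply/nbhs_ballP; exists (e / (C + 1)) => [|y]; first by rewrite /= divr_gt0.
rewrite -ball_normE /= ltr_pdivlMr // => xy; apply: hA; rewrite -ball_normE /=.
apply: le_lt_trans (fl _ _) _; apply: le_lt_trans xy; rewrite mulrC.
by apply: ler_wpM2l; rewrite ?lerDl.
Qed.

Lemma bounded_lip_continuous f : bounded_lip f -> continuous f.
Proof. by move=> [C C0 [_ fl]]; exact: lip_continuous fl. Qed.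

Lemma bounded_lip_measurable f : bounded_lip f -> measurable_fun setT f.
Proof. by move=> /bounded_lip_continuous; exact: continuous_measurable_rV. Qed.

Lemma taylor_derive i f g x : taylor i f g ->
  (fun h : R => h^-1 *: ((f \o shift x) (h *: delta_mx ord0 i) - f x)) @ 0^' --> g x.
Proof.
move=> [C C0 hC]; apply/cvgrPdist_le => e e0; near=> h.
have h0 : h != 0 by near: h; exact: nbhs_dnbhs_neq.
rewrite distrC (_ : h^-1 *: _ - _ = h^-1 * (f (h *: delta_mx ord0 i + x) - f x - h * g x)); last first.
  change (h^-1 * (f (h *: delta_mx ord0 i + x) - f x) - g x =
    h^-1 * (f (h *: delta_mx ord0 i + x) - f x - h * g x)).
  by rewrite [RHS]mulrBr mulrA mulVf // mul1r.
rewrite normrM normfV mulrC ler_pdivrMr ?normr_gt0 //; apply: le_trans (hC x h) _.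
rewrite -(real_normK (num_real h)) expr2 mulrA; apply: ler_wpM2r => //.
apply: (@le_trans _ _ ((C + 1) * (e / (C + 1)))); last by rewrite mulrC divfK // gt_eqF // ltr_wpDl.
apply: ler_pM => //; first by rewrite lerDl.
by near: h; apply: dnbhs0_le; rewrite divr_gt0 // ltr_wpDl.
Unshelve. all: end_near.
Qed.

Lemma Cb_Ck k f : Cb k f -> Ck k f.
Proof.
elim: k f => [|k IH] f [fb fd]; first exact: bounded_lip_continuous.
split; first exact: bounded_lip_continuous.
move=> i; have [g tg cg] := fd i; split.
  by move=> x; exact: cvgP (taylor_derive tg).
rewrite (_ : partial i f = g); first exact: IH.
by apply/funext => x; exact: cvg_lim (taylor_derive (x := x) tg).
Qed.

Lemma test_function_ball f (x0 : V) (r : R) : (forall k, Cb k f) ->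
  (forall x, r <= `|x - x0| -> f x = 0) -> test_function setT f.
Proof.
move=> cf f0; split => //; first by move=> k; exact: Cb_Ck.
apply: bounded_closed_compact; last exact: closed_closure.
have sub : closure [set x | f x != 0] `<=` [set x | `|x - x0| <= r].
  have cl : closed [set x : V | `|x - x0| <= r].
    have -> : [set x : V | `|x - x0| <= r] = (fun x : V => `|x - x0|) @^-1` [set t | t <= r] by [].
    apply: closed_comp; last exact: closed_le.
    move=> x _; apply: (@lip_continuous (fun x : V => `|x - x0|) 1) => // a b.
    by rewrite mul1r; apply: le_trans (ler_dist_dist _ _) _; rewrite opprB addrA subrK.
  rewrite closureE; apply: smallest_sub => // x /= fx.
  by rewrite leNgt; apply: contra fx => h; rewrite f0 // ltW.
exists (r + `|x0|); split; first exact: num_real.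
move=> M hM x /sub /= xr; apply: le_trans (ltW hM).
by have := ler_normD (x - x0) x0; rewrite subrK; move: xr; clear; lra.
Qed.

Section mean.
Variables (psi : V -> R) (m : R).
Hypotheses (mpsi : measurable_fun setT psi) (bpsi : bd mu (fun x => `|psi x|) m).

Definition mean g : R := (\int[mu]_y (psi y * g y))%R.

Lemma mean_integrable g C : measurable_fun setT g -> (forall x, `|g x| <= C) ->
  mu.-integrable setT (EFin \o (fun y => psi y * g y)).
Proof.
move=> mg gC; have C0 : 0 <= C by apply: le_trans (normr_ge0 (g 0)) (gC 0).
apply: (@bd_integrable _ _ _ mu _ (C * m)); last by meas.
apply: (bd_le (bdZ C0 bpsi)); [by meas|by move=> x; nn|move=> x].
by rewrite normrM mulrC; apply: ler_wpM2r.
Qed.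

Lemma mean_le g C : measurable_fun setT g -> (forall x, `|g x| <= C) -> `|mean g| <= C * m.
Proof.
move=> mg gC; have C0 : 0 <= C by apply: le_trans (normr_ge0 (g 0)) (gC 0).
have i1 := mean_integrable mg gC.
apply: le_trans (le_normr_Rintegral measurableT i1) _.
have b : bd mu (fun y => `|psi y * g y|) (C * m).
  apply: (bd_le (bdZ C0 bpsi)); [by meas|by move=> x; nn|move=> x].
  by rewrite normrM mulrC; apply: ler_wpM2r.
have [c [E _ cm]] := bd_int b; rewrite /Rintegral.
by apply: le_trans cm; rewrite E.
Qed.

Lemma meanB g (h : V -> R) C D : measurable_fun setT g -> (forall x, `|g x| <= C) ->
  measurable_fun setT h -> (forall x, `|h x| <= D) ->
  mean (fun y => g y - h y) = mean g - mean h.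
Proof.
move=> mg gC mh hD; rewrite /mean -RintegralB //; last 2 first.
- exact: (mean_integrable mg gC).
- exact: (mean_integrable mh hD).
by apply: eq_Rintegral => y _; rewrite mulrBr.
Qed.

Lemma meanZ (k : R) g C : measurable_fun setT g -> (forall x, `|g x| <= C) ->
  mean (fun y => k * g y) = k * mean g.
Proof.
move=> mg gC; rewrite /mean -RintegralZl //; last exact: (mean_integrable mg gC).
by apply: eq_Rintegral => y _; rewrite mulrCA.
Qed.

(** Averaging the [taylor] inequality of rho(x - y) against psi(y) multiplies its constant by the
    L^1 norm of psi. *)
Lemma conv_Cb k rho : Cb k rho -> Cb k (fun x => mean (fun y => rho (x - y))).
Proof.
have mr (f : V -> R) (x : V) : bounded_lip f -> measurable_fun setT (fun y : V => f (x - y)).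
  by move=> /bounded_lip_measurable mf; meas.
have lip f : bounded_lip f -> bounded_lip (fun x => mean (fun y => f (x - y))).
  move=> fb; have [C C0 [f1 f2]] := fb; have m0 := bd_ge0 bpsi.
  exists (C * m); first exact: mulr_ge0.
  split=> [x|x y]; first by apply: mean_le => //; exact: mr.
  rewrite -(meanB (C := C) (D := C)) //; try exact: mr.
  rewrite mulrAC; apply: mean_le.
    by have := mr _ x fb; have := mr _ y fb => m1 m2; meas.
  move=> z; apply: le_trans (f2 _ _) _.
  by rewrite opprB addrA subrK.
elim: k rho => [|k IH] f [fb fd]; split; [exact: lip|by []|exact: lip|].
move=> i; have [g [C C0 hC] cg] := fd i; exists (fun x => mean (fun y => g (x - y))); last exact: IH.
have [A A0 [f1 _]] := fb; have [B B0 [g1 _]] := Cb_lip cg.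
exists (C * m) => [|x t]; first by rewrite mulr_ge0 // (bd_ge0 bpsi).
have m1 := mr _ (t *: delta_mx ord0 i + x) fb; have m2 := mr _ x fb; have m3 := mr _ x (Cb_lip cg).
have mtg : measurable_fun setT (fun y : V => t * g (x - y)) by meas.
rewrite -(meanZ t (C := B)) // -(meanB (C := A) (D := A)) //.
rewrite -(meanB (C := A + A) (D := `|t| * B)) //; last 3 first.
- by meas.
- by move=> y; apply: le_trans (ler_normB _ _) _; apply: lerD.
- by move=> y; rewrite normrM ler_wpM2l.
rewrite mulrAC; apply: mean_le; first by meas.
by move=> y; have := hC (x - y) t; rewrite addrA.
Qed.

End mean.

End convolution.

Section product_sigma_finite.
Context {d1 d2 : measure_display} {T1 : measurableType d1} {T2 : measurableType d2} {R : realType}.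
Variables (m1 : {sigma_finite_measure set T1 -> \bar R}) (m2 : {sigma_finite_measure set T2 -> \bar R}).

(* The product measure under a name of its own, on which canonical inference finds the
   sigma-finite structure. *)
Definition prod_measure : set (T1 * T2) -> \bar R := (m1 \x m2)%E.

HB.instance Definition _ := Measure.copy prod_measure (m1 \x m2)%E.

Let prod_measure_sigma_finite : sigma_finite setT prod_measure.
Proof.
have /sigma_finiteP[F [FT ndF Foo]] := sigma_finiteT m1.
have /sigma_finiteP[G [GT ndG Goo]] := sigma_finiteT m2.
exists (fun i => F i `*` G i).
  rewrite -setXTT FT GT predeqE => -[x y]; split; last by move=> [k _ []]; split; exists k.
  move=> [/= [i _ Fix] [j _ Gjy]]; exists (maxn i j) => //; split.
  - by move: x Fix; exact/subsetPset/ndF/leq_maxl.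
  - by move: y Gjy; exact/subsetPset/ndG/leq_maxr.
move=> i; have [mF Fi] := Foo i; have [mG Gi] := Goo i; split; first exact: measurableX.
rewrite [prod_measure _]product_measure1E //.
by rewrite lte_mul_pinfty // ge0_fin_numE.
Qed.

HB.instance Definition _ := Measure_isSigmaFinite.Build _ _ _ prod_measure prod_measure_sigma_finite.

End product_sigma_finite.

(** * Mollification in the energy space *)

Section mollification.
Context {R : realType} {n : nat}.
Local Notation V := 'rV[R]_n.
Local Notation mu := (@lebesgue_rV R n).
Local Notation mu2 := (mu \x mu)%E.
Implicit Types (s : R) (f g u psi rho : V -> R) (F : V -> R -> R).

Lemma integral_shift (f : V -> \bar R) (a : V) : measurable_fun setT f ->
  (\int[mu]_x f (a + x)%R = \int[mu]_x f x)%E.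
Proof.
move=> mf.
have sh (g : V -> \bar R) : measurable_fun setT g -> (forall x, 0 <= g x)%E ->
    (\int[mu]_x g (a + x)%R = \int[mu]_x g x)%E.
  move=> mg g0; have := ge0_integral_affine a ltr01 mg g0.
  rewrite expr1n invr1 mul1e => <-; apply: eq_integral => x _; by rewrite scale1r.
rewrite integralE [RHS]integralE; congr (_ - _)%E.
  rewrite (_ : (fun x => f (a + x)%R)^\+%E = (fun x => f^\+ (a + x)%R)%E); last first.
    by apply/funext => x; rewrite !funeposE.
  by apply: sh; [exact: measurable_funepos|move=> x; exact: funepos_ge0].
rewrite (_ : (fun x => f (a + x)%R)^\-%E = (fun x => f^\- (a + x)%R)%E); last first.
  by apply/funext => x; rewrite !funenegE.
by apply: sh; [exact: measurable_funeneg|move=> x; exact: funeneg_ge0].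
Qed.

(* Jensen's inequality for the probability density [rho], from [2 m b - m^2 <= b^2]. *)
Lemma sqr_mean_le (psi rho : V -> R) (B : R) : measurable_fun setT psi -> measurable_fun setT rho ->
  (forall x, `|psi x| <= B) -> (forall x, 0 <= rho x) -> bd mu rho 1 ->
  (\int[mu]_x (rho x)%:E = 1)%E ->
  (((\int[mu]_x (psi x * rho x))%R ^+ 2)%:E <= \int[mu]_x (psi x ^+ 2 * rho x)%:E)%E.
Proof.
move=> mp mr pB r0 br r1; have B0 : 0 <= B by apply: le_trans (normr_ge0 (psi 0)) (pB 0).
have ir (g : V -> R) C : measurable_fun setT g -> (forall x, `|g x| <= C) ->
    mu.-integrable setT (EFin \o (fun x => g x * rho x)).
  move=> mg gC; have C0 : 0 <= C by apply: le_trans (normr_ge0 (g 0)) (gC 0).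
  apply: (@bd_integrable _ _ _ mu _ (C * 1)); last by meas.
  apply: (bd_le (bdZ C0 br)); [by meas|by move=> x; nn|move=> x].
  by rewrite normrM (ger0_norm (r0 x)); apply: ler_wpM2r.
have ip := ir psi B mp pB.
set M := (\int[mu]_x (psi x * rho x))%R.
have EM : (\int[mu]_x (psi x * rho x)%:E = M%:E)%E.
  by rewrite /M /Rintegral fineK //; exact: (integrable_fin_num measurableT ip).
have irho : mu.-integrable setT (EFin \o rho).
  by have := ir (fun=> 1) 1; rewrite normr1 => /(_ (measurable_cst _) (fun=> lexx _)); under eq_fun do rewrite mul1r.
have -> : (M ^+ 2)%:E = (\int[mu]_x ((2 * M * (psi x * rho x)) - M ^+ 2 * rho x)%:E)%E.
  transitivity ((2 * M)%:E * M%:E - (M ^+ 2)%:E * 1)%E; first by rewrite mule1 -EFinM -EFinB; congr EFin; ring.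
  rewrite -EM -r1 -!integralZl // -integralB //=; last 2 first.
  - exact: (integrableZl measurableT (2 * M) ip).
  - exact: (integrableZl measurableT (M ^+ 2) irho).
have i2 : mu.-integrable setT (EFin \o (fun x => psi x ^+ 2 * rho x)).
  apply: (ir _ (B ^+ 2)) => [|x]; first by meas.
  by rewrite normrX lerXn2r ?nnegrE.
apply: le_integral => //.
  have := integrableB measurableT (integrableZl measurableT (2 * M) ip) (integrableZl measurableT (M ^+ 2) irho).
  by apply: eq_integrable => // x _.
move=> x _; rewrite lee_fin; have := mulr_ge0 (sqr_ge0 (psi x - M)) (r0 x).
by rewrite !expr2; clear; lra.
Qed.

Section jensen.
Context {d1 : measure_display} {T1 : measurableType d1}.
Variables (m1 : {sigma_finite_measure set T1 -> \bar R}) (w : T1 -> R) (b : T1 * V -> R)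
  (rho : V -> R) (B e : R).
Hypotheses (mw : measurable_fun setT w) (w0 : forall p, 0 <= w p)
  (mb : measurable_fun setT b) (bB : forall p, `|b p| <= B)
  (mr : measurable_fun setT rho) (r0 : forall x, 0 <= rho x) (br : bd mu rho 1)
  (r1 : (\int[mu]_x (rho x)%:E = 1)%E)
  (mm : measurable_fun setT (fun p => (\int[mu]_z (b (p, z) * rho z))%R)).

Lemma bd_sqr_mean : bd (m1 \x mu)%E (fun p => w p.1 * b p ^+ 2 * rho p.2) e ->
  bd m1 (fun p => w p * (\int[mu]_z (b (p, z) * rho z))%R ^+ 2) e.
Proof.
move=> bf; apply: (bd_section_x bf).
- by apply: measurable_funM => //; exact: measurable_funX.
- by move=> p; apply: mulr_ge0 => //; exact: sqr_ge0.
move=> p /=; rewrite EFinM.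
have mbp : measurable_fun setT (fun z => b (p, z)).
  by apply: (measurableT_comp mb); exact: measurable_pair1.
have h := sqr_mean_le mbp mr (fun z => bB (p, z)) r0 br r1.
apply: le_trans (lee_wpmul2l _ h) _; first by rewrite lee_fin.
rewrite -ge0_integralZl ?lee_fin //.
- rewrite le_eqVlt; apply/orP; left; apply/eqP; apply: eq_integral => z _.
  by rewrite -EFinM mulrA.
- by apply/measurable_EFinP; apply: measurable_funM => //; exact: measurable_funX.
- by move=> z _; rewrite lee_fin; apply: mulr_ge0 => //; exact: sqr_ge0.
Qed.

Lemma bd_sqr_mean_unif : (forall z, bd m1 (fun p => w p * b (p, z) ^+ 2) e) ->
  bd m1 (fun p => w p * (\int[mu]_z (b (p, z) * rho z))%R ^+ 2) e.
Proof.
move=> bz; apply: bd_sqr_mean; rewrite -[e]mulr1.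
have mf : measurable_fun setT (fun p : T1 * V => w p.1 * b p ^+ 2 * rho p.2).
  apply: measurable_funM; last by apply: (measurableT_comp mr); exact: measurable_snd.
  apply: measurable_funM; last exact: measurable_funX.
  by apply: (measurableT_comp mw); exact: measurable_fst.
apply: (bd_prod_y (h := fun z => e * rho z) mf).
- by move=> p; rewrite mulr_ge0 // mulr_ge0 // sqr_ge0.
- by move=> z; rewrite mulrC; apply: (bd_ext (bdZ (r0 z) (bz z))) => p /=; rewrite mulrC.
by apply: bdZ => //; exact: bd_ge0 (bz 0).
Qed.

End jensen.

Definition density (d K : R) rho := [/\ measurable_fun setT rho, forall x, 0 <= rho x <= K,
  forall x, d <= `|x| -> rho x = 0 & (\int[mu]_x (rho x)%:E = 1)%E].

Definition moll psi rho (x : V) : R := (\int[mu]_z (psi (x + z) * rho z))%R.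

Lemma mollE psi rho x : measurable_fun setT psi -> measurable_fun setT rho ->
  moll psi rho x = mean psi (fun y => rho (y - x)).
Proof.
move=> mp mr; rewrite /moll /mean /Rintegral; congr fine.
rewrite -(@integral_shift (fun y => (psi y * rho (y - x))%:E) x).
  by apply: eq_integral => z _; rewrite [x + z - x]addrAC subrr add0r.
by apply/measurable_EFinP; meas.
Qed.

Section moll_bounds.
Variables (s d K B e : R) (psi rho : V -> R).
Hypotheses (s0 : 2^-1 <= s) (s1 : s < 1) (d0 : 0 < d) (d1 : d <= 1)
  (dr : density d (K * d ^- n) rho)
  (mp : measurable_fun setT psi) (pB : forall x, `|psi x| <= B) (ep : enb s psi e).

Let mr : measurable_fun setT rho. Proof. by case: dr. Qed.
Let r0 x : 0 <= rho x. Proof. by case: dr => _ /(_ x)/andP[]. Qed.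
Let br : bd mu rho 1.
Proof. by case: dr => _ _ _ E; split => //; rewrite E. Qed.
Let r1 : (\int[mu]_x (rho x)%:E = 1)%E. Proof. by case: dr. Qed.
Let B0 : 0 <= B. Proof. by apply: le_trans (normr_ge0 (psi 0)) (pB 0). Qed.

Let ir (g : V -> R) C : measurable_fun setT g -> (forall x, `|g x| <= C) ->
  mu.-integrable setT (EFin \o (fun x => g x * rho x)).
Proof.
move=> mg gC; have C0 : 0 <= C by apply: le_trans (normr_ge0 (g 0)) (gC 0).
apply: (@bd_integrable _ _ _ mu _ (C * 1)); last by meas.
apply: (bd_le (bdZ C0 br)); [by meas|by move=> x; nn|move=> x].
by rewrite normrM (ger0_norm (r0 x)); apply: ler_wpM2r.
Qed.

Lemma moll_le x : `|moll psi rho x| <= B.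
Proof.
have i1 := ir (g := fun z => psi (x + z)) (C := B) ltac:(by meas) (fun z => pB _).
apply: le_trans (le_normr_Rintegral measurableT i1) _; rewrite /Rintegral.
have b : bd mu (fun z => `|psi (x + z) * rho z|) (B * 1).
  apply: (bd_le (bdZ B0 br)); [by meas|by move=> z; nn|move=> z].
  by rewrite normrM (ger0_norm (r0 z)); apply: ler_wpM2r.
by have [c [-> _ ]] := bd_int b; rewrite mulr1.
Qed.

Lemma moll_sub x y : moll psi rho x - moll psi rho y =
  (\int[mu]_z ((psi (x + z) - psi (y + z)) * rho z))%R.
Proof.
rewrite /moll -RintegralB //; last 2 first.
- by apply: (ir (C := B)) => //; meas.
- by apply: (ir (C := B)) => //; meas.
by apply: eq_Rintegral => z _; rewrite mulrBl.
Qed.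

Lemma moll_subr x : moll psi rho x - psi x = (\int[mu]_z ((psi (x + z) - psi x) * rho z))%R.
Proof.
have E : psi x = (\int[mu]_z (psi x * rho z))%R.
  rewrite /Rintegral; under eq_integral do rewrite EFinM.
  rewrite integralZl // ?r1 ?mule1 //.
  by have := ir (g := fun=> 1) (C := 1) (measurable_cst _) ltac:(by move=> z; rewrite normr1); under eq_fun do rewrite mul1r.
rewrite {1}E {1}/moll -RintegralB //; last 2 first.
- by apply: (ir (C := B)) => //; meas.
- by apply: (ir (C := B)) => //; meas.
by apply: eq_Rintegral => z _; rewrite mulrBl.
Qed.

Hypothesis mm : measurable_fun setT (moll psi rho).

(** Differences of the mollification are averages of differences of translates; Jensen's inequality
    and translation invariance of the energy give the same bound. *)
Lemma moll_energy : enb s (moll psi rho) e.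
Proof.
have mJ := @measurable_J R n s.
pose w (z : V * V) : R := J s (z.1 - z.2).
pose b (p : (V * V) * V) : R := psi (p.1.1 + p.2) - psi (p.1.2 + p.2).
have m11 : measurable_fun setT (fun p : (V * V) * V => p.1.1).
  exact: (measurableT_comp measurable_fst measurable_fst).
have m12 : measurable_fun setT (fun p : (V * V) * V => p.1.2).
  exact: (measurableT_comp measurable_snd measurable_fst).
have m2 : measurable_fun setT (fun p : (V * V) * V => p.2) by exact: measurable_snd.
have mb : measurable_fun setT b.
  apply: measurable_funD.
    by apply: (measurableT_comp mp); exact: measurable_funDV.
  by apply: measurable_oppr_comp; apply: (measurableT_comp mp); exact: measurable_funDV.
have mw : measurable_fun setT w by rewrite /w; meas.
have w0 z : 0 <= w z by exact: J_ge0 (ltW s1).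
have bB p : `|b p| <= B + B by apply: le_trans (ler_normB _ _) _; exact: lerD.
have bE z : (\int[mu]_y (b (z, y) * rho y))%R = Df (moll psi rho) z.
  by rewrite /Df moll_sub.
have mm' : measurable_fun setT (fun z => (\int[mu]_y (b (z, y) * rho y))%R).
  by under eq_fun do rewrite bE; exact: measurable_Df.
have bz z : bd mu2 (fun p => w p * b (p, z) ^+ 2) e.
  have := bd_diag z ltr01 ep; rewrite !expr1n !invr1 !mul1r => bb; apply: (bd_ext bb) => p.
  have e1 : z + 1 *: p.1 - (z + 1 *: p.2) = p.1 - p.2 by rewrite !scale1r opprD addrACA subrr add0r.
  change (J s (p.1 - p.2) * (psi (p.1 + z) - psi (p.2 + z)) ^+ 2 =
    J s (z + 1 *: p.1 - (z + 1 *: p.2)) * (psi (z + 1 *: p.1) - psi (z + 1 *: p.2)) ^+ 2).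
  by rewrite e1 !scale1r ![z + _]addrC.
have h : bd mu2 (fun p => w p * (\int[mu]_z (b (p, z) * rho z))%R ^+ 2) e.
  exact: (@bd_sqr_mean_unif _ _ (prod_measure mu mu) w b rho (B + B) e mw w0 mb bB mr r0 br r1 mm' bz).
by apply: (bd_ext h) => z; rewrite bE.
Qed.

(** On its support the density is at most a multiple of [J], so the Jensen average is controlled by
    the energy. The factor 1/(1 - s) is harmless, as d is sent to 0 at fixed s. *)
Lemma moll_l2 : bd mu (fun x => (moll psi rho x - psi x) ^+ 2) (K * d * (1 - s)^-1 * e).
Proof.
have mJ := @measurable_J R n s.
pose c : R := (K * d ^- n) * (d `^ (n%:R + 2 * s) / (1 - s)).
have K0 : 0 <= K * d ^- n by have [_ /(_ 0)/andP[a b] _ _] := dr; exact: le_trans b.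
have s10 : 0 < (1 - s)^-1 by rewrite invr_gt0 subr_gt0.
have c0 : 0 <= c by rewrite /c mulr_ge0 // mulr_ge0 ?powR_ge0 // ltW.
have KE : K * d ^- n * d ^+ n = K by rewrite mulfVK // gt_eqF // exprn_gt0.
have cK : c <= K * d * (1 - s)^-1.
  rewrite /c mulrA; apply: ler_wpM2r; first exact: ltW.
  rewrite powRD; last by rewrite (gt_eqF d0) implybT.
  rewrite powR_mulrn ?(ltW d0) // mulrA KE; apply: ler_wpM2l.
    by rewrite -KE mulr_ge0 // exprn_ge0 // ltW.
  rewrite -[leRHS]powRr1 ?(ltW d0) //; apply: ger_powR; first by rewrite d0.
  by rewrite -ler_pdivrMl // mulr1.
pose b (p : V * V) : R := psi (p.1 + p.2) - psi p.1.
have mb : measurable_fun setT b by rewrite /b; meas.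
have bB p : `|b p| <= B + B by apply: le_trans (ler_normB _ _) _; exact: lerD.
have bE z : (\int[mu]_y (b (z, y) * rho y))%R = moll psi rho z - psi z.
  by rewrite moll_subr.
have mm' : measurable_fun setT (fun z => (\int[mu]_y (b (z, y) * rho y))%R).
  under eq_fun do rewrite bE.
  by apply: measurable_funD => //; exact: measurable_oppr_comp.
have ef : bd mu2 (fun p => c * (J s p.2 * b p ^+ 2)) (c * e).
  apply: (bd_ext (bdZ c0 (bd_shear ep))) => p; rewrite /Df /b /=.
  rewrite opprD addrA subrr sub0r JN; congr (_ * (_ * _)); ring.
have bf : bd mu2 (fun p => 1 * b p ^+ 2 * rho p.2) (c * e).
  apply: (bd_le ef).
  - by meas.
  - by move=> p; rewrite mul1r; nn.
  move=> p; rewrite mul1r; have [p0|p0] := eqVneq p.2 0.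
    rewrite /b p0 addr0 subrr expr0n mul0r mulr0; by rewrite mulr0.
  rewrite mulrC mulrA; apply: ler_wpM2r; first exact: sqr_ge0.
  have [_ /(_ p.2)/andP[_ rK] rz _] := dr.
  have j0 := J_ge0 p.2 (ltW s1).
  have [pd|pd] := leP d `|p.2|; first by rewrite rz // mulr_ge0.
  apply: le_trans rK _; rewrite /c -mulrA; apply: ler_peMr => //.
  have s00 : 0 <= s by apply: le_trans s0; rewrite invr_ge0.
  have p00 : 0 < `|p.2| by rewrite normr_gt0.
  have := J_lower s00 (ltW s1) p00 (ltW pd); rewrite powRN => h.
  rewrite mulrAC ler_pdivlMr ?subr_gt0 // mul1r -ler_pdivrMl ?powR_gt0 //.
  by rewrite mulrC.
have h : bd mu (fun p => 1 * (\int[mu]_z (b (p, z) * rho z))%R ^+ 2) (c * e).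
  have mw1 : measurable_fun setT (fun _ : V => 1 : R) by exact: measurable_cst.
  exact: (@bd_sqr_mean _ _ mu (fun=> 1) b rho (B + B) (c * e) mw1 (fun=> ler01) mb bB mr r0 br r1 mm' bf).
apply: (bd_ext (bdW h _)).
  by apply: ler_wpM2r => //; exact: bd_ge0 ep.
by move=> z; rewrite bE mul1r.
Qed.

End moll_bounds.

End mollification.

(** * From smooth tests to tests of finite energy *)

Section smooth_tests.
Context {R : realType} {n : nat}.
Local Notation V := 'rV[R]_n.
Local Notation mu := (@lebesgue_rV R n).
Local Notation mu2 := (mu \x mu)%E.
Implicit Types (s : R) (f g u psi rho phi : V -> R) (F : V -> R -> R).

Lemma bd_integral_le (P Q : V * V -> R) c : mu2.-integrable setT (EFin \o P) ->
  (forall z, P z <= Q z) -> bd mu2 Q c -> (\int[mu2]_z (P z)%:E <= c%:E)%E.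
Proof.
move=> iP PQ bQ; have [mQ Q0 Qc] := bQ; apply: le_trans Qc; apply: le_integral => //.
  apply: (@bd_integrable _ _ _ mu2 _ c) => //; apply: (bd_ext bQ) => z.
  by rewrite ger0_norm.
by move=> z _; rewrite lee_fin.
Qed.

(** Otherwise every region off the diagonal would carry at most c' - eps of the total c', and by
    Fatou's lemma so would their union. *)
Lemma energy_tail (g : V * V -> R) c eps : bd mu2 g c -> (forall x, g (x, x) = 0) -> 0 < eps ->
  exists2 d, 0 < d <= 1 & bd mu2 (fun z => (`|z.1 - z.2| < d)%R%:R * g z) eps.
Proof.
move=> bg gd e0; have [mg g0 _] := bg; have [c' [E bg' _]] := bd_int bg.
have [//|nd] := pselect (exists2 d, 0 < d <= 1 & bd mu2 (fun z => (`|z.1 - z.2| < d)%R%:R * g z) eps).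
have bh k : bd mu2 (fun z => (k.+1%:R^-1 <= `|z.1 - z.2|)%R%:R * g z) (c' - eps).
  have bf : bd mu2 (fun z => (`|z.1 - z.2| < k.+1%:R^-1)%R%:R * g z) c'.
    apply: (bd_le bg'); [by meas|by move=> z; nn|move=> z].
    by apply: ler_piMl => //; case: (_ < _).
  have [a [Ea ba _]] := bd_int bf.
  have ae : eps <= a.
    rewrite leNgt; apply/negP => ae; apply: nd; exists k.+1%:R^-1; last exact: bdW ba (ltW ae).
    by rewrite invr_gt0 ltr0n invf_le1 // ler1n.
  have b2 : bd mu2 (fun z => (k.+1%:R^-1 <= `|z.1 - z.2|)%R%:R * g z +
      (`|z.1 - z.2| < k.+1%:R^-1)%R%:R * g z) c'.
    apply: (bd_ext bg') => z; case: (leP k.+1%:R^-1 `|z.1 - z.2|) => _ /=.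
      by rewrite mul1r mul0r addr0.
    by rewrite mul1r mul0r add0r.
  apply: (bdW (bd_subr b2 _ _ _ _ Ea)); [by meas|by move=> z; nn|by meas|by move=> z; nn|].
  by rewrite lerD2l lerN2.
have bl : bd mu2 g (c' - eps).
  apply: (bd_fatou bh mg g0); apply: aeW => -[x y].
  have [->|xy] := eqVneq x y.
    by rewrite gd; under eq_fun do rewrite mulr0; exact: cvg_cst.
  apply: cvg_near_cst; have xy0 : 0 < `|x - y| by rewrite normr_gt0 subr_eq0.
  have [N _ HN] := near_infty_natSinv_lt (PosNum xy0).
  exists N => // k Nk /=; have /= h := HN k Nk.
  by rewrite (ltW h) mul1r.
have : c' <= c' - eps by apply: (bd_lower bl); rewrite E.
by move=> h; exfalso; move: h e0; clear; lra.
Qed.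

Lemma far_energy (L CJ s d m : R) g : 2^-1 <= s -> s < 1 -> 0 < d -> d <= 1 ->
  bd mu (fun z : V => J s z * Num.min 1 (`|z| ^+ 2)) CJ -> measurable_fun setT g ->
  bd mu (fun x => g x ^+ 2) m ->
  bd mu2 (fun z => (d <= `|z.1 - z.2|)%R%:R * (J s (z.1 - z.2) * Df g z ^+ 2)) (4 * (CJ / d ^+ 2) * m).
Proof.
move=> s0 s1 d0 d1 bJ mg bg; have mJ := @measurable_J R n s; have mDg := measurable_Df mg.
have d20 : 0 < d ^+ 2 by rewrite exprn_gt0.
have bt : bd mu (fun z : V => (d <= `|z|)%R%:R * J s z) (CJ / d ^+ 2).
  have di : 0 <= (d ^+ 2)^-1 by rewrite invr_ge0 ltW.
  apply: (bd_le (bdW (bdZ di bJ) _)); [|by meas|by move=> z; have := J_ge0 z (ltW s1) => j0; nn|].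
    by rewrite mulrC.
  move=> z; have j0 := J_ge0 z (ltW s1).
  case: (leP d `|z|) => dz /=; last by rewrite mul0r; nn.
  rewrite mul1r mulrCA; apply: ler_peMr => //; rewrite -ler_pdivrMl ?invr_gt0 // invrK mulr1.
  rewrite le_min exprn_ile1 ?(ltW d0) //=.
  by rewrite lerXn2r ?nnegrE // ltW.
have b1 := bd_convolution bg bt; have b2 := bd_swap b1.
apply: (bd_le (bdW (bdZ (ler0n _ 2) (bdD b1 b2)) _)).
- by rewrite le_eqVlt; apply/orP; left; apply/eqP; ring.
- by meas.
- by move=> z; have := J_ge0 (z.1 - z.2) (ltW s1) => j0; nn.
move=> z /=; rewrite [`|z.2 - z.1|]distrC [J s (z.2 - z.1)]JB /Df.
have := J_ge0 (z.1 - z.2) (ltW s1); move: (J s _) => j j0.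
case: (d <= _) => /=; last by rewrite !mul0r !mulr0 addr0 mulr0.
rewrite !mul1r; have := mulr_ge0 j0 (sqr_ge0 (g z.1 + g z.2)).
by move: (g z.1) (g z.2) => p q; rewrite !expr2; clear; lra.
Qed.

(** Young's inequality with two weights: [K] near the diagonal, where the energy [t] of u is small
    while that of g is only bounded, and [eta] elsewhere, where the energy of g is controlled by its
    square integral. *)
Lemma form_small (L CJ s d t K eta eu eg m : R) F u g : (0 < n)%N -> 1 <= L -> 2^-1 <= s -> s < 1 ->
  bd mu (fun z : V => J s z * Num.min 1 (`|z| ^+ 2)) CJ -> flux L s F ->
  measurable_fun setT u -> measurable_fun setT g -> enb s u eu -> enb s g eg ->
  bd mu (fun x => g x ^+ 2) m -> 0 < d -> d <= 1 -> 0 < K -> 0 < eta ->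
  bd mu2 (fun z => (`|z.1 - z.2| < d)%R%:R * (J s (z.1 - z.2) * Df u z ^+ 2)) t ->
  (form F u g <= (L * (K * t + K^-1 * eg + eta * eu + eta^-1 * (4 * (CJ / d ^+ 2) * m)))%:E)%E.
Proof.
move=> n0 L1 s0 s1 bJ fF mu_ mg bu bg b2 d0 d1 K0 e0 bt.
have L0 : 0 <= L by apply: le_trans L1.
have Ki : 0 < K^-1 by rewrite invr_gt0.
have ei : 0 < eta^-1 by rewrite invr_gt0.
have bf := far_energy L s0 s1 d0 d1 bJ mg b2.
apply: (bd_integral_le (form_integrable L1 (ltW s1) fF mu_ mg bu bg) _
  (bdZ L0 (bdD (bdD (bdD (bdZ (ltW K0) bt) (bdZ (ltW Ki) bg)) (bdZ (ltW e0) bu)) (bdZ (ltW ei) bf)))).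
move=> z; have j0 := J_ge0 (z.1 - z.2) (ltW s1).
apply: le_trans (ler_norm _) _; rewrite normrM.
apply: le_trans (ler_wpM2r (normr_ge0 _) (flux_le (z.1 - z.2) (Df u z) L1 (ltW s1) fF)) _.
set j := J s (z.1 - z.2) in j0 *; clearbody j.
have -> : L * j * `|Df u z| * `|Df g z| = L * (j * (`|Df u z| * `|Df g z|)) by ring.
apply: ler_wpM2l => //.
have young (k : R) : 0 < k -> `|Df u z| * `|Df g z| <= k * Df u z ^+ 2 + k^-1 * Df g z ^+ 2.
  move=> k0; rewrite -(real_normK (num_real (Df u z))) -(real_normK (num_real (Df g z))).
  move: (`|Df u z|) (`|Df g z|) (normr_ge0 (Df u z)) (normr_ge0 (Df g z)) => a b a0 b0.
  rewrite -(ler_pM2l k0) mulrDr [k * (k^-1 * _)]mulrA mulfV ?mul1r ?gt_eqF //.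
  have := sqr_ge0 (k * a - b); have : 0 <= k * (a * b) by rewrite !mulr_ge0 // ltW.
  by rewrite !expr2; clear; lra.
have a0 := sqr_ge0 (Df u z); have b0 := sqr_ge0 (Df g z).
have := young K K0; have := young eta e0.
have k1 := mulr_ge0 (ltW K0) a0; have k2 := mulr_ge0 (ltW Ki) b0.
have k3 := mulr_ge0 (ltW e0) a0; have k4 := mulr_ge0 (ltW ei) b0.
move=> /(ler_wpM2l j0) y1 /(ler_wpM2l j0) y2.
have {}k1 := mulr_ge0 j0 k1; have {}k2 := mulr_ge0 j0 k2.
have {}k3 := mulr_ge0 j0 k3; have {}k4 := mulr_ge0 j0 k4.
move: (`|Df u z| * `|Df g z|) (Df u z ^+ 2) (Df g z ^+ 2) y1 y2 k1 k2 k3 k4 => ab p q y1 y2 k1 k2 k3 k4.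
case: (ltP `|z.1 - z.2| d) => _ /=; rewrite ?mul1r ?mul0r ?mulr0 ?addr0 ?add0r.
  by move: y2 k3; clear; lra.
by move: y1 k2; clear; lra.
Qed.

Lemma exists_density : (0 < n)%N -> exists2 K : R, 0 <= K & forall d, 0 < d ->
  exists rho, [/\ density d (K * d ^- n) rho, forall k, Cb k rho & forall x, rho (- x) = rho x].
Proof.
move=> n0; have mb (a : R) : measurable_fun setT (bump (n := n) a).
  by apply: bounded_lip_measurable; exact: Cb_lip (Cb_bump 0 a).
have b1 : bd mu (bump 1) (2 ^+ n).
  have := bd_cube (n := n) (@ltr01 R); rewrite mulr1 => b.
  apply: (bd_le b) => //; first by move=> x; exact: bump_ge0.
  move=> x; case: (ltP `|x| 1) => x1 /=; first exact: bump_le1.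
  by rewrite bump_eq0 // invr1.
have [A [EA _ _]] := bd_int b1.
have A0 : 0 <= A.
  by rewrite -lee_fin -EA; apply: integral_ge0 => x _; rewrite lee_fin bump_ge0.
have {}A0 : 0 < A.
  rewrite lt_neqAle A0 andbT; apply/eqP => A00.
  have bz : bd mu (bump 1) 0 by split => //; [move=> x; exact: bump_ge0|rewrite EA -A00].
  have ae0 := bd_ae0 bz.
  have bc : bd mu (fun x : V => (`|x| < 1)%R%:R) 0.
    apply: (bd_ae_le (bd0 mu)); [by meas|by move=> x; exact: ler0n|].
    apply: filterS ae0 => x bx; case: (ltP `|x| 1) => //= x1.
    by have := bump_gt0 ltr01 (x := x); rewrite invr1 bx ltxx => /(_ x1).
  have := bd_lower bc (cube_lower (n := n) (@ltr01 R)); by rewrite expr1n ler10.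
have Ai : 0 < A^-1 by rewrite invr_gt0.
exists A^-1; first exact: ltW.
move=> d d0; have di : 0 < d^-1 by rewrite invr_gt0.
have dn : 0 < d ^- n by rewrite invr_gt0 exprn_gt0.
exists (fun x => A^-1 * d ^- n * bump d^-1 x); split.
- split; first by have := mb d^-1 => mbd; meas.
  + move=> x; apply/andP; split; first by rewrite !mulr_ge0 ?bump_ge0 // ltW.
    by apply: ler_piMr; [rewrite mulr_ge0 // ltW|exact: bump_le1].
  + by move=> x xd; rewrite bump_eq0 ?mulr0 // invrK.
  have := @ge0_integral_affine R n 0 d^-1 (fun x => (bump 1 x)%:E) di.
  rewrite EA => /(_ _ _) h.
  under eq_integral do rewrite EFinM.
  rewrite ge0_integralZl //; last 3 first.
  + by apply/measurable_EFinP; exact: mb.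
  + by move=> x _; rewrite lee_fin bump_ge0.
  + by rewrite lee_fin mulr_ge0 // ltW.
  rewrite (_ : (\int[mu]_x (bump d^-1 x)%:E)%E = (d^-1 ^- n * A)%:E).
    rewrite -EFinM exprVn invrK mulrA; congr EFin; field.
    by rewrite !gt_eqF // exprn_gt0.
  rewrite EFinM -h; last 2 first.
  + by apply/measurable_EFinP; exact: mb.
  + by move=> x; rewrite lee_fin bump_ge0.
  by apply: eq_integral => x _; rewrite add0r bumpZ mul1r.
- by move=> k; apply: CbZ; exact: Cb_bump.
by move=> x; rewrite bumpN.
Qed.

(** Mollifications keep the bound [B] and enlarge the support to at most 2 r, so [hM] applies to
    them. The error psi - moll psi is small in L^2 but merely bounded in energy, which is what
    [form_small] can handle. *)
Lemma form_le_smooth (L s r B M e : R) F u psi (x0 : V) : (2 <= n)%N -> 1 <= L -> 2^-1 <= s -> s < 1 ->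
  flux L s F -> measurable_fun setT u -> (exists c, enb s u c) ->
  measurable_fun setT psi -> (forall x, `|psi x| <= B) -> 0 < r ->
  (forall x, r <= `|x - x0| -> psi x = 0) -> enb s psi e ->
  (forall phi, (forall k, Cb k phi) -> (forall x, `|phi x| <= B) ->
     (forall x, 2 * r <= `|x - x0| -> phi x = 0) -> (form F u phi <= M%:E)%E) ->
  (form F u psi <= M%:E)%E.
Proof.
move=> n2 L1 s0 s1 fF mu_ [eu bu] mp pB r0 pz ep hM; have n0 : (0 < n)%N by apply: leq_trans n2.
have B0 : 0 <= B by apply: le_trans (normr_ge0 (psi 0)) (pB 0).
have [CJ CJ0 hJ] := J_quadratic (R := R) n2; have bJ := hJ s s0 s1.
have [Kd Kd0 hd] := exists_density n0.
have L0 : 0 < L by apply: lt_le_trans L1.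
have eu0 := bd_ge0 bu; have e0 := bd_ge0 ep.
have mJ := @measurable_J R n s; have mDu := measurable_Df mu_.
have bpsi : bd mu (fun x => `|psi x|) (B * (2 * r) ^+ n).
  apply: (bd_le (bdZ B0 (bd_cube_at x0 r0))); [by meas|by move=> x; nn|move=> x].
  case: (ltP `|x - x0| r) => xr /=; first by rewrite mulr1.
  by rewrite pz // normr0 mulr0.
apply/lee_addgt0Pr => eps eps0.
(* Order of choices: the weights [K] and [eta], next the distance [d] from the diagonal depending on
   [K], and finally the mollification radius [dd]; each accounts for a quarter of [eps]. *)
pose K := 16 * L * (e + 1) / eps.
have e10 : 0 < e + 1 by rewrite ltr_wpDl.
have K0 : 0 < K by rewrite divr_gt0 // !mulr_gt0.
have KE : K = 16 * L * (e + 1) / eps by [].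
clearbody K.
pose eta := eps / (4 * L * (eu + 1)).
have eu10 : 0 < eu + 1 by rewrite ltr_wpDl.
have et0 : 0 < eta by rewrite divr_gt0 // !mulr_gt0.
have etE : eta = eps / (4 * L * (eu + 1)) by [].
clearbody eta.
have t0 : 0 < eps / (4 * L * K) by rewrite divr_gt0 // !mulr_gt0.
have gd (x : V) : J s ((x, x).1 - (x, x).2) * Df u (x, x) ^+ 2 = 0.
  by rewrite /Df /= !subrr expr0n mulr0.
have [d /andP[d0 d1] bt] := energy_tail bu gd t0.
pose X : R := 4 * (CJ / d ^+ 2) * (Kd * (1 - s)^-1 * e).
have X0 : 0 <= X.
  by rewrite /X !mulr_ge0 ?invr_ge0 ?exprn_ge0 ?subr_ge0 // ltW.
pose Y := 4 * L * eta^-1 * (X + 1).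
have Y0 : 0 < Y by rewrite /Y !mulr_gt0 ?invr_gt0 // ltr_wpDl.
pose dd := Num.min (Num.min 1 r) (eps / Y).
have dd0 : 0 < dd by rewrite !lt_min ltr01 r0 divr_gt0.
have dd1 : dd <= 1 by rewrite !ge_min lexx.
have ddr : dd <= r by rewrite !ge_min lexx orbT.
have ddY : dd <= eps / Y by rewrite !ge_min lexx orbT.
clearbody dd.
have [rho [dr cr rN]] := hd dd dd0.
have mr : measurable_fun setT rho by case: dr.
have mollC k : Cb k (moll psi rho).
  have := conv_Cb mp bpsi (cr k); rewrite (_ : (fun x => _) = moll psi rho) //.
  apply/funext => x; rewrite mollE //; congr (mean _ _); apply/funext => y.
  by rewrite -rN opprB.
have mm : measurable_fun setT (moll psi rho).
  by apply: bounded_lip_measurable; exact: Cb_lip (mollC 0%N).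
have em := moll_energy s1 dr mp pB ep mm.
have l2 := moll_l2 s0 s1 dd0 dd1 dr mp pB ep mm.
have h1 := hM (moll psi rho) mollC (moll_le dr mp pB).
have {}h1 : (form F u (moll psi rho) <= M%:E)%E.
  apply: h1 => x xr; rewrite /moll /Rintegral (_ : (\int[mu]_z _)%E = 0%E) //.
  apply: integral0_eq => z _; congr EFin.
  have [zd|zd] := leP dd `|z|; first by have [_ _ -> // _] := dr; rewrite mulr0.
  rewrite pz ?mul0r //; have := ler_normB (x + z - x0) z.
  by rewrite addrAC addrK; move: xr zd ddr; clear; lra.
have mg : measurable_fun setT (fun x => psi x - moll psi rho x) by meas.
have eg := enbB (ltW s1) ep em mp mm.
have l2' : bd mu (fun x => (psi x - moll psi rho x) ^+ 2) (Kd * dd * (1 - s)^-1 * e).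
  by apply: (bd_ext l2) => x; rewrite -sqrrN opprB.
have h2 := form_small n0 L1 s0 s1 bJ fF mu_ mg bu eg l2' d0 d1 K0 et0 bt.
have i1 := form_integrable L1 (ltW s1) fF mu_ mm bu em.
have i2 := form_integrable L1 (ltW s1) fF mu_ mg bu eg.
have -> : form F u psi = (form F u (moll psi rho) + form F u (fun x => psi x - moll psi rho x)%R)%E.
  have := integralD measurableT i1 i2; rewrite /= => E.
  rewrite /form -E; apply: eq_integral => z _; rewrite -EFinD -mulrDr; congr (_ * _)%:E.
  by rewrite /Df; ring.
apply: leeD => //; apply: le_trans h2 _; rewrite lee_fin.
have t1 : L * (K * (eps / (4 * L * K))) = eps / 4 by field; rewrite !gt_eqF.
have t2 : L * (K^-1 * (2 * (e + e))) <= eps / 4.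
  have -> : L * (K^-1 * (2 * (e + e))) = eps / 4 * (e / (e + 1)).
    by rewrite KE; field; rewrite !gt_eqF.
  by apply: ler_piMr; [rewrite divr_ge0 // ltW|rewrite ler_pdivrMr // mul1r lerDl].
have t3 : L * (eta * eu) <= eps / 4.
  have -> : L * (eta * eu) = eps / 4 * (eu / (eu + 1)).
    by rewrite etE; field; rewrite !gt_eqF.
  by apply: ler_piMr; [rewrite divr_ge0 // ltW|rewrite ler_pdivrMr // mul1r lerDl].
have t4 : L * (eta^-1 * (4 * (CJ / d ^+ 2) * (Kd * dd * (1 - s)^-1 * e))) <= eps / 4.
  have -> : L * (eta^-1 * (4 * (CJ / d ^+ 2) * (Kd * dd * (1 - s)^-1 * e))) = L * eta^-1 * X * dd.
    by rewrite /X; ring.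
  apply: (@le_trans _ _ (Y / 4 * (eps / Y))).
    have ei0 : 0 <= eta^-1 by rewrite invr_ge0 ltW.
    apply: ler_pM => //; [by apply: mulr_ge0 => //; apply: mulr_ge0 => //; exact: ltW|exact: ltW|].
    have -> : Y / 4 = L * eta^-1 * (X + 1) by rewrite /Y; field; rewrite gt_eqF.
    by apply: ler_wpM2l; [rewrite mulr_ge0 // ltW|rewrite lerDl].
  by rewrite le_eqVlt; apply/orP; left; apply/eqP; field; rewrite gt_eqF.
rewrite 3![L * (_ + _)]mulrDr t1; move: t2 t3 t4.
by move: (L * (K^-1 * _)) (L * (eta * eu)) (L * (eta^-1 * _)) => a b c; clear; lra.
Qed.

End smooth_tests.

(** * Excess decay and the series of slopes *)

Section excess_decay.
Context {R : realType} {n : nat}.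
Local Notation V := 'rV[R]_n.
Local Notation mu := (@lebesgue_rV R n).
Local Notation mu2 := (mu \x mu)%E.
Implicit Types (s : R) (f u v w psi : V -> R) (F G : V -> R -> R).

(** Affine functions have excess 0 since their increments are constant; this measures the distance
    to them before any gradient is known. *)
Definition excess s w (E : R) := forall h : V, `|h| <= 1 ->
  exists c, bd mu (fun x => `|incr h w x - c| * om s x) E.

Lemma bd_weight s f c : 0 <= s -> measurable_fun setT f -> bd mu (fun x => `|f x|) c ->
  bd mu (fun x => `|f x| * om s x) c.
Proof.
move=> s0 mf bf; have mom := @measurable_om R n s.
apply: (bd_le bf); [by meas|by move=> x; nn|move=> x].
by apply: ler_piMr => //; exact: om_le1.
Qed.

Lemma excess_perturb s w w' E d h c : 0 <= s -> measurable_fun setT w -> measurable_fun setT w' ->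
  bd mu (fun x => `|w' x - w x|) d -> bd mu (fun x => `|incr h w x - c| * om s x) E ->
  bd mu (fun x => `|incr h w' x - c| * om s x) (E + 2 * d).
Proof.
move=> s0 mw mw' bd' bE; have mom := @measurable_om R n s.
have mi := measurable_incr h mw; have mi' := measurable_incr h mw'.
have md : measurable_fun setT (fun x => w' x - w x) by meas.
have b1 := bd_weight s0 md bd'.
have b2 := bd_weight s0 (_ : measurable_fun setT (fun x => w' (h + x) - w (h + x))) (bd_shift h bd').
apply: (bd_le (bdW (bdD bE (bdD (b2 _) b1)) _)); [by meas|by rewrite mulr2n mulrDl mul1r|by meas|by move=> x; nn|].
move=> x; rewrite -!mulrDl; apply: ler_wpM2r; first exact: om_ge0.
have -> : incr h w' x - c = (incr h w x - c) + ((w' (h + x) - w (h + x)) - (w' x - w x)) by rewrite /incr; ring.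
by apply: le_trans (ler_normD _ _) _; rewrite lerD2l; exact: ler_normB.
Qed.

(** The comparison solution gains the factor rho/4 by [homogeneous_decay]; passing from [u] to it
    and back costs its L^1 distance to [u]. *)
Lemma one_step (L s0 : R) : (2 <= n)%N -> 1 <= L -> 2^-1 < s0 -> s0 < 1 ->
  exists (N : nat) (C : R), [/\ (0 < N)%N, 0 < C &
    forall s F G u E M, s0 <= s -> s < 1 -> flux L s F -> potential L s F G ->
    measurable_fun setT u -> (exists c, enb s u c) -> loc2 u -> 0 < E -> 0 <= M ->
    (forall psi, H0 s 1 psi -> (forall x, `|psi x| <= 1) -> (form F u psi <= M%:E)%E) ->
    excess s u E -> excess s (fun x => u (0 + 2^-1 ^+ N *: x)) (2^-1 ^+ N * (E / 2 + C * M))].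
Proof.
move=> n2 L1 s0h s01; have n0 : (0 < n)%N by apply: leq_trans n2.
have [CJ _ hJ] := J_quadratic (R := R) n2.
have q0 : (0 : R) < 4^-1 by [].
have [N N0 hN] := homogeneous_decay n2 L1 hJ s0h s01 q0.
have [C1 C10 hC] := comparison_estimate n2 L1 (R := R).
pose rho : R := 2^-1 ^+ N; have rhoE : 2^-1 ^+ N = rho by [].
have rho0 : 0 < rho by rewrite exprn_gt0.
rewrite rhoE in hN; clearbody rho.
pose C : R := 4^-1 * 2 * C1 + rho^-1 * (2 * (rho ^- n * C1)).
have C0 : 0 < C.
  by rewrite /C addr_gt0 // !mulr_gt0 // ?invr_gt0 // exprn_gt0.
exists N, C; split => //.
move=> s F G u E M s0s s1 fF pG mu_ eu lu E0 M0 hM exc; rewrite rhoE.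
have sh : 2^-1 <= s by clear - s0h s0s; lra.
have s00 : 0 <= s by clear - sh; lra.
have [v sv hv] := exists_solution n0 L1 sh s1 fF pG mu_ eu lu.
(* [comparison_estimate] needs a positive mass while [M] may vanish; the addition costs a quarter of
   E, and together with the decay of v this makes E/2. *)
pose M' := M + E / (4 * C).
have M'0 : 0 < M' by rewrite /M' ltr_wpDl // divr_gt0 // mulr_gt0.
have hM' psi : H0 s 1 psi -> (forall x, `|psi x| <= 1) -> (form F u psi <= M'%:E)%E.
  move=> hp p1; apply: le_trans (hM _ hp p1) _; rewrite lee_fin lerDl.
  by rewrite divr_ge0 // ltW // mulr_gt0.
have bw := hC s F u v M' sh s1 fF mu_ eu sv hv M'0 hM'.
have [mv _ _ _] := sv.
have bw' : bd mu (fun x => `|v x - u x|) (C1 * M') by apply: (bd_ext bw) => x; rewrite distrC.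
have E'0 : 0 < E + 2 * (C1 * M') by rewrite addr_gt0 // !mulr_gt0.
have ev h : `|h| <= 1 -> exists c, bd mu (fun x => `|incr h v x - c| * om s x) (E + 2 * (C1 * M')).
  by move=> /exc[c bc]; exists c; exact: excess_perturb bc.
move=> h hh; have [c bc] := hN s F v _ s0s s1 fF sv E'0 ev h hh.
exists c.
have ma := measurable_affine (0 : V) rho.
have mvr : measurable_fun setT (fun x : V => v (0 + rho *: x)) by meas.
have mur : measurable_fun setT (fun x : V => u (0 + rho *: x)) by meas.
apply: (bdW (excess_perturb s00 mvr mur (bd_affine (0 : V) rho0 bw) bc)).
rewrite le_eqVlt; apply/orP; left; apply/eqP.
rewrite /M'; have Cn : C != 0 by rewrite gt_eqF.
have -> : rho * (E / 2 + C * M) = rho * (4^-1 * E + C * (M + E / (4 * C))) by field.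
have CE : rho * C = 4^-1 * rho * 2 * C1 + 2 * (rho ^- n * C1).
  by rewrite /C; field; rewrite !gt_eqF // exprn_gt0.
move: (M + E / (4 * C)) => X; transitivity (4^-1 * rho * E + rho * C * X); last by ring.
by rewrite CE; ring.
Qed.

Lemma potential_rescale (L s r : R) F G : 0 < r -> potential L s F G ->
  potential L s (rescale_flux s r F) (rescale_flux s r G).
Proof.
move=> r0 [mG G0 Gk]; have p0 : 0 < r `^ (n%:R + 2 * s) by rewrite powR_gt0.
split.
- have mg : measurable_fun setT (fun p : V * measurableTypeR R => G (r *: p.1) p.2).
    apply: (@measurableT_comp _ _ _ _ _ _ (fun p : V * measurableTypeR R => G p.1 p.2) _
      (fun p : V * measurableTypeR R => (r *: p.1, p.2))) => //.
    by apply: measurable_fun_pair; [meas|exact: measurable_snd].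
  by apply: measurable_funM; [exact: measurable_cst|].
- by move=> zeta; rewrite /rescale_flux G0 mulr0.
move=> zeta t t'; have h := Gk (r *: zeta) t t'.
have JE : J s zeta = r `^ (n%:R + 2 * s) * J s (r *: zeta).
  by rewrite JZ ?(ltW r0) // mulrA powRN mulfV ?mul1r // gt_eqF.
have := ler_wpM2l (ltW p0) h; rewrite /rescale_flux JE.
move: (r `^ _) (J s _) (G _ _) (G _ _) (F _ _) => p j a b c.
have -> : p * ((2 * L)^-1 * j * (t' - t) ^+ 2) = (2 * L)^-1 * (p * j) * (t' - t) ^+ 2 by ring.
have -> // : p * (b - a - c * (t' - t)) = p * b - p * a - p * c * (t' - t) by ring.
Qed.

(** An integral over the unit cube rather than a mean; the volume is divided out only in the
    limit. *)
Definition slope h w : R := (\int[mu]_x ((`|x| < 1)%R%:R * incr h w x))%R.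

Lemma excess_cube s w E h c (r : R) : 2^-1 <= s -> s < 1 -> 0 < r -> measurable_fun setT w ->
  bd mu (fun x => `|incr h w x - c| * om s x) E ->
  bd mu (fun x => (`|x| <= r)%R%:R * `|incr h w x - c|) ((1 + r) ^+ (n + 2) * E).
Proof.
move=> s0 s1 r0 mw b; have mi := measurable_incr h mw.
by apply: (om_unweight s0 s1 r0 _ b); meas.
Qed.

Lemma cube_integral (f : V -> R) (c E : R) : measurable_fun setT f ->
  bd mu (fun x => (`|x| < 1)%R%:R * `|f x - c|) E ->
  `|(\int[mu]_x ((`|x| < 1)%R%:R * f x))%R - c * (\int[mu]_x ((`|x| < 1)%R%:R : R))%R| <= E.
Proof.
move=> mf bE; have b1 := bd_cube (n := n) (@ltr01 R); rewrite mulr1 in b1.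
have mc : measurable_fun setT (fun x : V => (`|x| < 1)%R%:R : R) by meas.
have i1 : mu.-integrable setT (EFin \o (fun x : V => c * (`|x| < 1)%R%:R)).
  apply: (@bd_integrable _ _ _ mu _ (`|c| * 2 ^+ n)); last by meas.
  apply: (bd_ext (bdZ (normr_ge0 c) b1)) => x.
  by rewrite normrM (ger0_norm (ler0n _ _)).
have i0 : mu.-integrable setT (EFin \o (fun x : V => (`|x| < 1)%R%:R : R)).
  apply: (@bd_integrable _ _ _ mu _ (2 ^+ n)) => //; apply: (bd_ext b1) => x.
  by rewrite ger0_norm.
have i2 : mu.-integrable setT (EFin \o (fun x : V => (`|x| < 1)%R%:R * f x)).
  apply: (@bd_integrable _ _ _ mu _ (E + `|c| * 2 ^+ n)); last by meas.
  apply: (bd_le (bdD bE (bdZ (normr_ge0 c) b1))); [by meas|by move=> x; nn|move=> x].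
  rewrite normrM (ger0_norm (ler0n _ _)) [`|c| * _]mulrC -mulrDr; apply: ler_wpM2l; first exact: ler0n.
  by have := ler_normD (f x - c) c; rewrite subrK.
rewrite -RintegralZl // -RintegralB //.
have i3 : mu.-integrable setT (EFin \o (fun x : V => (`|x| < 1)%R%:R * f x - c * (`|x| < 1)%R%:R)).
  by have := integrableB measurableT i2 i1; apply: eq_integrable => // x _.
apply: le_trans (le_normr_Rintegral measurableT i3) _; rewrite /Rintegral.
have b3 : bd mu (fun x => `|(`|x| < 1)%R%:R * f x - c * (`|x| < 1)%R%:R|) E.
  apply: (bd_ext bE) => x.
  by rewrite [c * _]mulrC -mulrBr normrM (ger0_norm (ler0n _ _)).
by have [a [-> _ ]] := bd_int b3.
Qed.

Lemma slope_le s w E h : 2^-1 <= s -> s < 1 -> measurable_fun setT w ->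
  bd mu (fun x => `|incr h w x| * om s x) E -> `|slope h w| <= 2 ^+ (n + 2) * E.
Proof.
move=> s0 s1 mw b; have mi := measurable_incr h mw.
have b' : bd mu (fun x => `|incr h w x - 0| * om s x) E by apply: (bd_ext b) => x; rewrite subr0.
have bc := excess_cube s0 s1 ltr01 mw b'.
have := @cube_integral (incr h w) 0 (2 ^+ (n + 2) * E) mi; rewrite mul0r subr0; apply.
apply: (bd_le bc); [by meas|by move=> x; nn|move=> x].
by apply: ler_wpM2r => //; rewrite ler_nat; case: (ltP `|x| 1) => // x1; rewrite (ltW x1).
Qed.

(** The step h is reached by 2^N steps rho h, and each of their increments is close to the same
    constant c. So the slope of [w] is close to 2^N c and that of the rescaled function to c, up to
    the volume of the cube. *)
Lemma slope_scale s w E h (N : nat) : 2^-1 <= s -> s < 1 -> measurable_fun setT w -> `|h| <= 1 ->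
  excess s w E ->
  `|slope h (fun x => w (0 + 2^-1 ^+ N *: x)) - 2^-1 ^+ N * slope h w| <=
    ((2^-1 ^+ N) ^- n * 2 ^+ (n + 2) + 3 ^+ (n + 2)) * E.
Proof.
move=> s0 s1 mw h1 exc; set rho : R := 2^-1 ^+ N.
have rho0 : 0 < rho by rewrite exprn_gt0.
have rho1 : rho <= 1 by rewrite exprn_ile1 // ?invr_ge0 // invf_le1 // ler1n.
have [|c bc] := exc (rho *: h); first by rewrite normVZ ?(ltW rho0) // mulr_ile1 // ltW.
have ma := measurable_affine (0 : V) rho.
have mwr : measurable_fun setT (fun x : V => w (0 + rho *: x)) by meas.
have mi := measurable_incr h mw; have mi1 := measurable_incr h mwr; have mi2 := measurable_incr (rho *: h) mw.
pose kap := (\int[mu]_x ((`|x| < 1)%R%:R : R))%R.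
have e1 : `|slope h (fun x => w (0 + rho *: x)) - c * kap| <= rho ^- n * (2 ^+ (n + 2) * E).
  apply: cube_integral => //; have b := bd_affine (0 : V) rho0 (excess_cube s0 s1 ltr01 mw bc).
  apply: (bd_le b); [by meas|by move=> x; nn|move=> x].
  have -> : incr h (fun x => w (0 + rho *: x)) x = incr (rho *: h) w (0 + rho *: x).
    by rewrite /incr !add0r scalerDr.
  apply: ler_wpM2r => //; rewrite ler_nat; case: (ltP `|x| 1) => // x1.
  rewrite add0r normVZ ?(ltW rho0) // (_ : rho * `|x| <= 1) //.
  by apply: mulr_ile1 => //; rewrite ?ltW.
have e2 : `|slope h w - ((2 ^ N)%N%:R * c) * kap| <= (2 ^ N)%N%:R * (3 ^+ (n + 2) * E).
  apply: cube_integral => //.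
  have b3 := excess_cube s0 s1 (ltr0Sn R 1) mw bc.
  have sumE k x : incr ((k%:R * rho) *: h) w x = \sum_(0 <= j < k) incr (rho *: h) w ((j%:R * rho) *: h + x).
    elim: k => [|k IH]; first by rewrite big_nil mul0r scale0r /incr add0r subrr.
    rewrite big_nat_recr //= -IH /incr.
    have -> : (k.+1%:R * rho) *: h + x = rho *: h + ((k%:R * rho) *: h + x).
      by rewrite addrA -scalerDl -natr1 mulrDl mul1r [rho + _]addrC.
    by ring.
  have key k : (k <= 2 ^ N)%N -> bd mu (fun x => (`|x| < 1)%R%:R * `|incr ((k%:R * rho) *: h) w x - k%:R * c|)
      (k%:R * (3 ^+ (n + 2) * E)).
    elim: k => [|k IH] kN.
      rewrite [X in bd _ _ X]mul0r; apply: (bd_ext (bd0 mu)) => x.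
      by rewrite mul0r scale0r /incr add0r !mul0r !subrr normr0 mulr0.
    have bk := IH (ltnW kN).
    have bs := bd_shift ((k%:R * rho) *: h) b3.
    have mk := measurable_incr ((k%:R * rho) *: h) mw.
    have mk1 := measurable_incr ((k.+1%:R * rho) *: h) mw.
    apply: (bd_le (bdW (bdD bk bs) _)); [|by meas|by move=> x; nn|move=> x].
      by rewrite -[k.+1%:R]natr1 mulrDl mul1r.
    have -> : incr ((k.+1%:R * rho) *: h) w x - k.+1%:R * c = (incr ((k%:R * rho) *: h) w x - k%:R * c) +
        (incr (rho *: h) w ((k%:R * rho) *: h + x) - c).
      rewrite !sumE big_nat_recr //= -[k.+1%:R]natr1; ring.
    apply: le_trans (ler_wpM2l (ler0n _ _) (ler_normD _ _)) _; rewrite mulrDr lerD2l.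
    apply: ler_wpM2r => //; rewrite ler_nat; case: (ltP `|x| 1) => // x1.
    suff -> : `|(k%:R * rho) *: h + x| <= 2 by [].
    apply: le_trans (ler_normD _ _) _; have -> : 2 = 1 + 1 :> R by lra.
    apply: lerD; last exact: ltW.
    rewrite normVZ; last by rewrite mulr_ge0 // ltW.
    apply: mulr_ile1 => //; first by rewrite mulr_ge0 // ltW.
    rewrite /rho exprVn -natrX ler_pdivrMr ?ltr0n ?expn_gt0 // mul1r ler_nat; exact: ltnW.
  have := key _ (leqnn _); rewrite (_ : (2 ^ N)%N%:R * rho = 1) ?scale1r //.
  by rewrite /rho natrX exprVn mulfV // gt_eqF // exprn_gt0.
have rN : rho * (2 ^ N)%N%:R = 1.
  by rewrite /rho natrX exprVn mulVf // gt_eqF // exprn_gt0.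
have := ler_wpM2l (ltW rho0) e2; rewrite -{1}(gtr0_norm rho0) -normrM mulrBr => e3.
have e4 : rho * ((2 ^ N)%N%:R * c * kap) = c * kap by rewrite !mulrA rN mul1r.
have e5 : rho * ((2 ^ N)%N%:R * (3 ^+ (n + 2) * E)) = 3 ^+ (n + 2) * E by rewrite mulrA rN mul1r.
rewrite e4 e5 in e3; rewrite mulrDl -[rho ^- n * _ * E]mulrA.
apply: le_trans (lerD e1 e3); rewrite [X in _ <= _ + X]distrC.
exact: ler_distD.
Qed.

Lemma bounded_variation_cvg (q : nat -> R) B : (forall k, \sum_(0 <= j < k) `|q j.+1 - q j| <= B) -> cvgn q.
Proof.
move=> qB.
have cS : cvgn [normed series (fun j => q j.+1 - q j)].
  apply: nondecreasing_is_cvgn.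
    move=> a b ab; change (\sum_(0 <= k < a) `|q k.+1 - q k| <= \sum_(0 <= k < b) `|q k.+1 - q k|).
    by rewrite (@big_cat_nat _ _ _ a 0 b) //= lerDl; apply: sumr_ge0.
  by exists B => _ [N _ <-]; exact: qB.
have c := normed_cvg cS.
have -> : q = (fun k => q 0%N + series (fun j => q j.+1 - q j) k).
  by apply/funext => k; rewrite /series /= telescope_sumr // addrC subrK.
by apply: is_cvgD => //; exact: is_cvg_cst.
Qed.

Lemma excess_start s w B : 2^-1 <= s -> s < 1 -> measurable_fun setT w ->
  bd mu (fun x => w x ^+ 2) B -> forall h,
  bd mu (fun x => `|incr h w x| * om s x) (2 * (B + (2 ^+ n + 2 * 4 ^+ n))).
Proof.
move=> s0 s1 mw bw h; have mom := @measurable_om R n s; have mi := measurable_incr h mw.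
have s00 : 0 <= s by lra.
have bo := bd_om (n := n) s0 s1.
apply: (bd_le (bdW (bdD (bdD (bd_shift h bw) bw) (bdZ (ler0n _ 2) bo)) _)).
- by rewrite le_eqVlt; apply/orP; left; apply/eqP; ring.
- by meas.
- by move=> x; nn.
move=> x; have o0 := om_ge0 s x; have o1 := om_le1 x s00.
have key (t : R) : `|t| * om s x <= t ^+ 2 + om s x.
  rewrite -(real_normK (num_real t)); move: (`|t|) (normr_ge0 t) => a a0.
  have [a1|a1] := leP a 1.
    by apply: ler_wpDl; [exact: sqr_ge0|exact: ler_piMl].
  apply: ler_wpDr => //; apply: (@le_trans _ _ a); first exact: ler_piMr.
  by rewrite expr2; apply: ler_peMr => //; exact: ltW.
apply: (@le_trans _ _ ((`|w (h + x)| + `|w x|) * om s x)).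
  by apply: ler_wpM2r => //; exact: ler_normB.
rewrite mulrDl; have := key (w (h + x)); have := key (w x).
by clear; lra.
Qed.

(** The excess divided by the scale satisfies e_(k+1) = e_k / 2 + C1 m(r_k), hence has a sum bounded
    by its initial value and the sum of the m(r_k); consecutive slopes differ by at most C2 e_k. The
    chain starts at the scale 2^(Np), where the contribution of u itself carries the factor
    2^-(Np). *)
Lemma slope_series (L s0 : R) : (2 <= n)%N -> 1 <= L -> 2^-1 < s0 -> s0 < 1 ->
  exists (N : nat) (K1 K2 : R), [/\ (0 < N)%N, 0 < K2 &
    forall s F G u (B : R) (m : R -> R) (x0 h : V) (S : R) (p : nat), s0 <= s -> s < 1 -> flux L s F -> potential L s F G ->
    measurable_fun setT u -> (exists c, enb s u c) -> bd mu (fun x => u x ^+ 2) B -> `|h| <= 1 ->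
    (forall r : R, 0 <= m r) ->
    (forall (r : R) psi, 0 < r -> H0 s 1 psi -> (forall x, `|psi x| <= 1) ->
      (form (rescale_flux s r F) (fun x : V => u (x0 + r *: x)%R) psi <= (r * m r)%:E)%E) ->
    (forall k, \sum_(0 <= j < k) m (2^-1 ^+ (N * j) * 2 ^+ (N * p)) <= S) ->
    let q k := slope h (fun x : V => u (x0 + (2^-1 ^+ (N * k) * 2 ^+ (N * p)) *: x)) /
      (2^-1 ^+ (N * k) * 2 ^+ (N * p)) in
    forall k, `|q k| <= K1 * (B + 1) * 2^-1 ^+ (N * p) + K2 * S /\
      \sum_(0 <= j < k) `|q j.+1 - q j| <= K1 * (B + 1) * 2^-1 ^+ (N * p) + K2 * S].
Proof.
move=> n2 L1 s0h s01; have [N [C1 [N0 C10 hstep]]] := one_step n2 L1 s0h s01.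
pose Kn : R := 2 ^+ n + 2 * 4 ^+ n; have Kn0 : 0 <= Kn by rewrite /Kn; nn.
have Kn1 : 1 <= Kn by rewrite /Kn; have : 1 <= 2 ^+ n :> R by [rewrite exprn_ege1 // ler1n]; have : 0 <= 4 ^+ n :> R by [exact: exprn_ge0]; clear; lra.
pose rho : R := 2^-1 ^+ N; have rhoE : 2^-1 ^+ N = rho by [].
have rho0 : 0 < rho by rewrite exprn_gt0.
pose C2 : R := ((2^-1 ^+ N) ^- n * 2 ^+ (n + 2) + 3 ^+ (n + 2)) / rho.
have C20 : 0 < C2.
  by rewrite /C2 divr_gt0 // addr_gt0 ?mulr_gt0 ?invr_gt0 ?exprn_gt0.
have C2E : ((2^-1 ^+ N) ^- n * 2 ^+ (n + 2) + 3 ^+ (n + 2)) = C2 * rho by rewrite /C2 divfK // gt_eqF.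
clearbody C2.
exists N, ((2 ^+ (n + 2) + 2 * C2) * (2 * Kn)), (2 * C2 * C1); split => //; first by rewrite !mulr_gt0.
move=> s F G u B m x0 h S p s0s s1 fF pG mu_ [eu bu] b2 hh m0 hform hS.
have sh : 2^-1 <= s by clear - s0h s0s; lra.
have s00 : 0 <= s by clear - sh; lra.
have lu : loc2 u.
  move=> ro; exists B; apply: (bd_le b2); [by meas|by move=> x; nn|move=> x].
  by apply: ler_piMl; [exact: sqr_ge0|case: (_ < _)].
have B0 := bd_ge0 b2.
pose r k : R := 2^-1 ^+ (N * k) * 2 ^+ (N * p).
have r0 k : 0 < r k by rewrite /r mulr_gt0 // exprn_gt0.
have rS k : r k.+1 = rho * r k by rewrite /r mulnS exprD mulrA.
pose U k := fun x : V => u (x0 + r k *: x).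
pose D : R := 2 * (B + Kn).
have D0 : 0 < D by rewrite /D mulr_gt0 // ltr_wpDl // (lt_le_trans _ Kn1).
(* Bounds for the excess of [U k] divided by [r k], see [exc]. *)
pose fix e k := if k is k'.+1 then e k' / 2 + C1 * m (r k') else D / r 0%N.
have eS k : e k.+1 = e k / 2 + C1 * m (r k) by [].
have e0 k : 0 < e k.
  elim: k => [|k IH]; first by rewrite /= divr_gt0.
  by rewrite eS ltr_wpDr ?divr_gt0 // mulr_ge0 // ltW.
have mU k : measurable_fun setT (U k).
  by rewrite /U; have := measurable_affine x0 (r k) => ma; meas.
have US k : U k.+1 = (fun x => U k (0 + rho *: x)).
  by apply/funext => x; rewrite /U rS add0r scalerA mulrC.
have r01 : 1 <= r 0%N by rewrite /r muln0 expr0 mul1r exprn_ege1 // ler1n.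
(* The initial excess is bounded by the square integral of u, which dilation by r 0 >= 1 does not
   increase. *)
have start h' : bd mu (fun x => `|incr h' (U 0%N) x| * om s x) D.
  have bU : bd mu (fun x => U 0%N x ^+ 2) B.
    apply: (bdW (bd_affine x0 (r0 0%N) b2)); apply: ler_piMl => //.
    by rewrite invf_le1 ?exprn_gt0 // exprn_ege1.
  exact: excess_start sh s1 (mU 0%N) bU h'.
have exc k : excess s (U k) (r k * e k).
  elim: k => [|k IH].
    move=> h' _; exists 0; apply: (bd_ext (bdW (start h') _)) => [|x].
      by rewrite /= mulrC divfK // gt_eqF.
    by rewrite subr0.
  have -> : r k.+1 * e k.+1 = 2^-1 ^+ N * ((r k * e k) / 2 + C1 * (r k * m (r k))).
    by rewrite rS eS -/rho; ring.
  rewrite US; apply: (hstep s _ _ _ _ _ s0s s1 (rescale_flux_flux L1 (r0 k) fF)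
    (potential_rescale (r0 k) pG) (mU k)) => //.
  - by eexists; exact: (enb_rescale x0 (r0 k) bu).
  - exact: loc2_rescale.
  - by rewrite mulr_gt0.
  - by rewrite mulr_ge0 // ltW.
  - by move=> psi hp p1; exact: hform.
have esum k : \sum_(0 <= j < k) e j + 2 * e k <= 2 * e 0%N + 2 * C1 * S.
  have h1 : \sum_(0 <= j < k) e j + 2 * e k <= 2 * e 0%N + 2 * C1 * \sum_(0 <= j < k) m (r j).
    elim: k => [|k IH]; first by rewrite !big_nil mulr0 addr0 add0r.
    rewrite !big_nat_recr //= mulrDr -[D / r 0%N]/(e 0%N); move: IH; move: (\sum_(0 <= j < k) e j) (\sum_(0 <= j < k) m (r j)).
    by clear; move=> a b; lra.
  apply: le_trans h1 _; rewrite lerD2l; apply: ler_wpM2l; first by rewrite mulr_ge0 // ltW.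
  exact: hS.
move=> q; have qE k : q k = slope h (U k) / r k by [].
have qd k : `|q k.+1 - q k| <= C2 * e k.
  have := slope_scale N sh s1 (mU k) hh (exc k); rewrite C2E rhoE -US => h1.
  rewrite !qE rS; have -> : slope h (U k.+1) / (rho * r k) - slope h (U k) / r k =
     (slope h (U k.+1) - rho * slope h (U k)) / (rho * r k) by field; rewrite !gt_eqF.
  have rr : 0 < rho * r k by rewrite mulr_gt0.
  rewrite normrM normfV (gtr0_norm rr) ler_pdivrMr //.
  by apply: le_trans h1 _; rewrite le_eqVlt; apply/orP; left; apply/eqP; ring.
have e00 : e 0%N = D * 2^-1 ^+ (N * p).
  by rewrite /= /r muln0 expr0 mul1r exprVn.
have DK : D <= 2 * Kn * (B + 1).
  rewrite /D; have := mulr_ge0 B0 (_ : 0 <= Kn - 1); rewrite subr_ge0 => /(_ Kn1).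
  by clear; lra.
have vs k : \sum_(0 <= j < k) `|q j.+1 - q j| <= C2 * (2 * e 0%N + 2 * C1 * S).
  apply: le_trans (ler_sum _ (fun j _ => qd j)) _; rewrite -mulr_sumr; apply: ler_wpM2l; first exact: ltW.
  by apply: le_trans (esum k); rewrite lerDl mulr_ge0 // ltW.
have q0 : `|q 0%N| <= 2 ^+ (n + 2) * e 0%N.
  rewrite qE normrM normfV (gtr0_norm (r0 0%N)) ler_pdivrMr // -mulrA.
  have -> : e 0%N * r 0%N = D by rewrite /= divfK // gt_eqF.
  exact: slope_le sh s1 (mU 0%N) (start h).
have pp : 0 <= 2^-1 ^+ (N * p) :> R by rewrite exprn_ge0 // invr_ge0.
have bnd : 2 ^+ (n + 2) * e 0%N + C2 * (2 * e 0%N + 2 * C1 * S) <=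
    (2 ^+ (n + 2) + 2 * C2) * (2 * Kn) * (B + 1) * 2^-1 ^+ (N * p) + 2 * C2 * C1 * S.
  have -> : 2 ^+ (n + 2) * e 0%N + C2 * (2 * e 0%N + 2 * C1 * S) =
    (2 ^+ (n + 2) + 2 * C2) * (D * 2^-1 ^+ (N * p)) + 2 * C2 * C1 * S by rewrite e00; ring.
  rewrite lerD2r -!mulrA; apply: ler_wpM2l; first by rewrite addr_ge0 ?exprn_ge0 // mulr_ge0 // ltW.
  by rewrite !mulrA; apply: ler_wpM2r => //; rewrite -mulrA mulrA.
move=> k; split; last first.
  apply: le_trans (vs k) _; apply: le_trans bnd; rewrite lerDr.
  by rewrite mulr_ge0 ?exprn_ge0 // ltW.
have : `|q k - q 0%N| <= \sum_(0 <= j < k) `|q j.+1 - q j|.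
  by rewrite -(telescope_sumr q (leq0n k)); exact: ler_norm_sum.
move=> h1; apply: le_trans bnd; have := ler_normD (q k - q 0%N) (q 0%N); rewrite subrK.
by move: h1 (vs k) q0; clear; lra.
Qed.

End excess_decay.

(** * Difference quotients paired with test functions *)

Section test_functions.
Context {R : realType} {n : nat}.
Local Notation V := 'rV[R]_n.
Local Notation mu := (@lebesgue_rV R n).
Local Notation mu2 := (mu \x mu)%E.
Implicit Types (f g u psi : V -> R).

Lemma compact_cube (K : set V) : compact K -> exists2 r : R, 0 < r & forall x, K x -> `|x| < r.
Proof.
move=> /compact_bounded[M [Mr hM]]; exists (`|M| + 2); first by rewrite ltr_wpDl.
move=> x Kx; apply: le_lt_trans (_ : _ <= `|M| + 1) _; last by rewrite ltrD2l ltr1n.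
by apply: hM => //; rewrite (le_lt_trans (ler_norm M)) // ltrDl.
Qed.

Lemma closed_cube (r : R) : closed [set x : V | `|x| <= r].
Proof.
have -> : [set x : V | `|x| <= r] = (fun x : V => `|x|) @^-1` [set t | t <= r] by [].
apply: closed_comp; last exact: closed_le.
move=> x _; apply: (@lip_continuous _ _ (fun x : V => `|x|) 1) => // a b.
by rewrite mul1r; exact: ler_dist_dist.
Qed.

Lemma compact_closed_cube (r : R) : compact [set x : V | `|x| <= r].
Proof.
apply: bounded_closed_compact; last exact: closed_cube.
exists r; split; first exact: num_real.
by move=> M rM x /= xr; apply: le_trans xr (ltW rM).
Qed.

Lemma continuous_support_bounded f (r : R) : continuous f -> (forall x, r <= `|x| -> f x = 0) ->
  exists2 M : R, 0 <= M & forall x, `|f x| <= M.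
Proof.
move=> cf f0.
have /compact_bounded[M [Mr hM]] : compact (f @` [set x : V | `|x| <= r]).
  by apply: continuous_compact; [exact: continuous_subspaceT|exact: compact_closed_cube].
exists (`|M| + 1); first by rewrite addr_ge0.
move=> x; have [xr|xr] := leP r `|x|; first by rewrite f0 // normr0 addr_ge0.
apply: (hM (`|M| + 1)); first by rewrite (le_lt_trans (ler_norm M)) // ltrDl.
by exists x => //=; exact: ltW.
Qed.

Lemma test_function_support psi : test_function setT psi ->
  exists2 r : R, 0 < r & forall x, r <= `|x| -> psi x = 0.
Proof.
move=> [_ cK _]; have [r r0 hr] := compact_cube cK; exists r => // x xr.
apply/eqP; apply: contraTT xr => px; rewrite -ltNge; apply: hr.
exact: subset_closure.
Qed.

Lemma test_function_continuous psi : test_function setT psi -> continuous psi.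
Proof. by move=> [h _ _]; exact: (h 0%N). Qed.

Lemma test_function_partial psi i : test_function setT psi ->
  continuous (partial i psi) /\ forall x, derivable psi x (delta_mx ord0 i).
Proof. by move=> [h _ _]; have /= [_ /(_ i)[dp cp]] := h 1%N. Qed.

Lemma partial_support psi i (r : R) x : (forall x, r <= `|x| -> psi x = 0) -> r < `|x| ->
  partial i psi x = 0.
Proof.
move=> p0 rx; rewrite /partial /derive.
have h : (fun h : R => h^-1 *: ((psi \o shift x) (h *: delta_mx ord0 i) - psi x)) @ 0^' --> (0 : R).
  apply: cvg_near_cst; near=> h; rewrite /= (p0 x) ?ltW // subr0 p0 ?scaler0 //.
  have : `|h| <= `|x| - r by near: h; apply: dnbhs0_le; rewrite subr_gt0.
  have := norm_shift i h x; have := lerB_dist x (h *: delta_mx ord0 i + x).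
  rewrite [`|x - _|]distrC; clear; lra.
exact: cvg_lim h.
Unshelve. all: end_near.
Qed.

Lemma line_mean_value psi i (z : V) (t : R) : test_function setT psi ->
  exists2 c, `|c| <= `|t| & psi (t *: delta_mx ord0 i + z) - psi z = partial i psi (c *: delta_mx ord0 i + z) * t.
Proof.
move=> tp; have [_ dp] := test_function_partial i tp.
set e : V := delta_mx ord0 i in dp *.
have fd (x : R) : is_derive x (1 : R) (fun y : R => psi (y *: e + z)) (partial i psi (x *: e + z)).
  have E : (fun h : R => h^-1 *: (((fun y : R => psi (y *: e + z)) \o shift x) (h *: (1 : R)) - psi (x *: e + z))) =
      (fun h : R => h^-1 *: ((psi \o shift (x *: e + z)) (h *: e) - psi (x *: e + z))).
    by apply/funext => h /=; rewrite [h *: 1]mulr1 scalerDl addrA.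
  apply: DeriveDef; first by rewrite /derivable E; exact: dp.
  by rewrite /derive E.
have [c] := mean_value 0 t fd.
rewrite !subr0 scale0r add0r => ct E; exists c => //.
Qed.

Lemma measurable_Rintegral_param (f : V * V -> R) : measurable_fun setT f ->
  measurable_fun setT (fun x => (\int[mu]_y f (x, y))%R).
Proof.
move=> mf; apply: measurableT_comp; first exact: fine_measurable.
under eq_fun do rewrite integralE.
have pE x : (fun y => (f (x, y))%:E)^\+%E = (fun y => (Num.max (f (x, y)) 0)%:E).
  by apply/funext => y; rewrite funeposE -EFin_max.
have nE x : (fun y => (f (x, y))%:E)^\-%E = (fun y => (Num.max (- f (x, y)) 0)%:E).
  by apply/funext => y; rewrite funenegE -EFinN -EFin_max.
apply: emeasurable_funB.
  under eq_fun do rewrite pE.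
  apply: (@measurable_fun_fubini_tonelli_F _ _ _ _ _ mu (fun z => (Num.max (f z) 0)%:E)) => //.
    by apply/measurable_EFinP; meas.
  by move=> z; rewrite lee_fin le_max lexx orbT.
under eq_fun do rewrite nE.
apply: (@measurable_fun_fubini_tonelli_F _ _ _ _ _ mu (fun z => (Num.max (- f z) 0)%:E)) => //.
  by apply/measurable_EFinP; meas.
by move=> z; rewrite lee_fin le_max lexx orbT.
Qed.

End test_functions.

Section difference_quotients.
Context {R : realType} {n : nat}.
Local Notation V := 'rV[R]_n.
Local Notation mu := (@lebesgue_rV R n).
Local Notation mu2 := (mu \x mu)%E.
Implicit Types (f g u psi : V -> R).

Lemma normB_le_sqr (a b : R) : `|a - b| <= 1 + (a ^+ 2 + b ^+ 2).
Proof.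
have := sqr_ge0 (a - 2^-1); have := sqr_ge0 (a + 2^-1); have := sqr_ge0 (b - 2^-1).
by have := sqr_ge0 (b + 2^-1); rewrite ler_norml => *; apply/andP; split; nra.
Qed.

Section pairing.
Variables (u psi : V -> R) (a : V -> V) (B M r : R).
Hypotheses (bu : bd mu (fun x => u x ^+ 2) B) (mu_ : measurable_fun setT u)
  (mp : measurable_fun setT psi) (ma : measurable_fun setT a) (r0 : 0 < r)
  (pM : forall x, `|psi x| <= M) (p0 : forall x, r <= `|x| -> psi x = 0).

Let chi (y : V) : R := (`|y| < 1)%R%:R.

Let mchi : measurable_fun setT chi. Proof. by rewrite /chi; meas. Qed.

Let M0 : 0 <= M. Proof. exact: le_trans (normr_ge0 (psi 0)) (pM 0). Qed.

Let le_sq (b t p : R) : 0 <= b -> `|p| <= M -> `|b * t * p| <= b * (M * ((p != 0)%:R + t ^+ 2)).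
Proof.
move=> b0 pM'; have [->|pn] := eqVneq p 0.
  by rewrite mulr0 normr0 add0r; nn.
rewrite !normrM (ger0_norm b0) -mulrA; apply: ler_wpM2l => //=.
rewrite mulrC; apply: ler_pM => //.
by rewrite ler_norml; nra.
Qed.

Let in_cube x : (psi x != 0)%:R <= (`|x| < r)%R%:R :> R.
Proof.
have [xr|xr] := ltP `|x| r; last by rewrite p0 // eqxx.
by case: (psi x != 0).
Qed.

Lemma pairing_integrable_shift :
  mu2.-integrable setT (fun z => (chi z.2 * u (a z.2 + z.1) * psi z.1)%:E).
Proof.
have m1 : measurable_fun setT (fun z : V * V => chi z.2 * u (a z.2 + z.1) * psi z.1).
  by rewrite /chi; meas.
apply: (bd_integrable (c := 2 ^+ n * (M * ((2 * r) ^+ n + B)))); last exact: m1.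
apply: (bd_le (g := fun z : V * V => chi z.2 * (M * ((`|z.1| < r)%R%:R + u (a z.2 + z.1) ^+ 2)))).
2: by meas.
2: by move=> z; exact: normr_ge0.
2: move=> z; apply: le_trans (le_sq _ _ (pM _)) _; first exact: ler0n.
2: by apply: ler_wpM2l; rewrite ?ler0n //; apply: ler_wpM2l => //; rewrite lerD2r.
apply: (bd_prod_y (h := fun y => chi y * (M * ((2 * r) ^+ n + B)))).
- by rewrite /chi; meas.
- by move=> z; rewrite /chi; nn.
- move=> y /=; apply: bdZ; first exact: ler0n.
  by apply: bdZ => //; apply: bdD; [exact: bd_cube|exact: (bd_shift (h := fun x => u x ^+ 2))].
apply: (bd_ext (g := fun y => (M * ((2 * r) ^+ n + B)) * chi y)); last by move=> y; rewrite mulrC.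
rewrite [2 ^+ n * _]mulrC; apply: bdZ; last by rewrite -[2]mulr1; exact: bd_cube.
by apply: mulr_ge0 => //; apply: addr_ge0; [nn; rewrite mulr_ge0 // ltW|exact: bd_ge0 bu].
Qed.

Lemma pairing_integrable :
  mu2.-integrable setT (fun z => (chi z.2 * u z.1 * psi (- a z.2 + z.1))%:E).
Proof.
have m1 : measurable_fun setT (fun z : V * V => chi z.2 * u z.1 * psi (- a z.2 + z.1)).
  by rewrite /chi; meas.
apply: (bd_integrable (c := 2 ^+ n * (M * ((2 * r) ^+ n + B)))); last exact: m1.
apply: (bd_le (g := fun z : V * V => chi z.2 * (M * ((`|- a z.2 + z.1| < r)%R%:R + u z.1 ^+ 2)))).
2: by meas.
2: by move=> z; exact: normr_ge0.
2: move=> z; apply: le_trans (le_sq _ _ (pM _)) _; first exact: ler0n.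
2: by apply: ler_wpM2l; rewrite ?ler0n //; apply: ler_wpM2l => //; rewrite lerD2r.
apply: (bd_prod_y (h := fun y => chi y * (M * ((2 * r) ^+ n + B)))).
- by rewrite /chi; meas.
- by move=> z; rewrite /chi; nn.
- move=> y /=; apply: bdZ; first exact: ler0n.
  apply: bdZ => //; apply: bdD => //; apply: (bd_shift (h := fun x => (`|x| < r)%R%:R)); exact: bd_cube.
apply: (bd_ext (g := fun y => (M * ((2 * r) ^+ n + B)) * chi y)); last by move=> y; rewrite mulrC.
rewrite [2 ^+ n * _]mulrC; apply: bdZ; last by rewrite -[2]mulr1; exact: bd_cube.
by apply: mulr_ge0 => //; apply: addr_ge0; [nn; rewrite mulr_ge0 // ltW|exact: bd_ge0 bu].
Qed.

Lemma pairing_shift :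
  (\int[mu2]_z (chi z.2 * u (a z.2 + z.1) * psi z.1)%:E =
   \int[mu2]_z (chi z.2 * u z.1 * psi (- a z.2 + z.1))%:E)%E.
Proof.
rewrite -(integral21_prod_meas1 pairing_integrable_shift) -(integral21_prod_meas1 pairing_integrable).
apply: eq_integral => y _; rewrite /fubini_G /=.
rewrite -(integral_shift (f := fun x => (chi y * u x * psi (- a y + x))%:E) (a y)); last first.
  by meas.
by apply: eq_integral => x _; rewrite addrA addNr add0r.
Qed.

End pairing.

Lemma measurable_incr_scaled u (h : V) (r : R) : measurable_fun setT u ->
  measurable_fun setT (fun x : V => slope h (fun y => u (x + r *: y)) / r).
Proof.
move=> mu_; apply: measurable_funM; last exact: measurable_cst.
rewrite /slope.
apply: (measurable_Rintegral_param (f := fun z : V * V =>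
  (`|z.2| < 1)%R%:R * incr h (fun y => u (z.1 + r *: y)) z.2)).
by rewrite /incr; meas.
Qed.

Section slope_pairing.
Variables (u psi : V -> R) (h : V) (B M r t : R).
Hypotheses (bu : bd mu (fun x => u x ^+ 2) B) (mu_ : measurable_fun setT u)
  (mp : measurable_fun setT psi) (r0 : 0 < r) (t0 : 0 < t)
  (pM : forall x, `|psi x| <= M) (p0 : forall x, r <= `|x| -> psi x = 0).

Let chi (y : V) : R := (`|y| < 1)%R%:R.
Let Q (z : V * V) : R := chi z.2 * u z.1 *
  ((psi (- (t *: (h + z.2)) + z.1) - psi (- (t *: z.2) + z.1)) / t).

(** Discrete integration by parts: the translations by t (h + y) and t y are moved from u to psi
    under the double integral. *)
Lemma slope_pairing_integrable : mu2.-integrable setT (EFin \o Q) /\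
  mu.-integrable setT (fun x => (slope h (fun y => u (x + t *: y)) / t * psi x)%:E) /\
  (\int[mu]_x (slope h (fun y => u (x + t *: y)) / t * psi x)%:E = \int[mu2]_z (Q z)%:E)%E.
Proof.
have ma1 : measurable_fun setT (fun y : V => t *: (h + y)) by meas.
have ma2 : measurable_fun setT (fun y : V => t *: y) by meas.
have i1 := pairing_integrable_shift bu mu_ mp ma1 r0 pM p0.
have i2 := pairing_integrable_shift bu mu_ mp ma2 r0 pM p0.
have j1 := pairing_integrable bu mu_ mp ma1 r0 pM p0.
have j2 := pairing_integrable bu mu_ mp ma2 r0 pM p0.
have e1 := pairing_shift bu mu_ mp ma1 r0 pM p0.
have e2 := pairing_shift bu mu_ mp ma2 r0 pM p0.
pose P (z : V * V) : R := chi z.2 * incr h (fun y => u (z.1 + t *: y)) z.2 * psi z.1 / t.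
have PE : EFin \o P = (fun z => (t^-1)%:E * ((chi z.2 * u (t *: (h + z.2) + z.1) * psi z.1)%:E -
    (chi z.2 * u (t *: z.2 + z.1) * psi z.1)%:E))%E.
  apply/funext => z; rewrite -EFinB -EFinM /= /P /incr; congr EFin.
  by rewrite ![z.1 + _]addrC; ring.
have QE : EFin \o Q = (fun z => (t^-1)%:E * ((chi z.2 * u z.1 * psi (- (t *: (h + z.2)) + z.1))%:E -
    (chi z.2 * u z.1 * psi (- (t *: z.2) + z.1))%:E))%E.
  by apply/funext => z; rewrite -EFinB -EFinM /= /Q; congr EFin; ring.
have iP : mu2.-integrable setT (EFin \o P) by rewrite PE; apply: integrableZl => //; exact: integrableB.
have iQ : mu2.-integrable setT (EFin \o Q) by rewrite QE; apply: integrableZl => //; exact: integrableB.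
have PQ : (\int[mu2]_z (EFin \o P) z = \int[mu2]_z (EFin \o Q) z)%E.
  rewrite PE QE integralZl //; last exact: integrableB.
  rewrite integralZl //; last exact: integrableB.
  by rewrite !integralB // e1 e2.
have FE x : fubini_F mu (EFin \o P) x = (slope h (fun y => u (x + t *: y)) / t * psi x)%:E.
  rewrite /fubini_F /slope.
  have ic : mu.-integrable setT (fun y => (chi y * incr h (fun y => u (x + t *: y)) y)%:E).
    have bs a : bd mu (fun y => u (a + t *: y) ^+ 2) (t ^- n * B) by apply: (bd_affine (h := fun x => u x ^+ 2)).
    apply: (bd_integrable (c := 2 ^+ n + (t ^- n * B + t ^- n * B))); last by rewrite /chi /incr; meas.
    apply: (bd_le (g := fun y => chi y + (u ((x + t *: h) + t *: y) ^+ 2 + u (x + t *: y) ^+ 2))).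
    - apply: bdD; last exact: bdD.
      by rewrite -[2]mulr1; exact: bd_cube.
    - by rewrite /chi /incr; meas.
    - by move=> y; exact: normr_ge0.
    move=> y; rewrite /incr scalerDr addrA /chi; case: (`|y| < 1)%R => /=.
      by rewrite mul1r; exact: normB_le_sqr.
    by rewrite mul0r normr0; nn.
  rewrite /Rintegral -mulrA EFinM fineK; last exact: integrable_fin_num.
  rewrite muleC -integralZl //; apply: eq_integral => y _.
  by rewrite -EFinM /= /P; congr EFin; ring.
split=> //; split.
  by have := integrable_fubini_F iP; rewrite (funext FE).
rewrite -[RHS]PQ -(integral12_prod_meas1 iP).
by apply: eq_integral => x _; rewrite FE.
Qed.

End slope_pairing.

Lemma cube_mass : exists2 k : R, 1 <= k & (\int[mu]_y ((`|y| < 1)%R%:R)%:E = k%:E)%E.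
Proof.
have [k [E _ _]] := bd_int (@bd_cube R n 1 ltr01); exists k => //.
by have := @cube_lower R n 1 ltr01; rewrite E expr1n lee_fin.
Qed.

(** After the translation has been moved to psi, the mean value theorem replaces the quotients by
    values of - partial i psi at points tending to z.1; the integral over the cube variable produces
    the factor [k]. *)
Lemma pairing_limit u psi (i : 'I_n) (B k : R) (r_ : nat -> R) :
  bd mu (fun x => u x ^+ 2) B -> measurable_fun setT u -> test_function setT psi ->
  (forall j, 0 < r_ j <= 1) -> r_ @ \oo --> 0 ->
  (\int[mu]_y ((`|y| < 1)%R%:R)%:E = k%:E)%E ->
  (fun j => \int[mu]_x (slope (delta_mx ord0 i) (fun y => u (x + r_ j *: y)) / r_ j * psi x)%:E)%E @ \oo -->
  (- (k%:E * \int[mu]_x (u x * partial i psi x)%:E))%E.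
Proof.
move=> bu mu_ tp rj r_0 kE.
have [rho rho0 p0] := test_function_support tp.
have cp := test_function_continuous tp; have [cd _] := test_function_partial i tp.
have [M M0 pM] := continuous_support_bounded cp p0.
have d0 x : rho + 1 <= `|x| -> partial i psi x = 0.
  by move=> xr; apply: (partial_support _ p0); apply: lt_le_trans xr; rewrite ltrDl.
have [M1 M10 dM] := continuous_support_bounded cd d0.
have mp : measurable_fun setT psi by exact: continuous_measurable_rV.
have md : measurable_fun setT (partial i psi) by exact: continuous_measurable_rV.
set e : V := delta_mx ord0 i.
pose Q j (z : V * V) : R := (`|z.2| < 1)%R%:R * u z.1 *
  ((psi (- (r_ j *: (e + z.2)) + z.1) - psi (- (r_ j *: z.2) + z.1)) / r_ j).
pose Qoo (z : V * V) : R := (`|z.2| < 1)%R%:R * u z.1 * - partial i psi z.1.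
have rp j : 0 < r_ j by case/andP: (rj j).
have QE j := slope_pairing_integrable e bu mu_ mp rho0 (rp j) pM p0.
under eq_fun do rewrite (QE _).2.2.
have mvt j (z : V * V) : exists2 c, `|c| <= r_ j & Q j z =
    (`|z.2| < 1)%R%:R * u z.1 * - partial i psi (c *: e + (- (r_ j *: z.2) + z.1)).
  have [c cr E] := line_mean_value i (- (r_ j *: z.2) + z.1) (- r_ j) tp.
  exists c; first by rewrite normrN (ger0_norm (ltW (rp j))) in cr.
  rewrite /Q (_ : - (r_ j *: (e + z.2)) + z.1 = - r_ j *: e + (- (r_ j *: z.2) + z.1)).
    by rewrite E mulrN mulNr mulfK // gt_eqF.
  by rewrite scalerDr opprD scaleNr addrA.
have near_z j (z : V * V) c : `|c| <= r_ j -> `|z.2| < 1 ->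
    `|c *: e + (- (r_ j *: z.2) + z.1) - z.1| <= 2 * r_ j.
  move=> cr z1; rewrite addrA addrK; apply: le_trans (ler_normB _ _) _.
  rewrite mulr2n mulrDl mul1r; apply: lerD.
    rewrite normrZ; apply: le_trans cr; rewrite ler_piMr //; exact: norm_delta_mx.
  by rewrite normrZ (ger0_norm (ltW (rp j))) ler_piMr // ltW.
have mQ j : measurable_fun setT (Q j) by rewrite /Q; meas.
have mQoo : measurable_fun setT Qoo by rewrite /Qoo; meas.
(* Dominating function: |u| is at most 1 + u^2, and the radius rho + 4 leaves room for the
   displacement by at most 2. *)
pose D (z : V * V) : R := (`|z.2| < 1)%R%:R * ((`|z.1| < rho + 4)%R%:R * (M1 * (1 + u z.1 ^+ 2))).
have mD : measurable_fun setT D by rewrite /D; meas.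
have D0 z : 0 <= D z by rewrite /D; nn.
have bD : bd mu2 D (2 ^+ n * (M1 * ((2 * (rho + 4)) ^+ n + B))).
  have r40 : 0 < rho + 4 by rewrite addr_gt0.
  apply: (bd_prod_y (h := fun y : V => (M1 * ((2 * (rho + 4)) ^+ n + B)) * (`|y| < 1)%R%:R)) => //.
    move=> y; rewrite /D /= mulrC; apply: bdZ; first exact: ler0n.
    apply: (bd_le (g := fun x : V => M1 * ((`|x| < rho + 4)%R%:R + u x ^+ 2))).
    - by apply: bdZ => //; apply: bdD => //; exact: bd_cube.
    - by meas.
    - by move=> x /=; nn.
    move=> x /=; rewrite [M1 * (1 + _)]mulrDr mulr1 mulrDr [M1 * (_ + _)]mulrDr [_%:R * M1]mulrC lerD2l.
    by case: (`|x| < _)%R; rewrite ?mul1r // mul0r; nn.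
  rewrite [2 ^+ n * _]mulrC; apply: bdZ; last by rewrite -[2]mulr1; exact: bd_cube.
  by apply: mulr_ge0 => //; apply: addr_ge0; [nn; rewrite mulr_ge0 // ltW|exact: bd_ge0 bu].
have QD j z : `|Q j z| <= D z.
  have [c cr ->] := mvt j z; rewrite /D.
  have [z1|_] := ltP `|z.2| 1; last by rewrite !mul0r normr0.
  rewrite !mul1r normrM normrN.
  have [z2|z2] := ltP `|z.1| (rho + 4).
    rewrite mul1r mulrC; apply: ler_pM => //.
    by move: (u _) => a; have := normB_le_sqr a 0; rewrite subr0 expr0n addr0.
  rewrite d0 ?normr0 ?mulr0 ?mul0r //.
  have := near_z j z c cr z1; rewrite distrC => h1.
  have h2 := le_trans (lerB_dist _ _) h1; case/andP: (rj j) => _ r1.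
  by clear - r1 h2 z2; lra.
have cQ z : (fun j => Q j z) @ \oo --> Qoo z.
  rewrite /Qoo; have [z1|z1] := ltP `|z.2| 1; last first.
    rewrite !mul0r (_ : (fun j => Q j z) = fun=> 0); first exact: cvg_cst.
    by apply/funext => j; have [c _ ->] := mvt j z; rewrite ltNge z1 !mul0r.
  have [c hc] : exists c : nat -> R, forall j, `|c j| <= r_ j /\ Q j z =
      (`|z.2| < 1)%R%:R * u z.1 * - partial i psi (c j *: e + (- (r_ j *: z.2) + z.1)).
    have h j : exists c : R, `|c| <= r_ j /\ Q j z =
      (`|z.2| < 1)%R%:R * u z.1 * - partial i psi (c *: e + (- (r_ j *: z.2) + z.1)).
      by have [c ? ?] := mvt j z; exists c.
    by exists (fun j => sval (cid (h j))) => j; exact: (svalP (cid (h j))).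
  under eq_fun do rewrite (hc _).2 z1.
  apply: cvgMr; apply: cvgN.
  apply: (@cvg_comp _ _ _ (fun j => c j *: e + (- (r_ j *: z.2) + z.1)) (partial i psi) _ (nbhs z.1)); last exact: cd.
  apply/cvgrPdist_le => eps eps0.
  have e20 : 0 < eps / 2 by rewrite divr_gt0.
  move/cvgrPdist_le : r_0 => /(_ _ e20)[N _ hN].
  exists N => // j Nj /=; rewrite distrC; apply: le_trans (near_z j z (c j) (hc j).1 z1) _.
  have := hN j Nj; rewrite /= sub0r normrN (ger0_norm (ltW (rp j))); clear -n; lra.
have [|||iQ _ h] := @dominated_convergence _ _ _ mu2 setT measurableT (fun j z => (Q j z)%:E)
    (fun z => (Qoo z)%:E) (fun z => (D z)%:E) (fun j => proj2 (measurable_EFinP _ _) (mQ j))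
    (proj2 (measurable_EFinP _ _) mQoo).
- by apply: aeW => z _; apply: cvg_EFin; [exact: nearW|exact: cQ].
- by apply: (bd_integrable (c := 2 ^+ n * (M1 * ((2 * (rho + 4)) ^+ n + B)))) => //; apply: (bd_ext bD) => z; rewrite ger0_norm.
- by apply: aeW => z j _; rewrite /= lee_fin.
suff -> : (- (k%:E * \int[mu]_x (u x * partial i psi x)%:E) = \int[mu2]_z (Qoo z)%:E)%E by exact: h.
rewrite -(integral12_prod_meas1 iQ).
have iud : mu.-integrable setT (fun x => (u x * partial i psi x)%:E).
  apply: (bd_integrable (c := M1 * ((2 * (rho + 4)) ^+ n + B))); last by meas.
  apply: (bd_le (g := fun x : V => M1 * ((`|x| < rho + 4)%R%:R + u x ^+ 2))).
  - by apply: bdZ => //; apply: bdD => //; apply: bd_cube; rewrite addr_gt0.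
  - by meas.
  - by move=> x; exact: normr_ge0.
  move=> x; have [xr|xr] := ltP `|x| (rho + 4).
    rewrite normrM mulrC; apply: ler_pM => //.
    by move: (u _) => a; have := normB_le_sqr a 0; rewrite subr0 expr0n addr0.
  by rewrite d0 ?mulr0 ?normr0; [nn|apply: le_trans xr; rewrite lerD2l ler1n].
rewrite -mulNe -EFinN -integralZl //.
apply: eq_integral => x _; rewrite /fubini_F.
have -> : (fun y => (Qoo (x, y))%:E) = (fun y : V => (u x * - partial i psi x)%:E * ((`|y| < 1)%R%:R)%:E)%E.
  by apply/funext => y; rewrite -EFinM /Qoo; congr EFin; rewrite /= -mulrA mulrC.
rewrite integralZl //; last first.
  apply: (bd_integrable (c := (2 * 1) ^+ n)); last by meas.
  apply: (bd_ext (bd_cube ltr01)) => y; rewrite ger0_norm //; exact: ler0n.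
by rewrite kE -!EFinM; congr EFin; ring.
Qed.

End difference_quotients.

(** * Identification of the weak gradient *)

Section limit_gradient.
Context {R : realType} {n : nat}.
Local Notation V := 'rV[R]_n.
Local Notation mu := (@lebesgue_rV R n).
Implicit Types (f g u psi : V -> R).

Definition loc_bounded (f : V -> R) := forall r : R, 0 < r ->
  exists C, bd mu (fun x => (`|x| < r)%R%:R * `|f x|) C.

Lemma loc_bounded_L1_loc f : measurable_fun setT f -> loc_bounded f -> L1_loc setT f.
Proof.
move=> mf lf; split=> // K cK _; have [r r0 hr] := compact_cube cK.
have mK : measurable K.
  rewrite -[K]setCK; apply: measurableC; apply: open_measurable_rV.
  by apply: closed_openC; apply: compact_closed => //; exact: norm_hausdorff.
have [C [m1 p1 h1]] := lf r r0; apply: le_lt_trans (ltry C); apply: le_trans h1.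
rewrite [leLHS]integral_mkcond; apply: ge0_le_integral => //.
- by move=> x _; rewrite patchE; case: ifP => // _; rewrite lee_fin.
- apply/(measurable_restrictT (fun x => (`|f x|)%:E) mK).
  by apply: measurable_funTS; meas.
- exact/measurable_EFinP.
move=> x _; rewrite patchE; case: ifPn => [|_]; last by rewrite lee_fin.
by rewrite inE => /hr ->; rewrite mul1r.
Qed.

Section limit.
Variables (u II : V -> R) (B K : R) (r_ : nat -> R).
Hypotheses (bu : bd mu (fun x => u x ^+ 2) B) (mu_ : measurable_fun setT u)
  (I0 : forall x, 0 <= II x) (lI : loc_bounded II)
  (K0 : 0 <= K) (rj : forall j, 0 < r_ j <= 1) (r_0 : r_ @ \oo --> 0).

(** Two limits of the same pairing are compared: one by dominated convergence with the locally
    integrable majorant K II, the other by [pairing_limit]. *)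
Lemma slope_limit_derivative (i : 'I_n) :
  {ae mu, forall x, (forall j, `|slope (delta_mx ord0 i) (fun y => u (x + r_ j *: y)) / r_ j| <= K * II x) /\
    cvgn (fun j => slope (delta_mx ord0 i) (fun y => u (x + r_ j *: y)) / r_ j)} ->
  exists g, [/\ measurable_fun setT g, {ae mu, forall x, `|g x| <= K * II x} &
    forall psi, test_function setT psi ->
      (\int[mu]_x (u x * partial i psi x)%:E = - \int[mu]_x (g x * psi x)%:E)%E].
Proof.
set e : V := delta_mx ord0 i; pose q j (x : V) : R := slope e (fun y => u (x + r_ j *: y)) / r_ j.
move=> hq; have [k k1 kE] := @cube_mass R n.
have k0 : 0 < k by exact: lt_le_trans k1.
have mq j : measurable_fun setT (q j) by exact: measurable_incr_scaled.
pose qoo (x : V) : R := fine (limn_esup (fun j => (q j x)%:E)).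
have mqoo : measurable_fun setT qoo.
  apply: measurableT_comp; first exact: fine_measurable.
  by apply: measurable_fun_limn_esup => j; exact/measurable_EFinP.
have cq : {ae mu, forall x, (q ^~ x @ \oo --> qoo x) /\ forall j, `|q j x| <= K * II x}.
  apply: filterS hq => x [h1 h2]; split; last exact: h1.
  have hl : (fun j => q j x) @ \oo --> limn (fun j => q j x) by exact: h2.
  rewrite /qoo (_ : limn_esup _ = (limn (fun j => q j x))%:E) //.
  have /cvg_limn_einf_sup[_ ->] // : (fun j => (q j x)%:E) @ \oo --> (limn (fun j => q j x))%:E.
  by apply: cvg_EFin; [exact: nearW|exact: hl].
have qb : {ae mu, forall x, `|qoo x| <= K * II x}.
  apply: filterS cq => x [h1 h2].
  have h3 : (fun j => `|q j x|) @ \oo --> `|qoo x| by exact: cvg_norm.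
  rewrite -(cvg_lim _ h3) //; apply: limr_le; first by apply/cvg_ex; exists `|qoo x|.
  by exists 0%N.
(* Here the volume [k] of the cube is divided out; k >= 1 keeps the bound. *)
exists (fun x => k^-1 * qoo x); split; first by meas.
  apply: filterS qb => x; rewrite normrM ger0_norm ?invr_ge0 ?(ltW k0) //; apply: le_trans.
  by rewrite ler_piMl // invf_le1.
move=> psi tp.
have [rho rho0 p0] := test_function_support tp.
have cp := test_function_continuous tp.
have [M M0 pM] := continuous_support_bounded cp p0.
have mp : measurable_fun setT psi by exact: continuous_measurable_rV.
have [C hC] := lI rho0.
pose D (x : V) : R := (K * M) * ((`|x| < rho)%R%:R * `|II x|).
have bD : bd mu D (K * M * C) by apply: bdZ => //; exact: mulr_ge0.
have mqp j : measurable_fun setT (fun x => (q j x * psi x)%:E) by meas.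
have mqoop : measurable_fun setT (fun x => (qoo x * psi x)%:E) by meas.
have [|||iq _ h] := @dominated_convergence _ _ _ mu setT measurableT (fun j x => (q j x * psi x)%:E)
    (fun x => (qoo x * psi x)%:E) (fun x => (D x)%:E) mqp mqoop.
- apply: filterS cq => x [h1 _] _; apply: cvg_EFin; first exact: nearW.
  by apply: cvgM => //; exact: cvg_cst.
- apply: (bd_integrable (c := K * M * C)); last exact: bd_meas bD.
  by apply: (bd_ext bD) => x; rewrite ger0_norm //; exact: (bd_fun_ge0 bD).
- apply: filterS cq => x [_ h2] j _; rewrite /= lee_fin /D.
  have [xr|xr] := ltP `|x| rho; last by rewrite p0 // mulr0 normr0 mul0r mulr0.
  rewrite mul1r normrM mulrAC; apply: ler_pM => //.
  by rewrite (ger0_norm (I0 x)); exact: h2.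
have h' := pairing_limit (i := i) bu mu_ tp rj r_0 kE.
have E : (\int[mu]_x (qoo x * psi x)%:E = - (k%:E * \int[mu]_x (u x * partial i psi x)%:E))%E.
  exact: (cvg_unique _ h h').
have -> : (\int[mu]_x (k^-1 * qoo x * psi x)%:E = (k^-1)%:E * \int[mu]_x (qoo x * psi x)%:E)%E.
  by rewrite -integralZl //; apply: eq_integral => x _; rewrite -EFinM mulrA.
by rewrite E muleN oppeK muleA -EFinM mulVf ?mul1e // gt_eqF.
Qed.

Lemma limit_weak_gradient : (forall i : 'I_n, {ae mu, forall x,
    (forall j, `|slope (delta_mx ord0 i) (fun y => u (x + r_ j *: y)) / r_ j| <= K * II x) /\
    cvgn (fun j => slope (delta_mx ord0 i) (fun y => u (x + r_ j *: y)) / r_ j)}) ->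
  exists2 g, weak_gradient setT u g & {ae mu, forall x, forall i, `|g x ord0 i| <= K * II x}.
Proof.
move=> hq; have hg i := slope_limit_derivative (hq i).
pose G i := sval (cid (hg i)).
have [mG bG wG] : [/\ forall i, measurable_fun setT (G i), forall i, {ae mu, forall x, `|G i x| <= K * II x} &
    forall i psi, test_function setT psi ->
      (\int[mu]_x (u x * partial i psi x)%:E = - \int[mu]_x (G i x * psi x)%:E)%E].
  by split=> i; have [] := svalP (cid (hg i)).
exists (fun x => \row_i G i x); last first.
  have : {ae mu, forall x, forall i : 'I_n, `|G i x| <= K * II x} by exact: filter_forall.
  by apply: filterS => x h i; rewrite mxE.
split.
- apply: loc_bounded_L1_loc => // r r0; exists ((2 * r) ^+ n + B).
  apply: (bd_le (g := fun x : V => (`|x| < r)%R%:R + u x ^+ 2)); [|by meas|by move=> x; nn|].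
    by apply: bdD => //; exact: bd_cube.
  move=> x /=; case: (`|x| < r)%R => /=; last by rewrite mul0r; nn.
  by rewrite mul1r; have := normB_le_sqr (u x) 0; rewrite subr0 expr0n addr0.
- move=> i; have -> : (fun x => (\row_j G j x : V) ord0 i) = G i by apply/funext => x; rewrite mxE.
  apply: loc_bounded_L1_loc => // r r0; have [C hC] := lI r0; exists (K * C).
  apply: (bd_ae_le (g := fun x : V => K * ((`|x| < r)%R%:R * `|II x|))); first exact: bdZ.
  - by have := mG i => ?; meas.
  - by move=> x; nn.
  apply: filterS (bG i) => x h; rewrite mulrCA; apply: ler_wpM2l; first exact: ler0n.
  by rewrite (ger0_norm (I0 x)).
by move=> i psi tp; rewrite wG //; congr (- _)%E; apply: eq_integral => x _; rewrite mxE.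
Qed.

End limit.

End limit_gradient.

(** * Starting at ever larger scales *)

Section slope_limits.
Context {R : realType} {n : nat}.
Local Notation V := 'rV[R]_n.
Local Notation mu := (@lebesgue_rV R n).
Implicit Types (s : R) (u psi : V -> R) (F G : V -> R -> R).

(** [S] bounds the sums for all starting scales at once, so sending p to infinity in [slope_series]
    removes the term with [B] from the bound; convergence already follows from p = 0. *)
Lemma slope_limits (L s0 : R) : (2 <= n)%N -> 1 <= L -> 2^-1 < s0 -> s0 < 1 ->
  exists (N : nat) (K : R), [/\ (0 < N)%N, 0 < K &
    forall s F G u (B : R) (m : R -> R) (x0 h : V) (S : R), s0 <= s -> s < 1 ->
    flux L s F -> potential L s F G ->
    measurable_fun setT u -> (exists c, enb s u c) -> bd mu (fun x => u x ^+ 2) B -> `|h| <= 1 ->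
    (forall r : R, 0 <= m r) ->
    (forall (r : R) psi, 0 < r -> H0 s 1 psi -> (forall x, `|psi x| <= 1) ->
      (form (rescale_flux s r F) (fun x : V => u (x0 + r *: x)%R) psi <= (r * m r)%:E)%E) ->
    (forall p k, \sum_(0 <= j < k) m (2^-1 ^+ (N * j) * 2 ^+ (N * p)) <= S) ->
    let q k := slope h (fun x : V => u (x0 + 2^-1 ^+ (N * k) *: x)) / 2^-1 ^+ (N * k) in
    (forall k, `|q k| <= K * S) /\ cvgn q].
Proof.
move=> n2 L1 s0h s01; have [N [K1 [K2 [N0 K20 H]]]] := slope_series n2 L1 s0h s01.
exists N, K2; split=> // s F G u B m x0 h S ss0 s1 fF pG mu_ eu bu h1 m0 hm hS q.
have {}H p := H s F G u B m x0 h S p ss0 s1 fF pG mu_ eu bu h1 m0 hm (hS p).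
split=> [i|]; last first.
  apply: (bounded_variation_cvg (B := K1 * (B + 1) * 2^-1 ^+ (N * 0) + K2 * S)) => k.
  by have [_] := H 0%N k; rewrite !muln0 expr0 mulr1 /q; under eq_bigr do rewrite !mulr1.
apply/ler_addgt0Pr => e e0.
have [||M hM] := @exists_expr_le R (2^-1 ^+ N) (K1 * (B + 1)) e _ _ e0.
- by rewrite exprn_ge0 // invr_ge0.
- by rewrite exprn_ilt1 // ?invr_ge0 // ?invf_lt1 // ?ltr1n // -lt0n.
(* For the chain started at 2^(NM), the scale 2^-(Ni) has index M + i. *)
have [+ _] := H M (M + i)%N.
rewrite (_ : 2^-1 ^+ (N * (M + i)) * 2 ^+ (N * M) = 2^-1 ^+ (N * i)); last first.
  by rewrite mulnDr exprD mulrAC -exprMn mulVf ?pnatr_eq0 // expr1n mul1r.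
move=> h2; apply: le_trans h2 _; rewrite addrC lerD2l exprM; exact: hM.
Qed.

End slope_limits.

(** * Dyadic sums and the Riesz potential *)

Section dyadic_sums.
Context {R : realType}.

(** The powers r_j^(-b) at least double from one index to the next because b >= 1, so the last one
    with t < 2 r_j controls the sum. *)
Lemma dyadic_sum (b t : R) (r_ : nat -> R) k : 1 <= b -> 0 < t -> (forall j, 0 < r_ j) ->
  (forall j, 2 * r_ j.+1 <= r_ j) ->
  \sum_(0 <= j < k) (r_ j `^ (- b) * (t < 2 * r_ j)%R%:R) <= 2 * (t / 2) `^ (- b).
Proof.
move=> b1 t0 rp r2; have b0 : 0 <= b by exact: le_trans b1.
have step j : 2 * r_ j `^ (- b) <= r_ j.+1 `^ (- b).
  have h : (2^-1 * r_ j) `^ (- b) <= r_ j.+1 `^ (- b).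
    by apply: powRN_le => //; have := r2 j; lra.
  apply: le_trans h; rewrite powRM ?invr_ge0 // ?(ltW (rp _)) //; apply: ler_wpM2r; first exact: powR_ge0.
  rewrite -[2^-1]powR_inv1 // -powRrM mulrNN mul1r -[leLHS]powRr1 //.
  by apply: ler_powR => //; rewrite ler1n.
have full j : \sum_(0 <= i < j) r_ i `^ (- b) <= r_ j `^ (- b).
  elim: j => [|j IH]; first by rewrite big_geq // powR_ge0.
  by rewrite big_nat_recr //=; have := step j; move: IH; lra.
elim: k => [|k IH]; first by rewrite big_geq // mulr_ge0 // powR_ge0.
rewrite big_nat_recr //=; have [tk|_] := ltP t (2 * r_ k); last by rewrite mulr0 addr0.
have h1 : \sum_(0 <= j < k) (r_ j `^ (- b) * (t < 2 * r_ j)%R%:R) <= r_ k `^ (- b).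
  apply: le_trans (full k); apply: ler_sum => j _; rewrite ler_piMr ?powR_ge0 //.
  by case: (t < _)%R.
have h2 : r_ k `^ (- b) <= (t / 2) `^ (- b).
  apply: powRN_le => //; first by rewrite divr_gt0.
  by move: tk; lra.
by rewrite mulr1; move: h1 h2; lra.
Qed.

End dyadic_sums.

Section riesz.
Context {R : realType} {n : nat}.
Local Notation V := 'rV[R]_n.
Local Notation mu := (@lebesgue_rV R n).
Variables (nu : {finite_measure set V -> \bar R}) (b : R).
Hypotheses (b0 : 0 < b) (bn : b < n%:R).

Definition cube_measure (x : V) (r : R) : R := fine (nu [set y | `|y - x| < r]).

(** [fine] sends an infinite potential to 0, and the integrand is 0 at y = x for b > 0; both
    defaults concern only a null set of x, by [sup_riesz_finite] and [no_atom]. *)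
Definition sup_riesz (x : V) : R := fine (\int[nu]_y (`|y - x| `^ (- b))%:E)%E.

Let measurable_cube (x : V) (r : R) : measurable [set y : V | `|y - x| < r].
Proof.
rewrite -[X in measurable X]setTI.
rewrite (_ : [set y | _] = (fun y : V => (`|y - x| < r)%R) @^-1` [set true]) //.
have m1 : measurable_fun setT (fun y : V => (`|y - x| < r)%R) by meas.
exact: m1.
Qed.

Let nu_fin (A : set V) : measurable A -> nu A = (fine (nu A))%:E.
Proof. by move=> mA; rewrite fineK //; exact: fin_num_measure. Qed.

Lemma cube_measure_ge0 x r : 0 <= cube_measure x r.
Proof. by apply: fine_ge0; exact: measure_ge0. Qed.

Lemma sup_riesz_ge0 x : 0 <= sup_riesz x.
Proof. by apply: fine_ge0; apply: integral_ge0 => y _; rewrite lee_fin powR_ge0. Qed.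

Lemma cube_measureE x r : (\int[nu]_y ((`|y - x| < r)%R%:R)%:E = (cube_measure x r)%:E)%E.
Proof.
rewrite /cube_measure -nu_fin; last exact: measurable_cube.
rewrite -[X in nu X]setIT -(integral_indic _ measurableT) //.
apply: eq_integral => y _; rewrite indicE; congr (_%:R)%:E; congr nat_of_bool.
by apply/idP/idP; rewrite inE.
Qed.

Lemma sum_cube_measure (a r_ : nat -> R) x k : (forall j, 0 <= a j) ->
  (\int[nu]_y (\sum_(0 <= j < k) (a j * (`|y - x| < r_ j)%R%:R))%:E =
   (\sum_(0 <= j < k) a j * cube_measure x (r_ j))%:E)%E.
Proof.
move=> a0; elim: k => [|k IH].
  by under eq_integral do rewrite big_geq //; rewrite integral0 big_geq.
under eq_integral do rewrite big_nat_recr //= EFinD.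
have mt j : measurable_fun setT (fun y : V => a j * (`|y - x| < r_ j)%R%:R) by meas.
rewrite ge0_integralD //; first 1 last.
- by move=> y _; rewrite lee_fin; apply: sumr_ge0 => j _; apply: mulr_ge0.
- by apply/measurable_EFinP; apply: measurable_sum.
- by move=> y _; rewrite lee_fin; apply: mulr_ge0.
- exact/measurable_EFinP.
rewrite IH big_nat_recr //= EFinD; congr (_ + _)%E.
under eq_integral do rewrite EFinM.
rewrite ge0_integralZl_EFin //; first by rewrite cube_measureE.
by apply/measurable_EFinP; meas.
Qed.

Lemma measurable_sup_riesz : measurable_fun setT sup_riesz.
Proof.
apply: measurableT_comp; first exact: fine_measurable.
apply: (@measurable_fun_fubini_tonelli_F _ _ _ _ _ nu (fun z : V * V => (`|z.2 - z.1| `^ (- b))%:E)).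
  by apply/measurable_EFinP; meas.
by move=> z; rewrite lee_fin powR_ge0.
Qed.

(** For fixed y the kernel is locally integrable in x, as b < n, with a bound independent of y; the
    measure nu is finite. *)
Lemma sup_riesz_integral_loc (r : R) : 0 < r -> exists C,
  bd (mu \x nu)%E (fun z : V * V => (`|z.1| < r)%R%:R * `|z.2 - z.1| `^ (- b)) C.
Proof.
move=> r0; set c := 2 `^ b * 2 ^+ n / (1 - 2 `^ (b - n%:R)).
exists ((c + (2 * r) ^+ n) * fine (nu setT)).
apply: (bd_prod_y (h := fun _ : V => c + (2 * r) ^+ n)); first by meas.
- by move=> z; nn.
- move=> y; apply: (bd_le (g := fun x : V => (`|(- y) + x| < 1)%R%:R * `|- y + x| `^ (- b) + (`|x| < r)%R%:R)).
  + by apply: bdD; [exact: (bd_shift (- y) (bd_near b0 bn))|exact: bd_cube].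
  + by meas.
  + by move=> x; nn.
  move=> x /=; rewrite distrC [- y + x]addrC.
  case: (`|x| < r)%R; last by rewrite mul0r addr0; nn.
  rewrite mul1r; have [h|h] := ltP `|x - y| 1; first by rewrite mul1r lerDl.
  by rewrite mul0r add0r; have := powRN_le (ltW b0) ltr01 h; rewrite powR1.
split=> //.
  by move=> x; apply: addr_ge0; [exact: bd_ge0 (bd_near b0 bn)|nn; rewrite mulr_ge0 // ltW].
rewrite integral_cst // EFinM -nu_fin //.
Qed.

Lemma sup_riesz_loc : loc_bounded sup_riesz.
Proof.
move=> r r0; have [C hC] := sup_riesz_integral_loc r0; exists C.
apply: (bd_section_x hC).
- by have h := measurable_sup_riesz; meas.
- by move=> x; nn.
move=> x; rewrite (ger0_norm (sup_riesz_ge0 x)).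
under eq_integral do rewrite EFinM /=.
rewrite ge0_integralZl_EFin //; last by apply/measurable_EFinP; meas.
rewrite EFinM; apply: lee_wpmul2l; first by rewrite lee_fin ler0n.
rewrite /sup_riesz; case: (integral _ _ _) (@integral_ge0 _ _ _ nu setT (fun y => (`|y - x| `^ (- b))%:E)) => //=.
  by move=> _; exact: leey.
by move=> /(_ _)/= h; apply: h => y _; rewrite lee_fin powR_ge0.
Qed.

Lemma sup_riesz_finite : {ae mu, forall x, bd nu (fun y : V => `|y - x| `^ (- b)) (sup_riesz x)}.
Proof.
have h (k : nat) : {ae mu, forall x, `|x| < k.+1%:R ->
    bd nu (fun y : V => `|y - x| `^ (- b)) (sup_riesz x)}.
  have [C hC] := sup_riesz_integral_loc (ltr0Sn R k).
  have iC : (mu \x nu)%E.-integrable setT (EFin \o (fun z : V * V => (`|z.1| < k.+1%:R)%R%:R * `|z.2 - z.1| `^ (- b))).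
    by apply: (bd_integrable (c := C)); [apply: (bd_ext hC) => z; rewrite ger0_norm //; nn|exact: bd_meas hC].
  have := integrable_ae measurableT (integrable_fubini_F iC).
  apply: filterS => x /(_ Logic.I) h xk; split; first by meas.
    by move=> y; exact: powR_ge0.
  rewrite /sup_riesz fineK //; move: h; rewrite /fubini_F /= xk.
  by under eq_integral do rewrite mul1r.
have := ae_foralln h; apply: filterS => x {}h.
have [k hk] : exists k : nat, `|x| < k.+1%:R.
  by exists (Num.truncn `|x|); exact: truncnS_gt.
exact: h hk.
Qed.

(** Tonelli's theorem on the diagonal, whose sections in x are null. An atom at x would count in
    every cube around x while the power in [sup_riesz] vanishes there. *)
Lemma no_atom : {ae mu, forall x, {ae nu, forall y : V, y != x}}.
Proof.
have z0 : bd (mu \x nu)%E (fun z : V * V => (`|z.2 - z.1| <= 0)%R%:R) 0.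
  apply: (bd_prod_y (h := fun _ : V => 0)); [by meas|by move=> z; nn| |exact: bd0].
  move=> y; apply: bd_small; [by meas|by move=> x; nn|move=> e e0].
  have m0 : 0 < Num.min 1 e / 2 by rewrite divr_gt0 // lt_min ltr01.
  have m1 : 2 * (Num.min 1 e / 2) = Num.min 1 e by rewrite mulrC divfK // pnatr_eq0.
  have n0 : (0 < n)%N by rewrite -(ltr_nat R); exact: lt_trans bn.
  apply: (bdW (c := (2 * (Num.min 1 e / 2)) ^+ n)); last first.
    rewrite m1; apply: le_trans (_ : _ <= Num.min 1 e) _; last by rewrite ge_min lexx orbT.
    case: n n0 => // k _; rewrite exprS ler_piMr ?le_min ?ler01 ?(ltW e0) //.
    by rewrite exprn_ile1 // ?le_min ?ler01 ?(ltW e0) // ge_min lexx.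
  apply: bd_le (bd_cube_at y m0) _ _ _; [by meas|by move=> x; nn|move=> x /=].
  by rewrite distrC; apply: boolr_le; rewrite ?ler0n // => h; rewrite (le_lt_trans h).
have hA : {ae mu, forall x, fine (\int[nu]_y ((`|y - x| <= 0)%R%:R)%:E)%E = 0}.
  apply: bd_ae0; apply: (bd_section_x z0).
  - apply: measurableT_comp; first exact: fine_measurable.
    apply: (@measurable_fun_fubini_tonelli_F _ _ _ _ _ nu (fun z : V * V => ((`|z.2 - z.1| <= 0)%R%:R)%:E)).
      by apply/measurable_EFinP; meas.
    by move=> z; rewrite lee_fin ler0n.
  - by move=> x; apply: fine_ge0; apply: integral_ge0 => y _; rewrite lee_fin ler0n.
  move=> x; case: (integral _ _ _) (@integral_ge0 _ _ _ nu setT (fun y => ((`|y - x| <= 0)%R%:R)%:E)) => //=.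
    by move=> _; exact: leey.
  by move=> h; apply: h => y _; rewrite lee_fin ler0n.
apply: filterS hA => x hx.
have : bd nu (fun y : V => (`|y - x| <= 0)%R%:R) 0.
  have bN : bd nu (fun y : V => (`|y - x| <= 0)%R%:R) (fine (nu setT)).
    split; [by meas|by move=> y; nn|].
    rewrite -nu_fin //; apply: le_trans (_ : _ <= \int[nu]_y 1)%E _; last by rewrite integral_cst // mul1e.
    apply: ge0_le_integral => //; first by apply/measurable_EFinP; meas.
    by move=> y _; rewrite lee_fin; case: (`|y - x| <= 0)%R.
  have [c [E h _]] := bd_int bN; have c0 : c = 0 by move: hx; rewrite E.
  by rewrite c0 in h.
move/bd_ae0; apply: filterS => y; apply: contra_eqN => /eqP ->.
by rewrite subrr normr0 lexx oner_neq0.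
Qed.

(** [dyadic_sum] integrated against nu. The sequences are quantified inside the almost everywhere
    statement, so one null set serves all starting scales. *)
Lemma dyadic_cube_measure : 1 <= b -> {ae mu, forall x, forall (r_ : nat -> R) k,
  (forall j, 0 < r_ j) -> (forall j, 2 * r_ j.+1 <= r_ j) ->
  \sum_(0 <= j < k) (r_ j `^ (- b) * cube_measure x (2 * r_ j)) <= 2 * 2 `^ b * sup_riesz x}.
Proof.
move=> b1; apply: filterS2 sup_riesz_finite no_atom => x hx ax r_ k r0 r2.
have : bd nu (fun y => \sum_(0 <= j < k) (r_ j `^ (- b) * (`|y - x| < 2 * r_ j)%R%:R))
    (2 * 2 `^ b * sup_riesz x).
  apply: (bd_ae_le (g := fun y : V => 2 * 2 `^ b * `|y - x| `^ (- b))).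
  - by apply: bdZ => //; nn.
  - by apply: measurable_sum => j; meas.
  - by move=> y; apply: sumr_ge0 => j _; nn.
  apply: filterS ax => y yx; have h0 : 0 < `|y - x| by rewrite normr_gt0 subr_eq0.
  apply: le_trans (dyadic_sum k b1 h0 r0 r2) _.
  rewrite powRM ?normr_ge0 ?invr_ge0 // -[2^-1]powR_inv1 // -powRrM mulrNN mul1r.
  by rewrite -mulrA [2 `^ b * _]mulrC.
case=> _ _; rewrite sum_cube_measure; last by move=> j; exact: powR_ge0.
by rewrite lee_fin.
Qed.

End riesz.

(** * Comparison of the Euclidean and the sup norm *)

Section euclidean_norm.
Context {R : realType} {n : nat}.
Local Notation V := 'rV[R]_n.
Implicit Types (z : V).

Lemma enorm_ge0 z : 0 <= enorm z. Proof. exact: sqrtr_ge0. Qed.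

Lemma norm_le_enorm z : `|z| <= enorm z.
Proof.
apply/normV_leP => [|i]; first exact: enorm_ge0.
rewrite -sqrtr_sqr; apply: ler_wsqrtr; rewrite (bigD1 i) //= lerDl.
by apply: sumr_ge0 => j _; exact: sqr_ge0.
Qed.

Lemma enorm_le_bound z (M : R) : 0 <= M -> (forall i, `|z ord0 i| <= M) -> enorm z <= n%:R * M.
Proof.
move=> M0 h; rewrite -[leRHS]ger0_norm; last exact: mulr_ge0.
rewrite -sqrtr_sqr; apply: ler_wsqrtr.
apply: le_trans (_ : _ <= \sum_(i < n) M ^+ 2) _.
  apply: ler_sum => i _; rewrite -(real_normK (num_real (z ord0 i))).
  by apply: lerXn2r; rewrite ?nnegrE.
rewrite sumr_const card_ord -[leLHS]mulr_natl exprMn; apply: ler_wpM2r; first exact: sqr_ge0.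
by rewrite -natrX ler_nat; case: n => // k; rewrite expnS leq_pmulr // expn_gt0.
Qed.

Lemma enorm_le_norm z : enorm z <= n%:R * `|z|.
Proof. by apply: enorm_le_bound => // i; exact: coord_le_norm. Qed.

Lemma enorm0 : enorm (0 : V) = 0.
Proof. by apply/eqP; rewrite eq_le enorm_ge0 andbT; have := enorm_le_norm 0; rewrite normr0 mulr0. Qed.

Lemma enorm_gt0 z : z != 0 -> 0 < enorm z.
Proof. by move=> z0; apply: lt_le_trans (norm_le_enorm z); rewrite normr_gt0. Qed.

Lemma measurable_enorm : measurable_fun setT (enorm : V -> R).
Proof.
have -> : (enorm : V -> R) = (fun z : V => (\sum_(i < n) z ord0 i ^+ 2) `^ 2^-1).
  by apply/funext => z; rewrite powR12_sqrt //; apply: sumr_ge0 => i _; exact: sqr_ge0.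
apply: (measurableT_comp (measurable_powR _)); apply: measurable_sum => i.
by apply: measurable_funX; exact: measurable_coord.
Qed.

Lemma powR_norm_le_enorm z (a : R) : 0 <= a -> z != 0 ->
  enorm z `^ (- a) <= `|z| `^ (- a) <= n%:R `^ a * enorm z `^ (- a).
Proof.
move=> a0 z0; have zp : 0 < `|z| by rewrite normr_gt0.
rewrite powRN_le ?norm_le_enorm //=.
have n0 : 0 < n%:R :> R.
  by have := lt_le_trans (enorm_gt0 z0) (enorm_le_norm z); rewrite pmulr_lgt0.
have h := powRN_le a0 (enorm_gt0 z0) (enorm_le_norm z).
rewrite powRM // ?(ltW zp) // in h; rewrite (le_trans _ (ler_wpM2l (powR_ge0 _ _) h)) //.
by rewrite mulrA [n%:R `^ (- a)]powRN mulfV ?mul1r // gt_eqF // powR_gt0.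
Qed.

Lemma sup_riesz_le (nu : {finite_measure set V -> \bar R}) (beta : R) x : 0 < n%:R - beta -> 0 <= beta ->
  ((sup_riesz nu (n%:R - beta) x)%:E <= (n%:R ^+ n)%:E * riesz_potential beta nu x)%E.
Proof.
move=> b0 be0; set b := n%:R - beta.
have mr : measurable_fun setT (fun y : V => ((enorm (x - y) `^ b)%:E)^-1)%E.
  have -> : (fun y : V => ((enorm (x - y) `^ b)%:E)^-1)%E =
      (fun y : V => if (enorm (x - y) `^ b <= 0)%R then +oo else ((enorm (x - y) `^ b)^-1)%:E)%E.
    by apply/funext => y; rewrite inver le_eqVlt [(_ < 0)%R]ltNge powR_ge0 orbF.
  have me := measurable_enorm.
  have mp : measurable_fun setT (fun y : V => enorm (x - y) `^ b).
    apply: (measurableT_comp (measurable_powR _)).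
    by apply: (measurableT_comp me); meas.
  by apply: measurable_fun_ifT; meas.
have r0 y : (0 <= ((enorm (x - y) `^ b)%:E)^-1)%E by rewrite inve_ge0 lee_fin powR_ge0.
apply: le_trans (_ : _ <= \int[nu]_y (`|y - x| `^ (- b))%:E)%E _.
  rewrite /sup_riesz; case: (integral _ _ _) (@integral_ge0 _ _ _ nu setT (fun y => (`|y - x| `^ (- b))%:E)) => //=.
    by move=> _; exact: leey.
  by move=> h; apply: h => y _; rewrite lee_fin powR_ge0.
rewrite /riesz_potential -ge0_integralZl_EFin //.
apply: ge0_le_integral => //.
- by apply/measurable_EFinP; meas.
- exact: measurable_funeM.
(* At y = x the Riesz kernel is +oo, so the comparison is trivial there. *)
move=> y _; have [->|yx] := eqVneq y x.
  rewrite subrr enorm0 powR0 ?gt_eqF // inve0 mulry gtr0_sg ?mul1e ?leey //.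
  rewrite exprn_gt0 // ltr0n lt0n; apply: contraTneq b0 => ->.
  by rewrite sub0r oppr_gt0 -leNgt.
have xy : x - y != 0 by rewrite subr_eq0 eq_sym.
rewrite inver gt_eqF ?powR_gt0 ?enorm_gt0 // -EFinM lee_fin distrC.
have /andP[_ h] := powR_norm_le_enorm (ltW b0) xy; apply: le_trans h _.
rewrite powRN; apply: ler_wpM2r; first by rewrite invr_ge0 powR_ge0.
have n0 : (0 < n)%N by rewrite lt0n; apply: contraTneq b0 => ->; rewrite sub0r oppr_gt0 -leNgt.
by rewrite -powR_mulrn //; apply: ler_powR; [rewrite ler1n|rewrite /b gerBl].
Qed.

End euclidean_norm.

(** * A convex primitive of the nonlinearity *)

Section convex_primitive.
Context {R : realType}.
Variable phi : R -> R.
Hypotheses (mphi : measurable_fun setT phi)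
  (oddphi : forall t, phi (- t) = - phi t)
  (incphi : forall t t', t <= t' -> phi t <= phi t').

Let leb1 := @lebesgue_measure R.

Let phi0 : phi 0 = 0.
Proof. by apply/eqP; have := oddphi 0; rewrite oppr0 => /eqP; rewrite -addr_eq0 -mulr2n mulrn_eq0. Qed.

Let itvc (a b : R) (t : R) : R := ((a < t) && (t <= b))%R%:R.

Let mitvc a b : measurable_fun setT (itvc a b).
Proof.
rewrite /itvc; apply: measurable_natr; apply: measurable_and; last by meas.
by apply: (measurable_fun_ltr (f := fun=> a) (g := id)); meas.
Qed.

Let mI a b : measurable_fun setT (fun t : R => (itvc a b t)%:E).
Proof. by apply/measurable_EFinP; exact: mitvc. Qed.

Let itvc0 a b t : (0 <= (itvc a b t)%:E)%E.
Proof. by rewrite lee_fin /itvc ler0n. Qed.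

Let bd_itv a b : a <= b -> (\int[leb1]_t (itvc a b t)%:E = (b - a)%:E)%E.
Proof.
move=> ab; have -> : (fun t => (itvc a b t)%:E) = (fun t => (\1_(`]a, b]%classic : set (measurableTypeR R)) t)%:E).
  apply/funext => t; rewrite /itvc indicE; congr (_%:R)%:E; congr nat_of_bool.
  by apply/idP/idP; rewrite inE /= in_itv.
rewrite integral_indic // setIT; apply: etrans (lebesgue_measure_itv _) _; rewrite /= lte_fin.
by move: ab; rewrite le_eqVlt => /predU1P[->|->]; rewrite ?ltxx ?subrr // EFinB.
Qed.

Let area (a b : R) : R := fine (\int[leb1]_t (itvc a b t * phi t)%:E)%E.

Let mint a b : measurable_fun setT (fun t : R => itvc a b t * phi t).
Proof. by apply: measurable_funM => //; exact: mitvc. Qed.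

Let mP a b : measurable_fun setT (fun t : R => (itvc a b t * phi t)%:E).
Proof. by apply/measurable_EFinP; exact: mint. Qed.

Let int_ge0 (a b t : R) : 0 <= a -> 0 <= itvc a b t * phi t.
Proof.
move=> a0; rewrite /itvc; have [at_|_] := ltP a t; last by rewrite mul0r.
by case: (t <= b); rewrite /= ?mul0r // mul1r -phi0; apply: incphi; exact: le_trans a0 (ltW at_).
Qed.

Let areaE a b : 0 <= a -> a <= b ->
  (\int[leb1]_t (itvc a b t * phi t)%:E = (area a b)%:E)%E /\
  phi a * (b - a) <= area a b <= phi b * (b - a).
Proof.
move=> a0 ab; have b0 := le_trans a0 ab.
have pa : 0 <= phi a by rewrite -phi0; exact: incphi.
have pb : 0 <= phi b by rewrite -phi0; exact: incphi.
have up : (\int[leb1]_t (itvc a b t * phi t)%:E <= (phi b * (b - a))%:E)%E.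
  rewrite EFinM -(bd_itv ab) -ge0_integralZl_EFin //; last exact: mI.
  apply: ge0_le_integral => //; first by move=> t _; rewrite lee_fin int_ge0.
  - exact: mP.
  - by apply: measurable_funeM; exact: mI.
  move=> t _; rewrite -EFinM lee_fin /itvc mulrC; case: (a < t) => /=; last by rewrite !mulr0.
  by have [tb|_] := leP t b; rewrite ?mulr0 // ler_wpM2r // incphi.
have lo : ((phi a * (b - a))%:E <= \int[leb1]_t (itvc a b t * phi t)%:E)%E.
  rewrite EFinM -(bd_itv ab) -ge0_integralZl_EFin //; last exact: mI.
  apply: ge0_le_integral => //; first by move=> t _; rewrite -EFinM lee_fin mulr_ge0 // ler0n.
  - by apply: measurable_funeM; exact: mI.
  - exact: mP.
  move=> t _; rewrite -EFinM lee_fin /itvc mulrC.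
  have [at_|_] := ltP a t; last by rewrite !mul0r.
  by case: (t <= b); rewrite /= ?mul0r // !mul1r incphi // ltW.
by rewrite /area; move: up lo; case: (integral _ _ _) => //= r; rewrite !lee_fin => -> ->.
Qed.

Let area_add a b : 0 <= a -> a <= b -> area 0 b = area 0 a + area a b.
Proof.
move=> a0 ab; have b0 := le_trans a0 ab.
apply: EFin_inj; rewrite EFinD -(areaE (lexx 0) a0).1 -(areaE a0 ab).1 -(areaE (lexx 0) b0).1.
rewrite -ge0_integralD //; first last.
- exact: mP.
- by move=> t _; rewrite lee_fin int_ge0.
- exact: mP.
- by move=> t _; rewrite lee_fin int_ge0.
apply: eq_integral => t _; rewrite -EFinD -mulrDl /itvc; congr (_ * _)%:E.
have [h1|h1] := ltP 0 t; have [h2|h2] := leP t a; have [h3|h3] := ltP a t; have [h4|h4] := leP t b;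
  rewrite /= ?addr0 ?add0r //; lra.
Qed.

Let tangent x a : 0 <= x -> 0 <= a -> phi a * (x - a) <= area 0 x - area 0 a.
Proof.
move=> x0 a0; have [xa|ax] := leP x a.
  have [_ /andP[_ h]] := areaE x0 xa; have := area_add x0 xa; move: h; nra.
have [_ /andP[h _]] := areaE a0 (ltW ax); have := area_add a0 (ltW ax); move: h; nra.
Qed.

(** The area under phi from 0 to |b|: even because phi is odd, and its tangent inequality is
    monotonicity of phi integrated between the two points. *)
Lemma exists_convex_primitive : exists Q : R -> R,
  [/\ measurable_fun setT Q, Q 0 = 0 &
  forall a b, phi a * (b - a) <= Q b - Q a].
Proof.
exists (fun b => area 0 `|b|); split.
- rewrite /area; apply: measurableT_comp; first exact: fine_measurable.
  apply: (@measurable_fun_fubini_tonelli_F _ _ _ _ _ leb1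
     (fun z : R * R => (itvc 0 `|z.1| z.2 * phi z.2)%:E)).
    by apply/measurable_EFinP; rewrite /itvc; meas.
  by move=> z; rewrite lee_fin int_ge0.
- have [_] := areaE (lexx 0) (lexx 0); rewrite subrr !mulr0 normr0 => h.
  by apply/eqP; rewrite eq_le andbC.
move=> a b; have [a0|a0] := leP 0 a.
  rewrite (ger0_norm a0); apply: le_trans (tangent (normr_ge0 b) a0).
  by apply: ler_wpM2l; rewrite ?lerD2r ?ler_norm // -phi0 incphi.
rewrite (ltr0_norm a0); have a1 : 0 <= - a by rewrite oppr_ge0 ltW.
apply: le_trans (tangent (normr_ge0 b) a1); rewrite oddphi.
have : phi a <= 0 by rewrite -phi0 incphi // ltW.
have : - b <= `|b| by rewrite -normrN ler_norm.
nra.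
Qed.

End convex_primitive.

Lemma weighted_convexity {R : realType} (W v j N l P Qa Qb a b : R) : N * j <= W * v ^+ 2 -> 0 <= W -> 0 <= l ->
  (P - 2 * l * (a * v)) * (b * v - a * v) <= Qb - Qa ->
  l * N * j * (b - a) ^+ 2 <= W * (Qb + l * (b * v) ^+ 2) - W * (Qa + l * (a * v) ^+ 2) - W * (P * v) * (b - a).
Proof.
move=> h1 W0 l0 h2.
have h3 : l * (b - a) ^+ 2 * (N * j) <= l * (b - a) ^+ 2 * (W * v ^+ 2).
  by apply: ler_wpM2l => //; rewrite mulr_ge0 // sqr_ge0.
have h4 := ler_wpM2l W0 h2.
by nra.
Qed.

(** * The flux of the equation *)

Section concrete_flux.
Context {R : realType} {n : nat}.
Local Notation V := 'rV[R]_n.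
Local Notation mu := (@lebesgue_rV R n).
Local Notation mu2 := (mu \x mu)%E.
Variables (Lambda s : R) (Phi : R -> R).
Hypotheses (n0 : (0 < n)%N) (L1 : 1 <= Lambda) (s0 : 0 < s) (s1 : s < 1)
  (hPhi : structure_assumption Lambda Phi).

Definition phi_flux (zeta : V) (t : R) : R :=
  (1 - s) * (Phi (t / enorm zeta `^ s) / enorm zeta `^ s / enorm zeta ^+ n).

(** The factor n^(n+2) bounds the ratio of the kernels in the two norms, since n + 2s <= n + 2. *)
Definition ellipticity : R := Lambda * n%:R ^+ (n + 2).

Let w (zeta : V) : R := (1 - s) / enorm zeta ^+ n.
Let iv (zeta : V) : R := (enorm zeta `^ s)^-1.

Let Lp : 0 < Lambda. Proof. exact: lt_le_trans L1. Qed.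
Let nn1 : 1 <= n%:R ^+ (n + 2) :> R. Proof. by rewrite exprn_ege1 // ler1n. Qed.
Let np : 0 < n%:R ^+ (n + 2) :> R. Proof. exact: lt_le_trans nn1. Qed.

Lemma ellipticity_ge1 : 1 <= ellipticity.
Proof. by rewrite /ellipticity (le_trans L1) // ler_peMr // ltW. Qed.

Let w0 zeta : 0 <= w zeta.
Proof. by rewrite /w divr_ge0 ?exprn_ge0 ?enorm_ge0 // subr_ge0 ltW. Qed.

Let powR_le_expn (a : R) : a <= (n + 2)%:R -> n%:R `^ a <= n%:R ^+ (n + 2).
Proof. by move=> an; rewrite -powR_mulrn // ler_powR // ler1n. Qed.

Let kernel_bounds zeta : (n%:R ^+ (n + 2))^-1 * J s zeta <= w zeta * iv zeta ^+ 2 <= J s zeta.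
Proof.
have [->|z0] := eqVneq zeta 0.
  by rewrite J0 ?(ltW s0) // /iv enorm0 powR0 ?gt_eqF // invr0 expr0n /= !mulr0 lexx.
have ep : 0 < enorm zeta by exact: enorm_gt0.
have a0 : 0 <= n%:R + 2 * s by rewrite addr_ge0 // mulr_ge0 // ltW.
have -> : w zeta * iv zeta ^+ 2 = (1 - s) * enorm zeta `^ (- (n%:R + 2 * s)).
  rewrite powRN powRD; last by rewrite (gt_eqF ep) implybT.
  rewrite powR_mulrn ?(ltW ep) // /w /iv -mulrA; congr (_ * _).
  by rewrite mulrC [2 * s]mulrC powRrM powR_mulrn ?powR_ge0 // exprVn -invfM mulrC.
have /andP[h1 h2] := powR_norm_le_enorm a0 z0.
have s10 : 0 <= 1 - s by rewrite subr_ge0 ltW.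
rewrite /J (ler_wpM2l s10 h1) andbT mulrCA; apply: ler_wpM2l => //.
rewrite ler_pdivrMl //; apply: le_trans h2 _; apply: ler_wpM2r; first exact: powR_ge0.
by apply: powR_le_expn; rewrite natrD lerD2l; have := s1; lra.
Qed.

Let Phi_slope t t' : exists2 k, Lambda^-1 <= k <= Lambda & Phi t - Phi t' = k * (t - t').
Proof.
have [_ lip mon] := hPhi; have [->|tt] := eqVneq t t'.
  exists 1; last by rewrite !subrr mulr0.
  by rewrite L1 andbT invf_le1.
have d0 : t - t' != 0 by rewrite subr_eq0.
exists ((Phi t - Phi t') / (t - t')); last by rewrite divfK.
have d2 : 0 < `|t - t'| ^+ 2 by rewrite exprn_gt0 // normr_gt0.
apply/andP; split.
  rewrite -(ler_pM2r d2); apply: le_trans (mon t t') _.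
  by rewrite real_normK ?num_real // expr2 mulrA divfK.
apply: le_trans (ler_norm _) _; rewrite normrM normfV ler_pdivrMr ?normr_gt0 //.
Qed.

Let measurable_Phi : measurable_fun setT Phi.
Proof.
have [_ lip _] := hPhi; apply: continuous_measurable_fun => x.
apply/cvgrPdist_le => e e0; near=> y.
apply: le_trans (lip _ _) _; rewrite -ler_pdivlMl // mulrC; near: y.
by apply: cvgr_dist_le => //; rewrite divr_gt0.
Unshelve. all: end_near.
Qed.

Let menorm (d : measure_display) (T : measurableType d) (f : T -> V) : measurable_fun setT f ->
  measurable_fun setT (fun x => enorm (f x)).
Proof. by move=> mf; apply: measurableT_comp mf; exact: measurable_enorm. Qed.

Lemma phi_flux_flux : flux ellipticity s phi_flux.
Proof.
split=> [|zeta|zeta t t'].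
- have me : measurable_fun setT (fun p : V * measurableTypeR R => enorm p.1) by exact: menorm.
  have mps : measurable_fun setT (fun p : V * measurableTypeR R => enorm p.1 `^ s) by meas.
  rewrite /phi_flux; apply: measurable_funM; first by meas.
  apply: measurable_funM; last by meas.
  apply: measurable_funM; last by meas.
  apply: (measurableT_comp measurable_Phi); apply: measurable_funM; [exact: measurable_snd|by meas].
- have [odd _ _] := hPhi; rewrite /phi_flux mul0r.
  have -> : Phi 0 = 0 by apply/eqP; have := odd 0; rewrite oppr0 => /eqP; rewrite -addr_eq0 -mulr2n mulrn_eq0.
  by rewrite !mul0r mulr0.
have [k /andP[k1 k2] E] := Phi_slope (t * iv zeta) (t' * iv zeta).
exists (k * (w zeta * iv zeta ^+ 2)).
  have /andP[h1 h2] := kernel_bounds zeta.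
  have h0 : 0 <= w zeta * iv zeta ^+ 2 by rewrite mulr_ge0 // sqr_ge0.
  have Li : 0 <= Lambda^-1 by rewrite invr_ge0 ltW.
  have Ji : 0 <= (n%:R ^+ (n + 2))^-1 * J s zeta.
    by apply: mulr_ge0; [rewrite invr_ge0 ltW|apply: J_ge0; exact: ltW].
  rewrite /ellipticity; apply/andP; split.
    by rewrite invfM -[leLHS]mulrA; apply: ler_pM => //.
  apply: le_trans (_ : _ <= Lambda * J s zeta) _.
    by apply: ler_pM => //; exact: le_trans k1.
  apply: ler_wpM2r; first by apply: J_ge0; exact: ltW.
  by rewrite ler_peMr // ltW.
have id1 (W A B v : R) : (1 - s) * (A * v / W) - (1 - s) * (B * v / W) = (1 - s) / W * v * (A - B).
  by ring.
have id2 (W v a b : R) : (1 - s) / W * v * (k * (a * v - b * v)) = k * ((1 - s) / W * v ^+ 2) * (a - b).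
  by ring.
by apply: etrans (id1 _ _ _ _) _; rewrite E; exact: id2.
Qed.

(** Removing the linear part t / Lambda leaves an odd monotone function, with a convex primitive;
    adding the quadratic back gives the uniform convexity, which [weighted_convexity] transfers to
    the weights. *)
Lemma exists_phi_potential : exists G : V -> R -> R, potential ellipticity s phi_flux G.
Proof.
have [odd lip mon] := hPhi.
pose phi t := Phi t - Lambda^-1 * t.
have mphi : measurable_fun setT phi.
  by apply: measurable_funB => //; apply: measurable_funM.
have oddphi t : phi (- t) = - phi t by rewrite /phi odd mulrN opprB opprK addrC.
have incphi t t' : t <= t' -> phi t <= phi t'.
  move=> tt; rewrite -subr_ge0 /phi.
  have [k /andP[k1 _] E] := Phi_slope t' t.
  rewrite (_ : _ - _ = (k - Lambda^-1) * (t' - t)); first by rewrite mulr_ge0 // subr_ge0.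
  by rewrite mulrBl -E; ring.
have [Q [mQ Q0 hQ]] := exists_convex_primitive mphi oddphi incphi.
exists (fun zeta t => w zeta * (Q (t * iv zeta) + (2 * Lambda)^-1 * (t * iv zeta) ^+ 2)); split.
- have me : measurable_fun setT (fun p : V * measurableTypeR R => enorm p.1) by exact: menorm.
  have mps : measurable_fun setT (fun p : V * measurableTypeR R => enorm p.1 `^ s) by meas.
  have mt : measurable_fun setT (fun p : V * measurableTypeR R => p.2 * iv p.1).
    by apply: measurable_funM; [exact: measurable_snd|rewrite /iv; meas].
  rewrite /w; apply: measurable_funM; first by meas.
  apply: measurable_funD; first by apply: (measurableT_comp mQ).
  by apply: measurable_funM; [by meas|exact: measurable_funX].
- by move=> zeta; rewrite mul0r Q0 expr0n /= mulr0 addr0 mulr0.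
move=> zeta t t'; have {hQ} := hQ (t * iv zeta) (t' * iv zeta).
have Li : 0 <= (2 * Lambda)^-1 by rewrite invr_ge0 mulr_ge0 // ltW.
have /andP[h1 _] := kernel_bounds zeta.
rewrite /phi (_ : Lambda^-1 = 2 * (2 * Lambda)^-1); last first.
  by rewrite invfM mulrA mulfV ?mul1r // pnatr_eq0.
rewrite (_ : (2 * ellipticity)^-1 = (2 * Lambda)^-1 * (n%:R ^+ (n + 2))^-1 :> R); last first.
  by rewrite /ellipticity mulrA invfM.
move=> h; have := weighted_convexity h1 (w0 zeta) Li h.
rewrite /phi_flux (_ : (1 - s) * (Phi (t / enorm zeta `^ s) / enorm zeta `^ s / enorm zeta ^+ n) =
  w zeta * (Phi (t * iv zeta) * iv zeta)) //.
have id (W A v : R) : (1 - s) * (A * v / W) = (1 - s) / W * (A * v) by ring.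
exact: id.
Qed.

Lemma enb_phi (u : V -> R) : Ws2 s setT u -> exists c, enb s u c.
Proof.
move=> [mu_ _]; rewrite setXTT => h.
have mDf : measurable_fun setT (fun z : V * V => `|u z.1 - u z.2| ^+ 2 / enorm (z.1 - z.2) `^ (n%:R + 2 * s)).
  have me : measurable_fun setT (fun z : V * V => enorm (z.1 - z.2)) by apply: menorm; meas.
  by meas.
have [|c _ hc] := bd_ex mDf _ h.
  by move=> z; rewrite divr_ge0 ?exprn_ge0 ?powR_ge0.
exists (n%:R ^+ (n + 2) * c); apply: bd_le (bdZ (ltW np) hc) _ _ _.
- by have mJ := @measurable_J R n s; have mD := measurable_Df mu_; meas.
- by move=> z; apply: mulr_ge0; [apply: J_ge0; exact: ltW|exact: sqr_ge0].
move=> z; rewrite real_normK ?num_real // /Df.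
have [->|z0] := eqVneq (z.1 - z.2) 0.
  by rewrite J0 ?(ltW s0) // mul0r; apply: mulr_ge0; rewrite ?(ltW np) // divr_ge0 ?sqr_ge0 ?powR_ge0.
have a0 : 0 <= n%:R + 2 * s by rewrite addr_ge0 // mulr_ge0 // ltW.
have /andP[_ h2] := powR_norm_le_enorm a0 z0.
rewrite mulrC -powRN [leRHS]mulrCA; apply: ler_wpM2l; first exact: sqr_ge0.
apply: le_trans (_ : _ <= `|z.1 - z.2| `^ (- (n%:R + 2 * s))) _.
  by rewrite /J ler_piMl ?powR_ge0 // gerBl ltW.
apply: le_trans h2 _; apply: ler_wpM2r; first exact: powR_ge0.
by apply: powR_le_expn; rewrite natrD lerD2l; have := s1; lra.
Qed.

Lemma form_weak_form (u psi : V -> R) : measurable_fun setT u -> measurable_fun setT psi ->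
  (exists c, enb s u c) -> (exists c, enb s psi c) ->
  form phi_flux u psi = weak_form s Phi u psi.
Proof.
move=> mu_ mp [c hc] [c' hc'].
have i1 := form_integrable ellipticity_ge1 (ltW s1) phi_flux_flux mu_ mp hc hc'.
rewrite /weak_form; set f := fun z => _.
have s1' : 1 - s != 0 by rewrite subr_eq0 eq_sym lt_eqF.
have -> : f = (fun z => ((1 - s)^-1)%:E * (EFin \o (fun z : V * V => phi_flux (z.1 - z.2) (Df u z) * Df psi z)%R) z)%E.
  apply/funext => z; rewrite /f -EFinM; congr EFin; rewrite /phi_flux /Df.
  have id (a A v W d : R) : a != 0 -> A * (d * v) * W = a^-1 * (a * (A * v * W) * d).
    by move=> an0; field.
  exact: id.
by rewrite integralZl // muleA -EFinM mulfV // mul1e.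
Qed.

End concrete_flux.

(** * Integrals against signed measures *)

Section variation.
Context {R : realType} {n : nat}.
Local Notation V := 'rV[R]_n.

(* A name for [charge_abs] on which canonical inference finds finiteness. *)
Definition variation (m : {charge set V -> \bar R}) : set V -> \bar R := charge_abs m.

HB.instance Definition _ m := Measure.copy (variation m) (charge_abs m).

Let variation_fin m : fin_num_fun (variation m).
Proof.
move=> A mA; rewrite /variation /charge_abs /charge_variation /=.
by rewrite fin_numD !fin_num_measure.
Qed.

HB.instance Definition _ m := Measure_isFinite.Build _ _ _ (variation m) (variation_fin m).

Lemma integral_le_measure (m : {finite_measure set V -> \bar R}) (f : V -> R) (B : R) (A : set V) :
  0 <= B -> measurable_fun setT f -> measurable A -> (forall x, `|f x| <= B * \1_A x) ->
  (`|\int[m]_x (f x)%:E| <= (B * fine (m A))%:E)%E.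
Proof.
move=> B0 mf mA fB.
have bA : bd m (\1_A : V -> R) (fine (m A)).
  split; [exact: measurable_indic|by move=> x; rewrite indicE|].
  by rewrite integral_indic // setIT fineK // fin_num_measure.
have bf : bd m (fun x => `|f x|) (B * fine (m A)).
  by apply: bd_le (bdZ B0 bA) _ _ fB; [meas|move=> x; exact: normr_ge0].
apply: le_trans (le_abse_integral _ _ _) _ => //; first exact/measurable_EFinP.
by case: bf.
Qed.

Lemma charge_integral_le (m : {charge set V -> \bar R}) (f : V -> R) (B : R) (A : set V) :
  0 <= B -> measurable_fun setT f -> measurable A -> (forall x, `|f x| <= B * \1_A x) ->
  (charge_integral m setT (fun x => (f x)%:E) <= (B * fine (variation m A))%:E)%E.
Proof.
move=> B0 mf mA fB; rewrite /charge_integral.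
have hp := integral_le_measure (jordan_pos (hahn_posneg m)) B0 mf mA fB.
have hn := integral_le_measure (jordan_neg (hahn_posneg m)) B0 mf mA fB.
rewrite /variation /charge_abs /charge_variation fineD ?fin_num_measure // mulrDr EFinD.
apply: leeD; first exact: le_trans (lee_abs _) hp.
by apply: le_trans (lee_abs _) _; rewrite abseN.
Qed.

End variation.

(** * The rescaled equation and the gradient estimate *)

Section gradient_estimate.
Context {R : realType} {n : nat}.
Local Notation V := 'rV[R]_n.
Local Notation mu := (@lebesgue_rV R n).

(** Cut-offs take values in [0, 1], so the positive and negative parts are treated apart, each as
    the product of the constant 1 with a cut-off. *)
Lemma lip_enb (s r K : R) (phi : V -> R) : 2^-1 < s -> s < 1 -> (2 <= n)%N ->
  measurable_fun setT phi -> (forall x, `|phi x| <= 1) ->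
  (forall x y, `|phi x - phi y| <= K * `|x - y|) -> (forall x, r <= `|x| -> phi x = 0) ->
  exists c, enb s phi c.
Proof.
move=> s0 s1 n2 mp p1 lp p0; have [CJ _ hCJ] := @J_quadratic R n n2.
have bJ := hCJ s (ltW s0) s1.
have enb1 : exists c, enb s (fun _ : V => 1) c.
  exists 0; apply: (bd_ext (@bd0 _ _ _ _)) => z.
  by rewrite /Df subrr expr0n mulr0.
have l21 : loc2 (fun _ : V => 1 : R).
  move=> t; have [t0|t0] := ltP 0 t.
    exists ((2 * t) ^+ n); apply: (bd_ext (bd_cube t0)) => x.
    by rewrite expr1n mulr1.
  exists 0; apply: (bd_ext (@bd0 _ _ _ _)) => x.
  by rewrite ltNge (le_trans t0) // mul0r.
have H (f : V -> R) : measurable_fun setT f -> (forall x, `|f x| <= 1) ->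
  (forall x y, `|f x - f y| <= K * `|x - y|) -> (forall x, r <= `|x| -> f x = 0) ->
  exists c, enb s (fun x => posp (f x)) c.
  move=> mf f1 lf f0.
  have cf : cutoff K r (fun x => posp (f x)).
    split.
    - by rewrite /posp; meas.
    - move=> x; rewrite /posp le_max lexx orbT ge_max ler01 andbT.
      exact: le_trans (ler_norm _) (f1 x).
    - move=> x y; apply: le_trans (lf x y).
      rewrite /posp; have [h1|h1] := leP (f x) 0; have [h2|h2] := leP (f y) 0.
      + by rewrite subrr normr0.
      + by rewrite sub0r normrN (gtr0_norm h2) distrC; apply: le_trans (ler_norm _); lra.
      + by rewrite subr0 (gtr0_norm h1); apply: le_trans (ler_norm _); lra.
      + by [].
    - by move=> x xr; rewrite f0 // /posp maxxx.
  have [_ _ _ [c hc]] := H0_cutoff bJ (ltW s1) cf (@measurable_cst _ _ _ _ _ (1 : R)) enb1 l21.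
  exists c; apply: (bd_ext hc) => z.
  by rewrite /Df !mul1r.
have [c1 e1] := H phi mp p1 lp p0.
have [|||c2 e2] := H (fun x => - phi x) (measurable_oppr_comp mp).
- by move=> x; rewrite normrN.
- by move=> x y; rewrite -opprD normrN.
- by move=> x xr; rewrite p0 // oppr0.
exists (2 * (c1 + c2)).
have m1 : measurable_fun setT (fun x => posp (phi x)) by rewrite /posp; meas.
have m2 : measurable_fun setT (fun x => posp (- phi x)) by rewrite /posp; meas.
have := enbB (ltW s1) e1 e2 m1 m2.
congr (enb s _ _); apply/funext => x.
by rewrite /posp; have [h1|h1] := leP (phi x) 0; have [h2|h2] := leP (- phi x) 0; lra.
Qed.

Section rescaled_equation.
Variables (Lambda s : R) (Phi : R -> R) (m : {charge set V -> \bar R}) (u : V -> R).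
Hypotheses (n2 : (2 <= n)%N) (L1 : 1 <= Lambda) (s0 : 2^-1 < s) (s1 : s < 1)
  (hPhi : structure_assumption Lambda Phi) (hu : Ws2 s setT u) (su : weak_solution s Phi setT m u).

Let n0 : (0 < n)%N. Proof. exact: ltn_trans n2. Qed.
Let sp : 0 < s. Proof. by apply: lt_trans s0; rewrite invr_gt0. Qed.
Let mu_ : measurable_fun setT u. Proof. by case: hu. Qed.
Let eu : exists c, enb s u c. Proof. exact (enb_phi n0 sp s1 hu). Qed.
Let fF := phi_flux_flux n0 L1 sp s1 hPhi.

(** Rescaling multiplies the form by r^(n+2s) r^(-2n) = r times r^-(n-(2s-1)), the factor of the
    Riesz kernel. A test bounded by 1 near x0 sees at most the variation of the cube of radius 2 r,
    the doubling being due to mollification. *)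
Lemma form_rescaled_le (x0 : V) (r : R) psi : 0 < r -> H0 s 1 psi -> (forall x, `|psi x| <= 1) ->
  (form (rescale_flux s r (phi_flux s Phi)) (fun x : V => u (x0 + r *: x)%R) psi <=
   (r * (r `^ (- (n%:R - (2 * s - 1))) * cube_measure (variation m) x0 (2 * r)))%:E)%E.
Proof.
move=> r0 Hp p1; have [mp p0 _ [e ep]] := Hp; have [c hc] := eu.
have E1 := ellipticity_ge1 n0 L1.
rewrite (form_rescale x0 E1 (ltW s1) r0 fF mu_ mp hc ep).
set psi' := fun x : V => psi (- (r^-1 *: x0) + r^-1 *: x).
have [mp' _ _ [e' ep']] : H0 s (`|x0| + r * 1) psi' by apply: H0_rescale Hp.
have hM : (form (phi_flux s Phi) u psi' <= (cube_measure (variation m) x0 (2 * r))%:E)%E.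
  apply: (form_le_smooth n2 E1 (ltW s0) s1 fF mu_ eu mp' (B := 1) (x0 := x0) _ r0 _ ep').
  - by move=> x; exact: p1.
  - move=> x xr; rewrite /psi'; apply: p0; rewrite addrC -scalerBr normVZ ?invr_ge0 ?(ltW r0) //.
    by rewrite ler_pdivlMl // mulr1.
  move=> phi Cphi phi1 phi0.
  have tphi : test_function setT phi by apply: test_function_ball Cphi phi0.
  have mphi : measurable_fun setT phi by exact: bounded_lip_measurable (Cb_lip (Cphi 0%N)).
  have [_ _ /(_ phi tphi) Eq] := su.
  have m2 : measurable [set y : V | `|y - x0| < 2 * r].
    rewrite -[X in measurable X]setTI.
    have m1 : measurable_fun setT (fun y : V => (`|y - x0| < 2 * r)%R) by meas.
    exact: (m1 measurableT [set true]).
  have [K K0 [_ lphi]] := Cb_lip (Cphi 0%N).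
  have ephi : exists c, enb s phi c.
    apply: (lip_enb (r := 2 * r + `|x0|) s0 s1 n2 mphi phi1 lphi) => x xr; apply: phi0.
    by rewrite -lerBrDr in xr; apply: le_trans xr (lerB_dist _ _).
  rewrite (form_weak_form n0 L1 sp s1 hPhi mu_ mphi eu ephi) Eq; apply: le_trans (charge_integral_le m (B := 1) (A := [set y : V | `|y - x0| < 2 * r]) _ mphi m2 _) _ => //.
    move=> x; rewrite mul1r indicE; case: (boolP (x \in _)) => [_|]; first exact: phi1.
    by rewrite notin_setE /= => /negP; rewrite -leNgt => h; rewrite phi0 // normr0.
  by rewrite mul1r.
apply: le_trans (lee_wpmul2l _ hM) _.
  by rewrite lee_fin; nn; rewrite invr_ge0 exprn_ge0 // ltW.
rewrite -EFinM lee_fin [leRHS]mulrA; apply: ler_wpM2r; first exact: cube_measure_ge0.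
have rn : r ^- n = r `^ (- n%:R) by rewrite powRN powR_mulrn // ltW.
have rr : r `^ (1 : R) = r by rewrite powRr1 // ltW.
rewrite rn -[X in _ <= X * _]rr -!powRD ?(gt_eqF r0) ?implybT //.
by rewrite le_eqVlt; apply/orP; left; apply/eqP; congr powR; ring.
Qed.

End rescaled_equation.

Lemma gradient_estimate (Lambda s0 : R) : (2 <= n)%N -> 1 <= Lambda -> 2^-1 < s0 -> s0 < 1 ->
  exists2 c : R, 0 < c & forall s : R, s0 <= s -> s < 1 -> gradient_potential_estimate n s Lambda c.
Proof.
move=> n2 L1 s0h s01; have n0 : (0 < n)%N by exact: ltn_trans n2.
have E1 := ellipticity_ge1 n0 L1.
have [N [K [N0 K0 H]]] := slope_limits n2 E1 s0h s01.
(* The first n passes from coordinates to the Euclidean norm, 2 2^n bounds the constant of the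
   dyadic sums as b <= n, and n^n compares the two potentials. *)
exists (n%:R * (K * (2 * 2 ^+ n)) * n%:R ^+ n).
  have np : 0 < n%:R :> R by rewrite ltr0n.
  by rewrite !mulr_gt0 // ?exprn_gt0.
move=> s ss0 s1 m Phi u hPhi hu su.
have sh : 2^-1 < s by exact: lt_le_trans ss0.
have sp : 0 < s by apply: lt_trans sh; rewrite invr_gt0.
have mu_ : measurable_fun setT u by case: hu.
have eu : exists c, enb s u c by exact (enb_phi n0 sp s1 hu).
have [B bu] : exists B, bd mu (fun x => u x ^+ 2) B.
  have [_ h _] := hu; have [|||B _ hB] := @bd_ex _ _ _ mu (fun x => u x ^+ 2).
  - by meas.
  - by move=> x; exact: sqr_ge0.
  - by under eq_integral do rewrite -(real_normK (num_real _)).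
  by exists B.
have fF := phi_flux_flux n0 L1 sp s1 hPhi.
have [G pG] := exists_phi_potential n0 L1 sp s1 hPhi.
set b := n%:R - (2 * s - 1).
have n2R : 2 <= n%:R :> R by rewrite ler_nat.
(* From n >= 2 and s < 1; the dyadic sums rely on it. *)
have b1 : 1 <= b by rewrite /b; have := s1; lra.
have b0 : 0 < b by exact: lt_le_trans b1.
have bn : b < n%:R by rewrite /b; have := sh; lra.
pose II := sup_riesz (variation m) b.
have I0 x : 0 <= II x by exact: sup_riesz_ge0.
have lI : loc_bounded II by exact: sup_riesz_loc b0 bn.
pose r_ (j : nat) : R := 2^-1 ^+ (N * j).
have half0 : 0 <= 2^-1 :> R by rewrite invr_ge0.
have half1 : 2^-1 < 1 :> R by rewrite invf_lt1 // ltr1n.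
have rj j : 0 < r_ j <= 1.
  by rewrite /r_ exprn_gt0 ?invr_gt0 //= exprn_ile1 // ltW.
have r_0 : r_ @ \oo --> 0.
  rewrite (_ : r_ = fun j => (2^-1 ^+ N) ^+ j); last by apply/funext => j; rewrite /r_ exprM.
  by apply: cvg_expr; rewrite ger0_norm ?exprn_ge0 // exprn_ilt1 // -lt0n.
have K'0 : 0 <= K * (2 * 2 ^+ n) by rewrite !mulr_ge0 // ltW.
have [i|g wg hg] := limit_weak_gradient bu mu_ I0 lI K'0 rj r_0.
  apply: filterS (dyadic_cube_measure (variation m) b0 bn b1) => x hx.
  have [||h1 h2] := H s (phi_flux s Phi) G u B
    (fun r => r `^ (- b) * cube_measure (variation m) x (2 * r)) x (delta_mx ord0 i) (2 * 2 `^ b * II x)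
    ss0 s1 fF pG mu_ eu bu (norm_delta_mx i) _ (form_rescaled_le n2 L1 sh s1 hPhi hu su x).
  - by move=> r; rewrite mulr_ge0 ?powR_ge0 ?cube_measure_ge0.
  - move=> p k; apply: hx => j; first by rewrite mulr_gt0 // exprn_gt0 // invr_gt0.
    rewrite mulrA; apply: ler_wpM2r; first exact: exprn_ge0.
    rewrite mulnS exprD mulrA ler_piMl ?exprn_ge0 //.
    by rewrite -(prednK N0) exprS mulrA mulfV ?pnatr_eq0 // mul1r exprn_ile1 // ltW.
  split=> // j; apply: le_trans (h1 j) _.
  rewrite -[leRHS]mulrA; apply: ler_wpM2l; first exact: ltW.
  apply: ler_wpM2r => //; apply: ler_wpM2l => //.
  by rewrite -powR_mulrn //; apply: ler_powR; [rewrite ler1n|exact: ltW].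
exists g => //; apply: filterS hg => x hx.
have h1 : enorm (g x) <= n%:R * (K * (2 * 2 ^+ n) * II x).
  by apply: enorm_le_bound => //; rewrite mulr_ge0.
apply: le_trans (_ : (n%:R * (K * (2 * 2 ^+ n) * II x))%:E <= _)%E; first by rewrite lee_fin.
rewrite mulrA EFinM [X in (_ <= X * _)%E]EFinM -muleA; apply: lee_wpmul2l.
  by rewrite lee_fin mulr_ge0.
apply: (sup_riesz_le (variation m)) => //.
by have := sh; lra.
Qed.

End gradient_estimate.

Theorem theorem1p2 (R : realType) (n : nat) (Lambda : R) :
  (2 <= n)%N -> 1 <= Lambda ->
  (forall s : R, 2^-1 < s < 1 ->
     exists2 c : R, 0 < c & gradient_potential_estimate n s Lambda c) /\
  (forall s0 : R, 2^-1 < s0 < 1 ->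
     exists2 c : R, 0 < c &
       forall s : R, s0 <= s < 1 -> gradient_potential_estimate n s Lambda c).
Proof.
move=> n2 L1; split=> [s /andP[s0 s1]|s0 /andP[h s1]].
  have [c c0 hc] := gradient_estimate n2 L1 s0 s1; exists c => //; exact: hc.
have [c c0 hc] := gradient_estimate n2 L1 h s1; exists c => // s /andP[]; exact: hc.
Qed.
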